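(* Let $\alpha\ge0$, let $\xi$ be a nonnegative random variable, let $(\xi_i)_{i\ge1}$ be i.i.d. copies of $\xi$ and let $(W^i)_{i\ge1}$ be independent standard Brownian motions, independent of $(\xi_i)_{i\ge1}$. For each $N\ge1$ let $(\mathbf L,\tau_N)$, $\mathbf L=(L^1,\dots,L^N)$, be the unique maximal solution of the symmetric particle system $$X^i_t=\xi_i+W^i_t-\alpha\bar L^N_t+L^i_t,\qquad \bar L^N_t=\frac1N\sum_{j=1}^N L^j_t,\qquad i=1,\dots,N,$$ and let $(\ell,T)$ be the unique maximal solution of the McKean–Vlasov SDE $X_t=\xi+W_t-\alpha\ell_t+L_t$, $\ell_t=\mathbb E L_t$. Then the sequence $(\bar L^N_{\cdot\wedge\tau_N},\tau_N)_{N\ge1}$ converges weakly to $(\ell,T)$ on $C([0,T))\times[0,\infty]$. Moreover, if $\alpha\in[0,1)$, then for all $t\ge0$ the sequence $\sqrt N\sup_{0\le s\le t}|\bar L^N_s-\ell_s|$, $N\ge1$, is stochastically bounded, i.e. for all $\epsilon>0$ there exists $z>0$ such that $\limsup_{N\to\infty}\mathbb P\bigl(\sup_{0\le s\le t}|\bar L^N_s-\ell_s|\ge z/\sqrt N\bigr)<\epsilon$.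
   Context: Skorokhod problem. For a (stopping) time $\tau\in[0,\infty]$ and a càdlàg process $Z$ on $[0,\tau)$ with $Z_0\ge0$, a pair of càdlàg processes $(X,L)$ on $[0,\tau)$ solves the Skorokhod problem for $Z$ if $L$ is nondecreasing started from zero, $X_t=Z_t+L_t\ge0$ and $\int_0^t\mathbf 1_{\{X_s>0\}}\,dL_s=0$ for $t\in[0,\tau)$; the unique solution is $L_t=\sup_{0\le s\le t}(Z_s)_-$, $X=Z+L$, where $x_-=\max(-x,0)$. Particle system. Let $\mathcal F^N_t=\sigma(\xi_i,W^i_s: s\le t,\ i\le N)$. A solution is a pair $(\mathbf L,\tau)$ of a continuous $(\mathcal F^N_t)$-adapted process $\mathbf L=(L^1,\dots,L^N)$ and an $(\mathcal F^N_t)$-stopping time $\tau$ such that for each $i$ the solution $(X^i,F^i)$ to the Skorokhod problem for $\xi_i+W^i-\alpha\bar L^N$ on $[0,\tau)$ satisfies $F^i=L^i$ on $[0,\tau)$. (This is the case $q_{ij}=\alpha/N$, identity covariance, of a general system; the additional minimality requirement imposed there, that $L^i$ increases only when $i$ is an ''active'' node among those particles at zero, is automatic here since all nodes at zero are active.) It is maximal if for any other solution $(\mathbf L',\tau')$ with $\mathbf L'=\mathbf L$ on $[0,\tau'\wedge\tau)$ one has $\tau\ge\tau'$. A unique maximal solution $(\mathbf L,\tau_N)$ exists. $\bar L^N_{\cdot\wedge\tau_N}$ is the process stopped at $\tau_N$ (its value at $\tau_N$ being the left limit, or $0$ if $\tau_N=0$). McKean–Vlasov SDE. $W$ is a standard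 Brownian motion independent of $\xi$. A pair $(\ell,T)$ with $T\in[0,\infty]$ and $\ell:[0,T)\to\mathbb R$ càdlàg is a solution if the solution $(X,L)$ to the Skorokhod problem for $\xi+W-\alpha\ell$ on $[0,T)$ satisfies $\ell_t=\mathbb E L_t$ for $t\in[0,T)$; it is maximal if for any other solution $(\ell',T')$ with $\ell'=\ell$ on $[0,T'\wedge T)$ one has $T\ge T'$. A unique maximal solution exists and its $\ell$ is continuous. For $\alpha<1$ one has $\tau_N=T=\infty$. Topologies. $[0,\infty]$ carries the metric $(t,s)\mapsto|t/(1+t)-s/(1+s)|$ with $\infty/(1+\infty)=1$. $C([0,T))$ carries the topology of locally uniform convergence, and $\bar L^N_{\cdot\wedge\tau_N}$ is regarded as an element of $C([0,T))$ by restriction (trivial if $T=0$). *)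

(* Defs.v *)
From HB Require Import structures.
From mathcomp Require Import all_boot all_order all_algebra.
From mathcomp Require Import all_classical all_reals all_analysis.
Import Order.TTheory GRing.Theory Num.Theory.
Import numFieldNormedType.Exports.
Set Implicit Arguments.
Unset Strict Implicit.
Unset Printing Implicit Defensive.
Local Open Scope classical_set_scope.
Local Open Scope ring_scope.

(* [0, +oo] as a subspace of \bar R.  The library's distance on \bar R is
   |contract x - contract y| with contract x = x / (1 + |x|), which on
   [0, +oo] is the metric |t/(1+t) - s/(1+s)|. *)
Definition ext_time (R : realType) : set (\bar R) := [set x | (0 <= x)%E].
Arguments ext_time R : clear implicits.

Definition before (R : realType) (T : \bar R) : set R :=
  [set t | 0 <= t /\ (t%:E < T)%E].

Definition cadlag_on (R : realType) (T : \bar R) (f : R -> R) : Prop :=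
  forall t, before T t ->
    f s @[s --> t^'+] --> f t /\ (0 < t -> cvg (f s @[s --> t^'-])).

(* \int_0^t 1_{X_s > 0} dL_s = 0, where the Lebesgue-Stieltjes measure is the
   one of the path L frozen outside [0, t] (whence no mass at 0). *)
Definition flat_off_zero (R : realType) (X L : R -> R) (t : R) : Prop :=
  exists2 g : cumulative R R,
    forall s, g s = L (Num.max 0 (Num.min s t)) &
    (\int[lebesgue_stieltjes_measure g]_(s in [set r : R | (0 <= r <= t)%R])
       (\1_[set r : R | (0 < X r)%R] s)%:E = 0)%E.

Definition skorokhod (R : realType) (Z : R -> R) (T : \bar R) (X L : R -> R) :
    Prop :=
  [/\ cadlag_on T X, cadlag_on T L,
      (before T 0 -> L 0 = 0),
      (forall s t, 0 <= s -> s <= t -> before T t -> L s <= L t) &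
      forall t, before T t ->
        [/\ X t = Z t + L t, 0 <= X t & flat_off_zero X L t]].

Section independence.
Context {R : realType} {d : measure_display} {Om : measurableType d}.
Variable P : probability Om R.

Definition sigma_of {I : Type} (D : set I) (X : I -> Om -> R) :
    set_system Om :=
  <<s \bigcup_(i in D) preimage_set_system setT (X i) measurable >>.

Definition independent (F G : set_system Om) : Prop :=
  forall A B, F A -> G B -> (P (A `&` B) = P A * P B)%E.

Definition mutually_independent {I : eqType} (F : I -> set_system Om) : Prop :=
  forall (s : seq I) (A : I -> set Om), uniq s ->
    (forall i, i \in s -> F i (A i)) ->
    (P (\big[setI/setT]_(i <- s) A i) = \prod_(i <- s) P (A i))%E.

(* W is indexed by R, but only its values at times t >= 0 matter. *)
Definition brownian (W : R -> {RV P >-> R}) : Prop :=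
  [/\ forall w, W 0 w = 0,
      (forall w, {within [set t | 0 <= t], continuous (fun t => W t w)}),
      (forall s t B, 0 <= s -> s < t -> measurable B ->
         P [set w | B (W t w - W s w)] = normal_prob 0 (Num.sqrt (t - s)) B) &
      forall s t, 0 <= s -> s < t ->
        independent (sigma_of [set r | 0 <= r <= s] (fun r => W r : Om -> R))
          (sigma_of [set: unit] (fun _ w => W t w - W s w))].

End independence.

Definition mean_path (R : realType) (Om : Type) (N : nat)
    (L : 'I_N -> R -> Om -> R) (w : Om) (t : R) : R :=
  (\sum_(j < N) L j t w) / N%:R.

(* The path f, given on [0, T), stopped at T. *)
Definition stopped (R : realType) (T : \bar R) (f : R -> R) (t : R) : R :=
  if (t%:E < T)%E then f t
  else if T == 0%E then 0 else lim (f s @[s --> (fine T)^'-]).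

Section particles.
Context {R : realType} {d : measure_display} {Om : measurableType d}.
Variables (P : probability Om R) (alpha : R).
Variables (xi : nat -> {RV P >-> R}) (W : nat -> R -> {RV P >-> R}).

Definition particle_filtration (N : nat) (t : R) : set_system Om :=
  <<s sigma_of [set i | (i < N)%N] (fun i => xi i : Om -> R)
      `|` sigma_of [set p : nat * R | (p.1 < N)%N /\ 0 <= p.2 <= t]
            (fun p => W p.1 p.2 : Om -> R) >>.

(* The process L lives on [0, tau): its values from tau on are never used, so
   that adaptedness is the measurability of L_t on {t < tau}. *)
Definition particle_solution (N : nat) (L : 'I_N -> R -> Om -> R)
    (tau : Om -> ext_time R) : Prop :=
  [/\ forall t, 0 <= t ->
        particle_filtration N t [set w | (\val (tau w) <= t%:E)%E],
      (forall i t B, 0 <= t -> measurable B ->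
        particle_filtration N t
          [set w | (t%:E < \val (tau w))%E /\ B (L i t w)]),
      (forall i w, {within before (\val (tau w)), continuous (fun t => L i t w)}) &
      {ae P, forall w, forall i : 'I_N, exists X F : R -> R,
        skorokhod (fun t => xi i w + W i t w - alpha * mean_path L w t)
          (\val (tau w)) X F /\
        forall t, before (\val (tau w)) t -> F t = L i t w}].

Definition maximal_particle_solution (N : nat) (L : 'I_N -> R -> Om -> R)
    (tau : Om -> ext_time R) : Prop :=
  particle_solution L tau /\
  forall (L' : 'I_N -> R -> Om -> R) (tau' : Om -> ext_time R),
    particle_solution L' tau' ->
    {ae P, forall w, forall i t,
      before (\val (tau' w)) t -> before (\val (tau w)) t ->
      L' i t w = L i t w} ->
    {ae P, forall w, (\val (tau' w) <= \val (tau w))%E}.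

End particles.

Section mckean_vlasov.
Context {R : realType} {d : measure_display} {Om : measurableType d}.
Variables (P : probability Om R) (alpha : R).
Variables (xi : {RV P >-> R}) (W : R -> {RV P >-> R}).

Definition mv_solution (l : R -> R) (T : ext_time R) : Prop :=
  cadlag_on (\val T) l /\
  exists X L : R -> Om -> R,
    {ae P, forall w, skorokhod (fun t => xi w + W t w - alpha * l t)
                       (\val T) (X^~ w) (L^~ w)} /\
    forall t, before (\val T) t -> (l t)%:E = ('E_P[L t])%E.

Definition maximal_mv_solution (l : R -> R) (T : ext_time R) : Prop :=
  mv_solution l T /\
  forall (l' : R -> R) (T' : ext_time R), mv_solution l' T' ->
    (forall t, before (\val T') t -> before (\val T) t -> l' t = l t) ->
    (\val T' <= \val T)%E.

End mckean_vlasov.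

(* C([0, T)) with the topology of uniform convergence on compact subsets,
   i.e. of locally uniform convergence. *)
Definition path_space (R : realType) (T : \bar R) : Type :=
  continuousType (before T) R.

HB.instance Definition _ (R : realType) (T : \bar R) :=
  Topological.copy (path_space T)
    (initial_topology
       (id : continuousType (before T) R -> {family compact, before T -> R})).

Definition restricts_to (R : realType) (T : \bar R) (f : R -> R)
    (y : path_space T) : Prop :=
  forall t : before T, (y : continuousType (before T) R) t = f (\val t).

Definition random_element (d : measure_display) (Om : measurableType d)
    (S : topologicalType) (X : Om -> S) : Prop :=
  forall U : set S, open U -> measurable (X @^-1` U).

Definition cvg_weakly (R : realType) (S : topologicalType)
    (d d' : measure_display) (Om : measurableType d) (Om' : measurableType d')
    (P : probability Om R) (P' : probability Om' R)
    (X : nat -> Om -> S) (Y : Om' -> S) : Prop :=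
  [/\ forall n, random_element (X n), random_element Y &
      forall f : S -> R, continuous f -> (exists M, forall x, `|f x| <= M) ->
        ('E_P[f \o X n] @[n --> \oo] --> 'E_P'[f \o Y])%E].

(* Main.v *)
(** With z_i(t) = xi_i + W^i_t, the Skorokhod solution driven by a nondecreasing
    mean path f is L^i_t = sup_{s <= t} (alpha f_s - z_i(s))_+, so solutions of the
    particle system (resp. the McKean-Vlasov equation) are fixed points of the
    empirical average (resp. expectation) of these suprema.  The Picard iterates
    increase to a minimal empirical fixed point lam, which lives until it explodes
    or at least N / alpha particles sit at zero.  Before the lifetime of l,
    alpha P(X_t = 0) < 1, and a stability estimate propagates the closeness of lam
    to l in small time steps: this gives uniqueness of l, the lower bound on tau_N
    and the convergence.  Conversely, if tau_N > s with probability bounded away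
    from zero, the mean-field Picard iterates stay bounded at time s, so l can be
    continued up to s.

    For alpha = 1 the sum of the particles is a Brownian motion, which a.s. becomes
    negative right after reaching zero; lam keeps a finite left limit there, by
    counting dyadic scales at which the sum is small.  For alpha < 1 the fixed
    points are alpha-Lipschitz in the data, and chaining with fourth moments bounds
    the fluctuations. *)
Require Import Defs.
From HB Require Import structures.
From mathcomp Require Import all_boot all_order all_algebra.
From mathcomp Require Import all_classical all_reals all_analysis.
From mathcomp Require Import measurable_realfun zify ring lra.
Import Order.TTheory GRing.Theory Num.Theory Num.Def.
Import numFieldNormedType.Exports.
Set Implicit Arguments.
Unset Strict Implicit.
Unset Printing Implicit Defensive.
Local Open Scope classical_set_scope.
Local Open Scope ring_scope.

(** The map from a mean path f to the average of the suprema is only alpha-Lipschitz in f. Over a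
    short time, however, only the particles near zero react, so the effective constant is alpha
    times their fraction. That alpha P(X_t = 0) < 1 is a Gaussian fact: the next Brownian increment
    pushes the particles at zero up by strictly more in mean than a fixed point could absorb
    otherwise. The law of large numbers is applied with deterministic f only, since the random fixed
    point is compared with f path by path.

    A second obstacle: the stopped path has to be continuous for each N, so its left limit at a
    finite lifetime must exist. For alpha > 1, nonnegativity of the sum of the positions bounds the
    mean path. For alpha = 1 the mean path drops out of this sum. The sum spends a time of order a^2
    near height a; this time is cut into pieces of length a^3, on each of which the mean path grows
    by at most a multiple of the oscillation of the paths, of order a^(3/2). The total, a^2 / a^3
    times a^(3/2), is a^(1/2), which is summable over a = 4^-n. *)

(** * Expectations and probabilities as real numbers *)

Section expectation_toolkit.
Context {R : realType} {d : measure_display} {Om : measurableType d}.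
Variable P : probability Om R.
Implicit Types (f g h X Y : Om -> R).

Definition mfn f := measurable_fun [set: Om] f.
Definition igr f := P.-integrable [set: Om] (EFin \o f).
(** The real-valued integral sends an infinite integral to 0, so the algebraic rules carry [igr]
    hypotheses. *)
Definition Ex f : R := \int[P]_w f w.
Definition Pr (A : set Om) : R := fine (P A).

Lemma igr_mfn f : igr f -> mfn f.
Proof. by move=> /integrableP[/measurable_EFinP]. Qed.

Lemma igr_dom g f : mfn f -> igr g -> (forall w, `|f w| <= g w) -> igr f.
Proof.
move=> mf ig le; apply: (le_integrable measurableT _ _ ig) => //.
 exact/measurable_EFinP.
by move=> w _ /=; rewrite lee_fin (le_trans (le w)) // ler_norm.
Qed.

Lemma igr_cst (c : R) : igr (cst c).
Proof. exact: finite_measure_integrable_cst. Qed.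

Lemma igr_bnd (c : R) f : mfn f -> (forall w, `|f w| <= c) -> igr f.
Proof. by move=> mf fc; apply: (igr_dom mf (igr_cst c)). Qed.

Lemma igrD f g : igr f -> igr g -> igr (fun w => f w + g w).
Proof. by move=> fi gi; have := integrableD measurableT fi gi. Qed.

Lemma igrZ (c : R) f : igr f -> igr (fun w => c * f w).
Proof. by move=> fi; have := integrableZl measurableT c fi. Qed.

Lemma igrN f : igr f -> igr (fun w => - f w).
Proof. by move=> /(igrZ (-1)); congr igr; apply/funext => w; rewrite mulN1r. Qed.

Lemma igrB f g : igr f -> igr g -> igr (fun w => f w - g w).
Proof. by move=> fi /igrN; apply: igrD. Qed.

Lemma igr_norm f : igr f -> igr (fun w => `|f w|).
Proof. exact: integrable_norm. Qed.

Lemma igr_sum (I : Type) (s : seq I) (F : I -> Om -> R) :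
 (forall i, igr (F i)) -> igr (fun w => \sum_(i <- s) F i w).
Proof.
move=> iF; elim: s => [|i s IH].
 by under eq_fun do rewrite big_nil; exact: igr_cst.
by under eq_fun do rewrite big_cons; exact: igrD.
Qed.

Lemma ExE f : igr f -> (Ex f)%:E = (\int[P]_w (f w)%:E)%E.
Proof. by move=> fi; rewrite /Ex /Rintegral fineK // integrable_fin_num. Qed.

Lemma ExD f g : igr f -> igr g -> Ex (fun w => f w + g w) = Ex f + Ex g.
Proof. by move=> fi gi; rewrite /Ex RintegralD. Qed.

Lemma ExB f g : igr f -> igr g -> Ex (fun w => f w - g w) = Ex f - Ex g.
Proof. by move=> fi gi; rewrite /Ex RintegralB. Qed.

Lemma ExZ (c : R) f : igr f -> Ex (fun w => c * f w) = c * Ex f.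
Proof. by move=> fi; rewrite /Ex RintegralZl. Qed.

Lemma Ex_cst (c : R) : Ex (cst c) = c.
Proof.
apply: EFin_inj; rewrite ExE; last exact: igr_cst. transitivity (c%:E * 1)%E; last by rewrite mule1.
apply: etrans; first exact: (integral_cst P measurableT c%:E).
by congr (_ * _)%E; exact: probability_setT.
Qed.

Lemma Ex_sum (I : Type) (s : seq I) (F : I -> Om -> R) : (forall i, igr (F i)) ->
 Ex (fun w => \sum_(i <- s) F i w) = \sum_(i <- s) Ex (F i).
Proof.
move=> iF; elim: s => [|i s IH].
 under eq_fun do rewrite big_nil; rewrite big_nil; exact: Ex_cst.
under eq_fun do rewrite big_cons; rewrite big_cons ExD ?IH //. exact: igr_sum.
Qed.

Lemma Ex_ge0 f : (forall w, 0 <= f w) -> 0 <= Ex f.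
Proof. by move=> f0; apply: Rintegral_ge0. Qed.

Lemma Ex_le f g : igr f -> igr g -> (forall w, f w <= g w) -> Ex f <= Ex g.
Proof. by move=> fi gi fg; apply: le_Rintegral. Qed.

Lemma Ex_norm f : igr f -> `|Ex f| <= Ex (fun w => `|f w|).
Proof. by move=> fi; apply: le_normr_Rintegral. Qed.

Lemma eq_Ex f g : (forall w, f w = g w) -> Ex f = Ex g.
Proof. by move=> fg; congr Ex; apply/funext. Qed.

Lemma Pr_fin A : measurable A -> (Pr A)%:E = P A.
Proof. by move=> mA; rewrite /Pr fineK // fin_num_measure. Qed.

Lemma Pr_ge0 A : 0 <= Pr A.
Proof. by rewrite /Pr fine_ge0. Qed.

Lemma Pr_le1 A : measurable A -> Pr A <= 1.
Proof. by move=> mA; rewrite -lee_fin Pr_fin // probability_le1. Qed.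

Lemma Pr_le A B : measurable A -> measurable B -> A `<=` B -> Pr A <= Pr B.
Proof.
by move=> mA mB AB; rewrite -lee_fin !Pr_fin // le_measure ?inE.
Qed.

Lemma PrC A : measurable A -> Pr (~` A) = 1 - Pr A.
Proof.
move=> mA; apply: EFin_inj; rewrite Pr_fin ?probability_setC //.
 by rewrite -Pr_fin.
exact: measurableC.
Qed.

Lemma PrU A B : measurable A -> measurable B -> Pr (A `|` B) <= Pr A + Pr B.
Proof.
move=> mA mB; rewrite -lee_fin EFinD !Pr_fin //; last exact: measurableU. exact: measureU2.
Qed.

Lemma mfn_indic A : measurable A -> mfn (\1_A : Om -> R).
Proof. by move=> mA; exact: measurable_indic. Qed.

Lemma igr_indic A : measurable A -> igr (\1_A : Om -> R).
Proof. by move=> mA; exact: integrable_indic. Qed.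

Lemma Ex_indic A : measurable A -> Ex (\1_A) = Pr A.
Proof.
move=> mA; apply: EFin_inj; rewrite ExE; last exact: igr_indic. by rewrite integral_indic // setIT Pr_fin.
Qed.

Lemma igr_indicM A f : measurable A -> igr f -> igr (fun w => \1_A w * f w).
Proof.
move=> mA fi; apply: (igr_dom _ (igr_norm fi)) => [|w].
 apply: measurable_funM => //; exact: igr_mfn.
rewrite normrM indicE; case: (_ \in _); rewrite /= ?normr1 ?mul1r //. by rewrite normr0 mul0r.
Qed.

Lemma Ex_gt0 f : igr f -> (forall w, 0 <= f w) -> P [set w | 0 < f w] != 0%E -> 0 < Ex f.
Proof.
move=> fi f0 Pf; rewrite lt_neqAle Ex_ge0 // andbT eq_sym. apply: contra Pf => /eqP Ef.
have : (\int[P]_w (f w)%:E = 0)%E by rewrite -ExE // Ef.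
have mf : measurable_fun setT (EFin \o f) by exact/measurable_EFinP/igr_mfn.
have E0 : (\int[P]_w `|(EFin \o f) w| = 0 -> ae_eq P setT (EFin \o f) (cst 0))%E.
 by case: (ae_eq_integral_abs P measurableT mf).
move=> I0; have : ae_eq P setT (EFin \o f) (cst 0%E).
 apply: E0; rewrite -[RHS]I0; apply: eq_integral => w _ /=. by rewrite ger0_norm.
move=> [N [mN PN sN]]; apply/eqP/(subset_measure0 _ mN _ PN).
 rewrite (_ : [set w | 0 < f w] = f @^-1` `]0, +oo[%classic).
  by rewrite -[_ @^-1` _]setTI; apply: (igr_mfn fi).
 by apply/seteqP; split=> w /=; rewrite in_itv /= andbT.
move=> w /= fw; apply: sN => /= /(_ I) [] h; move: fw; by rewrite h ltxx.
Qed.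

Lemma mfn_lt f (c : R) : mfn f -> measurable [set w | f w < c].
Proof.
move=> mf; rewrite (_ : [set _ | _] = setT `&` f @^-1` `]-oo, c[%classic).
 exact: mf.
by rewrite setTI; apply/seteqP; split=> w /=; rewrite in_itv.
Qed.

Lemma mfn_le f (c : R) : mfn f -> measurable [set w | f w <= c].
Proof.
move=> mf; rewrite (_ : [set _ | _] = setT `&` f @^-1` `]-oo, c]%classic).
 exact: mf.
by rewrite setTI; apply/seteqP; split=> w /=; rewrite in_itv.
Qed.

Lemma mfn_ge f (c : R) : mfn f -> measurable [set w | c <= f w].
Proof.
move=> mf; rewrite (_ : [set _ | _] = setT `&` f @^-1` `[c, +oo[%classic).
 exact: mf.
by rewrite setTI; apply/seteqP; split=> w /=; rewrite in_itv /= andbT.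
Qed.

Lemma mfn_gt f (c : R) : mfn f -> measurable [set w | c < f w].
Proof.
move=> mf; rewrite (_ : [set _ | _] = setT `&` f @^-1` `]c, +oo[%classic).
 exact: mf.
by rewrite setTI; apply/seteqP; split=> w /=; rewrite in_itv /= andbT.
Qed.

Lemma mfn_of_gt f : (forall c, measurable [set w | c < f w]) -> mfn f.
Proof.
move=> mf; apply: (measurability (RGenOInfty.G (R := R))).
 exact: RGenOInfty.measurableE.
move=> _ [_ [c ->] <-]; rewrite setTI. rewrite (_ : _ @^-1` _ = [set w | c < f w]) //.
by apply/seteqP; split=> w /=; rewrite in_itv /= andbT.
Qed.

Lemma markov_ineq f (c : R) : 0 < c -> igr f -> (forall w, 0 <= f w) -> Pr [set w | c <= f w] <= Ex f / c.
Proof.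
move=> c0 fi f0; rewrite ler_pdivlMr // mulrC.
have mA : measurable [set w | c <= f w] by apply: mfn_ge; exact: igr_mfn.
rewrite -Ex_indic // -ExZ; last exact: igr_indic.
apply: Ex_le => // [|w]; first by apply: igrZ; exact: igr_indic.
rewrite indicE; case: (boolP (w \in _)); rewrite ?inE /=.
 by rewrite mulr1.
by rewrite mulr0.
Qed.

Lemma Ex_dct (F : nat -> Om -> R) f g : (forall n, mfn (F n)) -> igr g ->
 (forall n w, `|F n w| <= g w) -> (forall w, F ^~ w @ \oo --> f w) ->
 igr f /\ Ex (F n) @[n --> \oo] --> Ex f.
Proof.
move=> mF gi Fg Ff. have mf : mfn f by apply: (measurable_fun_cvg mF) => w _; exact: Ff.
have [|||||] := @dominated_convergence _ _ _ P _ measurableT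
  (fun n => EFin \o F n) (EFin \o f) (EFin \o g).
- by move=> n; apply/measurable_EFinP; exact: mF.
- by apply/measurable_EFinP; exact: mf.
- by apply: aeW => w _ /=; apply: cvg_EFin; [exact: nearW|exact: Ff].
- exact: gi.
- by apply: aeW => w n _ /=; rewrite lee_fin.
move=> fi _ cv; split=> //. have cv' : (\int[P]_x (F n x)%:E)%E @[n --> \oo] --> (Ex f)%:E.
 by rewrite (ExE fi); exact: cv.
exact: (fine_cvg cv').
Qed.

Lemma Ex_ae f g : mfn f -> igr g -> {ae P, forall w, f w = g w} -> igr f /\ Ex f = Ex g.
Proof.
move=> mf gi fg. have aux (u v : Om -> \bar R) : (forall w, f w = g w -> u w = v w) -> ae_eq P setT u v.
 by move=> uv; apply: filterS fg => w /uv.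
split; last first.
 rewrite /Ex /Rintegral (ae_eq_integral (EFin \o g) (EFin \o f)) //.
 - exact/measurable_EFinP.
 - by apply/measurable_EFinP; exact: igr_mfn.
 - by apply: aux => w /= ->.
move/integrableP : (gi) => [mg gfin]; apply/integrableP; split.
 exact/measurable_EFinP.
apply: le_lt_trans gfin; rewrite le_eqVlt; apply/orP; left; apply/eqP. apply: ae_eq_integral => //.
- by apply: measurableT_comp => //; exact/measurable_EFinP.
- exact: measurableT_comp.
- by apply: aux => w /= ->.
Qed.

Lemma Ex_eq0_ae f : igr f -> (forall w, 0 <= f w) -> Ex f = 0 -> {ae P, forall w, f w = 0}.
Proof.
move=> fi f0 Ef. have mA : measurable [set w | 0 < f w] by apply: mfn_gt; exact: igr_mfn.
exists [set w | 0 < f w]; split=> //.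
 apply/eqP; apply: contraT => /(Ex_gt0 fi f0); by rewrite Ef ltxx.
move=> w /= h; rewrite lt_neqAle f0 andbT; apply/eqP => h'; exact: h.
Qed.

End expectation_toolkit.

(** * Product formula and pi-lambda arguments for independence *)

Section independence_toolkit.
Context {R : realType} {d : measure_display} {Om : measurableType d}.
Variable P : probability Om R.

Definition indepRV (X Y : Om -> R) := forall A B : set R, measurable A -> measurable B ->
 P (X @^-1` A `&` Y @^-1` B) = (P (X @^-1` A) * P (Y @^-1` B))%E.

(** The law of the pair agrees with the product of the marginals on rectangles, hence everywhere,
    and Fubini gives both claims. *)
Lemma indep_igrM (X Y : Om -> R) : igr P X -> igr P Y -> indepRV X Y -> igr P (fun w => X w * Y w) /\
 Ex P (fun w => X w * Y w) = Ex P X * Ex P Y.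
Proof.
move=> iX iY XY. have mX := igr_mfn iX; have mY := igr_mfn iY.
pose X' : {mfun Om >-> R} := mfun_Sub (mem_set mX : X \in mfun).
pose Y' : {mfun Om >-> R} := mfun_Sub (mem_set mY : Y \in mfun).
pose PX : probability R R := distribution P X'. pose PY : probability R R := distribution P Y'.
have mXY : measurable_fun setT (fun w => (X w, Y w)).
 exact: measurable_fun_pair.
pose XY' : {mfun Om >-> (R * R)%type} := mfun_Sub (mem_set mXY : (fun w => (X w, Y w)) \in mfun).
pose m' : {measure set (R * R) -> \bar R} := distribution P XY'.
have E := @product_measure_unique _ _ _ _ _ PX PY m' _.
have {}E S : measurable S -> (PX \x PY)%E S = m' S.
 exact: E => A B mA mB; rewrite /m' /= /distribution /pushforward /= -XY.
have mn : measurable_fun setT (fun z : R * R => (z.1 * z.2)%:E).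
 by apply/measurable_EFinP/measurable_funM => //; exact: measurable_snd.
have iPX : PX.-integrable setT (EFin : R -> \bar R).
 apply/integrableP; split; first exact/measurable_EFinP. rewrite ge0_integral_distribution //.
  by case/integrableP: iX.
 exact: measurableT_comp; exact/measurable_EFinP.
have iPY : PY.-integrable setT (EFin : R -> \bar R).
 apply/integrableP; split; first exact/measurable_EFinP. rewrite ge0_integral_distribution //.
  by case/integrableP: iY.
 exact: measurableT_comp; exact/measurable_EFinP.
have iprod : (PX \x PY)%E.-integrable setT (fun z : R * R => (z.1 * z.2)%:E).
 apply/integrable12ltyP => //=. under eq_integral => x _.
  under eq_integral do rewrite normrM EFinM. rewrite ge0_integralZl //=; last first.
   exact: measurableT_comp; exact/measurable_EFinP.
  over.
 rewrite ge0_integralZr //=.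
 - apply: lte_mul_pinfty => //.
  + exact: integral_ge0.
  + by rewrite ge0_fin_numE ?integral_ge0 //; case/integrableP: iPX.
  + by case/integrableP: iPY.
 - exact: measurableT_comp; exact/measurable_EFinP.
 - exact: integral_ge0.
have im' : m'.-integrable setT (fun z : R * R => (z.1 * z.2)%:E).
 case/integrableP: iprod => _ fin; apply/integrableP; split => //.
 by rewrite (eq_measure_integral (PX \x PY)%E) // => S mS _; exact/esym/E.
have iXY : igr P (fun w => X w * Y w).
 case/integrableP: im' => _; rewrite ge0_integral_distribution //; last first.
  exact: measurableT_comp.
 move=> fin; apply/integrableP; split => //. by apply/measurable_EFinP/measurable_funM.
split => //; apply: EFin_inj; rewrite ExE // EFinM !ExE //.
rewrite -(@integral_distribution _ _ _ _ _ P XY' (fun z => (z.1 * z.2)%:E)) //.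
rewrite (_ : distribution P XY' = m') //. rewrite (eq_measure_integral (PX \x PY)%E); last first.
 by move=> S mS _; exact/esym/E.
rewrite -integral12_prod_meas1 // /fubini_F /=. under eq_integral => x _.
 under eq_integral do rewrite EFinM. rewrite integralZl //. over.
rewrite /=. have finY : (\int[PY]_x x%:E)%E \is a fin_num by exact: integrable_fin_num.
rewrite -(fineK finY). under eq_integral do rewrite muleC.
rewrite integralZl // muleC fineK //; congr (_ * _)%E.
- by rewrite (@integral_distribution _ _ _ _ _ P X').
- by rewrite (@integral_distribution _ _ _ _ _ P Y').
Qed.

Lemma dynkin_indep_class (H : set Om) : measurable H ->
 dynkin [set A | measurable A /\ P (A `&` H) = (P A * P H)%E].
Proof.
move=> mH; split.
- by split=> //; rewrite setTI probability_setT mul1e.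
- move=> A [mA AH]; split; first exact: measurableC.
 have finH : P H \is a fin_num by exact: fin_num_measure.
 have finAH : P (A `&` H) \is a fin_num by apply: fin_num_measure; exact: measurableI.
 have -> : ~` A `&` H = H `\` A by rewrite setDE setIC.
 rewrite measureD //; last by rewrite ltey_eq finH. transitivity (P H - P A * P H)%E.
  by congr (_ - _)%E; rewrite setIC; exact: AH.
 rewrite probability_setC //. by rewrite muleBl // ?mul1e // fin_num_adde_defl // fin_numN fin_numM.
- move=> F tF mF; split; first by apply: bigcupT_measurable => n; case: (mF n). rewrite setI_bigcupl.
 have mFn n : measurable (F n) by case: (mF n). rewrite measure_bigcup //; last 2 first.
  by move=> n _; exact: measurableI. exact: trivIset_setIr.
 rewrite measure_bigcup // -(Pr_fin P mH) muleC -nneseriesZl; last first.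
  by [].
 rewrite (Pr_fin P mH). by apply: eq_eseriesr => n _; rewrite muleC; case: (mF n).
Qed.

(** Two passes of the pi-lambda theorem, one for each argument. *)
Lemma indep_generated (G H : set_system Om) :
 G `<=` measurable -> H `<=` measurable -> setI_closed G -> setI_closed H ->
 (forall A B, G A -> H B -> P (A `&` B) = (P A * P B)%E) ->
 independent P <<s G >> <<s H >>.
Proof.
move=> mG mH cG cH GH A B sA sB. have mB : measurable B.
 by move: B sB; apply: smallest_sub => //; exact: sigma_algebra_measurable.
have step1 C : H C -> forall A', <<s G >> A' -> P (A' `&` C) = (P A' * P C)%E.
 move=> HC A'; rewrite -(setI_closed_g_dynkin_g_sigma_algebra cG) => sA'.
 have sub : G `<=` [set A | measurable A /\ P (A `&` C) = (P A * P C)%E].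
  by move=> D GD; split; [exact: mG|exact: GH].
 by case: (smallest_sub (dynkin_indep_class (mH _ HC)) sub sA').
have mA : measurable A.
 by move: A sA; apply: smallest_sub => //; exact: sigma_algebra_measurable.
move: B sB {mB}; rewrite -(setI_closed_g_dynkin_g_sigma_algebra cH) => B sB.
have sub : H `<=` [set D | measurable D /\ P (D `&` A) = (P D * P A)%E].
 move=> D HD; split; first exact: mH. by rewrite setIC (step1 _ HD) // muleC.
case: (smallest_sub (dynkin_indep_class mA) sub sB) => _ e. by rewrite setIC e muleC.
Qed.

End independence_toolkit.

(** * Continuous induction, paths and running suprema *)

Section real_analysis.
Context {R : realType}.
Implicit Types (f g z : R -> R).

(** Continuous induction: the infimum of the counterexamples would satisfy the premise of the step,
    which pushes all counterexamples beyond it. The premise covers only s < t, so every use must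
    first reach t itself by a limit from the left. *)
Lemma real_ind (a b : R) (Q : R -> Prop) :
 (forall t, a <= t -> t <= b -> (forall s, a <= s -> s < t -> Q s) ->
   exists2 e : R, 0 < e & forall s, t <= s -> s < t + e -> s <= b -> Q s) ->
 forall t, a <= t -> t <= b -> Q t.
Proof.
move=> step t0 at0 t0b; apply: contrapT => nQ. pose B := [set t | [/\ a <= t, t <= b & ~ Q t]].
have B0 : B !=set0 by exists t0. have lB : has_lbound B by exists a => t []. have hB : has_inf B by split.
pose m := inf B. have am : a <= m by apply: lb_le_inf => // t [].
have mb : m <= b by apply: (le_trans (ge_inf lB (_ : B t0))). have [|e e0 He] := step m am mb.
 move=> s as_ sm; apply: contrapT => nQs.
 have : m <= s by apply: ge_inf => //; split=> //; apply: ltW; exact: lt_le_trans mb.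
 by rewrite leNgt sm.
have [t [at_ tb nQt] tm] := inf_adherent e0 hB. have Bt : B t by split.
by apply: nQt; apply: He => //; exact: ge_inf.
Qed.

(** Paths on the half-line are extended to negative times by their value at 0, so that ordinary
    continuity and suprema over all s <= t replace the one-sided notions. *)
Definition frozen f := forall t, t <= 0 -> f t = f 0.
Definition cpath f := continuous f /\ frozen f.

Lemma cts_dist f t : {for t, continuous f} -> forall e : R, 0 < e ->
 exists2 h : R, 0 < h & forall s, `|s - t| < h -> `|f s - f t| < e.
Proof.
move=> cf e e0; have /cvgrPdist_lt /(_ _ e0) := cf.
rewrite nearE /= => -[h /= h0 H]; exists h => // s st; rewrite distrC; apply: H. by rewrite /= distrC.
Qed.

Lemma dist_cts f t : (forall e : R, 0 < e ->
 exists2 h : R, 0 < h & forall s, `|s - t| < h -> `|f s - f t| < e) ->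
 {for t, continuous f}.
Proof.
move=> H; apply/cvgrPdist_lt => e e0; have [h h0 Hh] := H _ e0.
exists h => //= s; rewrite /= distrC => st; rewrite distrC; exact: Hh.
Qed.

(** Heine's theorem by continuous induction on the right end point; freezing takes care of the
    unbounded left side. *)
Lemma cpath_ucts f : cpath f -> forall K (e : R), 0 < e ->
 exists2 h : R, 0 < h & forall s t, s <= K -> t <= K -> `|s - t| < h -> `|f s - f t| < e.
Proof.
move=> [cf ff] K e e0. have K0 : 0 <= maxr 0 K by rewrite le_max lexx.
suff [h h0 H] : exists2 h : R, 0 < h & forall s t, s <= maxr 0 K -> t <= maxr 0 K ->
  `|s - t| < h -> `|f s - f t| < e.
 by exists h => // s t sK tK; apply: H; rewrite le_max ?sK ?tK orbT.
apply: (@real_ind 0 (maxr 0 K) (fun u => exists2 h : R, 0 < h &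
 forall s t, s <= u -> t <= u -> `|s - t| < h -> `|f s - f t| < e)) => // u u0 uK IH.
have e2 : 0 < e / 2 by lra. have [h h0 H] := cts_dist (cf u) e2.
have near s t : `|s - u| < h -> `|t - u| < h -> `|f s - f t| < e.
 move=> su tu; have -> : f s - f t = (f s - f u) - (f t - f u) by ring.
 apply: (le_lt_trans (ler_normB _ _)). by rewrite [ltRHS](splitr e) ltrD // H.
exists h => // v uv vuh _. move: u0; rewrite le_eqVlt => /orP[/eqP u0|u0].
 have frz s : s <= v -> `|f s - f 0| < e / 2.
  move=> sv; have [s0|s0] := leP s 0; first by rewrite ff // subrr normr0.
  rewrite u0; apply: H; rewrite -u0 subr0 gtr0_norm //. lra.
 exists 1 => // s t sv tv _. have -> : f s - f t = (f s - f 0) - (f t - f 0) by ring.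
 apply: (le_lt_trans (ler_normB _ _)). by rewrite [ltRHS](splitr e) ltrD // frz.
pose w := maxr 0 (u - h / 2). have wu : w < u by rewrite /w gt_max u0 ltrBlDr ltrDl divr_gt0.
have [|k k0 Hk] := IH w _ wu; first by rewrite /w le_max lexx.
exists (minr k (h / 2)); first by rewrite lt_min k0 divr_gt0.
move=> s t sv tv; rewrite lt_min => /andP[stk sth]. have [sw|sw] := leP s w.
 have [tw|tw] := leP t w; first exact: Hk. move: sth; rewrite ltr_distl => /andP[/ltW a1 a2].
 apply: near; rewrite ltr_distl.
  apply/andP; split; last by lra. have : u - h / 2 <= w by rewrite /w le_max lexx orbT. by lra.
 apply/andP; split; last by lra. have : u - h / 2 <= w by rewrite /w le_max lexx orbT. by lra.
have uw : u - h / 2 <= w by rewrite /w le_max lexx orbT. move: sth; rewrite ltr_distl => /andP[a1 a2].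
by apply: near; rewrite ltr_distl; apply/andP; split; lra.
Qed.

Lemma cpath_bdd f : cpath f -> forall K, exists C : R, forall s, s <= K -> `|f s| <= C.
Proof.
move=> [cf ff] K. have [|| c _ Hc] := @EVT_max R (fun s => `|f s|) 0 (maxr 0 K).
- by rewrite le_max lexx.
- apply: continuous_subspaceT => s; apply: continuous_comp; first exact: cf. exact: norm_continuous.
exists `|f c| => s sK; have [s0|s0] := leP s 0.
 by rewrite ff //; apply: Hc; rewrite in_itv /= lexx le_max lexx.
apply: Hc; rewrite in_itv /= (ltW s0) /= le_max sK orbT //.
Qed.

Lemma cpathD f g : cpath f -> cpath g -> cpath (fun t => f t + g t).
Proof.
move=> [cf ff] [cg fg]; split; last by move=> t t0; rewrite ff // fg.
by move=> t; apply: cvgD; [exact: cf|exact: cg].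
Qed.

Lemma cpathZ (c : R) f : cpath f -> cpath (fun t => c * f t).
Proof.
move=> [cf ff]; split; last by move=> t t0; rewrite ff.
by move=> t; apply: cvgM; [exact: cvg_cst|exact: cf].
Qed.

Lemma cpathB f g : cpath f -> cpath g -> cpath (fun t => f t - g t).
Proof.
move=> cf cg; have := cpathD cf (cpathZ (-1) cg). by congr cpath; apply/funext => t; rewrite mulN1r.
Qed.

Lemma cpath_cst (c : R) : cpath (fun=> c).
Proof. by split=> // t; exact: cvg_cst. Qed.

Lemma cpath_sum (I : Type) (s : seq I) (F : I -> R -> R) :
 (forall i, cpath (F i)) -> cpath (fun t => \sum_(i <- s) F i t).
Proof.
move=> cF; elim: s => [|i s IH].
 by under eq_fun do rewrite big_nil; exact: cpath_cst.
by under eq_fun do rewrite big_cons; exact: cpathD.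
Qed.

Lemma cpath_min f (K : R) : 0 <= K -> cpath f -> cpath (fun t => f (minr t K)).
Proof.
move=> K0 [cf ff]; split; last first.
 by move=> t t0; rewrite !min_l // ?(le_trans t0) //; exact: ff.
move=> t; apply: dist_cts => e e0; have [h h0 H] := cts_dist (cf (minr t K)) e0.
exists h => // s st; apply: H; apply: le_lt_trans st.
have a1 := ler_norm (s - t); have a2 := ler_norm (t - s). rewrite distrC in a2.
by have [tK|tK] := leP t K; have [sK|sK] := leP s K; rewrite !ler_norml; apply/andP; split; lra.
Qed.

(** With the positive part inside, [runsup] of -Z is the supremum of the negative parts of Z, that
    is, the regulator of the Skorokhod problem. *)
Definition runsup g t := sup [set maxr 0 (g s) | s in [set s | s <= t]].

Definition ubd g t := exists C : R, forall s, s <= t -> g s <= C.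

Lemma runsup_set0 g t : [set maxr 0 (g s) | s in [set s | s <= t]] !=set0.
Proof. by exists (maxr 0 (g t)); exists t => //=. Qed.

Lemma runsup_has g t : ubd g t -> has_sup [set maxr 0 (g s) | s in [set s | s <= t]].
Proof.
move=> [C HC]; split; first exact: runsup_set0. exists (maxr 0 C) => _ [s /= st <-].
by rewrite ge_max le_max lexx /= le_max HC ?orbT.
Qed.

Lemma runsup_ub g t s : ubd g t -> s <= t -> g s <= runsup g t.
Proof.
move=> /runsup_has hs st; apply: (@le_trans _ _ (maxr 0 (g s))).
 by rewrite le_max lexx orbT.
by apply: sup_upper_bound => //; exists s.
Qed.

Lemma runsup_ge0 g t : ubd g t -> 0 <= runsup g t.
Proof.
move=> /runsup_has hs; apply: (@le_trans _ _ (maxr 0 (g t))).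
 by rewrite le_max lexx.
by apply: sup_upper_bound => //; exists t => //=.
Qed.

Lemma runsup_le g t (c : R) : 0 <= c -> (forall s, s <= t -> g s <= c) -> runsup g t <= c.
Proof.
move=> c0 H; apply: ge_sup; first exact: runsup_set0. by move=> _ [s /= st <-]; rewrite ge_max c0 H.
Qed.

Lemma ubd_le g s t : s <= t -> ubd g t -> ubd g s.
Proof. by move=> st [C HC]; exists C => r rs; apply: HC; exact: le_trans st. Qed.

Lemma runsup_mono g s t : ubd g t -> s <= t -> runsup g s <= runsup g t.
Proof.
move=> b st; apply: runsup_le; first exact: runsup_ge0.
by move=> r rs; apply: runsup_ub => //; exact: le_trans st.
Qed.

Lemma runsup_leD g g' t (e : R) : 0 <= e -> ubd g' t ->
 (forall s, s <= t -> g s <= g' s + e) -> runsup g t <= runsup g' t + e.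
Proof.
move=> e0 b H; apply: runsup_le; first by rewrite addr_ge0 // runsup_ge0.
move=> s st; apply: (le_trans (H _ st)); rewrite lerD2r; exact: runsup_ub.
Qed.

Lemma eq_runsup g g' t : (forall s, s <= t -> g s = g' s) -> runsup g t = runsup g' t.
Proof.
move=> H; rewrite /runsup; congr sup; apply/seteqP; split=> _ [s /= st <-]; exists s => //=; by rewrite H.
Qed.

Lemma runsup_step g s t c : s <= t -> ubd g t -> runsup g s <= c ->
 (forall r, s < r -> r <= t -> g r <= c) -> runsup g t <= c.
Proof.
move=> st b sc H; apply: runsup_le.
 by apply: le_trans sc; apply: runsup_ge0; exact: ubd_le b.
move=> r rt; have [rs|sr] := leP r s; last exact: H.
by apply: le_trans sc; apply: runsup_ub => //; exact: ubd_le b.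
Qed.

Lemma cpath_ubd f t : cpath f -> ubd f t.
Proof.
by move=> /cpath_bdd /(_ t) [C HC]; exists C => s st; apply: le_trans (HC _ st); exact: ler_norm.
Qed.

Lemma frozen_runsup f t : cpath f -> t <= 0 -> runsup f t = maxr 0 (f 0).
Proof.
move=> cf t0; apply: le_anti; apply/andP; split.
 apply: runsup_le; first by rewrite le_max lexx.
 by move=> s st; rewrite (cf.2 s) ?(le_trans st) // le_max lexx orbT.
rewrite ge_max runsup_ge0 /=; last exact: cpath_ubd.
by rewrite -(cf.2 _ t0); apply: runsup_ub => //; exact: cpath_ubd.
Qed.

Lemma cpath_runsup f : cpath f -> cpath (runsup f).
Proof.
move=> cf; split; last by move=> t t0; rewrite !frozen_runsup. move=> t; apply: dist_cts => e e0.
have e2 : 0 < e / 2 by lra. have [h h0 H] := cpath_ucts cf (t + 1) e2.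
have key s r : s <= r -> r <= t + 1 -> r - s < h -> runsup f r <= runsup f s + e / 2.
 move=> sr rt rs; have b : ubd f r by exact: cpath_ubd.
 apply: (runsup_step sr b); first by rewrite lerDl ltW. move=> u su ur; have us : `|u - s| < h.
  by rewrite gtr0_norm ?subr_gt0 //; apply: le_lt_trans rs; rewrite lerD2r.
 have := H u s (le_trans ur rt) (le_trans sr rt) us.
 rewrite ltr_distl => /andP[_ /ltW]; move=> /le_trans; apply.
 by rewrite lerD2r; apply: runsup_ub => //; exact: cpath_ubd.
exists (minr h 1); first by rewrite lt_min h0 /=.
move=> s; rewrite lt_min => /andP[]; rewrite !ltr_distl => /andP[h1 h2] /andP[h3 h4].
have b r : ubd f r by exact: cpath_ubd. have [st|ts] := leP s t.
 have k : runsup f t <= runsup f s + e / 2 by apply: key => //; lra. have := runsup_mono (b t) st => m.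
 by apply/andP; split; lra.
have k : runsup f s <= runsup f t + e / 2 by apply: key => //; lra.
have := runsup_mono (b s) (ltW ts) => m. by apply/andP; split; lra.
Qed.

End real_analysis.

(** * Uniqueness and existence for the one-dimensional Skorokhod problem *)

Section skorokhod_problem.
Context {R : realType}.
Implicit Types (Z X L : R -> R) (T : \bar R).

(** The integral of a nonnegative function is a supremum over the simple functions below it, which
    is monotone for arbitrary functions. This allows indicators of {X > 0} to be handled before any
    measurability is known. *)
Lemma ge0_le_integral_any d (Om : measurableType d)
  (mu : {measure set Om -> \bar R}) (D : set Om) (f g : Om -> \bar R) :
 (forall x, D x -> 0 <= f x)%E -> (forall x, D x -> f x <= g x)%E ->
 (\int[mu]_(x in D) f x <= \int[mu]_(x in D) g x)%E.
Proof.
move=> f0 fg. have g0 x : D x -> (0 <= g x)%E by move=> Dx; apply: le_trans (f0 _ Dx) (fg _ Dx).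
rewrite !ge0_integralE //; apply: le_ereal_sup => _ [h /= hf <-]; exists h => //= x.
apply: (le_trans (hf x)); rewrite /patch; case: ifPn => //. by rewrite inE => /fg.
Qed.

Lemma integral_indic0_measure0 d (Om : measurableType d)
  (mu : {measure set Om -> \bar R}) (D A B : set Om) :
 measurable A -> A `<=` D -> A `<=` B ->
 (\int[mu]_(x in D) (\1_B x)%:E = 0)%E -> mu A = 0%E.
Proof.
move=> mA AD AB I0; apply/eqP; rewrite eq_le measure_ge0 andbT -I0.
have -> : mu A = (\int[mu]_(x in setT) (\1_A x)%:E)%E.
 by rewrite integral_indic // setIT.
rewrite [leRHS]integral_mkcond. apply: ge0_le_integral_any => [x _|x _]; first by rewrite lee_fin.
rewrite /patch; case: ifPn => xD.
 rewrite lee_fin !indicE ler_nat; case: (boolP (x \in A)) => // xA.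
 by rewrite mem_set //; apply: AB; rewrite inE in xA.
rewrite indicE; case: (boolP (x \in A)) => //; rewrite inE => /AD xD'. by move: xD; rewrite mem_set.
Qed.

Lemma measure0_cover d (Om : measurableType d) (mu : {measure set Om -> \bar R})
  (V : set Om) (F : nat -> set Om) :
 measurable V -> (forall n, mu.-negligible (F n)) -> V `<=` \bigcup_n F n ->
 mu V = 0%E.
Proof.
move=> mV nF VF; have [B [mB B0 VB]] : mu.-negligible V.
 by apply: (negligibleS VF); exact: negligible_bigcup.
exact: (subset_measure0 mV mB VB B0).
Qed.

Lemma lebesgue_stieltjes_itv_oc (g : cumulative R R) (a b : R) : a <= b ->
 lebesgue_stieltjes_measure g `]a, b]%classic = (g b - g a)%:E.
Proof.
move=> ab; rewrite /lebesgue_stieltjes_measure /measure_extension /=.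
rewrite measurable_mu_extE /=; last exact: is_ocitv. by rewrite wlength_itv_bnd.
Qed.

(** If L t exceeded the supremum M, take c halfway between and s0 the first time at which L reaches
    c. On [s0, t] one has X > 0, so dL gives no mass to this interval, although L still has to climb
    from c to L t. *)
Lemma skorokhod_runsup Z X L T : skorokhod Z T X L ->
 forall t, before T t -> L t = runsup (fun s => - Z (maxr 0 s)) t.
Proof.
move=> [cX cL L0 mL H] t [t0 tT]. have bef s : s <= t -> before T (maxr 0 s).
 move=> st; split; first by rewrite le_max lexx. by apply: le_lt_trans tT; rewrite lee_fin ge_max t0.
have {}L0 : L 0 = 0 by apply: L0; have := bef 0 t0; rewrite maxxx.
have L_ge0 : 0 <= L t by rewrite -L0; apply: mL. have ZL s : s <= t -> - Z (maxr 0 s) <= L t.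
 move=> st; have [XE X0 _] := H _ (bef _ st).
 apply: (@le_trans _ _ (L (maxr 0 s))); first by rewrite XE in X0; lra.
 by apply: mL => //; rewrite ?le_max ?lexx // ge_max t0.
apply: le_anti; apply/andP; split; last exact: runsup_le.
rewrite leNgt; apply/negP; set M := runsup _ _ => ML.
have ub : ubd (fun s => - Z (maxr 0 s)) t by exists (L t). have M0 : 0 <= M by exact: runsup_ge0.
pose c := (M + L t) / 2. have Mc : M < c by rewrite /c; lra. have cL' : c < L t by rewrite /c; lra.
pose S := [set s | [/\ 0 <= s, s <= t & c <= L s]]. have St : S t by split=> //; exact: ltW.
have lS : has_lbound S by exists 0 => s []. pose s0 := inf S.
have s0_ge0 : 0 <= s0 by apply: lb_le_inf; [exists t|move=> s []]. have s0t : s0 <= t by apply: ge_inf.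
have after s : s0 < s -> s <= t -> c <= L s.
 move=> s0s st; have [|r [r0 rt cr] rs] := @inf_adherent _ S (s - s0) _ (conj (ex_intro _ t St) lS).
  by rewrite subr_gt0.
 apply: (le_trans cr); apply: mL => //.
  by rewrite /s0 in rs; lra.
 by split; [lra|apply: le_lt_trans tT; rewrite lee_fin].
have bs0 : before T s0 by have := bef _ s0t; rewrite max_r. have cs0 : c <= L s0.
 move: s0t; rewrite le_eqVlt => /orP[/eqP -> |s0t]; first exact: ltW. rewrite leNgt; apply/negP => Lc.
 have [rc _] := cL _ bs0. have Hn : \forall s \near s0^'+, L s < c by move: rc => /cvgr_lt; apply.
 have : \forall s \near s0^'+, False.
  near=> s; have s1 : L s < c by near: s. have : c <= L s.
   by apply: after; [near: s; exact: nbhs_right_gt|near: s; exact: nbhs_right_le].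
  by rewrite leNgt s1.
 by move=> /filter_ex [].
have s0_gt0 : 0 < s0.
 rewrite lt_neqAle s0_ge0 andbT; apply/eqP => s00. by move: cs0; rewrite -s00 L0; lra.
have pos s : s0 <= s -> s <= t -> 0 < X s.
 move=> s0s st; have s_0 : 0 <= s by lra. have bs : before T s by have := bef _ st; rewrite max_r.
 have [-> _ _] := H _ bs. have := runsup_ub ub st; rewrite max_r // -/M => ZM.
 have : L s0 <= L s by exact: mL. lra.
have [_ _ [g gE I0]] := H _ (conj t0 tT). have A0 : lebesgue_stieltjes_measure g `[s0, t]%classic = 0%E.
 apply: (integral_indic0_measure0 _ _ _ I0) => //.
  by move=> s /=; rewrite in_itv /= => /andP[? ->]; rewrite andbT; lra.
 by move=> s /=; rewrite in_itv /= => /andP[? ?]; exact: pos.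
(* These left-open intervals decrease to [s0, t]. They start strictly before s0, where L < c, so a
   jump of L at s0 is counted as well. *)
pose F n := `](s0 - s0 / n.+1%:R), t]%classic. have FE : \bigcap_n F n = `[s0, t]%classic.
 apply/seteqP; split=> s /=; rewrite ?in_itv /=.
  move=> Fs; have := Fs 0%N I; rewrite /F /= in_itv /= => /andP[_ ->].
  rewrite andbT leNgt; apply/negP => ss0. have e0 : 0 < (s0 - s) / s0 by rewrite divr_gt0 // subr_gt0.
  have [n _ /(_ n (leqnn n))] := near_infty_natSinv_lt (PosNum e0).
  rewrite /= ltr_pdivlMr // mulrC => hn. have := Fs n I; rewrite /F /= in_itv /= => /andP[h1 _].
  by move: h1; rewrite ltrBlDr -ltrBlDl => /(lt_trans hn); rewrite ltxx.
 move=> /andP[s0s st] n _; rewrite /F /= in_itv /= st andbT. have : 0 < s0 / n.+1%:R by rewrite divr_gt0.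
 by move: (s0 / _) => q q0; lra.
have Fle n : 0 < s0 - s0 / n.+1%:R \/ s0 - s0 / n.+1%:R = 0.
 have : s0 / n.+1%:R <= s0 by rewrite ler_pdivrMr // ler_peMr ?ler1n // ltW. move: (s0 / _) => q.
 rewrite le_eqVlt => /orP[/eqP ->|?]; [right|left]; lra.
have muF n : ((L t - c)%:E <= lebesgue_stieltjes_measure g (F n))%E.
 have p0 : 0 < s0 / n.+1%:R by rewrite divr_gt0.
 have r0 : 0 <= s0 - s0 / n.+1%:R by case: (Fle n) => [/ltW|->].
 rewrite /F; move: p0 r0; move: (s0 / _) => q p0 r0.
 rewrite lebesgue_stieltjes_itv_oc ?lee_fin; last by lra.
 rewrite !gE minxx (max_r t0) (min_l (_ : _ <= t)); last by lra.
 rewrite max_r // lerD2l lerN2 leNgt; apply/negP => cLr.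
 have : s0 <= s0 - q by apply: ge_inf => //; split=> //; [lra|exact: ltW]. lra.
have mF n : measurable (F n) by exact: measurable_itv.
have cv : (lebesgue_stieltjes_measure g \o F) n @[n --> \oo] --> 0%E.
 have F0 : (lebesgue_stieltjes_measure g (F 0%N) < +oo)%E.
  by rewrite /F divr1 subrr lebesgue_stieltjes_itv_oc ?ltry.
 rewrite -A0 -FE; apply: nonincreasing_cvg_mu => //.
 - by rewrite FE; exact: measurable_itv.
 - move=> m n mn; apply/subsetPset => s; rewrite /F /= !in_itv /= => /andP[h ->].
  rewrite andbT; apply: le_lt_trans h; rewrite lerD2l lerN2.
  by rewrite ler_pM2l // lef_pV2 ?posrE // ler_nat ltnS.
have : ((L t - c)%:E <= lim ((lebesgue_stieltjes_measure g \o F) n @[n --> \oo]))%E.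
 apply: lime_ge; first by apply/cvg_ex; exists 0%E. by apply: nearW => n; exact: muF.
rewrite (cvg_lim _ cv) //. by rewrite lee_fin; lra.
Unshelve. all: by end_near. Qed.

Definition cumulative_of (g : R -> R) (nd : nondecreasing g) (rc : right_continuous g) : cumulative R R :=
 HB.pack g (isCumulative.Build R _ R g nd rc).

(** Continuous induction: if X is positive at u, then -Z stays below L p for a short while, so the
    supremum does not move. *)
Lemma runsup_flat Z (p q : R) : cpath Z -> p <= q ->
 (forall s, p <= s -> s <= q -> 0 < Z s + runsup (fun s => - Z s) s) ->
 runsup (fun s => - Z s) q = runsup (fun s => - Z s) p.
Proof.
move=> cZ pq pos; have cN : cpath (fun s => - Z s).
 by have := cpathZ (-1) cZ; congr cpath; apply/funext => s; rewrite mulN1r.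
set L := runsup _; have cL : cpath L by exact: cpath_runsup.
apply: (@real_ind R p q (fun s => L s = L p)) => // u pu uq IH. have Lu : L u = L p.
 move: pu; rewrite le_eqVlt => /orP[/eqP ->//|pu].
 apply/eqP; rewrite -subr_eq0 -normr_le0; apply/ler_addgt0Pl => e e0; rewrite addr0.
 have [h h0 H] := cts_dist (cL.1 u) e0. pose s := maxr p (u - h / 2).
 have su : s < u by rewrite gt_max pu ltrBlDr ltrDl divr_gt0.
 have hs : u - h / 2 <= s by rewrite le_max lexx orbT.
 rewrite -(IH s) // ?le_max ?lexx // distrC; apply/ltW/H. by rewrite ltr0_norm ?subr_lt0 //; lra.
have Zu : 0 < L p + Z u by rewrite -Lu addrC; apply: pos. have [h h0 H] := cts_dist (cZ.1 u) Zu.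
exists h => // s us suh sq; apply: le_anti; apply/andP; split; last first.
 by rewrite -Lu; apply: runsup_mono => //; exact: cpath_ubd.
apply: (runsup_step us); [exact: cpath_ubd|by rewrite -/L Lu|].
move=> r ur rs; have : `|r - u| < h by rewrite gtr0_norm ?subr_gt0 //; lra.
by move=> /H; rewrite ltr_distl => /andP[? _]; lra.
Qed.

Lemma runsup_skorokhod Z T : (forall K, before T K -> cpath (fun s => Z (maxr 0 (minr s K)))) ->
 (before T 0 -> 0 <= Z 0) ->
 let L := runsup (fun s => - Z (maxr 0 s)) in
 skorokhod Z T (fun t => Z t + L t) L.
Proof.
move=> cZ Z0 L. pose ZK K s := Z (maxr 0 (minr s K)). pose LK K := runsup (fun s => - ZK K s).
have cN K : before T K -> cpath (fun s => - ZK K s).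
 move=> bK; have := cpathZ (-1) (cZ _ bK). by congr cpath; apply/funext => s; rewrite mulN1r.
have cLK K : before T K -> cpath (LK K) by move=> /cN; exact: cpath_runsup.
have LE K s : s <= K -> L s = LK K s.
 move=> sK; apply: eq_runsup => r rs; rewrite /ZK min_l //; exact: le_trans sK.
have ubL t : before T t -> ubd (fun s => - Z (maxr 0 s)) t.
 move=> /cN /(cpath_ubd t)[C HC]; exists C => s st. by have := HC _ st; rewrite /ZK min_l.
have gap t : before T t -> exists2 K, t < K & before T K.
 move=> [t0 tT]; case: T tT {cZ Z0 ubL cN cLK} => [r| |] //.
  rewrite lte_fin => tr; exists ((t + r) / 2); first lra. by split; [lra|rewrite lte_fin; lra].
 by move=> _; exists (t + 1); [lra|split; [lra|rewrite ltry]].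
have loc (f : R -> R) (fK : R -> R) t K : t < K -> 0 <= t ->
  (forall s, 0 <= s -> s <= K -> f s = fK s) -> {for t, continuous fK} ->
  f s @[s --> t^'+] --> f t /\ (0 < t -> cvg (f s @[s --> t^'-])).
 move=> tK t0 ffK cf; rewrite ffK ?(ltW tK) //; split.
  have := cvg_at_right_filter cf; apply: cvg_trans; apply: near_eq_cvg; near=> s.
  rewrite ffK //; first by apply: (le_trans t0); near: s; exact: nbhs_right_ge.
  by near: s; apply: nbhs_right_le.
 move=> t_gt0; apply/cvg_ex; exists (fK t).
 have := cvg_at_left_filter cf; apply: cvg_trans; apply: near_eq_cvg; near=> s.
 rewrite ffK //; first by apply: ltW; near: s; exact: nbhs_left_gt.
 apply: (@le_trans _ _ t); last exact: ltW. by near: s; exact: nbhs_left_le.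
have cL : cadlag_on T L.
 move=> t bt; have [K tK bK] := gap _ bt.
 apply: (loc L (LK K) t K) => //; [exact: bt.1| |exact: (cLK _ bK).1]. by move=> s _ sK; exact: LE.
split => //.
- move=> t bt; have [K tK bK] := gap _ bt.
 apply: (loc _ (fun s => ZK K s + LK K s) t K) => //; [exact: bt.1| |].
  by move=> s s0 sK; rewrite (LE _ _ sK) /ZK min_l // max_r.
 by apply: (cpathD (cZ _ bK) (cLK _ bK)).1.
- move=> b0; rewrite (LE 0 0) // /LK frozen_runsup //; last exact: cN.
 by rewrite /ZK minxx maxxx max_l // oppr_le0; exact: Z0.
- by move=> s t s0 st bt; apply: runsup_mono => //; exact: ubL.
move=> t bt; have t0 := bt.1; split=> //.
 have := runsup_ub (ubL _ bt) (lexx t); rewrite max_r // -/L; lra.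
have LKE s : LK t (maxr 0 (minr s t)) = LK t s.
 have [ts|st] := leP t s.
  rewrite max_r //; apply: le_anti; rewrite runsup_mono //=; last first.
   by apply: cpath_ubd; exact: cN.
  apply: runsup_le => [|r rs]; first by apply: runsup_ge0; apply: cpath_ubd; exact: cN.
  rewrite (_ : ZK t r = ZK t (minr r t)); last by rewrite /ZK -minA minxx.
  apply: (runsup_ub (g := fun s => - ZK t s)); first by apply: cpath_ubd; exact: cN.
  by rewrite ge_min lexx orbT.
 have [s0|s0] := leP s 0; last by []. by rewrite ((cLK _ bt).2 s).
have nd : nondecreasing (LK t).
 by move=> r s rs; apply: runsup_mono => //; apply: cpath_ubd; exact: cN.
have rc : right_continuous (LK t).
 by apply: right_continuousW; exact: (cLK _ bt).1.
exists (cumulative_of nd rc).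
 by move=> s /=; rewrite (LE t) ?LKE // ge_max t0 /= ge_min lexx orbT.
pose V := [set r | 0 < ZK t r + LK t r].
have cX : cpath (fun r => ZK t r + LK t r) by exact: cpathD (cZ _ bt) (cLK _ bt).
have mV : measurable V by apply: mfn_gt; apply: continuous_measurable_fun; exact: cX.1.
(* The set {X > 0} is open, hence covered by the countably many rational intervals on which X > 0
   throughout; [runsup_flat] makes each of them null. *)
set mu := lebesgue_stieltjes_measure _. pose F n := if unpickle n is Some pq then
 let p : R := ratr (pq : rat * rat).1 in let q : R := ratr pq.2 in
 [set r | [/\ p < r, r <= q & forall s, p <= s -> s <= q -> 0 < ZK t s + LK t s]]
 else set0.
have negF n : mu.-negligible (F n).
 rewrite /F; case: unpickle => [[p q]|] /=; last exact: negligible_set0.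
 have [pq|pq] := leP (ratr p : R) (ratr q); last first.
  apply: (negligibleS _ (negligible_set0 _)) => r [pr rq _] /=.
  by have := lt_le_trans pr rq; rewrite ltNge (ltW pq).
 have [H|H] := pselect (forall s, ratr p <= s -> s <= ratr q -> 0 < ZK t s + LK t s); last first.
  by apply: (negligibleS _ (negligible_set0 _)) => r [_ _ /H].
 exists `](ratr p), (ratr q)]%classic; split => //.
  rewrite /mu lebesgue_stieltjes_itv_oc //= -/(LK t).
  by have := runsup_flat (cZ _ bt) pq H; rewrite -/(LK t) => ->; rewrite subrr.
 by move=> r [pr rq _]; rewrite /= in_itv /= pr.
have VF : V `<=` \bigcup_n F n.
 move=> r Vr. have [h h0 Hh] := cts_dist (cX.1 r) Vr.
 have [rh rh'] : r - h < r /\ r < r + h by split; lra. have [p] := rat_in_itvoo rh.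
 rewrite in_itv /= => /andP[p1 p2]. have [q] := rat_in_itvoo rh'. rewrite in_itv /= => /andP[q1 q2].
 exists (pickle (p, q)); [exact: I|rewrite /F pickleK]. split; [exact: p2|exact: ltW|].
 move=> s ps sq; have : `|s - r| < h by rewrite ltr_distl; apply/andP; split; lra.
 by move=> /Hh; rewrite ltr_distl subrr => /andP[].
have V0 : mu V = 0%E.
 exact (@measure0_cover _ (measurableTypeR R)
  (lebesgue_stieltjes_measure (cumulative_of nd rc)) V F mV negF VF).
transitivity (\int[mu]_(r in [set r : R | (0 <= r <= t)%R]) (\1_V r)%:E)%E.
 apply: eq_integral => r; rewrite inE /= => /andP[r0 rt]; congr (_ %:E).
 rewrite !indicE; congr (_ %:R); congr nat_of_bool.
 by apply/idP/idP; rewrite !inE /V /= (LE t) // /ZK min_l // max_r.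
have mD : measurable [set r : R | (0 <= r <= t)%R].
 by rewrite (_ : [set _ | _] = `[0, t]%classic).
rewrite integral_indic //; apply/eqP; rewrite eq_le measure_ge0 andbT -V0.
by apply: le_measure; rewrite ?inE //; exact: measurableI.
Unshelve. all: by end_near. Qed.

End skorokhod_problem.

(** * Reflected systems driven by given paths: stability, minimal fixed point, lifetime *)

Section reflected_system.
Context {R : realType}.
Variable alpha : R.
Hypothesis alpha0 : 0 <= alpha.
Implicit Types (f g y : R -> R).

Definition phi f y t := runsup (fun s => alpha * f s - y s) t.
Definition refl f y t := y t - alpha * f t + phi f y t.

(** Monotonicity up to t only, since a mean path may be meaningless after its lifetime. *)
Definition mono_to f t := forall r s, r <= s -> s <= t -> f r <= f s.

Lemma mono_to_le f s t : s <= t -> mono_to f t -> mono_to f s.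
Proof. by move=> st m r u ru us; apply: m => //; exact: le_trans st. Qed.

Lemma phi_ubd f y t : mono_to f t -> cpath y -> ubd (fun s => alpha * f s - y s) t.
Proof.
move=> mf /cpath_bdd /(_ t) [C HC]; exists (alpha * f t + C) => s st.
apply: lerD; first by apply: ler_wpM2l => //; exact: mf.
by apply: le_trans (HC _ st); rewrite -normrN ler_norm.
Qed.

Lemma phi_ge0 f y t : mono_to f t -> cpath y -> 0 <= phi f y t.
Proof. by move=> mf cy; apply: runsup_ge0; exact: phi_ubd. Qed.

Lemma phi_ub f y t s : mono_to f t -> cpath y -> s <= t -> alpha * f s - y s <= phi f y t.
Proof.
by move=> mf cy st; apply: (@runsup_ub _ (fun s => alpha * f s - y s)) => //; exact: phi_ubd.
Qed.

Lemma phi_mono f y s t : mono_to f t -> cpath y -> s <= t -> phi f y s <= phi f y t.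
Proof. by move=> mf cy st; apply: runsup_mono => //; exact: phi_ubd. Qed.

Lemma refl_ge0 f y t : mono_to f t -> cpath y -> 0 <= refl f y t.
Proof. by move=> mf cy; have := phi_ub mf cy (lexx t); rewrite /refl; lra. Qed.

Lemma phi_leD f g y t e : 0 <= e -> mono_to g t -> cpath y ->
 (forall s, s <= t -> f s <= g s + e) -> phi f y t <= phi g y t + alpha * e.
Proof.
move=> e0 mg cy H; apply: runsup_leD; [exact: mulr_ge0|exact: phi_ubd|].
by move=> s st; have := ler_wpM2l alpha0 (H s st); rewrite mulrDr; lra.
Qed.

Lemma phi_le f g y t : mono_to g t -> cpath y ->
 (forall s, s <= t -> f s <= g s) -> phi f y t <= phi g y t.
Proof.
move=> mg cy H; have := @phi_leD f g y t 0 (lexx _) mg cy.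
by rewrite mulr0 addr0; apply => s st; rewrite addr0 H.
Qed.

Lemma phi_dist f g y t e : mono_to f t -> mono_to g t -> cpath y ->
 (forall s, s <= t -> `|f s - g s| <= e) ->
 `|phi f y t - phi g y t| <= alpha * e.
Proof.
move=> mf mg cy H; have e0 : 0 <= e by apply: le_trans (H t (lexx _)).
rewrite ler_distlC; apply/andP; split.
 rewrite lerBlDr; apply: phi_leD => // s st. by have := H s st; rewrite ler_distl => /andP[]; lra.
by apply: phi_leD => // s st; have := H s st; rewrite ler_distl => /andP[]; lra.
Qed.

Lemma cpath_phi_arg f y : cpath f -> cpath y -> cpath (fun s => alpha * f s - y s).
Proof. by move=> cf cy; apply: cpathB => //; exact: cpathZ. Qed.

Lemma cpath_phi f y : cpath f -> cpath y -> cpath (phi f y).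
Proof. by move=> cf cy; apply: cpath_runsup; exact: cpath_phi_arg. Qed.

Lemma cpath_refl f y : cpath f -> cpath y -> cpath (refl f y).
Proof.
move=> cf cy; apply: cpathD; last exact: cpath_phi. by apply: cpathB => //; exact: cpathZ.
Qed.

Lemma eq_phi f g y t : (forall s, s <= t -> f s = g s) -> phi f y t = phi g y t.
Proof. by move=> H; apply: eq_runsup => s st; rewrite H. Qed.

Lemma cvg_real_sum (I : Type) (r : seq I) (F : nat -> I -> R) (l : I -> R) :
 (forall i, F ^~ i @ \oo --> l i) ->
 (fun n => \sum_(i <- r) F n i) @ \oo --> \sum_(i <- r) l i.
Proof.
move=> H; elim: r => [|i r IH].
 by rewrite big_nil; under eq_fun do rewrite big_nil; exact: cvg_cst.
by rewrite big_cons; under eq_fun do rewrite big_cons; apply: cvgD.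
Qed.

(** An increasing limit commutes with the running supremum, as two suprema do. This makes limits of
    Picard iterates fixed points. *)
Lemma phi_cvg (F : nat -> R -> R) f y t : cpath y -> (forall n, mono_to (F n) t) -> mono_to f t ->
 (forall n s, s <= t -> F n s <= F n.+1 s) ->
 (forall s, s <= t -> F ^~ s @ \oo --> f s) ->
 (fun n => phi (F n) y t) @ \oo --> phi f y t.
Proof.
move=> cy mF mf F1 Ff. have ndF s : s <= t -> nondecreasing_seq (F ^~ s).
 by move=> st; apply/nondecreasing_seqP => n; exact: F1.
have Flef n s : s <= t -> F n s <= f s.
 move=> st; rewrite -(cvg_lim _ (Ff _ st)) //.
 by apply: nondecreasing_cvgn_le; [exact: ndF|apply/cvg_ex; exists (f s); exact: Ff].
have ndp : nondecreasing_seq (fun n => phi (F n) y t).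
 by apply/nondecreasing_seqP => n; apply: phi_le => // s; exact: F1.
have up n : phi (F n) y t <= phi f y t by apply: phi_le => // s st; exact: Flef.
have cvp : cvgn (fun n => phi (F n) y t).
 apply: nondecreasing_is_cvgn => //; exists (phi f y t) => _ [n _ <-]; exact: up.
suff -> : phi f y t = limn (fun n => phi (F n) y t) by [].
apply: le_anti; apply/andP; split; last by apply: limr_le => //; exact: nearW. apply: runsup_le.
 by apply: limr_ge => //; apply: nearW => n; exact: phi_ge0.
move=> s st. have c1 : (fun n => alpha * F n s - y s) @ \oo --> alpha * f s - y s.
 by apply: cvgB; [apply: cvgM; [exact: cvg_cst|exact: Ff]|exact: cvg_cst].
rewrite -(cvg_lim _ c1) //; apply: ler_lim => //.
 by apply/cvg_ex; exists (alpha * f s - y s).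
by apply: nearW => n; exact: phi_ub.
Qed.

Section system.
Variables (N : nat) (z : 'I_N -> R -> R).
Hypothesis N0 : (0 < N)%N.
Hypothesis cz : forall i, cpath (z i).

Definition avg_phi f t := (\sum_(i < N) phi f (z i) t) / N%:R.

Let N0R : 0 < N%:R :> R. Proof. by rewrite ltr0n. Qed.

Lemma avg_phi_le f g t : mono_to g t -> (forall s, s <= t -> f s <= g s) -> avg_phi f t <= avg_phi g t.
Proof.
move=> mg fg; rewrite /avg_phi ler_pM2r ?invr_gt0 //. by apply: ler_sum => i _; exact: phi_le.
Qed.

Lemma cpath_avg_phi f : cpath f -> cpath (avg_phi f).
Proof.
move=> cf; rewrite /avg_phi (_ : (fun t => _) = (fun t => N%:R^-1 * \sum_(i < N) phi f (z i) t)).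
 by apply: cpathZ; apply: cpath_sum => i; exact: cpath_phi.
by apply/funext => t; rewrite mulrC.
Qed.

Lemma avg_phi_mono f t : mono_to f t -> mono_to (avg_phi f) t.
Proof.
move=> mf r s rs st; rewrite /avg_phi ler_pM2r ?invr_gt0 //.
by apply: ler_sum => i _; apply: phi_mono => //; exact: mono_to_le mf.
Qed.

(** A particle outside A stays above dl under g, so its regulator is flat after t1 and, as long as 2
    alpha |f - g| < dl, the two regulators differ by at most alpha e. Only the particles of A see
    the current distance E, which gives E <= eta + alpha e + c E and hence E <= B. Continuous
    induction removes the circularity. The factor 2 in the condition on dl pays for the change of
    alpha f and for that of the regulator. *)
Lemma stability_step f g (t1 t2 dl eta e c : R) (A : {set 'I_N}) :
 cpath f -> cpath g -> mono_to f t2 -> mono_to g t2 -> t1 <= t2 ->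
 (forall s, s <= t2 -> f s = avg_phi f s) ->
 (forall s, s <= t2 -> `|avg_phi g s - g s| <= eta) ->
 (forall s, s <= t1 -> `|f s - g s| <= e) ->
 (forall i, i \notin A -> forall s, t1 <= s -> s <= t2 -> dl < refl g (z i) s) ->
 alpha * #|A|%:R <= c * N%:R -> 0 <= c -> c < 1 ->
 let B := (eta + (1 + alpha) * e) / (1 - c) in
 2 * alpha * B < dl ->
 (forall s, s <= t2 -> `|f s - g s| <= B) /\
 (forall i, i \notin A -> forall s, t1 <= s -> s <= t2 -> 0 < refl f (z i) s).
Proof.
move=> cf cg mf mg t12 fixf Gg fg1 reflA cA c0 c1 B Bdl.
have e0 : 0 <= e by apply: le_trans (fg1 t1 (lexx _)).
have eta0 : 0 <= eta by apply: le_trans (Gg t1 t12). have c1' : 0 < 1 - c by rewrite subr_gt0.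
have BE : B * (1 - c) = eta + (1 + alpha) * e by rewrite mulfVK // gt_eqF.
have ae0 : 0 <= alpha * e by exact: mulr_ge0. have B0 : 0 <= B.
 by apply: divr_ge0; [rewrite addr_ge0 // mulr_ge0 // addr_ge0|exact: ltW].
have eB : e <= B.
 rewrite -(ler_pM2r c1') BE mulrDl mul1r. have : e * c >= 0 by exact: mulr_ge0. by lra.
have dl0 : 0 < dl by apply: le_lt_trans Bdl; apply: mulr_ge0 => //; exact: mulr_ge0.
have ldl M : 2 * alpha * M < dl -> forall s, s <= t2 -> (forall r, r <= s -> `|f r - g r| <= M) ->
  forall i r, r <= s -> `|phi f (z i) r - phi g (z i) r| <= if i \in A then alpha * M else alpha * e.
 move=> Mdl s st2 HM i r rs. have mfr : mono_to f r by apply: mono_to_le mf; apply: le_trans st2.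
 have mgr : mono_to g r by apply: mono_to_le mg; apply: le_trans st2.
 have M0 : 0 <= M by apply: le_trans (HM r rs). case: ifPn => iA.
  by apply: phi_dist => // u ur; apply: HM; exact: le_trans rs.
 have [rt1|t1r] := leP r t1.
  by apply: phi_dist => // u ur; apply: fg1; exact: le_trans rt1.
 have rt2 : r <= t2 by exact: le_trans st2. have flat : phi g (z i) r = phi g (z i) t1.
  have := @runsup_flat R (fun s => z i s - alpha * g s) t1 r.
  have -> : (fun s => - (z i s - alpha * g s)) = (fun s => alpha * g s - z i s).
   by apply/funext => u; rewrite opprB.
  apply => //; first by apply: cpathB => //; exact: cpathZ.
   exact: ltW.
  by move=> u t1u ur; apply: lt_trans dl0 _; apply: reflA => //; exact: le_trans rt2.
 have p1 := @phi_dist f g (z i) t1 e (mono_to_le t12 mf) (mono_to_le t12 mg) (cz i) fg1.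
 have mono1 : phi f (z i) t1 <= phi f (z i) r by apply: phi_mono => //; exact: ltW.
 rewrite ler_distl in p1; case/andP: p1 => p1 p2.
 rewrite flat ler_distl; apply/andP; split; first by lra.
 apply: (runsup_step (ltW t1r)); [exact: phi_ubd|exact: p2|].
 move=> u t1u ur; have ut2 : u <= t2 by exact: le_trans rt2.
 have := reflA i iA u (ltW t1u) ut2; rewrite /refl => h1.
 have h2 : phi g (z i) u <= phi g (z i) t1 by rewrite -flat; exact: phi_mono.
 have h3 := HM u (le_trans ur rs); rewrite ler_distl in h3; case/andP: h3 => _ h3.
 have h4 := ler_wpM2l alpha0 h3; rewrite mulrDr in h4. have aM : 0 <= alpha * M by exact: mulr_ge0.
 by lra.
have main : forall s, s <= t2 -> `|f s - g s| <= B.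
 have low s : s <= t1 -> `|f s - g s| <= B by move=> /fg1 /le_trans; apply.
 suff H : forall s, t1 <= s -> s <= t2 -> `|f s - g s| <= B.
  by move=> s st2; have [/low|/ltW/H] := leP s t1; [|apply].
 apply: real_ind => u t1u ut2 IH. have cd : cpath (fun s => `|f s - g s|).
  have [cfg ffg] := cpathB cf cg; split; last by move=> t t0; rewrite ffg.
  by move=> t; apply: (@cvg_comp _ _ _ (fun s => f s - g s) Num.norm _ _ _ (cfg t)); exact: norm_continuous.
 have Hu : `|f u - g u| <= B.
  move: t1u; rewrite le_eqVlt => /orP[/eqP <-|t1u]; first exact: low. apply/ler_addgt0Pr => k k0.
  have [h h0 H] := cts_dist (cd.1 u) k0. pose s := maxr t1 (u - h / 2).
  have su : s < u by rewrite gt_max t1u ltrBlDr ltrDl divr_gt0.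
  have hs : u - h / 2 <= s by rewrite le_max lexx orbT.
  have us : `|s - u| < h by rewrite ltr0_norm ?subr_lt0 //; lra.
  have := H _ us; rewrite ltr_distl => /andP[+ _].
  have := IH s; rewrite le_max lexx => /(_ isT su); lra.
 (* This slack keeps 2 alpha (B + k) below dl, so the estimate applies slightly beyond u; it then
    improves the bound B + k back to B. *)
 pose k := (dl - 2 * alpha * B) / (2 * alpha + 1).
 have a1 : 0 < 2 * alpha + 1 by rewrite ltr_wpDl // mulr_ge0.
 have k0 : 0 < k by rewrite divr_gt0 // subr_gt0.
 have kE : k * (2 * alpha + 1) = dl - 2 * alpha * B by rewrite mulfVK // gt_eqF.
 have [h h0 H] := cts_dist (cd.1 u) k0. exists h => // s us suh st2.
 have Hs r : r <= s -> `|f r - g r| <= B + k.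
  move=> rs; have [ru|ur] := ltP r u.
   have [/low|/ltW t1r] := leP r t1; first by lra. by have := IH r t1r ru; lra.
  have ru : `|r - u| < h by rewrite ger0_norm ?subr_ge0 //; lra.
  by have := H _ ru; rewrite ltr_distl => /andP[_]; lra.
 pose E := runsup (fun r => `|f r - g r|) s. have EB r : r <= s -> `|f r - g r| <= E.
  by move=> rs; apply: (@runsup_ub _ (fun r => `|f r - g r|)) => //; exact: cpath_ubd.
 have Ek : E <= B + k by apply: runsup_le => //; rewrite addr_ge0 // ltW.
 have E0 : 0 <= E by apply: le_trans (EB s (lexx _)). have Edl : 2 * alpha * E < dl.
  have : 2 * alpha * E <= 2 * alpha * (B + k) by rewrite ler_wpM2l // mulr_ge0.
  have : k * (2 * alpha + 1) = k * (2 * alpha) + k by ring. by rewrite kE; lra.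
 have key r : r <= s -> `|f r - g r| <= eta + alpha * e + c * E.
  move=> rs; have rt2 : r <= t2 by exact: le_trans st2.
  have -> : f r - g r = (avg_phi f r - avg_phi g r) + (avg_phi g r - g r).
   by rewrite -fixf //; ring.
  apply: (le_trans (ler_normD _ _)). rewrite [eta + _]addrC addrAC; apply: lerD; last exact: Gg.
  rewrite /avg_phi -mulrBl -sumrB normrM (gtr0_norm (x := N%:R^-1)) ?invr_gt0 //.
  rewrite ler_pdivrMr //. apply: (le_trans (ler_norm_sum _ _ _)).
  apply: (@le_trans _ _ (\sum_(i < N) (alpha * e + (if i \in A then alpha * E else 0)))).
   apply: ler_sum => i _; apply: le_trans (ldl _ Edl s st2 EB i r rs) _.
   by case: ifP => _; rewrite ?addr0 // lerDr.
  rewrite big_split /= sumr_const card_ord -big_mkcond /= sumr_const.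
  rewrite mulrDl; apply: lerD; first by rewrite mulr_natr.
  have -> : alpha * E *+ #|A| = alpha * #|A|%:R * E by rewrite -mulr_natr; ring.
  have -> : c * E * N%:R = c * N%:R * E by ring. exact: ler_wpM2r.
 have : E <= eta + alpha * e + c * E.
  apply: runsup_le; last exact: key. by rewrite !addr_ge0 // mulr_ge0.
 move=> EE; apply: (le_trans (EB s (lexx _))). rewrite -(ler_pM2r c1') BE.
 have -> : E * (1 - c) = E - c * E by ring. by rewrite mulrDl mul1r; lra.
split=> // i iA s t1s st2. have h1 := ldl B Bdl s st2 (fun r rs => main r (le_trans rs st2)) i s (lexx _).
rewrite (negbTE iA) ler_distl in h1; case/andP: h1 => h1 _.
have h2 := reflA i iA s t1s st2; rewrite /refl in h2 *.
have h3 := main s st2; rewrite ler_distl in h3; case/andP: h3 => _ h3.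
have h4 := ler_wpM2l alpha0 h3; rewrite mulrDr in h4.
have h5 : alpha * e <= alpha * B by exact: ler_wpM2l. by lra.
Qed.

Hypothesis z0 : forall i, 0 <= z i 0.

Fixpoint picard (n : nat) : R -> R := if n is m.+1 then avg_phi (picard m) else fun=> 0.

Lemma cpath_picard n : cpath (picard n).
Proof. by elim: n => [|n IH] /=; [exact: cpath_cst|exact: cpath_avg_phi]. Qed.

Lemma picard_mono n t : mono_to (picard n) t.
Proof. by elim: n => [|n IH] //=; exact: avg_phi_mono. Qed.

Lemma avg_phi_ge0 f t : mono_to f t -> 0 <= avg_phi f t.
Proof.
move=> mf; rewrite /avg_phi divr_ge0 // ?ler0n //. by apply: sumr_ge0 => i _; exact: phi_ge0.
Qed.

Lemma picard_ge0 n t : 0 <= picard n t.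
Proof. by case: n => [//|n] /=; apply: avg_phi_ge0; exact: picard_mono. Qed.

Lemma picard_le n t : picard n t <= picard n.+1 t.
Proof.
elim: n t => [|n IH] t; first exact: picard_ge0.
apply: (@avg_phi_le (picard n) (picard n.+1)); first exact: (picard_mono n.+1). by move=> s _; exact: IH.
Qed.

Lemma picard0 n t : t <= 0 -> picard n t = 0.
Proof.
move=> t0; rewrite ((cpath_picard n).2 t t0) {t t0}; elim: n => [//|n IH] /=.
rewrite /avg_phi big1 ?mul0r // => i _; rewrite /phi frozen_runsup //.
 by rewrite IH mulr0 sub0r max_l // oppr_le0.
by apply: cpath_phi_arg => //; exact: cpath_picard.
Qed.

Lemma picard_le_fixpoint f t n : mono_to f t -> 
 (forall s, s <= t -> f s = avg_phi f s) -> forall s, s <= t -> picard n s <= f s.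
Proof.
move=> mf ff; elim: n => [|n IH] s st.
 by rewrite ff //; apply: avg_phi_ge0; exact: mono_to_le mf.
rewrite ff //=; apply: avg_phi_le; first exact: mono_to_le mf.
by move=> r rs; apply: IH; exact: le_trans st.
Qed.

Definition lfin t := exists M : R, forall n, picard n t <= M.
(** Meaningful only under [lfin t]: the supremum of an unbounded set is a default value. *)
Definition lam t := sup (range (picard ^~ t)).

Lemma lfin_le s t : s <= t -> lfin t -> lfin s.
Proof.
by move=> st [M HM]; exists M => n; apply: le_trans (HM n); exact: (@picard_mono n t).
Qed.

Lemma lam_ub n t : lfin t -> picard n t <= lam t.
Proof.
move=> [M HM]; apply: sup_upper_bound; last by exists n.
by split; [exists (picard 0 t), 0%N|exists M => _ [m _ <-]].
Qed.

Lemma lam_le M t : (forall n, picard n t <= M) -> lam t <= M.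
Proof.
move=> HM; apply: ge_sup; first by exists (picard 0 t); exists 0%N. by move=> _ [m _ <-].
Qed.

Lemma lam_cvg t : lfin t -> picard ^~ t @ \oo --> lam t.
Proof.
move=> [M HM]; apply: nondecreasing_cvgn.
 by apply/nondecreasing_seqP => n; exact: picard_le.
by exists M => _ [n _ <-].
Qed.

Lemma lam_mono t : lfin t -> mono_to lam t.
Proof.
move=> ft r s rs st; apply: lam_le => n. apply: le_trans (lam_ub n (lfin_le st ft)).
exact: (@picard_mono n t).
Qed.

Lemma lam0 t : t <= 0 -> lam t = 0.
Proof.
move=> t0; apply: le_anti; apply/andP; split.
 by apply: lam_le => n; rewrite picard0.
rewrite -(picard0 0 t0); apply: lam_ub; exists 0 => n; by rewrite picard0.
Qed.

Lemma lam_fix t : lfin t -> lam t = avg_phi lam t.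
Proof.
move=> ft; have c1 : (fun n => picard n.+1 t) @ \oo --> lam t.
 by have := lam_cvg ft; rewrite -(cvg_shiftS (picard ^~ t)).
have c2 : (fun n => picard n.+1 t) @ \oo --> avg_phi lam t.
 rewrite /= /avg_phi; apply: cvgM; last exact: cvg_cst. apply: cvg_real_sum => i; apply: phi_cvg => //.
 - by move=> n; exact: picard_mono.
 - exact: lam_mono.
 - by move=> n s _; exact: picard_le.
 - by move=> s st; apply: lam_cvg; exact: lfin_le ft.
by rewrite -(cvg_lim _ c1) // (cvg_lim _ c2).
Qed.

Definition zeros t : {set 'I_N} := finset (fun i => refl lam (z i) t == 0).
(** The condition for continuing beyond t: if the mean path rises by x, the particles at zero return
    at most alpha (#zeros / N) x, which is less than x. *)
Definition good t := lfin t /\ alpha * #|zeros t|%:R < N%:R.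

Lemma dist_min (K x y : R) : `|minr x K - minr y K| <= `|x - y|.
Proof.
have a1 := ler_norm (x - y); have a2 := ler_norm (y - x); rewrite distrC in a2.
by have [?|?] := leP x K; have [?|?] := leP y K; rewrite ler_norml; apply/andP; split; lra.
Qed.

Lemma dist_max0 (x y : R) : `|maxr 0 x - maxr 0 y| <= `|x - y|.
Proof.
have a1 := ler_norm (x - y); have a2 := ler_norm (y - x); rewrite distrC in a2.
by have [?|?] := leP 0 x; have [?|?] := leP 0 y; rewrite ler_norml; apply/andP; split; lra.
Qed.

Lemma finite_pos_lb (F : 'I_N -> R) : (forall i, 0 <= F i) ->
 exists2 dl : R, 0 < dl & forall i, F i != 0 -> dl <= F i.
Proof.
move=> F0; exists (\big[minr/1]_(i | F i != 0) F i).
 by apply: lt_bigmin => // i Fi; rewrite lt_neqAle eq_sym Fi F0.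
by move=> i Fi; exact: bigmin_le_cond.
Qed.

Lemma family_ucts (F : 'I_N -> R -> R) K (k : R) : (forall i, cpath (F i)) -> 0 < k ->
 exists2 h : R, 0 < h & forall i s t, s <= K -> t <= K -> `|s - t| < h -> `|F i s - F i t| < k.
Proof.
move=> cF k0. have /choice[H HH] (i : 'I_N) : exists h : R, 0 < h /\ forall s t, s <= K -> t <= K ->
  `|s - t| < h -> `|F i s - F i t| < k.
 by have [h h0 Hh] := cpath_ucts (cF i) K k0; exists h.
exists (\big[minr/1]_i H i).
 by apply: lt_bigmin => // i _; case: (HH i).
move=> i s t sK tK st; apply: (HH i).2 => //; apply: lt_le_trans st _. exact: bigmin_le.
Qed.

(** The constant lam t + b is a barrier for all Picard iterates on [t, t + h]. Particles at distance
    at least dl from zero need no push there, and each particle at zero contributes at most alpha b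
    + k, which the strict inequality in [good] absorbs. *)
Lemma lam_ext t (e : R) : 0 < e -> good t ->
 exists2 h : R, 0 < h & forall s, t <= s -> s <= t + h -> good s /\ lam s <= lam t + e.
Proof.
move=> e0 [ft zt]. have mt := lam_mono ft.
have [dl dl0 Hdl] := finite_pos_lb (fun i => refl_ge0 mt (cz i)).
pose q : R := #|zeros t|%:R; have q0 : 0 <= q by exact: ler0n.
have qN : q <= N%:R by rewrite ler_nat -[leqRHS]card_ord max_card.
pose b := minr e (dl / (4 * (alpha + 1))). have a1 : 0 < alpha + 1 by rewrite ltr_wpDl.
have b0 : 0 < b by rewrite lt_min e0 divr_gt0 // mulr_gt0. have be : b <= e by rewrite ge_min lexx.
have bd : (alpha + 1) * b <= dl / 4.
 rewrite -ler_pdivlMl //; have : b <= dl / (4 * (alpha + 1)) by rewrite ge_min lexx orbT.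
 by rewrite invfM // mulrA mulrC.
have gap : 0 < N%:R - alpha * q by rewrite subr_gt0.
(* The first entry keeps the other particles off zero; the second makes the total contribution q
   (alpha b + k) of the zeros at most N b. *)
pose k := minr (dl / 4) (b * (N%:R - alpha * q) / N%:R).
have k0 : 0 < k by rewrite lt_min !divr_gt0 // mulr_gt0. have kd : k <= dl / 4 by rewrite ge_min lexx.
have kb : q * k <= b * (N%:R - alpha * q).
 have : k <= b * (N%:R - alpha * q) / N%:R by rewrite ge_min lexx orbT.
 rewrite ler_pdivlMr // mulrC; apply: le_trans; exact: ler_wpM2r (ltW k0) _ _ qN.
have ab : alpha * b <= dl / 4 by rewrite mulrDl mul1r in bd; lra.
have [h0 h00 H] := family_ucts (t + 1) cz k0. pose h := minr (h0 / 2) 1.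
have h_gt0 : 0 < h by rewrite lt_min ltr01 andbT divr_gt0. have hh : h <= h0 / 2 by rewrite ge_min lexx.
have h1 : h <= 1 by rewrite ge_min lexx orbT. have Hz i r : t <= r -> r <= t + h -> `|z i r - z i t| < k.
 move=> tr rh; apply: H; [lra|lra|]. by rewrite ger0_norm ?subr_ge0 //; lra.
have super n s : t <= s -> s <= t + h -> picard n s <= lam t + b.
 elim: n s => [|n IH] s ts sh.
  rewrite addr_ge0 ?(ltW b0) //; apply: le_trans (lam_ub 0 ft); exact: picard_ge0.
 rewrite /= /avg_phi ler_pdivrMr // mulrDl. apply: (@le_trans _ _ (\sum_(i < N) (phi lam (z i) t +
   (if i \in zeros t then alpha * b + k else 0)))).
  apply: ler_sum => i _; apply: (runsup_step ts).
  - by apply: phi_ubd => //; exact: picard_mono.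
  - apply: (@le_trans _ _ (phi lam (z i) t)).
    by apply: phi_le => // r rt; apply: lam_ub; exact: lfin_le ft.
   rewrite lerDl; case: ifP => // _.
    by apply: addr_ge0; [apply: mulr_ge0 => //; exact: ltW|exact: ltW].
  move=> r tr rs; have r_h : r <= t + h by exact: le_trans sh.
  have h3 := ler_wpM2l alpha0 (IH r (ltW tr) r_h); rewrite mulrDr in h3.
  have := Hz i r (ltW tr) r_h; rewrite ltr_distl => /andP[h4 _].
  have -> : phi lam (z i) t = refl lam (z i) t - z i t + alpha * lam t.
   by rewrite /refl; ring.
  rewrite inE; case: eqP => [->|/eqP/Hdl h5]; first by lra. by lra.
 rewrite big_split /= -big_mkcond /= sumr_const.
 rewrite [X in X + _ <= _](_ : _ = lam t * N%:R); last first.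
  by rewrite (lam_fix ft) /avg_phi divfK ?gt_eqF.
 rewrite lerD2l; have -> : (alpha * b + k) *+ #|zeros t| = (alpha * b + k) * q.
  by rewrite mulr_natr.
 have -> : (alpha * b + k) * q = b * (alpha * q) + q * k by ring. by move: kb; rewrite mulrBr; lra.
have fs s : t <= s -> s <= t + h -> lfin s.
 by move=> ts sh; exists (lam t + b) => n; exact: super.
have ls s : t <= s -> s <= t + h -> lam s <= lam t + b.
 by move=> ts sh; apply: lam_le => n; exact: super.
exists h => // s ts sh; split; last by apply: (le_trans (ls s ts sh)); rewrite lerD2l.
split; first exact: fs. apply: le_lt_trans zt; apply: ler_wpM2l => //; rewrite ler_nat.
apply: subset_leq_card; apply/fintype.subsetP => i; rewrite !inE => /eqP rs.
apply/eqP; apply: contrapT => /eqP/Hdl rt. have h3 := ler_wpM2l alpha0 (ls s ts sh); rewrite mulrDr in h3.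
have := Hz i s ts sh; rewrite ltr_distl => /andP[h4 _]. have h5 : phi lam (z i) t <= phi lam (z i) s.
 by apply: phi_mono => //; apply: lam_mono; exact: fs.
rewrite /refl in rs rt; lra.
Qed.

(** A supremum of continuous functions is lower semicontinuous; together with [lam_ext] this yields
    continuity. *)
Lemma lam_left t (e : R) : lfin t -> 0 < e ->
 exists2 h : R, 0 < h & forall s, t - h < s -> s <= t -> lam t - e < lam s.
Proof.
move=> ft e0; have /cvgrPdist_lt/(_ (e / 2)) := lam_cvg ft.
rewrite divr_gt0 // => /(_ isT)[n _ /(_ n (leqnn n)) Hn]. have e2 : 0 < e / 2 by rewrite divr_gt0.
have [h h0 H] := cts_dist ((cpath_picard n).1 t) e2.
exists h => // s hs st; have hn := lam_ub n (lfin_le st ft).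
have : `|s - t| < h by rewrite ler0_norm ?subr_le0 //; lra. move=> /H; rewrite ltr_distl => /andP[h1 _].
move: Hn; rewrite /= ltr_distl => /andP[_]; lra.
Qed.

Lemma cpath_lam K : 0 <= K -> (forall s, 0 <= s -> s <= K -> good s) -> cpath (fun s => lam (minr s K)).
Proof.
move=> K0 gd; split; last first.
 by move=> t t0; rewrite !lam0 // ge_min ?t0 ?lexx.
move=> t; apply: dist_cts => e e0. pose cl s := maxr 0 (minr s K).
have cl01 s : 0 <= cl s /\ cl s <= K by rewrite /cl le_max lexx ge_max K0 ge_min lexx orbT.
have lamcl s : lam (minr s K) = lam (cl s).
 by rewrite /cl; have [h|//] := leP (minr s K) 0; rewrite !lam0.
have clip s : `|cl s - cl t| <= `|s - t|.
 by apply: le_trans (dist_max0 _ _) (dist_min _ _ _).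
have gt := gd _ (cl01 t).1 (cl01 t).2. have [h1 h10 H1] := lam_ext (divr_gt0 e0 (ltr0Sn R 1)) gt.
have [h2 h20 H2] := lam_left gt.1 e0. exists (minr h1 h2); first by rewrite lt_min h10.
move=> s; rewrite lt_min => /andP[s1 s2]; rewrite !lamcl.
have := le_lt_trans (clip s) s1; have := le_lt_trans (clip s) s2.
rewrite !ltr_distl => /andP[b1 b2] /andP[b3 b4]. have gs := gd _ (cl01 s).1 (cl01 s).2.
have [st|ts] := leP (cl s) (cl t).
 have := H2 (cl s) b1 st; have := lam_mono gt.1 st (lexx _). by move=> ? ?; apply/andP; split; lra.
have [_] := H1 (cl s) (ltW ts) (ltW b4); have := lam_mono gs.1 (ltW ts) (lexx _).
by move=> ? ?; apply/andP; split; lra.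
Qed.

(** Continuous induction with [stability_step] at e = eta = 0. Taking for A the zeros at u gives c <
    1 because u is good. *)
Lemma lam_unique f K : 0 <= K -> cpath f -> mono_to f K -> f 0 = 0 ->
 (forall s, s <= K -> f s = avg_phi f s) ->
 (forall s, 0 <= s -> s <= K -> good s) ->
 forall s, s <= K -> f s = lam s.
Proof.
move=> K0 cf mf f0 ff gd. have neg s : s <= 0 -> f s = lam s by move=> s0; rewrite (cf.2 _ s0) f0 lam0.
suff H : forall s, 0 <= s -> s <= K -> f s = lam s.
 by move=> s sK; have [/neg//|/ltW/H] := leP s 0; apply.
pose g s := lam (minr s K). have cg : cpath g by exact: cpath_lam.
have gE s : s <= K -> g s = lam s by move=> sK; rewrite /g min_l. have mg : mono_to g K.
 move=> r s rs sK; rewrite !gE ?(le_trans rs) //. exact: (lam_mono (gd _ K0 (lexx _)).1).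
apply: real_ind => u u0 uK IH. have IHu s : s < u -> f s = lam s.
 by move=> su; have [/neg//|/ltW s0] := leP s 0; exact: IH.
have fu : f u = lam u.
 move: u0; rewrite le_eqVlt => /orP[/eqP <-|u0]; first exact: neg.
 rewrite -gE //; apply/eqP; rewrite -subr_eq0 -normr_le0; apply/ler_addgt0Pl => e e0.
 rewrite addr0; have [h h0 H] := cts_dist ((cpathB cf cg).1 u) e0.
 have su : u - h / 2 < u by rewrite ltrBlDr ltrDl divr_gt0.
 have : `|u - h / 2 - u| < h by rewrite ltr0_norm ?subr_lt0 //; lra.
 move=> /H; rewrite IHu // gE; last by rewrite (le_trans (ltW su)).
 by rewrite subrr sub0r normrN => /ltW.
have gdu := gd _ u0 uK; have mu := lam_mono gdu.1.
have [dl dl0 Hdl] := finite_pos_lb (fun i => refl_ge0 mu (cz i)).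
have dl2 : 0 < dl / 2 by rewrite divr_gt0.
have [h h0 H] := family_ucts (F := fun i => refl g (z i)) K (fun i => cpath_refl cg (cz i)) dl2.
exists h => // s us suh sK. pose A := zeros u.
have /= := @stability_step f g u s (dl / 2) 0 0 (alpha * #|A|%:R / N%:R) A cf cg
 (mono_to_le sK mf) (mono_to_le sK mg) us.
rewrite mulr0 addr0 mul0r mulr0; case.
- by move=> r rs; apply: ff; exact: le_trans sK.
- move=> r rs; have rK : r <= K by exact: le_trans sK.
 rewrite gE // (lam_fix (lfin_le rK (gd _ K0 (lexx _)).1)).
 rewrite [avg_phi g r](_ : _ = avg_phi lam r) ?subrr ?normr0 //.
 rewrite /avg_phi; congr (_ / _); apply: eq_bigr => i _; apply: eq_phi => v vr.
 by rewrite gE // (le_trans vr).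
- move=> r ru; rewrite gE ?(le_trans ru) //.
 move: ru; rewrite le_eqVlt => /orP[/eqP ->|/IHu ->]; rewrite ?fu subrr normr0 //.
- move=> i; rewrite inE => /Hdl iA r ur rs; have rK : r <= K by exact: le_trans sK.
 have : `|r - u| < h by rewrite ger0_norm ?subr_ge0 //; lra. move=> /(H i r u rK uK).
 have -> : refl g (z i) u = refl lam (z i) u.
  rewrite /refl gE //; congr (_ + _); apply: eq_phi => v vu. by rewrite gE // (le_trans vu).
 by rewrite ltr_distl => /andP[h1 _]; lra.
- by rewrite divfK // gt_eqF.
- by rewrite divr_ge0 ?mulr_ge0 ?ler0n.
- by rewrite ltr_pdivrMr // mul1r; exact: gdu.2.
- exact: dl2.
move=> + _ => /(_ s (lexx _)); rewrite normr_le0 subr_eq0 gE // => /eqP //.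
Qed.

Definition tau_star := ereal_inf [set t%:E | t in [set t | 0 <= t /\ ~ good t]].

Lemma tau_star_ge0 : (0 <= tau_star)%E.
Proof. by apply: le_ereal_inf_tmp => _ [t [t0 _] <-]; rewrite lee_fin. Qed.

Lemma good_before t : before tau_star t -> good t.
Proof.
move=> [t0 tT]; apply: contrapT => bt; move: tT; rewrite ltNge => /negP; apply.
by apply: ereal_inf_lbound; exists t.
Qed.

(** By [lam_ext] the good times are open to the right, so the infimum of the bad times is
    attained. *)
Lemma tau_star_bad t : tau_star = t%:E -> ~ good t.
Proof.
move=> tE gt; have t0 : 0 <= t by rewrite -lee_fin -tE; exact: tau_star_ge0.
have [h h0 H] := lam_ext ltr01 gt. have : ((t + h)%:E <= tau_star)%E.
 apply: le_ereal_inf_tmp => _ [s [s0 bs] <-]; rewrite lee_fin leNgt; apply/negP => sh.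
 have [st|ts] := ltP s t.
  by apply: bs; apply: good_before; split => //; rewrite tE lte_fin.
 by apply: bs; case: (H s ts (ltW sh)).
by rewrite tE lee_fin; lra.
Qed.

End system.
End reflected_system.

(** * Path space and measurability of path functionals *)

Section path_space_sigma_algebra.
Context {R : realType}.

Record cpath_type := CPath { cpath_fun :> R -> R; cpath_ok : cpath cpath_fun }.

HB.instance Definition _ := gen_eqMixin cpath_type.
HB.instance Definition _ := gen_choiceMixin cpath_type.
HB.instance Definition _ := isPointed.Build cpath_type (CPath (cpath_cst 0)).

Definition evals : set_system cpath_type := \bigcup_(t in [set: R])
  preimage_set_system setT (fun x : cpath_type => x t) measurable.

(** A common target space, on which the particles, defined under P, can be compared in law with the
    limit, defined under P'. *)
Definition wiener := g_sigma_algebraType evals.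
HB.instance Definition _ := Measurable.on wiener.

Lemma mfn_eval t : mfn (fun x : wiener => cpath_fun x t).
Proof.
move=> _ B mB; rewrite setTI; apply: sub_sigma_algebra; exists t => //. by exists B => //; rewrite setTI.
Qed.

Lemma measurable_to_wiener d (Om : measurableType d) (Z : Om -> wiener) :
 (forall t, mfn (fun w => cpath_fun (Z w) t)) -> measurable_fun setT Z.
Proof.

move=> mZ; apply: (@measurability _ _ _ _ _ Z evals) => // _ [_ [t _ [B mB <-]] <-].
rewrite !setTI; have := mZ t measurableT B mB. by rewrite setTI.
Qed.

End path_space_sigma_algebra.

Section path_functionals.
Context {R : realType} {d : measure_display} {Om : measurableType d}.

(** The supremum is seen by the rationals and by t itself. The hypothesis is lower semicontinuity
    from the right, which alpha f - y satisfies even where the nondecreasing f jumps. *)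
Lemma mfn_runsup (g : Om -> R -> R) (t : R) : (forall s, s <= t -> mfn (fun w => g w s)) ->
 (forall w, ubd (g w) t) ->
 (forall w s, s < t -> forall e : R, 0 < e -> exists2 h : R, 0 < h &
   forall r, s <= r -> r < s + h -> g w s - e < g w r) ->
 mfn (fun w => runsup (g w) t).
Proof.
move=> mg ub rc; apply: mfn_of_gt => c. have [c0|c0] := ltP c 0.
 rewrite (_ : [set _ | _] = setT) //; apply/seteqP; split=> // w _ /=.
 by apply: lt_le_trans c0 _; exact: runsup_ge0.
pose F (q : rat) := if (ratr q <= t :> R) then [set w | c < g w (ratr q)] else set0.
rewrite (_ : [set _ | _] = [set w | c < g w t] `|` \bigcup_q F q).
 apply: measurableU; first exact/mfn_gt/mg.
 apply: bigcupT_measurable_rat => q; rewrite /F; case: ifP => // qt. exact/mfn_gt/mg.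
apply/seteqP; split=> w /=.
 move=> cr; apply: contrapT => /not_orP[/negP ngt nF]. rewrite -leNgt in ngt.
 suff : runsup (g w) t <= c by rewrite leNgt cr.
 apply: runsup_le => // s; rewrite le_eqVlt => /orP[/eqP ->//|st]. rewrite leNgt; apply/negP => cs.
 have [h h0 H] := rc w s st (g w s - c) ltac:(by rewrite subr_gt0).
 have sm : s < minr t (s + h) by rewrite lt_min st ltrDl.
 have [q] := rat_in_itvoo sm; rewrite in_itv /= => /andP[sq]. rewrite lt_min => /andP[qt qh].
 apply: nF; exists q => //; rewrite /F (ltW qt) /=. by have := H _ (ltW sq) qh; rewrite subKr.
case=> [ct|[q _]]; first by apply: lt_le_trans ct _; exact: runsup_ub.
rewrite /F; case: ifP => // qt /= cq. by apply: lt_le_trans cq _; exact: runsup_ub.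
Qed.

Lemma mfn_phi (alpha : R) (f : Om -> R -> R) (y : Om -> R -> R) t :
 (forall s, s <= t -> mfn (fun w => f w s)) ->
 (forall s, s <= t -> mfn (fun w => y w s)) ->
 0 <= alpha -> (forall w, mono_to (f w) t) -> (forall w, cpath (y w)) ->
 mfn (fun w => phi alpha (f w) (y w) t).
Proof.
move=> mf my a0 mm cy; apply: mfn_runsup.
- move=> s st; apply: measurable_funB; last exact: my. by apply: measurable_funM => //; exact: mf.
- by move=> w; exact: phi_ubd.
move=> w s st e e0; have [h h0 H] := cts_dist ((cy w).1 s) e0.
exists (minr h (t - s)); first by rewrite lt_min h0 subr_gt0.
move=> r sr rh; have [rh' rt] : r < s + h /\ r < t.
 by move: rh; rewrite -ltrBlDl lt_min !ltrBlDl => /andP[? ?]; split => //; lra.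
have := ler_wpM2l a0 (mm w s r sr (ltW rt)). have : `|r - s| < h by rewrite ger0_norm ?subr_ge0 //; lra.
by move=> /H; rewrite ltr_distl => /andP[? ?] ?; lra.
Qed.

Lemma mfn_refl (alpha : R) (f : Om -> R -> R) (y : Om -> R -> R) t :
 (forall s, s <= t -> mfn (fun w => f w s)) ->
 (forall s, s <= t -> mfn (fun w => y w s)) ->
 0 <= alpha -> (forall w, mono_to (f w) t) -> (forall w, cpath (y w)) ->
 mfn (fun w => refl alpha (f w) (y w) t).
Proof.
move=> mf my a0 mm cy; apply: measurable_funD; last exact: mfn_phi.
by apply: measurable_funB; [exact: my|apply: measurable_funM => //; exact: mf].
Qed.

Lemma mfn_picard (alpha : R) N (z : Om -> 'I_N -> R -> R) n t : 0 <= alpha ->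
 (0 < N)%N -> (forall w i, cpath (z w i)) ->
 (forall i s, s <= t -> mfn (fun w => z w i s)) ->
 forall s, s <= t -> mfn (fun w => picard alpha (z w) n s).
Proof.
move=> a0 N0 cz mz; elim: n => [|n IH] s st /=; first exact: measurable_cst.
rewrite /avg_phi; apply: measurable_funM => //; apply: measurable_sum => i. apply: mfn_phi => //.
- by move=> r rs; apply: IH; exact: le_trans st.
- by move=> r rs; apply: mz; exact: le_trans st.
- by move=> w; apply: picard_mono.
Qed.

End path_functionals.

(** * Independence of joins of sigma-algebras *)

Section independence_of_joins.
Context {R : realType} {d : measure_display} {Om : measurableType d}.
Variable P : probability Om R.

Lemma indep_sub (F G F' G' : set_system Om) : independent P F G ->
 F' `<=` F -> G' `<=` G -> independent P F' G'.
Proof. by move=> FG sF sG A B /sF FA /sG GB; exact: FG. Qed.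

Lemma indep_sym (F G : set_system Om) : independent P F G -> independent P G F.
Proof. by move=> FG A B GA FB; rewrite setIC FG // muleC. Qed.

Lemma sigma_of_measurable {I : Type} (D : set I) (X : I -> Om -> R) :
 (forall i, D i -> mfn (X i)) -> sigma_of D X `<=` measurable.
Proof.
move=> mX; apply: smallest_sub; first exact: sigma_algebra_measurable.
move=> _ [i Di [B mB <-]]; exact: (mX i Di measurableT B mB).
Qed.

Lemma g_sigma_setI (G : set_system Om) : setI_closed <<s G >>.
Proof.
move=> A B sA sB; exact: (@measurableI _ (g_sigma_algebraType G) A B sA sB).
Qed.

Lemma g_sigma_setT (G : set_system Om) : <<s G >> setT.
Proof. exact: (@measurableT _ (g_sigma_algebraType G)). Qed.

Definition pi_measurable (G : set_system Om) := [/\ G `<=` measurable, setI_closed G & G setT].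

Lemma pi_sigma_of {I : Type} (D : set I) (X : I -> Om -> R) :
 (forall i, D i -> mfn (X i)) -> pi_measurable (sigma_of D X).
Proof.
by move=> mX; split; [exact: sigma_of_measurable|exact: g_sigma_setI|exact: g_sigma_setT].
Qed.

Lemma pi_trivial : pi_measurable [set setT].
Proof. by split=> // [_ ->//|_ _ -> ->]; rewrite setTI. Qed.

Lemma indep_trivial (F : set_system Om) : independent P F [set setT].
Proof. by move=> A _ _ ->; rewrite setIT probability_setT mule1. Qed.

(** Meant for initial values A and Brownian motions B of two groups of particles. The intersections
    of a set of A with a set of B form a pi-system generating the join, and P factorizes over the
    four factors. *)
Lemma indep_join (A1 A2 B1 B2 : set_system Om) :
 pi_measurable A1 -> pi_measurable A2 -> pi_measurable B1 -> pi_measurable B2 ->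
 (forall a1 a2 b1 b2, A1 a1 -> A2 a2 -> B1 b1 -> B2 b2 ->
   P (a1 `&` a2 `&` (b1 `&` b2)) = (P (a1 `&` a2) * P (b1 `&` b2))%E) ->
 independent P A1 A2 -> independent P B1 B2 ->
 independent P <<s A1 `|` B1 >> <<s A2 `|` B2 >>.
Proof.
move=> [mA1 cA1 tA1] [mA2 cA2 tA2] [mB1 cB1 tB1] [mB2 cB2 tB2] AB A12 B12.
pose G := [set X | exists a b, [/\ A1 a, B1 b & X = a `&` b]].
pose H := [set X | exists a b, [/\ A2 a, B2 b & X = a `&` b]]. have sG : <<s A1 `|` B1 >> `<=` <<s G >>.
 apply: smallest_sub; first exact: smallest_sigma_algebra. move=> X [aX|bX]; apply: sub_sigma_algebra.
  by exists X, setT; rewrite setIT.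
 by exists setT, X; rewrite setTI.
have sH : <<s A2 `|` B2 >> `<=` <<s H >>.
 apply: smallest_sub; first exact: smallest_sigma_algebra. move=> X [aX|bX]; apply: sub_sigma_algebra.
  by exists X, setT; rewrite setIT.
 by exists setT, X; rewrite setTI.
apply: (indep_sub _ sG sH); apply: indep_generated.
- by move=> _ [a [b [aA bB ->]]]; apply: measurableI; [exact: mA1|exact: mB1].
- by move=> _ [a [b [aA bB ->]]]; apply: measurableI; [exact: mA2|exact: mB2].
- move=> _ _ [a [b [aA bB ->]]] [a' [b' [aA' bB' ->]]].
 exists (a `&` a'), (b `&` b'); split; [exact: cA1|exact: cB1|]. by rewrite setIACA.
- move=> _ _ [a [b [aA bB ->]]] [a' [b' [aA' bB' ->]]].
 exists (a `&` a'), (b `&` b'); split; [exact: cA2|exact: cB2|]. by rewrite setIACA.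
move=> _ _ [a [b [aA bB ->]]] [a' [b' [aA' bB' ->]]]. rewrite setIACA AB // A12 // B12 //.
have e1 : P (a `&` b) = (P a * P b)%E.
 by have := AB a setT b setT aA tA2 bB tB2; rewrite !setIT.
have e2 : P (a' `&` b') = (P a' * P b')%E.
 by have := AB setT a' setT b' tA1 aA' tB1 bB'; rewrite !setTI.
by rewrite e1 e2 muleACA.
Qed.

(** The finite intersections with one factor from each F j form a pi-system, on which mutual
    independence is the product formula itself. *)
Lemma mutual_group (I : eqType) (F : I -> set_system Om) (s : seq I) i :
 mutually_independent P F -> uniq s -> i \notin s ->
 (forall j, pi_measurable (F j)) ->
 independent P <<s \bigcup_(j in [set j | j \in s]) F j >> (F i).
Proof.
move=> mi us is_ pF. pose G := [set X | exists A : I -> set Om, (forall j, F j (A j)) /\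
  X = \big[setI/setT]_(j <- s) A j].
have mF j : F j `<=` measurable by case: (pF j). have tF j : F j setT by case: (pF j).
have cF j : setI_closed (F j) by case: (pF j).
apply: (@indep_sub <<s G >> <<s F i >>); last exact: sub_sigma_algebra.
 apply: indep_generated => //.
 - by move=> _ [A [FA ->]]; apply: bigsetI_measurable => j _; exact: mF.
 - move=> _ _ [A [FA ->]] [B [FB ->]]; exists (fun j => A j `&` B j); split.
   by move=> j; exact: cF.
  by rewrite big_split.
 move=> _ B [A [FA ->]] FB. pose A' j := if j == i then B else A j.
 have A's : \big[setI/setT]_(j <- s) A j = \big[setI/setT]_(j <- s) A' j.
  by apply: eq_big_seq => j js; rewrite /A'; case: eqP => // ji; rewrite -ji js in is_.
 have PA : P (\big[setI/setT]_(j <- s) A j) = (\prod_(j <- s) P (A j))%E.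
  by apply: mi => // j _; exact: FA.
 have := mi (i :: s) A' _ _; rewrite /= is_ us => /(_ isT); rewrite !big_cons.
 have -> : A' i = B by rewrite /A' eqxx. rewrite -A's setIC PA => ->; last first.
  by move=> j _; rewrite /A'; case: eqP => [->|].
 rewrite muleC; congr (_ * _)%E; apply: eq_big_seq => j js.
 by rewrite /A'; case: eqP => // ji; rewrite -ji js in is_.
apply: smallest_sub; first exact: smallest_sigma_algebra. move=> X [j /= js FX]; apply: sub_sigma_algebra.
exists (fun k => if k == j then X else setT); split.
 by move=> k; case: eqP => [->|].
rewrite (big_rem j) //= eqxx big1_seq ?setIT // => k /andP[_].
by rewrite mem_rem_uniq // inE => /andP[/negbTE ->].
Qed.

End independence_of_joins.

Section within_continuity.
Context {R : realType}.

Lemma within_cts_dist (A : set R) (f : R -> R) t : {within A, continuous f} ->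
 A t -> forall e : R, 0 < e -> exists2 h : R, 0 < h & forall s, A s -> `|s - t| < h -> `|f s - f t| < e.
Proof.
move=> cf At e e0. move/subspace_continuousP : cf => /(_ t At)/cvgrPdist_lt/(_ _ e0).
rewrite near_withinE nearE /= => -[h /= h0 H]; exists h => // s As st.
by rewrite distrC; apply: H => //; rewrite /= distrC.
Qed.

Lemma dist_within_cts (A : set R) (f : R -> R) :
 (forall t, A t -> forall e : R, 0 < e -> exists2 h : R, 0 < h & forall s, A s ->
  `|s - t| < h -> `|f s - f t| < e) -> {within A, continuous f}.
Proof.
move=> H; apply/subspace_continuousP => t At; apply/cvgrPdist_lt => e e0.
have [h h0 Hh] := H t At e e0; rewrite near_withinE nearE.
exists h => //= s; rewrite /= distrC => st As; rewrite distrC; exact: Hh.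
Qed.

End within_continuity.

(** * The path of an initial value plus a Brownian motion *)

Section path_of_process.
Context {R : realType} {d : measure_display} {Om : measurableType d}.
Variable P : probability Om R.
Variables (xi : {RV P >-> R}) (W : R -> {RV P >-> R}).
Hypothesis BW : brownian W.

Lemma cpath_brownian w : cpath (fun t => W (maxr 0 t) w).
Proof.
split; last by move=> t t0; rewrite max_l // maxxx. case: BW => _ cW _ _ t.
have cm : continuous (fun s : R => maxr 0 s).
 by move=> s; apply: dist_cts => e e0; exists e => // r rs; exact: le_lt_trans (dist_max0 _ _) rs.
apply: dist_cts => e e0. have mt0 : [set t : R | 0 <= t] (maxr 0 t) by rewrite /= le_max lexx.
have [h h0 H] := within_cts_dist (cW w) mt0 e0.
exists h => // s st; apply: H; first by rewrite /= le_max lexx. exact: le_lt_trans (dist_max0 _ _) st.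
Qed.

Lemma cpath_start w : cpath (fun t => maxr 0 (xi w) + W (maxr 0 t) w).
Proof. by apply: cpathD; [exact: cpath_cst|exact: cpath_brownian]. Qed.

(** Copies of a nonnegative variable are nonnegative only almost surely; taking the positive part of
    xi gives a nonnegative start for every w. *)
Definition zpath (w : Om) : wiener := CPath (cpath_start w).

Lemma zpath0 w : zpath w 0 = maxr 0 (xi w).
Proof. by rewrite /= maxxx; case: BW => -> _ _ _; rewrite addr0. Qed.

Lemma zpathE w t : 0 <= t -> zpath w t = maxr 0 (xi w) + W t w.
Proof. by move=> t0; rewrite /= (max_r t0). Qed.

Lemma zpath_incr w s t : 0 <= s -> 0 <= t -> zpath w t - zpath w s = W t w - W s w.
Proof. by move=> s0 t0; rewrite !zpathE //; ring. Qed.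

Lemma mfn_zpath t : mfn (fun w => zpath w t).
Proof.
apply: measurable_funD; last exact: measurable_funPT.
by apply: measurable_maxr; [exact: measurable_cst|exact: measurable_funPT].
Qed.

Lemma measurable_zpath : measurable_fun setT zpath.
Proof. exact: measurable_to_wiener mfn_zpath. Qed.

Definition sigma_path : set_system Om := <<s sigma_of [set: unit] (fun _ => xi : Om -> R)
   `|` sigma_of [set t | 0 <= t] (fun t => W t : Om -> R) >>.

End path_of_process.

Section generated_measurability.
Context {R : realType} {d : measure_display} {Om : measurableType d}.

Lemma mfn_sigma_of (I : Type) (D : set I) (X : I -> Om -> R) (G : set_system Om) i :
 D i -> sigma_of D X `<=` <<s G >> ->
 mfn (X i : g_sigma_algebraType G -> R).
Proof.
move=> Di sG _ B mB; rewrite setTI; apply: sG; apply: sub_sigma_algebra.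
by exists i => //; exists B => //; rewrite setTI.
Qed.

Lemma g_sigma_sub (G H : set_system Om) : H `<=` <<s G >> -> <<s H >> `<=` <<s G >>.
Proof. by move=> HG; apply: smallest_sub => //; exact: smallest_sigma_algebra. Qed.

End generated_measurability.

(** * The law of a path is determined by its start and its dyadic increments *)

Section law_of_paths.
Context {R : realType}.

Definition dy (n : nat) : R := (2 ^+ n)^-1.

Lemma dy_gt0 n : 0 < dy n.
Proof. by rewrite /dy invr_gt0 exprn_gt0. Qed.

(** The mesh [dy n] shrinks and the horizon n grows with the same index, so that the sigma-algebras
    of [cyls] increase to that of the whole path. *)
Definition cyl (n : nat) (C : set R) (B : nat -> set R) : set (@wiener R) :=
 [set x | C (cpath_fun x 0)] `&` \big[setI/setT]_(0 <= k < n * 2 ^ n)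
   [set x | B k (cpath_fun x (k.+1%:R * dy n) - cpath_fun x (k%:R * dy n))].

Definition cyls (n : nat) : set_system (@wiener R) :=
 [set X | exists C B, [/\ measurable C, forall k, measurable (B k) & X = cyl n C B]].

Lemma cyls_setI n : setI_closed (cyls n).
Proof.
move=> _ _ [C [B [mC mB ->]]] [C' [B' [mC' mB' ->]]]. exists (C `&` C'), (fun k => B k `&` B' k); split.
- exact: measurableI.
- by move=> k; exact: measurableI.
by rewrite /cyl setIACA -big_split.
Qed.

Lemma cyls_eval n k : (k <= n * 2 ^ n)%N ->
 mfn (fun x : g_sigma_algebraType (cyls n) => cpath_fun x (k%:R * dy n)).
Proof.
elim: k => [_|k IH kn].
 move=> _ B mB; rewrite setTI; apply: sub_sigma_algebra. exists B, (fun=> setT); split=> //.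
 rewrite /cyl big1 ?setIT ?mul0r //.
have -> : (fun x : g_sigma_algebraType (cyls n) => cpath_fun x (k.+1%:R * dy n)) =
  (fun x => cpath_fun x (k%:R * dy n) + (cpath_fun x (k.+1%:R * dy n) - cpath_fun x (k%:R * dy n))).
 by apply/funext => x; ring.
apply: measurable_funD; first by apply: IH; exact: ltnW.
move=> _ B mB; rewrite setTI; apply: sub_sigma_algebra.
exists setT, (fun j => if j == k then B else setT); split=> //.
 by move=> j; case: eqP.
rewrite /cyl (_ : [set x | _] = setT) // setTI.
rewrite (big_rem k) /= ?mem_index_iota ?kn // eqxx big1_seq ?setIT //.
move=> j /andP[_]; rewrite mem_rem_uniq ?iota_uniq // inE => /andP[/negbTE -> _]. by apply/seteqP; split.
Qed.

Lemma dy_scale n m k : (n <= m)%N -> k%:R * dy n = (k * 2 ^ (m - n))%:R * dy m.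
Proof.
move=> nm; rewrite /dy -{2}(subnK nm) exprD invfM natrM natrX.
have h : (2 : R) ^+ (m - n) != 0 by rewrite expf_neq0. by rewrite mulrA mulfK.
Qed.

Lemma cyls_eval_le n m k : (n <= m)%N -> (k <= n * 2 ^ n)%N ->
 mfn (fun x : g_sigma_algebraType (cyls m) => cpath_fun x (k%:R * dy n)).
Proof.
move=> nm kn; rewrite (dy_scale k nm); apply: cyls_eval.
rewrite (leq_trans (leq_mul kn (leqnn _))) // -mulnA -expnD subnKC //. by rewrite leq_mul2r nm orbT.
Qed.

Lemma cyls_mono n m : (n <= m)%N -> <<s cyls n >> `<=` <<s cyls m >>.
Proof.
move=> nm; apply: g_sigma_sub => _ [C [B [mC mB ->]]].
apply: (@measurableI _ (g_sigma_algebraType (cyls m))).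
 have := cyls_eval_le nm (leq0n (n * 2 ^ n)). by move=> /(_ measurableT C mC); rewrite setTI mul0r.
rewrite big_seq; apply: (@bigsetI_measurable _ (g_sigma_algebraType (cyls m))).
move=> k; rewrite mem_index_iota => /= kn.
have := measurable_funB (cyls_eval_le nm kn) (cyls_eval_le nm (ltnW kn)).
by move=> /(_ measurableT (B k) (mB k)); rewrite setTI.
Qed.

Lemma dy_small (e : R) : 0 < e -> \forall n \near \oo, dy n <= e.
Proof.
move=> e0; have H : geometric 1 (2^-1 : R) @ \oo --> 0.
 by apply: cvg_geometric; rewrite ger0_norm // invf_lt1 // ltr1n.
move/cvgrPdist_le : H => /(_ _ e0) H; apply: filterS H => n.
by rewrite /geometric /= sub0r normrN mul1r /dy exprVn ger0_norm // invr_ge0 exprn_ge0.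
Qed.

Lemma dy_cvg (t : R) : 0 <= t -> (Num.truncn (t * 2 ^+ n))%:R * dy n @[n --> \oo] --> t.
Proof.
move=> t0; apply/cvgrPdist_le => e e0. near=> n; have p0 : (0 : R) < 2 ^+ n by rewrite exprn_gt0.
have tn0 : 0 <= t * 2 ^+ n by rewrite mulr_ge0 // ltW. have /andP[h1 h2] := truncn_itv tn0.
have h3 : (Num.truncn (t * 2 ^+ n))%:R * dy n <= t by rewrite ler_pdivrMr.
have h4 : t < (Num.truncn (t * 2 ^+ n)).+1%:R * dy n by rewrite ltr_pdivlMr.
rewrite ger0_norm ?subr_ge0 //. have h5 : dy n <= e.
 by near: n; exact: dy_small.
move: h4; rewrite -natr1 mulrDl mul1r; lra.
Unshelve. all: by end_near. Qed.

(** By continuity, evaluation at t is the limit of the evaluations at the dyadic points below t,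
    each of which belongs to a cylinder algebra as soon as the horizon n passes t. *)
Lemma wiener_cyls : (measurable : set_system (@wiener R)) `<=` <<s \bigcup_(n in setT) <<s cyls n >> >>.
Proof.
set G := \bigcup_(n in _) _. apply: g_sigma_sub => _ [t _ [B mB <-]].
have sub n : <<s cyls n >> `<=` <<s G >>.
 by move=> X cX; apply: sub_sigma_algebra; exists n.
wlog t0 : t / 0 <= t.
 move=> H; have [/H//|t0] := leP 0 t.
 have -> : (fun x : cpath_type => x t) = (fun x : cpath_type => x 0).
  by apply/funext => x; apply: (cpath_ok x).2; exact: ltW.
 exact: H.
have me : mfn (fun x : g_sigma_algebraType G => cpath_fun x t).
 apply: (@measurable_fun_cvg _ (g_sigma_algebraType G) R setT
   (fun (n : nat) x => if (Num.truncn (t * 2 ^+ n) <= n * 2 ^ n)%N then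
    cpath_fun x ((Num.truncn (t * 2 ^+ n))%:R * dy n) else 0)).
  move=> n; case: leqP => h; last exact: measurable_cst. move=> _ D mD; rewrite setTI; apply: (sub n).
  by have := cyls_eval h measurableT mD; rewrite setTI.
 move=> x _; have cx := (cpath_ok x).1 t.
 have cv : cpath_fun x ((Num.truncn (t * 2 ^+ n))%:R * dy n) @[n --> \oo] --> cpath_fun x t.
  exact: (cvg_comp _ _ (dy_cvg t0) cx).
 apply: cvg_trans cv; apply: near_eq_cvg; near=> n.
 suff -> : (Num.truncn (t * 2 ^+ n) <= n * 2 ^ n)%N by []. rewrite -(ler_nat R) natrM natrX.
 have tn0 : 0 <= t * 2 ^+ n by rewrite mulr_ge0 // exprn_ge0.
 have /andP[h1 _] := truncn_itv tn0; apply: (le_trans h1).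
 rewrite ler_pM2r ?exprn_gt0 //; near: n; exact: nbhs_infty_ger.
have := me measurableT B mB; exact.
Unshelve. all: by end_near. Qed.

End law_of_paths.

Section process_laws.
Context {R : realType}.

(** Serves to add the initial value, and then the other particles, to the past of a Brownian motion
    while keeping its next increments independent. *)
Lemma indep_extend d (Om : measurableType d) (P : probability Om R) (A B1 B2 BB : set_system Om) :
 pi_measurable A -> pi_measurable B1 -> pi_measurable B2 ->
 (forall b1 b2, B1 b1 -> B2 b2 -> BB (b1 `&` b2)) ->
 independent P A BB -> independent P B1 B2 ->
 independent P <<s A `|` B1 >> B2.
Proof.
move=> pA pB1 pB2 sub AB B12. have pT := @pi_trivial d Om.
have := indep_join pA pT pB1 pB2 _ (@indep_trivial _ _ _ P A) B12.
move=> J; apply: (indep_sub (J _)) => //.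
 move=> a1 _ b1 b2 Aa -> Bb1 Bb2; rewrite setIT; apply: AB => //; exact: sub.
by move=> X BX; apply: sub_sigma_algebra; right.
Qed.

Lemma dynkin_same_law d1 d2 (T1 : measurableType d1) (T2 : measurableType d2) d
  (T : measurableType d) (P1 : probability T1 R) (P2 : probability T2 R)
  (X1 : T1 -> T) (X2 : T2 -> T) :
 measurable_fun setT X1 -> measurable_fun setT X2 ->
 dynkin [set A | measurable A /\ P1 (X1 @^-1` A) = P2 (X2 @^-1` A)].
Proof.
move=> m1 m2; split.
- by split=> //; rewrite !preimage_setT !probability_setT.
- move=> A [mA eA]; split; first exact: measurableC.
 have mA1 : measurable (X1 @^-1` A) by rewrite -[X in measurable X]setTI; exact: m1.
 have mA2 : measurable (X2 @^-1` A) by rewrite -[X in measurable X]setTI; exact: m2.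
 transitivity (1 - P1 (X1 @^-1` A))%E; first exact: probability_setC.
 by rewrite eA; apply/esym; exact: probability_setC.
move=> F tF HF; split; first by apply: bigcupT_measurable => n; case: (HF n).
have mF1 n : measurable (X1 @^-1` F n).
 by rewrite -[X in measurable X]setTI; apply: m1 => //; case: (HF n).
have mF2 n : measurable (X2 @^-1` F n).
 by rewrite -[X in measurable X]setTI; apply: m2 => //; case: (HF n).
rewrite !preimage_bigcup !measure_bigcup //.
 by apply: eq_eseriesr => n _; case: (HF n).
all: apply/trivIsetP => i j _ _ ij; move/trivIsetP : tF => /(_ i j I I ij) h.
all: by rewrite -preimage_setI h preimage_set0.
Qed.

Section one_process.
Context {d : measure_display} {Om : measurableType d}.
Variable P : probability Om R.
Variables (xi : {RV P >-> R}) (W : R -> {RV P >-> R}).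
Hypothesis BW : brownian W.
Hypothesis indep : independent P (sigma_of [set: unit] (fun _ => xi : Om -> R))
  (sigma_of [set t | 0 <= t] (fun t => W t : Om -> R)).

Lemma mfn_incr s t : mfn (fun w => W t w - W s w).
Proof. by apply: measurable_funB; exact: measurable_funPT. Qed.

Lemma increments_law (h : R) m (B : nat -> set R) : 0 < h -> (forall k, measurable (B k)) ->
 let A := \big[setI/setT]_(0 <= k < m) [set w | B k (W (k.+1%:R * h) w - W (k%:R * h) w)] in
 sigma_of [set r | 0 <= r <= m%:R * h] (fun r => W r : Om -> R) A /\
 P A = (\prod_(0 <= k < m) normal_prob 0 (Num.sqrt h) (B k))%E.
Proof.
move=> h0 mB; elim: m => [|m [IH1 IH2]] /=.
 by rewrite !big_geq // probability_setT; split=> //; exact: g_sigma_setT.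
rewrite !big_nat_recr //=. have mh0 : 0 <= m%:R * h by rewrite mulr_ge0 // ltW.
have mh1 : m%:R * h < m.+1%:R * h by rewrite ltr_pM2r // ltr_nat. split.
 apply: g_sigma_setI.
  apply: g_sigma_sub IH1 => X [r /andP[r0 rm] BX]; apply: sub_sigma_algebra.
  exists r => //=; rewrite r0 /=; apply: (le_trans rm); exact: ltW.
 set D := [set r | _].
 pose T := g_sigma_algebraType (\bigcup_(r in D) preimage_set_system setT (W r : Om -> R) measurable).
 have mW r : 0 <= r -> r <= m.+1%:R * h -> mfn (W r : T -> R).
  move=> r0 rm; apply: (@mfn_sigma_of _ _ _ _ D (fun r => W r : Om -> R)) => //. by rewrite /D /= r0.
 have : mfn (fun w : T => W (m.+1%:R * h) w - W (m%:R * h) w).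
  by apply: measurable_funB; apply: mW => //; [exact: le_trans (ltW mh1)|exact: ltW].
 by move=> /(_ measurableT _ (mB m)); rewrite setTI.
case: BW => _ _ nW iW; rewrite (iW _ _ mh0 mh1) //; last first.
 apply: sub_sigma_algebra; exists tt => //; exists (B m) => //. by rewrite setTI.
rewrite IH2 (nW _ _ _ mh0 mh1 (mB m)). have -> : m.+1%:R * h - m%:R * h = h by rewrite -natr1; ring.
by [].
Qed.

Lemma zpath_cyl_law n C B : measurable C -> (forall k, measurable (B k)) ->
 P (zpath xi BW @^-1` cyl n C B) =
 (P [set w | C (maxr 0 (xi w))%R] * \prod_(0 <= k < n * 2 ^ n) normal_prob 0 (Num.sqrt (dy n)) (B k))%E.
Proof.
move=> mC mB; have [sA PA] := increments_law (n * 2 ^ n) (dy_gt0 n) mB. rewrite -PA -indep.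
- congr (P _); rewrite /cyl preimage_setI; congr (_ `&` _).
  by apply/seteqP; split=> w; rewrite /preimage /mkset zpath0.
 rewrite (big_morph _ (preimage_setI _) (preimage_setT _)).
 apply: eq_bigr => k _; apply/seteqP; split=> w; rewrite /preimage /mkset zpath_incr //;
  by rewrite mulr_ge0 // ltW // dy_gt0.
- apply: sub_sigma_algebra; exists tt => //. exists [set x | C (maxr 0 x)] => //; last by rewrite setTI.
 have : measurable_fun setT (fun x : R => maxr 0 x).
  by apply: measurable_maxr => //; exact: measurable_cst.
 by move=> /(_ measurableT C mC); rewrite setTI.
apply: g_sigma_sub sA => X [r /andP[r0 _] BX]; apply: sub_sigma_algebra. by exists r.
Qed.

Lemma sigma_path_zpath (A : set wiener) : measurable A -> sigma_path xi W (zpath xi BW @^-1` A).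
Proof.
pose T := g_sigma_algebraType (sigma_of [set: unit] (fun _ => xi : Om -> R)
   `|` sigma_of [set t | 0 <= t] (fun t => W t : Om -> R)).
have mx : mfn (xi : T -> R).
 apply: (@mfn_sigma_of _ _ _ _ setT (fun _ : unit => xi : Om -> R) _ tt) => //.
 by move=> X BX; apply: sub_sigma_algebra; left.
have mW r : 0 <= r -> mfn (W r : T -> R).
 move=> r0; apply: (@mfn_sigma_of _ _ _ _ [set t | 0 <= t] (fun t => W t : Om -> R)) => //.
 by move=> X BX; apply: sub_sigma_algebra; right.
have : measurable_fun setT (zpath xi BW : T -> wiener).
 apply: measurable_to_wiener => t; apply: measurable_funD.
  by apply: measurable_maxr => //; exact: measurable_cst.
 by apply: mW; rewrite le_max lexx.
by move=> mZ mA; have := mZ measurableT A mA; rewrite setTI.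
Qed.

Lemma indep_future s t : 0 <= s -> s < t ->
 independent P <<s sigma_of [set: unit] (fun _ => xi : Om -> R) `|`
   sigma_of [set r | 0 <= r <= s] (fun r => W r : Om -> R) >>
  (sigma_of [set: unit] (fun _ w => W t w - W s w)).
Proof.
move=> s0 st; apply: (indep_extend _ _ _ _ indep).
- by apply: pi_sigma_of => _ _; exact: measurable_funPT.
- by apply: pi_sigma_of => r _; exact: measurable_funPT.
- by apply: pi_sigma_of => _ _; exact: mfn_incr.
- move=> b1 b2 Bb1 Bb2; apply: g_sigma_setI.
  apply: g_sigma_sub Bb1 => X [r /andP[r0 _] BX]; apply: sub_sigma_algebra. by exists r.
 pose T := g_sigma_algebraType (\bigcup_(r in [set r : R | 0 <= r])
   preimage_set_system setT (W r : Om -> R) measurable).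
 have mW r : 0 <= r -> mfn (W r : T -> R).
  by move=> r0; apply: (@mfn_sigma_of _ _ _ _ [set t | 0 <= t] (fun t => W t : Om -> R)).
 apply: g_sigma_sub Bb2 => X [_ _ [D mD <-]]. have : mfn (fun w : T => W t w - W s w).
  by apply: measurable_funB; apply: mW => //; exact: le_trans (ltW st).
 by move=> /(_ measurableT _ mD).
- by case: BW => _ _ _; exact.
Qed.

End one_process.

(** The law of the start and the normal increments determine the probabilities of the cylinders. Two
    pi-lambda passes follow, one inside each [cyls n] and one over their increasing union. *)
Lemma same_law_paths d1 d2 (T1 : measurableType d1) (T2 : measurableType d2)
  (P1 : probability T1 R) (P2 : probability T2 R)
  (x1 : {RV P1 >-> R}) (W1 : R -> {RV P1 >-> R})
  (x2 : {RV P2 >-> R}) (W2 : R -> {RV P2 >-> R})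
  (B1 : brownian W1) (B2 : brownian W2) :
 independent P1 (sigma_of [set: unit] (fun _ => x1 : T1 -> R))
  (sigma_of [set t | 0 <= t] (fun t => W1 t : T1 -> R)) ->
 independent P2 (sigma_of [set: unit] (fun _ => x2 : T2 -> R))
  (sigma_of [set t | 0 <= t] (fun t => W2 t : T2 -> R)) ->
 (forall B, measurable B -> distribution P1 x1 B = distribution P2 x2 B) ->
 forall A, measurable A -> P1 (zpath x1 B1 @^-1` A) = P2 (zpath x2 B2 @^-1` A).
Proof.
move=> i1 i2 dE A mA. have dk := dynkin_same_law P1 P2 (measurable_zpath x1 B1) (measurable_zpath x2 B2).
have mcyl n : cyls n `<=` (measurable : set_system (@wiener R)).
 move=> _ [C [B [mC mB ->]]]; apply: measurableI.
  by have := mfn_eval (0 : R) measurableT mC; rewrite setTI.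
 apply: bigsetI_measurable => k _.
 have := measurable_funB (mfn_eval (k.+1%:R * dy n : R)) (mfn_eval (k%:R * dy n)).
 by move=> /(_ measurableT (B k) (mB k)); rewrite setTI.
have sub n : <<s cyls n >> `<=` [set A | measurable A /\
  P1 (zpath x1 B1 @^-1` A) = P2 (zpath x2 B2 @^-1` A)].
 rewrite -(setI_closed_g_dynkin_g_sigma_algebra (@cyls_setI R n)).
 apply: smallest_sub => // _ [C [B [mC mB ->]]]; split.
  by apply: (mcyl n); exists C, B.
 rewrite !zpath_cyl_law //; congr (_ * _)%E. have mm : measurable [set x | C (maxr 0 x)].
  have : measurable_fun setT (fun x : R => maxr 0 x).
   by apply: measurable_maxr => //; exact: measurable_cst.
  by move=> /(_ measurableT C mC); rewrite setTI.
 exact: dE mm.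
have cI : setI_closed (\bigcup_(n in setT) <<s @cyls R n >>).
 move=> X Y [n _ nX] [m _ mY]; exists (maxn n m) => //.
 apply: g_sigma_setI; [exact: cyls_mono (leq_maxl _ _) _ nX|exact: cyls_mono (leq_maxr _ _) _ mY].
have := wiener_cyls mA; rewrite -(setI_closed_g_dynkin_g_sigma_algebra cI) => sA.
suff : (\bigcup_(n in setT) <<s @cyls R n >>) `<=` [set A | measurable A /\
  P1 (zpath x1 B1 @^-1` A) = P2 (zpath x2 B2 @^-1` A)].
 by move=> h; case: (smallest_sub dk h sA).
by move=> X [n _ nX]; exact: sub nX.
Qed.

End process_laws.

Section laws.
Context {R : realType}.

Context {d1 d2 d : measure_display} {T1 : measurableType d1} {T2 : measurableType d2}.
Context {S : measurableType d}.
Variables (X1 : T1 -> S) (X2 : T2 -> S).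
Hypotheses (mX1 : measurable_fun setT X1) (mX2 : measurable_fun setT X2).

Lemma law_integral (m1 : {measure set T1 -> \bar R}) (m2 : {measure set T2 -> \bar R}) (f : S -> \bar R) :
 (forall A, measurable A -> m1 (X1 @^-1` A) = m2 (X2 @^-1` A)) ->
 measurable_fun setT f ->
 (\int[m1]_w f (X1 w) = \int[m2]_w f (X2 w))%E.
Proof.
move=> eqm mf. have nonneg (g : S -> \bar R) : measurable_fun setT g -> (forall x, 0 <= g x)%E ->
  (\int[m1]_w g (X1 w) = \int[m2]_w g (X2 w))%E.
 move=> mg g0. have := ge0_integral_pushforward mX1 m1 measurableT mg (fun y _ => g0 y).
 have := ge0_integral_pushforward mX2 m2 measurableT mg (fun y _ => g0 y).
 rewrite !preimage_setT /= => <- <-. by apply: eq_measure_integral => A mA _; exact: eqm.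
rewrite [LHS]integralE [RHS]integralE.
have pc T (X : T -> S) : ((fun x => f (X x))^\+ = (fun x => f^\+ (X x)))%E.
 by apply/funext => x; rewrite !funeposE.
have nc T (X : T -> S) : ((fun x => f (X x))^\- = (fun x => f^\- (X x)))%E.
 by apply/funext => x; rewrite !funenegE.
rewrite (pc _ X1) (pc _ X2) (nc _ X1) (nc _ X2); congr (_ - _)%E; apply: nonneg.
- exact: measurable_funepos.
- by move=> x; exact: funepos_ge0.
- exact: measurable_funeneg.
- by move=> x; exact: funeneg_ge0.
Qed.

Variables (P1 : probability T1 R) (P2 : probability T2 R) (f : S -> R).
Hypothesis eqm : forall A, measurable A -> P1 (X1 @^-1` A) = P2 (X2 @^-1` A).
Hypothesis mf : mfn f.

Lemma law_igr : igr P1 (fun w => f (X1 w)) -> igr P2 (fun w => f (X2 w)).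
Proof.
move=> /integrableP[_ fin1]; apply/integrableP; split.
 by apply/measurable_EFinP; exact: measurableT_comp mf mX2.
have mg : measurable_fun setT (fun x => `|(f x)%:E|%E).
 by apply: measurableT_comp => //; apply/measurable_EFinP; exact: mf.
by have := law_integral eqm mg; rewrite /comp /= => <-.
Qed.

Lemma law_Ex : Ex P1 (fun w => f (X1 w)) = Ex P2 (fun w => f (X2 w)).
Proof.
rewrite /Ex /Rintegral; congr fine.
by apply: (law_integral eqm (f := EFin \o f)); apply/measurable_EFinP; exact: mf.
Qed.

End laws.

(** * Gaussian estimates *)

Section gaussian.
Context {R : realType}.
Local Notation leb := (@lebesgue_measure R).

Lemma normal_pdf_form (s x : R) : 0 < s ->
 normal_pdf 0 s x = (s * Num.sqrt (pi *+ 2))^-1 * expR (- (x ^+ 2 / (2 * s ^+ 2))).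
Proof.
move=> s0; rewrite /normal_pdf gt_eqF // /normal_peak /normal_fun subr0 mulNr.
congr (_^-1 * expR (- (_ / _))); last by rewrite mulr_natl.
by rewrite -mulrnAr sqrtrM ?sqr_ge0 // sqrtr_sqr gtr0_norm.
Qed.

Lemma normal_integral (s : R) (f : R -> \bar R) : (forall x, 0 <= f x)%E ->
 measurable_fun setT f -> 0 < s ->
 (\int[normal_prob 0 s]_x f x = \int[leb]_x (f x * (normal_pdf 0 s x)%:E))%E.
Proof.
move=> f0 mf s0. have dom := @normal_prob_dominates R 0 s.
rewrite -(Radon_Nikodym_SigmaFinite.change_of_variables dom f0 measurableT mf).
have mp : measurable_fun setT (fun x => (normal_pdf 0 s x)%:E).
 by apply/measurable_EFinP; exact: measurable_normal_pdf.
have iRN := Radon_Nikodym_SigmaFinite.f_integrable dom. apply: ae_eq_integral => //.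
- by apply: emeasurable_funM => //; exact: measurable_int iRN.
- by apply: emeasurable_funM.
- apply: ae_eqe_mul2l. apply: integral_ae_eq => //.
 by move=> E _ mE; rewrite -(Radon_Nikodym_SigmaFinite.f_integral dom).
Qed.

End gaussian.

Section gaussian_variable.
Context {R : realType} {d : measure_display} {Om : measurableType d}.
Variable P : probability Om R.

Definition gauss (s : R) (G : Om -> R) := [/\ 0 < s, mfn G &
 forall B, measurable B -> P (G @^-1` B) = normal_prob 0 s B].

Variables (s : R) (G : Om -> R).
Hypothesis gG : gauss s G.

Let s0 : 0 < s. Proof. by case: gG. Qed.
Let mG : mfn G. Proof. by case: gG. Qed.

Lemma gauss_integral (f : R -> \bar R) : (forall x, 0 <= f x)%E -> measurable_fun setT f ->
 (\int[P]_w f (G w) = \int[@lebesgue_measure R]_x (f x * (normal_pdf 0 s x)%:E))%E.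
Proof.
move=> f0 mf; rewrite -normal_integral //. case: gG => _ _ eqm.
exact: (@law_integral R _ _ _ _ (measurableTypeR R) _ G id mG (@measurable_id _ _ _) P (normal_prob 0 s) f eqm mf).
Qed.

(** No integral is computed: the tilted density is s' / s times the normal density of standard
    deviation s'. *)
Lemma gauss_exp (b s' : R) : 0 < s' -> b = (2 * s ^+ 2)^-1 - (2 * s' ^+ 2)^-1 ->
 igr P (fun w => expR (b * G w ^+ 2)) /\ Ex P (fun w => expR (b * G w ^+ 2)) = s' / s.
Proof.
move=> s'0 bE. have mf : measurable_fun setT (fun x : R => (expR (b * x ^+ 2))%:E).
 apply/measurable_EFinP; apply: measurableT_comp; first exact: measurable_expR.
 by apply: measurable_funM => //; apply: measurable_funX; exact: measurable_id.
have I : (\int[P]_w (expR (b * G w ^+ 2))%:E = (s' / s)%:E)%E.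
 have f0 (x : R) : (0 <= (expR (b * x ^+ 2))%:E)%E by rewrite lee_fin expR_ge0.
 rewrite (gauss_integral f0 mf).
 transitivity (\int[@lebesgue_measure R]_x ((s' / s)%:E * (normal_pdf 0 s' x)%:E))%E.
  apply: eq_integral => x _; rewrite -!EFinM !normal_pdf_form //; congr EFin.
  have sn : s != 0 by rewrite gt_eqF. have s'n : s' != 0 by rewrite gt_eqF. rewrite [LHS]mulrCA -expRD.
  have -> : b * x ^+ 2 + - (x ^+ 2 / (2 * s ^+ 2)) = - (x ^+ 2 / (2 * s' ^+ 2)).
   by rewrite bE; ring.
  rewrite [RHS]mulrA; congr (_ * _). have qn : Num.sqrt (pi *+ 2) != 0 :> R.
   by rewrite gt_eqF // sqrtr_gt0 pmulrn_lgt0 // pi_gt0.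
  by move: (Num.sqrt _) qn => q qn; field; rewrite sn s'n qn.
 rewrite ge0_integralZl //.
 - by rewrite integral_normal_pdf mule1.
 - by apply/measurable_EFinP; exact: measurable_normal_pdf.
 - by move=> x _; rewrite lee_fin normal_pdf_ge0.
 - by rewrite lee_fin divr_ge0 // ltW.
have ig : igr P (fun w => expR (b * G w ^+ 2)).
 apply/integrableP; split.
  by apply: (measurableT_comp mf); exact: mG.
 under eq_integral do rewrite gee0_abs ?lee_fin ?expR_ge0 //. by rewrite /comp /= I ltry.
by split=> //; apply: EFin_inj; rewrite ExE.
Qed.

(** A crude constant: with u = G^2 / (4 s^2) one has G^4 = 64 s^4 (u^2 / 4) and u^2 / 4 <= exp u,
    whose mean is sqrt 2 <= 2. *)
Lemma gauss_moment4 : igr P (fun w => G w ^+ 4) /\ Ex P (fun w => G w ^+ 4) <= 128 * s ^+ 4.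
Proof.
have sn : s != 0 by rewrite gt_eqF. have q2 : (Num.sqrt 2 : R) ^+ 2 = 2 by rewrite sqr_sqrtr.
have q0 : 0 < Num.sqrt 2 :> R by rewrite sqrtr_gt0. have qle : Num.sqrt 2 <= 2 :> R by nra.
have [||ig E] := @gauss_exp ((4 * s ^+ 2)^-1) (Num.sqrt 2 * s).
- by rewrite mulr_gt0.
- by rewrite exprMn q2; field.
have mG4 : mfn (fun w => G w ^+ 4) by exact: measurable_funX.
have key w : G w ^+ 4 <= 64 * s ^+ 4 * expR ((4 * s ^+ 2)^-1 * G w ^+ 2).
 set u := (4 * s ^+ 2)^-1 * G w ^+ 2.
 have u0 : 0 <= u by rewrite mulr_ge0 ?sqr_ge0 // invr_ge0 mulr_ge0 ?sqr_ge0.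
 have -> : G w ^+ 4 = 64 * s ^+ 4 * (u ^+ 2 / 4) by rewrite /u; field.
 apply: ler_wpM2l; first by rewrite mulr_ge0 // exprn_ge0 // ltW. rewrite [u in expR u]splitr expRD.
 by have := expR_ge1Dx (u / 2); nra.
have ig4 : igr P (fun w => G w ^+ 4).
 apply: (@igr_dom _ _ _ _ _ _ mG4 (igrZ (64 * s ^+ 4) ig)) => w.
 by rewrite ger0_norm // (_ : 4%N = (2 * 2)%N) // exprM sqr_ge0.
split=> //; apply: (le_trans (Ex_le ig4 (igrZ _ ig) key)). rewrite ExZ // E mulfK //.
have s4 : 0 <= s ^+ 4 by rewrite exprn_ge0 // ltW. by move: (s ^+ 4) s4 => q; nra.
Qed.

Lemma gauss_igrX n : (n <= 4)%N -> igr P (fun w => G w ^+ n).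
Proof.
move=> n4; have [ig _] := gauss_moment4. apply: (@igr_dom _ _ _ _ _ _ _ (igrD (igr_cst P 1) ig)).
 exact: measurable_funX.
move=> w /=; rewrite normrX. have -> : G w ^+ 4 = `|G w| ^+ 4.
 by rewrite (_ : 4%N = (2 * 2)%N) // !exprM real_normK // num_real.
have [le1|ge1] := leP `|G w| 1.
 by rewrite (le_trans (exprn_ile1 _ _ le1)) // lerDl exprn_ge0.
by apply: (le_trans (ler_weXn2l (ltW ge1) n4)); rewrite lerDr.
Qed.

Lemma gauss_igr : igr P G.
Proof. by have := @gauss_igrX 1 isT; congr igr; apply/funext => w; rewrite expr1. Qed.

(** With x = G^2 / (2 s^2), the inequality 1 - x <= exp (-x) and the mean 1 / sqrt 2 <= 3/4 of the
    right side give E x >= 1/4. *)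
Lemma gauss_moment2 : s ^+ 2 / 2 <= Ex P (fun w => G w ^+ 2).
Proof.
have sn : s != 0 by rewrite gt_eqF. have q2 : (Num.sqrt 2 : R) ^+ 2 = 2 by rewrite sqr_sqrtr.
have q0 : 0 < Num.sqrt 2 :> R by rewrite sqrtr_gt0. have qn : Num.sqrt 2 != 0 :> R by rewrite gt_eqF.
have [||ig E] := @gauss_exp (- (2 * s ^+ 2)^-1) (s / Num.sqrt 2).
- by rewrite divr_gt0.
- by rewrite expr_div_n q2; field.
have i2 := @gauss_igrX 2 isT.
have key w : 1 - (2 * s ^+ 2)^-1 * G w ^+ 2 <= expR (- (2 * s ^+ 2)^-1 * G w ^+ 2).
 by rewrite mulNr; exact: expR_ge1Dx.
have ic := igr_cst P (1 : R). have := Ex_le (igrB ic (igrZ _ i2)) ig key.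
have -> : Ex P (fun w => 1 - (2 * s ^+ 2)^-1 * G w ^+ 2) = 1 - (2 * s ^+ 2)^-1 * Ex P (fun w => G w ^+ 2).
 by rewrite -(ExZ _ i2) -[X in X - _](Ex_cst P 1) -(ExB ic (igrZ _ i2)).
rewrite E mulrAC divff // mul1r. move: (Ex P _) => e. have i34 : (Num.sqrt 2 : R)^-1 <= 3 / 4.
 by rewrite -[leLHS]mul1r ler_pdivrMr //; nra.
move=> h; have h4 : 1 / 4 <= (2 * s ^+ 2)^-1 * e by lra.
have s2 : 0 < 2 * s ^+ 2 by rewrite mulr_gt0 // exprn_gt0. have := ler_wpM2l (ltW s2) h4.
by rewrite [leRHS]mulrA divff ?gt_eqF // mul1r; lra.
Qed.

Lemma gauss_sym : gauss s (fun w => - G w).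
Proof.
case: (gG) => _ _ eqm; split=> //; first exact: measurableT_comp. move=> B mB.
have mN : measurable_fun setT (-%R : R -> R).
 by apply: oppr_measurable; exact: measurableT.
have mB' : measurable (-%R @^-1` B) by rewrite -[X in measurable X]setTI; exact: mN.
have := eqm _ mB'; rewrite /preimage /= => ->. rewrite /normal_prob.
have mp : measurable_fun setT (fun x => (normal_pdf 0 s x)%:E).
 by apply/measurable_EFinP; exact: measurable_normal_pdf.
transitivity (\int[@lebesgue_measure R]_(x in -%R @^-1` B) (normal_pdf 0 s (- x))%:E)%E.
 by apply: eq_integral => x _; rewrite !normal_pdf_form // sqrrN.
have := @ge0_integral_pushforward _ _ (measurableTypeR R) (measurableTypeR R) R -%R mN lebesgue_measure B (fun x => (normal_pdf 0 s x)%:E) mB (measurable_funTS mp).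
rewrite /preimage /= /comp => <-; last by move=> y _; rewrite lee_fin normal_pdf_ge0.
by apply: eq_measure_integral => A mA _; exact: lebesgue_measureN.
Qed.

Lemma gauss_mean0 : Ex P G = 0.
Proof.
have [_ mN eqN] := gauss_sym; case: (gG) => _ _ eqm.
have := @law_Ex R _ _ _ _ _ (measurableTypeR R) G (fun w => - G w) mG mN P P id.
move=> /(_ (fun A mA => etrans (eqm A mA) (esym (eqN A mA))) (@measurable_id _ _ _)).
have -> : Ex P (fun w => id (- G w)) = - Ex P G.
 rewrite -[RHS]mulN1r -(ExZ _ gauss_igr); congr (Ex P _). by apply/funext => w; rewrite mulN1r.
by have -> : Ex P (fun w => id (G w)) = Ex P G by []; lra.
Qed.

Lemma gauss_atomless c : P [set w | G w = c] = 0%E.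
Proof.
case: (gG) => _ _ eqm; have := eqm [set c] (measurable_set1 c).
have -> : G @^-1` [set c] = [set w | G w = c] by [].
move=> ->; have /null_content_dominatesP := @normal_prob_dominates R 0 s.
by apply; [exact: measurable_set1|exact: lebesgue_measure_set1].
Qed.

Lemma gauss_gt c : P [set w | c < G w] != 0%E.
Proof.
case: (gG) => _ _ eqm; have mI := @measurable_itv R `]c, +oo[. have := eqm _ mI.
have -> : G @^-1` `]c, +oo[%classic = [set w | c < G w].
 by apply/seteqP; split=> w /=; rewrite in_itv /= andbT.
move=> ->. have mJ := @measurable_itv R `]c, (c + 1)[.
have sub : `]c, (c + 1)[%classic `<=` `]c, +oo[%classic .
 by move=> x /=; rewrite !in_itv /= andbT => /andP[].
pose I : set R := `]c, +oo[%classic; pose J : set R := `]c, (c + 1)[%classic.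
have le1 : (normal_prob 0 s J <= normal_prob 0 s I)%E.
 by apply: le_measure => //; rewrite inE.
pose k := (s * Num.sqrt (pi *+ 2))^-1 * expR (- ((`|c| + 1) ^+ 2 / (2 * s ^+ 2))). have k0 : 0 < k.
 by rewrite mulr_gt0 ?expR_gt0 // invr_gt0 mulr_gt0 // sqrtr_gt0 pmulrn_lgt0 // pi_gt0.
have : (k%:E <= normal_prob 0 s J)%E.
 rewrite /normal_prob. have -> : k%:E = (\int[@lebesgue_measure R]_(x in J) k%:E)%E.
  have lc : (c%:E < (c + 1)%:E)%E by rewrite lte_fin ltrDl. have lJ : lebesgue_measure J = 1%E.
   by rewrite /J lebesgue_measure_itv /= lc -EFinB (_ : c + 1 - c = 1) //; lra.
  transitivity (k%:E * @lebesgue_measure R J)%E; first by rewrite lJ mule1. by rewrite integral_cst.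
 apply: ge0_le_integral => //.
 - by move=> x _; rewrite lee_fin ltW.
 - by apply/measurable_EFinP; apply: measurable_funTS; exact: measurable_normal_pdf.
 - move=> x; rewrite /J /= in_itv /= => /andP[cx xc]. rewrite lee_fin normal_pdf_form // ler_wpM2l //.
   by rewrite invr_ge0 mulr_ge0 ?sqrtr_ge0 // ltW.
  rewrite ler_expR lerN2 ler_wpM2r //.
   by rewrite invr_ge0 mulr_ge0 // sqr_ge0.
  have := ler_norm c; have := ler_norm (- c); rewrite normrN => h1 h2. by nra.
move=> kle; apply: contraTneq (le_trans kle le1) => ->. by rewrite lee_fin -ltNge.
Qed.

End gaussian_variable.

(** * Fourth moments and sums of independent variables *)

Section powers.
Context {R : realType} {d : measure_display} {Om : measurableType d}.
Variable P : probability Om R.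
Implicit Types X Y : Om -> R.

Lemma igr_pow X n : mfn X -> igr P (fun w => X w ^+ 4) -> (n <= 4)%N -> igr P (fun w => X w ^+ n).
Proof.
move=> mX ig n4; apply: (igr_dom _ (igrD (igr_cst P 1) ig)).
 exact: measurable_funX.
move=> w /=; rewrite normrX. have -> : X w ^+ 4 = `|X w| ^+ 4.
 by rewrite (_ : 4%N = (2 * 2)%N) // !exprM real_normK // num_real.
have [le1|ge1] := leP `|X w| 1.
 by rewrite (le_trans (exprn_ile1 _ _ le1)) // lerDl exprn_ge0.
by apply: (le_trans (ler_weXn2l (ltW ge1) n4)); rewrite lerDr.
Qed.

Lemma pow4_add (x y : R) : (x + y) ^+ 4 <= 8 * (x ^+ 4 + y ^+ 4).
Proof.
have h1 : (x + y) ^+ 2 <= 2 * (x ^+ 2 + y ^+ 2).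
 by rewrite -subr_ge0; have := sqr_ge0 (x - y); rewrite !expr2; lra.
have h2 : (x ^+ 2 + y ^+ 2) ^+ 2 <= 2 * (x ^+ 4 + y ^+ 4).
 by rewrite -subr_ge0; have := sqr_ge0 (x ^+ 2 - y ^+ 2); set a := _ ^+ 2; rewrite /a; nra.
have -> : (x + y) ^+ 4 = ((x + y) ^+ 2) ^+ 2 by rewrite -exprM.
have h3 : ((x + y) ^+ 2) ^+ 2 <= (2 * (x ^+ 2 + y ^+ 2)) ^+ 2.
 by rewrite ler_pXn2r // nnegrE ?sqr_ge0 // (le_trans (sqr_ge0 _) h1).
by apply: (le_trans h3); rewrite exprMn; lra.
Qed.

Lemma pow4_ge0 (x : R) : 0 <= x ^+ 4.
Proof. by rewrite (_ : 4%N = (2 * 2)%N) // exprM sqr_ge0. Qed.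

Lemma igr_pow4D X Y : mfn X -> mfn Y -> igr P (fun w => X w ^+ 4) ->
 igr P (fun w => Y w ^+ 4) -> igr P (fun w => (X w + Y w) ^+ 4).
Proof.
move=> mX mY iX iY; apply: (igr_dom _ (igrZ 8 (igrD iX iY))).
 by apply: measurable_funX; exact: measurable_funD.
by move=> w; rewrite ger0_norm ?pow4_ge0 // pow4_add.
Qed.

Lemma Ex_sqr_le X : mfn X -> igr P (fun w => X w ^+ 4) ->
 Ex P (fun w => X w ^+ 2) ^+ 2 <= Ex P (fun w => X w ^+ 4).
Proof.
move=> mX i4; have i2 : igr P (fun w => X w ^+ 2) by exact: igr_pow. set m := Ex P (fun w => X w ^+ 2).
have iL : igr P (fun w => (2 * m) * X w ^+ 2) by exact: igrZ.
have := Ex_le (igrB iL (igr_cst P (m ^+ 2))) i4.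
have -> : Ex P (fun w => 2 * m * X w ^+ 2 - cst (m ^+ 2) w) = m ^+ 2.
 by rewrite (ExB iL (igr_cst P (m ^+ 2))) ExZ // Ex_cst -/m; ring.
apply=> w /=; rewrite -subr_ge0.
have -> : X w ^+ 4 - (2 * m * X w ^+ 2 - m ^+ 2) = (X w ^+ 2 - m) ^+ 2 by ring. exact: sqr_ge0.
Qed.

Lemma indepRV_sigma (F G : set_system Om) X Y : independent P <<s F >> <<s G >> ->
 mfn (X : g_sigma_algebraType F -> R) -> mfn (Y : g_sigma_algebraType G -> R) ->
 indepRV P X Y.
Proof.
move=> FG mX mY A B mA mB; apply: FG.
 by have := mX measurableT _ mA; rewrite setTI.
by have := mY measurableT _ mB; rewrite setTI.
Qed.

Lemma indepRV_fun X Y (f g : R -> R) : indepRV P X Y -> measurable_fun setT f -> measurable_fun setT g ->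
 indepRV P (fun w => f (X w)) (fun w => g (Y w)).
Proof.
move=> XY mf mg A B mA mB; apply: (XY (f @^-1` A) (g @^-1` B)).
 by have := mf measurableT _ mA; rewrite setTI.
by have := mg measurableT _ mB; rewrite setTI.
Qed.

Lemma fourth_moment_step X Y : mfn X -> mfn Y -> indepRV P X Y ->
 igr P (fun w => X w ^+ 4) -> igr P (fun w => Y w ^+ 4) -> Ex P Y = 0 ->
 Ex P X = 0 ->
 Ex P (fun w => (X w + Y w) ^+ 2) = Ex P (fun w => X w ^+ 2) + Ex P (fun w => Y w ^+ 2) /\
 Ex P (fun w => (X w + Y w) ^+ 4) = Ex P (fun w => X w ^+ 4) +
  6 * (Ex P (fun w => X w ^+ 2) * Ex P (fun w => Y w ^+ 2)) +
  Ex P (fun w => Y w ^+ 4).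
Proof.
move=> mX mY XY iX iY EY EX. have pw n : measurable_fun setT (fun x : R => x ^+ n).
 by apply: measurable_funX; exact: measurable_id.
have pX n : (n <= 4)%N -> igr P (fun w => X w ^+ n) by exact: igr_pow.
have pY n : (n <= 4)%N -> igr P (fun w => Y w ^+ n) by exact: igr_pow.
have prod a b : (a <= 4)%N -> (b <= 4)%N -> igr P (fun w => X w ^+ a * Y w ^+ b) /\
  Ex P (fun w => X w ^+ a * Y w ^+ b) = Ex P (fun w => X w ^+ a) * Ex P (fun w => Y w ^+ b).
 by move=> a4 b4; apply: indep_igrM; [exact: pX|exact: pY|exact: (indepRV_fun XY (pw a) (pw b))].
have X1 : Ex P (fun w => X w ^+ 1) = 0.
 by rewrite (@eq_Ex _ _ _ P _ X) // => w; rewrite expr1.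
have Y1 : Ex P (fun w => Y w ^+ 1) = 0.
 by rewrite (@eq_Ex _ _ _ P _ Y) // => w; rewrite expr1.
have [i11 E11] := prod 1 1 isT isT. have [i31 E31] := prod 3 1 isT isT.
have [i22 E22] := prod 2 2 isT isT. have [i13 E13] := prod 1 3 isT isT. split.
 rewrite (@eq_Ex _ _ _ P _ (fun w => X w ^+ 2 + (2 * (X w ^+ 1 * Y w ^+ 1) + Y w ^+ 2))).
  have i1 := igrZ 2 i11; have iY2 := pY 2 isT.
  by rewrite (ExD (pX 2 isT) (igrD i1 iY2)) (ExD i1 iY2) ExZ // E11 X1; ring.
 by move=> w; ring.
rewrite (@eq_Ex _ _ _ P _ (fun w => X w ^+ 4 + (4 * (X w ^+ 3 * Y w ^+ 1) +
  (6 * (X w ^+ 2 * Y w ^+ 2) + (4 * (X w ^+ 1 * Y w ^+ 3) + Y w ^+ 4))))).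
 have j1 := igrZ 4 i31; have j2 := igrZ 6 i22; have j3 := igrZ 4 i13.
 have j4 := igrD j3 iY; have j5 := igrD j2 j4.
 rewrite (ExD iX (igrD j1 j5)) (ExD j1 j5) (ExD j2 j4) (ExD j3 iY).
 by rewrite !ExZ // E31 E22 E13 X1 Y1; ring.
by move=> w; ring.
Qed.

End powers.

(** * Events of probability tending to one *)

Section whp.
Context {R : realType} {d : measure_display} {Om : measurableType d}.
Variable P : probability Om R.
Implicit Types E F : nat -> set Om.

(* The sets [E N] need not be measurable, whence the inner approximation. *)
Definition whp E := forall e : R, 0 < e -> exists N0, forall N, (N0 <= N)%N ->
 exists A, [/\ measurable A, A `<=` E N & 1 - e <= Pr P A].

Lemma whp_sub E F : (exists N0, forall N, (N0 <= N)%N -> E N `<=` F N) -> whp E -> whp F.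
Proof.
move=> [N0 EF] wE e e0; have [N1 h] := wE e e0; exists (maxn N0 N1) => N.
rewrite geq_max => /andP[N0N N1N]; have [A [mA AE le]] := h N N1N.
by exists A; split=> //; apply: (subset_trans AE); exact: EF.
Qed.

Lemma whpI E F : whp E -> whp F -> whp (fun N => E N `&` F N).
Proof.
move=> wE wF e e0; have e20 : 0 < e / 2 by rewrite divr_gt0.
have [N1 h1] := wE _ e20; have [N2 h2] := wF _ e20.
exists (maxn N1 N2) => N; rewrite geq_max => /andP[N1N N2N].
have [A [mA AE le1]] := h1 N N1N; have [B [mB BF le2]] := h2 N N2N.
exists (A `&` B); split; [exact: measurableI|by move=> w [/AE ? /BF]|].
have := PrU P (measurableC mA) (measurableC mB). rewrite -setCI !PrC //; first by lra. exact: measurableI.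
Qed.

Lemma whpT : whp (fun _ => setT).
Proof.
move=> e e0; exists 0%N => N _; exists setT; split=> //. by rewrite /Pr probability_setT /=; lra.
Qed.

Lemma whp_fin (m : nat) (E : nat -> nat -> set Om) : (forall k, (k < m)%N -> whp (E k)) ->
 whp (fun N => [set w | forall k, (k < m)%N -> E k N w]).
Proof.
elim: m => [|m IH] h; first by apply: whp_sub whpT; exists 0%N => N _ w.
have h1 : whp (fun N => [set w | forall k, (k < m)%N -> E k N w]).
 by apply: IH => k km; apply: h; exact: ltnW.
apply: whp_sub (whpI h1 (h m (ltnSn m))); exists 0%N => N _ w [a b] k.
by rewrite ltnS leq_eqVlt => /orP[/eqP->|/a].
Qed.

Lemma whp_rate E (C : R) : (forall N, (0 < N)%N -> exists A, [/\ measurable A, A `<=` E N &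
   1 - C / N%:R <= Pr P A]) -> whp E.
Proof.
move=> h e e0. exists (Num.truncn (`|C| / e)).+1 => N leN. have N0 : (0 < N)%N by apply: leq_trans leN.
have [A [mA AE le]] := h N N0; exists A; split=> //; apply: le_trans le.
rewrite lerD2l lerN2 ler_pdivrMr ?ltr0n //. apply: (le_trans (ler_norm C)); rewrite mulrC -ler_pdivrMr //.
have t : `|C| / e < (Num.truncn (`|C| / e)).+1%:R by exact: truncnS_gt.
by apply: (le_trans (ltW t)); rewrite ler_nat.
Qed.

End whp.

(** * Dyadic chaining with fourth moments *)

Section chaining.
Context {R : realType}.

Lemma cauchy_sum (r c : nat -> R) m : (forall n, 0 < r n) ->
 (\sum_(n < m) r n * c n) ^+ 2 <= (\sum_(n < m) r n) * \sum_(n < m) r n * c n ^+ 2.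
Proof.
move=> r0; elim: m => [|m IH]; first by rewrite !big_ord0 expr0n mul0r. rewrite !big_ord_recr /=.
set S := \sum_(n < m) r n * c n in IH *; set A := \sum_(n < m) r n in IH *.
set T := \sum_(n < m) r n * c n ^+ 2 in IH *. have A0 : 0 <= A by apply: sumr_ge0 => n _; exact: ltW.
have T0 : 0 <= T by apply: sumr_ge0 => n _; rewrite mulr_ge0 ?sqr_ge0 // ltW.
have := r0 m; move: (r m) (c m) => x y x0. suff : 2 * S * y <= T + A * y ^+ 2 by nra.
have [A00|An] := eqVneq A 0.
 have S0 : S = 0.
  by apply/eqP; rewrite -sqrf_eq0 eq_le sqr_ge0 andbT; move: IH; rewrite A00 mul0r.
 by rewrite S0 A00; lra.
have Ap : 0 < A by rewrite lt_neqAle eq_sym An. rewrite -(ler_pM2l Ap).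
by have := sqr_ge0 (S - A * y); nra.
Qed.

Definition grid (a h : R) (n k : nat) := a + k%:R * (h / 2 ^+ n).

Lemma grid_double a h n k : grid a h n.+1 (2 * k) = grid a h n k.
Proof.
rewrite /grid natrM exprS invfM; congr (_ + _). have n0 : 2 ^+ n != 0 :> R by rewrite expf_neq0. by field.
Qed.

Definition incr4 (f : R -> R) a h n := \sum_(k < 2 ^ n) (f (grid a h n k.+1) - f (grid a h n k)) ^+ 4.

Lemma incr4_ge0 f a h n : 0 <= incr4 f a h n.
Proof. by apply: sumr_ge0 => k _; exact: pow4_ge0. Qed.

Definition root4 (x : R) := Num.sqrt (Num.sqrt x).

Lemma root4_ge0 x : 0 <= root4 x.
Proof. exact: sqrtr_ge0. Qed.

Lemma root4E x : 0 <= x -> root4 x ^+ 4 = x.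
Proof. by move=> x0; rewrite (_ : 4%N = (2 * 2)%N) // exprM !sqr_sqrtr // sqrtr_ge0. Qed.

Lemma le_root4 (x y : R) : x ^+ 4 <= y -> `|x| <= root4 y.
Proof.
move=> xy; have y0 : 0 <= y by apply: le_trans xy; exact: pow4_ge0.
rewrite -(@ler_pXn2r _ 4) ?nnegrE ?sqrtr_ge0 // root4E //. by rewrite -normrX ger0_norm // pow4_ge0.
Qed.

(** A dyadic point of level m is at most one grid step away from a point of the coarser level, and a
    step costs at most the l^4 norm of all increments of its level. *)
Lemma chain_sum f a h m j : (j <= 2 ^ m)%N ->
 `|f (grid a h m j) - f a| <= \sum_(n < m.+1) root4 (incr4 f a h n).
Proof.
have step n k : (k < 2 ^ n)%N -> `|f (grid a h n k.+1) - f (grid a h n k)| <= root4 (incr4 f a h n).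
 move=> kn; apply: le_root4; rewrite /incr4 (bigD1 (Ordinal kn)) //= lerDl.
 by apply: sumr_ge0 => i _; exact: pow4_ge0.
have g0 : grid a h 0 0 = a by rewrite /grid mul0r addr0. elim: m j => [|m IH] j.
 case: j => [|[|//]] _; rewrite big_ord_recr big_ord0 /= add0r.
  by rewrite g0 subrr normr0 sqrtr_ge0.
 by rewrite -[X in _ - f X]g0; exact: step.
rewrite big_ord_recr /= => jm. have je := odd_double_half j; rewrite -muln2 mulnC in je.
have jm2 : (j./2 <= 2 ^ m)%N.
 by move: jm; rewrite expnS -je; case: (odd j); lia.
case: (boolP (odd j)) je => [_|_] /=; last first.
 rewrite add0n => <-; rewrite grid_double. by apply: (le_trans (IH _ jm2)); rewrite lerDl sqrtr_ge0.
rewrite add1n => je. have jm3 : (j./2 * 2 < 2 ^ m.+1)%N by rewrite mulnC je. rewrite -je.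
have -> : f (grid a h m.+1 (2 * j./2).+1) - f a =
  (f (grid a h m.+1 (2 * j./2).+1) - f (grid a h m.+1 (2 * j./2))) +
  (f (grid a h m j./2) - f a) by rewrite grid_double; lra.
rewrite [leRHS]addrC; apply: (le_trans (ler_normD _ _)); apply: lerD; last exact: IH.
by apply: step; rewrite mulnC.
Qed.

(** Two weighted Cauchy-Schwarz inequalities with weights r n = (9/10)^n, whose sum is at most 10:
    the fourth power of the sum costs 10^3, and r^-3 leaves the factor (1000/729)^n. This factor
    stays below 2^n, the rate at which the mean of [incr4] decays. *)
Lemma chain_bound f a h m j : (j <= 2 ^ m)%N -> (f (grid a h m j) - f a) ^+ 4 <=
 1000 * \sum_(n < m.+1) (1000 / 729) ^+ n * incr4 f a h n.
Proof.
move=> jm; set c := fun n => root4 (incr4 f a h n). pose r n : R := (9 / 10) ^+ n.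
have r0 n : 0 < r n by apply: exprn_gt0; lra.
have c4 n : c n ^+ 4 = incr4 f a h n by rewrite root4E // incr4_ge0. have rs : \sum_(n < m.+1) r n <= 10.
 suff h' k : \sum_(n < k) r n = 10 * (1 - r k) by rewrite h'; have := r0 m.+1; lra.
 elim: k => [|k IH]; first by rewrite big_ord0 /r expr0; lra.
 by rewrite big_ord_recr /= IH /r exprS; lra.
have rs0 : 0 <= \sum_(n < m.+1) r n by apply: sumr_ge0 => n _; exact: ltW.
have := chain_sum f a h jm; rewrite -/c => hs.
have e1 : \sum_(n < m.+1) c n = \sum_(n < m.+1) r n * (c n / r n).
 by apply: eq_bigr => n _; rewrite mulrC mulfVK // gt_eqF.
have h1 := cauchy_sum (fun n => c n / r n) m.+1 r0.
have h2 := cauchy_sum (fun n => (c n / r n) ^+ 2) m.+1 r0. rewrite -e1 in h1.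
set S := \sum_(n < m.+1) c n in hs h1. set A := \sum_(n < m.+1) r n in rs rs0 h1 h2.
set Q := \sum_(n < m.+1) r n * (c n / r n) ^+ 2 in h1 h2.
have e2 : \sum_(n < m.+1) r n * ((c n / r n) ^+ 2) ^+ 2 =
  \sum_(n < m.+1) (1000 / 729) ^+ n * incr4 f a h n.
 apply: eq_bigr => n _; rewrite -exprM -c4 expr_div_n. have rn : r n != 0 by rewrite gt_eqF.
 have -> : (1000 / 729 : R) ^+ n = (r n ^+ 3)^-1.
  rewrite /r -exprM mulnC exprM -exprVn; congr (_ ^+ n). by field.
 by field.
rewrite e2 in h2; set V := \sum_(n < m.+1) _ in h2 *.
have S0 : 0 <= S by apply: sumr_ge0 => n _; exact: sqrtr_ge0.
have Q0 : 0 <= Q by apply: sumr_ge0 => n _; rewrite mulr_ge0 ?sqr_ge0 // ltW. have V0 : 0 <= V.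
 by apply: sumr_ge0 => n _; apply: mulr_ge0; [apply: exprn_ge0; lra|exact: incr4_ge0].
have x4 : (f (grid a h m j) - f a) ^+ 4 <= S ^+ 4.
 by rewrite -(ger0_norm (pow4_ge0 (f (grid a h m j) - f a))) normrX ler_pXn2r // nnegrE.
apply: (le_trans x4). have -> : S ^+ 4 = (S ^+ 2) ^+ 2 by rewrite -exprM.
have AQ : S ^+ 2 <= 10 * Q by apply: (le_trans h1); exact: ler_wpM2r.
have AV : Q ^+ 2 <= 10 * V by apply: (le_trans h2); exact: ler_wpM2r.
have := sqr_ge0 S; move: (S ^+ 2) AQ => s AQ s0.
have : s ^+ 2 <= (10 * Q) ^+ 2 by rewrite ler_pXn2r // nnegrE mulr_ge0. by rewrite exprMn; lra.
Qed.

(** Replacing s by [maxr a s] hides the times before a from the running supremum. *)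
Definition osc4 (f : R -> R) a h := runsup (fun s => (f (maxr a s) - f a) ^+ 4) (a + h).

End chaining.

Section fatou_bound.
Context {R : realType} {d : measure_display} {Om : measurableType d}.
Variable P : probability Om R.

(** Fatou's lemma, with g <= liminf F m spelled out through the levels c below g. *)
Lemma fatou_bound (F : nat -> Om -> R) (g : Om -> R) (C : R) :
 (forall n, igr P (F n)) -> (forall n w, 0 <= F n w) -> (forall n, Ex P (F n) <= C) ->
 mfn g -> (forall w, 0 <= g w) ->
 (forall w c, c < g w -> exists m0, forall m, (m0 <= m)%N -> c <= F m w) ->
 igr P g /\ Ex P g <= C.
Proof.
move=> iF F0 FC mg g0 gF. have mF n : measurable_fun setT (fun w => (F n w)%:E).
 by apply/measurable_EFinP; exact: igr_mfn (iF n).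
have le : (\int[P]_w (g w)%:E <= C%:E)%E.
 have einf (u : (\bar R)^nat) : limn_einf u = ereal_sup (range (einfs u)).
  by rewrite limn_einf_lim; apply/cvg_lim => //; exact: cvg_einfs_sup.
 apply: (@le_trans _ _ (\int[P]_w limn_einf (fun n => (F n w)%:E)))%E.
  apply: ge0_le_integral_any => w _; first by rewrite lee_fin. rewrite einf; apply/lee_subgt0Pr => e e0.
  have [|m0 Hm] := gF w (g w - e); first by rewrite ltrBlDr ltrDl.
  rewrite -EFinB; apply: (@le_trans _ _ (einfs (fun n => (F n w)%:E) m0)).
   by apply: le_ereal_inf_tmp => _ [m /= m0m <-]; rewrite lee_fin; exact: Hm.
  by apply: ereal_sup_ubound; exists m0.
 apply: (le_trans (fatou P measurableT mF _)).
  by move=> n w _; rewrite lee_fin.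
 rewrite einf; apply: ge_ereal_sup => _ [n _ <-]. apply: (@le_trans _ _ (\int[P]_w (F n w)%:E))%E.
  by apply: ereal_inf_lbound; exists n => /=.
 by rewrite -ExE // lee_fin.
have ig : igr P g.
 apply/integrableP; split; first exact/measurable_EFinP.
 under eq_integral do rewrite gee0_abs ?lee_fin //. exact: le_lt_trans le (ltry _).
by split=> //; rewrite -lee_fin ExE.
Qed.

End fatou_bound.

Section continuous_oscillation.
Context {R : realType}.
Implicit Types f : R -> R.

Lemma cpathM f g : cpath f -> cpath g -> cpath (fun t => f t * g t).
Proof.
move=> [cf ff] [cg fg]; split; first by move=> t; apply: cvgM; [exact: cf|exact: cg].
by move=> t t0; rewrite ff // fg.
Qed.

Lemma cpathX f n : cpath f -> cpath (fun t => f t ^+ n).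
Proof.
move=> cf; elim: n => [|n IH]; first exact: cpath_cst.
have := cpathM cf IH; congr cpath; apply/funext => t; by rewrite exprS.
Qed.

Lemma cpath_max f a : 0 <= a -> cpath f -> cpath (fun s => f (maxr a s)).
Proof.
move=> a0 [cf ff]; split; last first.
 by move=> t t0; rewrite !max_l // (le_trans t0).
move=> t; apply: dist_cts => e e0; have [h h0 H] := cts_dist (cf (maxr a t)) e0.
exists h => // s st; apply: H; apply: le_lt_trans st.
case: (leP a s) => as_; case: (leP a t) => at_; rewrite ?subrr ?normr0 //.
- rewrite !ger0_norm ?subr_ge0 //; [by lra|by apply: le_trans as_; exact: ltW].
- rewrite ler0_norm ?subr_le0 // ler0_norm; [by lra|]. by rewrite subr_le0 (le_trans (ltW as_)).
Qed.

Lemma cpath_osc4_arg f a : 0 <= a -> cpath f -> cpath (fun s => (f (maxr a s) - f a) ^+ 4).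
Proof.
by move=> a0 cf; apply: cpathX; apply: cpathB; [exact: cpath_max|exact: cpath_cst].
Qed.

Lemma osc4_ub f a h s : 0 <= a -> cpath f -> a <= s -> s <= a + h -> (f s - f a) ^+ 4 <= osc4 f a h.
Proof.
move=> a0 cf as_ sh. have := runsup_ub (cpath_ubd (a + h) (cpath_osc4_arg a0 cf)) sh. by rewrite max_r.
Qed.

Lemma osc4_ge0 f a h : 0 <= a -> cpath f -> 0 <= osc4 f a h.
Proof. by move=> a0 cf; apply: runsup_ge0; exact: cpath_ubd (cpath_osc4_arg a0 cf). Qed.

Lemma osc4_le f a h c : 0 <= c ->
 (forall s, a <= s -> s <= a + h -> (f s - f a) ^+ 4 <= c) -> 0 <= h -> osc4 f a h <= c.
Proof.
move=> c0 H h0; apply: runsup_le => // s sh. case: (leP a s) => as_; first exact: H.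
by rewrite subrr expr0n.
Qed.

Lemma mfn_osc4 d (Om : measurableType d) (f : Om -> R -> R) a h : 0 <= a ->
 (forall s, mfn (fun w => f w s)) -> (forall w, cpath (f w)) ->
 mfn (fun w => osc4 (f w) a h).
Proof.
move=> a0 mf cf; apply: mfn_runsup.
- move=> s _; apply: measurable_funX; apply: measurable_funB; exact: mf.
- by move=> w; exact: cpath_ubd (cpath_osc4_arg a0 (cf w)).
- move=> w s _ e e0; have [cg _] := cpath_osc4_arg a0 (cf w).
 have [k k0 H] := cts_dist (cg s) e0; exists k => // r sr rk.
 have := H r; rewrite ger0_norm ?subr_ge0 // ltrBlDl => /(_ rk). by rewrite ltr_distl => /andP[].
Qed.

(** By continuity a time with a large deviation can be moved to a nearby grid point, where
    [chain_bound] applies; the bound increases in m, so it holds for all later m. *)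
Lemma osc4_approx f a h c : 0 <= a -> 0 < h -> cpath f -> c < osc4 f a h ->
 exists m0, forall m, (m0 <= m)%N ->
 c <= 1000 * \sum_(n < m.+1) (1000 / 729) ^+ n * incr4 f a h n.
Proof.
move=> a0 h0 cf cosc; apply: contrapT => H.
pose F m := 1000 * \sum_(n < m.+1) (1000 / 729) ^+ n * incr4 f a h n.
have t0 n : 0 <= (1000 / 729) ^+ n * incr4 f a h n.
 by apply: mulr_ge0; [apply: exprn_ge0; lra|exact: incr4_ge0].
have F0 m : 0 <= F m.
 by apply: mulr_ge0; [lra|apply: sumr_ge0 => n _; exact: t0].
have FS m : F m <= F m.+1.
 by rewrite /F [\sum_(n < m.+2) _]big_ord_recr /= mulrDr lerDl; apply: mulr_ge0; [lra|].
have Fm : {homo F : m n / (m <= n)%N >-> m <= n}.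
 by apply: homo_leq => //; exact: le_trans.
have Fc m : F m < c.
 rewrite ltNge; apply/negP => cF; apply: H; exists m => m' mm'. exact: le_trans cF (Fm _ _ mm').
have c0 : 0 <= c by apply: le_trans (F0 0%N) (ltW (Fc 0%N)). suff : osc4 f a h <= c by rewrite leNgt cosc.
apply: osc4_le => //; last exact: ltW. move=> s as_ sh; rewrite leNgt; apply/negP => cs.
have [cg _] := cpathX 4 (cpathB cf (cpath_cst (f a))).
have e0 : 0 < (f s - f a) ^+ 4 - c by rewrite subr_gt0. have [k k0 Hk] := cts_dist (cg s) e0.
have [m mk] : exists m, h / 2 ^+ m < k.
 have kh : 0 < k / (2 * h) by rewrite divr_gt0 // mulr_gt0.
 have [m _ /(_ m (leqnn m))] := dy_small kh; rewrite /dy => hm; exists m.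
 rewrite mulrC; apply: (@le_lt_trans _ _ (k / (2 * h) * h)); first by rewrite ler_pM2r.
 by rewrite invfM mulrA mulfVK ?gt_eqF //; lra.
have hm0 : 0 < h / 2 ^+ m by rewrite divr_gt0 // exprn_gt0. pose j := Num.truncn ((s - a) / (h / 2 ^+ m)).
have x0 : 0 <= (s - a) / (h / 2 ^+ m) by rewrite divr_ge0 ?subr_ge0 // ltW.
have [jle jlt] : j%:R * (h / 2 ^+ m) <= s - a /\ s - a < j.+1%:R * (h / 2 ^+ m).
 by rewrite -ler_pdivlMr // -ltr_pdivrMr //; have /andP[] := truncn_itv x0.
have jm : (j <= 2 ^ m)%N.
 rewrite -(ler_nat R) natrX -(ler_pM2r hm0) (le_trans jle) //.
 by rewrite mulrCA divff ?mulr1 ?expf_neq0 //; lra.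
have := Hk (grid a h m j). have -> : `|grid a h m j - s| < k.
 rewrite /grid ltr_distl; move: jlt; rewrite -natr1 mulrDl mul1r.
 by move: (h / 2 ^+ m) (j%:R * _) mk jle => q p mk jle; lra.
move=> /(_ isT); rewrite ltr_distl => /andP[lt _]. have := chain_bound f a h jm; rewrite -/(F m) => le.
by have := lt_le_trans lt le; have := Fc m; lra.
Qed.

End continuous_oscillation.

Section chaining_expectation.
Context {R : realType} {d : measure_display} {Om : measurableType d}.
Variable P : probability Om R.

(** Kolmogorov's criterion: level n has mean at most K h^2 / 2^n against the weight (1000/729)^n,
    and the series of (500/729)^n has sum 729/229 < 4, whence 4000. *)
Lemma chaining (f : Om -> R -> R) (a h K : R) : 0 <= a -> 0 < h -> 0 <= K ->
 (forall s, mfn (fun w => f w s)) -> (forall w, cpath (f w)) ->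
 (forall s t, a <= s -> s <= t -> t <= a + h ->
   igr P (fun w => (f w t - f w s) ^+ 4) /\ Ex P (fun w => (f w t - f w s) ^+ 4) <= K * (t - s) ^+ 2) ->
 igr P (fun w => osc4 (f w) a h) /\ Ex P (fun w => osc4 (f w) a h) <= 4000 * K * h ^+ 2.
Proof.
move=> a0 h0 K0 mf cf H. have G n k : (k < 2 ^ n)%N ->
  igr P (fun w => (f w (grid a h n k.+1) - f w (grid a h n k)) ^+ 4) /\ Ex P (fun w => (f w (grid a h n k.+1) - f w (grid a h n k)) ^+ 4) <=
   K * (h / 2 ^+ n) ^+ 2.
 move=> kn; have hn : 0 < h / 2 ^+ n by rewrite divr_gt0 // exprn_gt0.
 have [|||i E] := H (grid a h n k) (grid a h n k.+1).
 - by rewrite /grid lerDl mulr_ge0 // ltW.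
 - by rewrite /grid lerD2l ler_wpM2r ?ltW // ltr_nat.
 - rewrite /grid lerD2l; apply: (@le_trans _ _ ((2 ^ n)%:R * (h / 2 ^+ n))).
   by rewrite ler_wpM2r ?(ltW hn) // ler_nat.
  by rewrite natrX mulrCA divff ?mulr1 // expf_neq0.
 split=> //; apply: (le_trans E); rewrite /grid -natr1.
 by rewrite le_eqVlt; apply/orP; left; apply/eqP; congr (_ * _ ^+ 2); lra.
have iI n : igr P (fun w => incr4 (f w) a h n).
 rewrite /incr4; have := @igr_sum _ _ _ P 'I_(2 ^ n) (index_enum _).
 apply=> k; by have [] := G n k (ltn_ord k).
have EI n : Ex P (fun w => incr4 (f w) a h n) <= K * h ^+ 2 / 2 ^+ n.
 rewrite (@Ex_sum _ _ _ P 'I_(2 ^ n) (index_enum _) (fun k w => (f w (grid a h n k.+1) - f w (grid a h n k)) ^+ 4)); last first.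
  by move=> k; have [] := G n k (ltn_ord k).
 apply: (@le_trans _ _ (\sum_(k < 2 ^ n) K * (h / 2 ^+ n) ^+ 2)).
  by apply: ler_sum => k _; have [] := G n k (ltn_ord k).
 rewrite sumr_const card_ord -[leLHS]mulr_natl natrX. have n0 : 2 ^+ n != 0 :> R by rewrite expf_neq0.
 by rewrite le_eqVlt; apply/orP; left; apply/eqP; field.
apply: (@fatou_bound _ _ _ P (fun m w => 1000 * \sum_(n < m.+1) (1000 / 729) ^+ n * incr4 (f w) a h n)).
- move=> m; apply: igrZ; apply: igr_sum => n; exact: igrZ.
- move=> m w; apply: mulr_ge0; first by lra.
 by apply: sumr_ge0 => n _; apply: mulr_ge0; [apply: exprn_ge0; lra|exact: incr4_ge0].
- move=> m; rewrite ExZ; last by apply: igr_sum => n; exact: igrZ.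
 rewrite Ex_sum; last by move=> n; exact: igrZ.
 have -> : 4000 * K * h ^+ 2 = 1000 * (4 * (K * h ^+ 2)) by ring. apply: ler_wpM2l; first by lra.
 have Q0 : 0 <= K * h ^+ 2 by rewrite mulr_ge0 // sqr_ge0.
 apply: (@le_trans _ _ (\sum_(n < m.+1) (500 / 729) ^+ n * (K * h ^+ 2))).
  apply: ler_sum => n _; rewrite ExZ //.
  apply: (@le_trans _ _ ((1000 / 729) ^+ n * (K * h ^+ 2 / 2 ^+ n))).
   by apply: ler_wpM2l; [apply: exprn_ge0; lra|exact: EI].
  rewrite mulrCA mulrC -expr_div_n. by have -> : (1000 / 729 / 2 : R) = 500 / 729 by lra.
 rewrite -mulr_suml; apply: ler_wpM2r => //.
 suff h' k : \sum_(n < k) (500 / 729 : R) ^+ n = 729 / 229 * (1 - (500 / 729) ^+ k).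
  rewrite h'; have : 0 <= (500 / 729 : R) ^+ m.+1 by apply: exprn_ge0; lra. by lra.
 elim: k => [|k IH]; first by rewrite big_ord0 expr0; lra. by rewrite big_ord_recr /= IH exprS; lra.
- exact: mfn_osc4.
- by move=> w; exact: osc4_ge0.
- by move=> w c; exact: osc4_approx.
Qed.

End chaining_expectation.

Section integrals_up_to_null_sets.
Context {R : realType} {d : measure_display} {Om : measurableType d}.
Variable mu : {measure set Om -> \bar R}.
Import HBNNSimple.

(** The local times in [mv_solution] are bare functions of w, so their expectations are compared
    without measurability: a simple function below f is cut off on the exceptional null set and then
    lies below g. *)
Lemma ge0_ae_le_integral_any (f g : Om -> \bar R) : (forall w, 0 <= f w)%E -> (forall w, 0 <= g w)%E ->
 {ae mu, forall w, (f w <= g w)%E} -> (\int[mu]_w f w <= \int[mu]_w g w)%E.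
Proof.
move=> f0 g0 [N [mN N0 sN]]. rewrite [leLHS]ge0_integralTE //; apply: ge_ereal_sup => _ [h /= hf <-].
rewrite -integralT_nnsfun. have mh : measurable_fun setT (fun w => (h w)%:E) by apply/measurable_EFinP.
rewrite (ae_eq_integral (fun w => (h w * \1_(~` N) w)%:E)) //; last 2 first.
- apply/measurable_EFinP; apply: measurable_funM => //. by apply: measurable_indic; exact: measurableC.
- exists N; split=> // w /= H; apply: contrapT => wN; apply: H => _. by rewrite indicE mem_set // mulr1.
apply: ge0_le_integral_any => w _; rewrite indicE.
 by rewrite lee_fin mulr_ge0.
case: (boolP (w \in ~` N)); rewrite ?mulr0 ?mulr1 // inE => wN.
apply: (le_trans (hf w)); apply: contrapT => H; apply: wN; exact: sN.
Qed.

Lemma ae_eq_integral_any (f g : Om -> \bar R) :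
 {ae mu, forall w, f w = g w} -> (\int[mu]_w f w = \int[mu]_w g w)%E.
Proof.
move=> fg; rewrite [LHS]integralE [RHS]integralE; congr (_ - _)%E; apply/eqP;
 rewrite eq_le; apply/andP; split; apply: ge0_ae_le_integral_any => [w|w|];
 rewrite ?funepos_ge0 ?funeneg_ge0 //; apply: filterS fg => w h;
 by rewrite ?funeposE ?funenegE h.
Qed.

Lemma ae_le_integral_any (f g : Om -> \bar R) :
 {ae mu, forall w, (f w <= g w)%E} -> (\int[mu]_w f w <= \int[mu]_w g w)%E.
Proof.
move=> fg; rewrite [leLHS]integralE [leRHS]integralE; apply: leeB;
 apply: ge0_ae_le_integral_any => [w|w|];
 rewrite ?funepos_ge0 ?funeneg_ge0 //; apply: filterS fg => w h.
- by rewrite !funeposE ge_max !le_max h lexx orbT.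
- by rewrite !funenegE ge_max !le_max leeN2 h lexx orbT.
Qed.

End integrals_up_to_null_sets.

(** The constant 4000 of [chaining] times the 128 of [incr_moment4], locked so that it stays an atom
    for arithmetic tactics. *)
Definition osc_cst (R : realType)  : R := locked (4000 * 128).

Lemma osc_cst_gt0 (R : realType) : 0 < osc_cst R.
Proof. by rewrite /osc_cst -lock; lra. Qed.

(** * The mean-field equation for one particle *)

Section one_particle.
Context {R : realType} {d : measure_display} {Om : measurableType d}.
Variable P : probability Om R.
Variables (alpha : R) (xi : {RV P >-> R}) (W : R -> {RV P >-> R}).
Hypothesis alpha0 : 0 <= alpha.
Hypothesis xi_ge0 : forall w, 0 <= xi w.
Hypothesis BW : brownian W.
Hypothesis indep : independent P (sigma_of [set: unit] (fun _ => xi : Om -> R))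
 (sigma_of [set t | 0 <= t] (fun t => W t : Om -> R)).
Let z := zpath xi BW.

Section brownian_bounds.
Implicit Types (a h s t : R) (A : set Om).

Lemma gauss_incr s t : 0 <= s -> s < t -> gauss P (Num.sqrt (t - s)) (fun w => W t w - W s w).
Proof.
move=> s0 st; split; first by rewrite sqrtr_gt0 subr_gt0.
 exact: mfn_incr.
by move=> B mB; case: BW => _ _ H _; exact: H.
Qed.

Lemma incr_moment4 s t : 0 <= s -> s <= t -> igr P (fun w => (W t w - W s w) ^+ 4) /\
 Ex P (fun w => (W t w - W s w) ^+ 4) <= 128 * (t - s) ^+ 2.
Proof.
move=> s0; rewrite le_eqVlt => /orP[/eqP <-|st].
 have -> : (fun w => (W s w - W s w) ^+ 4) = cst 0.
  by apply/funext => w; rewrite subrr expr0n.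
 by split; [exact: igr_cst|rewrite Ex_cst subrr expr0n mulr0].
have [i E] := gauss_moment4 (gauss_incr s0 st); split=> //; apply: (le_trans E).
by rewrite (_ : 4%N = (2 * 2)%N) // [_ ^+ (2 * 2)]exprM sqr_sqrtr // subr_ge0 ltW.
Qed.

Lemma mfn_z t : mfn (fun w => z w t). Proof. exact: mfn_zpath. Qed.

Lemma cpath_z w : cpath (z w). Proof. exact: cpath_ok. Qed.

(** Chaining for the path 1_A z, whose increments have factorizing moments. For A known at time a,
    this keeps the factor P(A), on which the occupation argument at alpha = 1 relies. *)
Lemma indic_osc4 A a h : measurable A -> 0 <= a -> 0 < h ->
 (forall s t, a <= s -> s < t -> indepRV P (\1_A : Om -> R) (fun w => W t w - W s w)) ->
 igr P (fun w => \1_A w * osc4 (z w) a h) /\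
 Ex P (fun w => \1_A w * osc4 (z w) a h) <= osc_cst R * Pr P A * h ^+ 2.
Proof.
move=> mA a0 h0 ind. have mI : mfn (\1_A : Om -> R) by exact: mfn_indic.
have I01 w : \1_A w = 0 :> R \/ \1_A w = 1 :> R.
 by rewrite indicE; case: (w \in A); [right|left].
have -> : (fun w => \1_A w * osc4 (z w) a h) = (fun w => osc4 (fun s => \1_A w * z w s) a h).
 apply/funext => w; case: (I01 w) => ->.
  rewrite mul0r; apply/esym/eqP; rewrite eq_le osc4_ge0 ?andbT //.
   by apply: osc4_le => //; [move=> s _ _; rewrite !mul0r subrr expr0n|exact: ltW].
  by apply: cpathZ; exact: cpath_z.
 by rewrite mul1r; congr (osc4 _ _ _); apply/funext => s; rewrite mul1r.
have -> : osc_cst R * Pr P A * h ^+ 2 = 4000 * (128 * Pr P A) * h ^+ 2.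
 by rewrite /osc_cst -lock -!mulrA.
have PA0 : 0 <= Pr P A by exact: Pr_ge0. apply: chaining => //.
- exact: mulr_ge0.
- by move=> s; apply: measurable_funM => //; exact: mfn_z.
- by move=> w; apply: cpathZ; exact: cpath_z.
move=> s t as_ st _; have s0 := le_trans a0 as_; have t0 := le_trans s0 st.
have e w : (\1_A w * z w t - \1_A w * z w s) ^+ 4 = \1_A w * (W t w - W s w) ^+ 4.
 rewrite -mulrBr zpath_incr //; case: (I01 w) => ->; first by rewrite !mul0r expr0n. by rewrite !mul1r.
have -> : (fun w => (\1_A w * z w t - \1_A w * z w s) ^+ 4) =
  (fun w => \1_A w * (W t w - W s w) ^+ 4) by apply/funext.
have [i E] := incr_moment4 s0 st. split; first exact: igr_indicM.
move: st; rewrite le_eqVlt => /orP[/eqP st|st].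
 rewrite (@eq_Ex _ _ _ P _ (cst 0)) ?Ex_cst; last first.
  by move=> w; rewrite st subrr expr0n mulr0.
 by rewrite mulr_ge0 ?sqr_ge0 // mulr_ge0.
have pw : measurable_fun setT (fun x : R => x ^+ 4).
 by apply: measurable_funX; exact: measurable_id.
have ind4 := indepRV_fun (ind s t as_ st) (@measurable_id _ _ setT) pw.
have [_ ->] := indep_igrM (igr_indic P mA) i ind4. rewrite Ex_indic // [128 * _]mulrC -mulrA.
exact: ler_wpM2l.
Qed.

Lemma osc4_moment a h : 0 <= a -> 0 < h -> igr P (fun w => osc4 (z w) a h) /\
 Ex P (fun w => osc4 (z w) a h) <= osc_cst R * h ^+ 2.
Proof.
move=> a0 h0; have := indic_osc4 (@measurableT _ Om) a0 h0.
have -> : Pr P setT = 1 by rewrite /Pr probability_setT.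
rewrite mulr1; have -> : (fun w => \1_setT w * osc4 (z w) a h) = (fun w => osc4 (z w) a h).
 by apply/funext => w; rewrite indicE in_setT mul1r.
apply=> s t _ _ B C mB mC. rewrite preimage_indic.
case: ifPn => _; case: ifPn => _; rewrite ?setTI ?probability_setT ?mul1e ?set0I ?measure0 ?mul0e //.
- by rewrite setCT set0I measure0 mul0e.
Qed.

End brownian_bounds.

Section mean_field.
Implicit Types (f g : R -> R) (s t K : R).

Lemma z0_ge0 w : 0 <= z w 0.
Proof. by rewrite zpath0 le_max lexx. Qed.

(** An integrable bound for the deviation of z from its start up to K; it dominates in all limits
    taken under the expectation. *)
Definition zdev K w := root4 (osc4 (z w) 0 K).

Lemma zdev_ge0 K w : 0 <= zdev K w.
Proof. exact: root4_ge0. Qed.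

Lemma zdev_ub K w s : 0 < K -> s <= K -> `|z w s - z w 0| <= zdev K w.
Proof.
move=> K0 sK; apply: le_root4. have [s0|s0] := leP 0 s.
 by apply: osc4_ub => //; [exact: cpath_z|rewrite add0r].
have -> : z w s = z w 0 by have [_ ->] := cpath_z w; rewrite // ltW.
by rewrite subrr expr0n; apply: osc4_ge0 => //; exact: cpath_z.
Qed.

Lemma zdev4 K w : zdev K w ^+ 4 = osc4 (z w) 0 K.
Proof. by rewrite root4E // osc4_ge0 //; exact: cpath_z. Qed.

Lemma mfn_zdev K : mfn (zdev K).
Proof.
have m : mfn (fun w => osc4 (z w) 0 K).
 by apply: mfn_osc4 => //; [exact: mfn_z|exact: cpath_z].
have ms : measurable_fun setT (@Num.sqrt R).
 by apply: continuous_measurable_fun; exact: sqrt_continuous.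
by apply: (measurableT_comp ms); apply: (measurableT_comp ms).
Qed.

Lemma igr_zdev4 K : 0 < K -> igr P (fun w => zdev K w ^+ 4).
Proof.
move=> K0; have [i _] := osc4_moment (lexx 0) K0. by move: i; congr igr; apply/funext => w; rewrite zdev4.
Qed.

Lemma igr_zdev K : 0 < K -> igr P (zdev K).
Proof.
move=> K0; have := igr_pow (mfn_zdev K) (igr_zdev4 K0) (n := 1) isT.
by congr igr; apply/funext => w; rewrite expr1.
Qed.

Lemma phi_bound f K t w : 0 < K -> t <= K -> mono_to f t ->
 phi alpha f (z w) t <= alpha * `|f t| + zdev K w.
Proof.
move=> K0 tK mf; apply: runsup_le.
 by rewrite addr_ge0 ?zdev_ge0 // mulr_ge0.
move=> s st; have := zdev_ub w K0 (le_trans st tK).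
rewrite ler_norml => /andP[h _]; have := z0_ge0 w => h0. have : alpha * f s <= alpha * `|f t|.
 by apply: ler_wpM2l => //; apply: (le_trans (mf s t st _)) => //; exact: ler_norm.
by lra.
Qed.

Lemma mfn_phi_z f t : mono_to f t -> mfn (fun w => phi alpha f (z w) t).
Proof.
move=> mf; apply: mfn_phi => //.
- by move=> s _; exact: measurable_cst.
- by move=> s _; exact: mfn_z.
- by move=> w; exact: cpath_z.
Qed.

Lemma mfn_refl_z f t : mono_to f t -> mfn (fun w => refl alpha f (z w) t).
Proof.
move=> mf; apply: mfn_refl => //.
- by move=> s _; exact: measurable_cst.
- by move=> s _; exact: mfn_z.
- by move=> w; exact: cpath_z.
Qed.

Lemma phi_z_ge0 f t w : mono_to f t -> 0 <= phi alpha f (z w) t.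
Proof. by move=> mf; apply: phi_ge0 => //; exact: cpath_z. Qed.

Lemma igr_phi4 f t : mono_to f t -> igr P (fun w => phi alpha f (z w) t ^+ 4).
Proof.
move=> mf; pose K := maxr 0 t + 1. have K0 : 0 < K by rewrite ltr_wpDl // le_max lexx.
have tK : t <= K by rewrite ler_wpDr // le_max lexx orbT. pose c := alpha * `|f t|.
have i := igr_pow4D (measurable_cst c) (mfn_zdev K) (igr_cst P (c ^+ 4)) (igr_zdev4 K0).
apply: (igr_dom _ i); first by apply: measurable_funX; exact: mfn_phi_z.
move=> w; rewrite normrX (ger0_norm (phi_z_ge0 w mf)).
apply: lerXn2r; rewrite ?nnegrE ?phi_z_ge0 // ?phi_bound //. by rewrite addr_ge0 ?zdev_ge0 // mulr_ge0.
Qed.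

Lemma igr_phi f t : mono_to f t -> igr P (fun w => phi alpha f (z w) t).
Proof.
move=> mf; have := igr_pow (mfn_phi_z mf) (igr_phi4 mf) (n := 1) isT.
by congr igr; apply/funext => w; rewrite expr1.
Qed.

Definition Gam f t := Ex P (fun w => phi alpha f (z w) t).

Lemma Gam_ge0 f t : mono_to f t -> 0 <= Gam f t.
Proof. by move=> mf; apply: Ex_ge0 => w; exact: phi_z_ge0. Qed.

Lemma Gam_mono f t : mono_to f t -> mono_to (Gam f) t.
Proof.
move=> mf r s rs st; have ms := mono_to_le st mf.
apply: Ex_le; [exact: igr_phi (mono_to_le rs ms)|exact: igr_phi|move=> w].
by apply: phi_mono => //; exact: cpath_z.
Qed.

Lemma Gam_le f g t : mono_to f t -> mono_to g t -> (forall s, s <= t -> f s <= g s) -> Gam f t <= Gam g t.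
Proof.
move=> mf mg fg; apply: Ex_le; [exact: igr_phi|exact: igr_phi|move=> w].
by apply: phi_le => //; exact: cpath_z.
Qed.

Lemma eq_Gam f g t : (forall s, s <= t -> f s = g s) -> Gam f t = Gam g t.
Proof. by move=> fg; apply: eq_Ex => w; exact: eq_phi. Qed.

Definition fixed_to f t := mono_to f t /\ forall s, s <= t -> f s = Gam f s.

Lemma fixed_to_le f s t : s <= t -> fixed_to f t -> fixed_to f s.
Proof.
move=> st [mf h]; split; first exact: mono_to_le mf. by move=> r rs; apply: h; exact: le_trans st.
Qed.

Lemma fixed_ge0 f t : fixed_to f t -> 0 <= f t.
Proof. by move=> [mf ->] //; exact: Gam_ge0. Qed.

Definition past t := sigma_of [set: unit] (fun _ => xi : Om -> R) `|`
 sigma_of [set r | 0 <= r <= t] (fun r => W r : Om -> R).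

Lemma mfn_z_past s t : 0 <= t -> s <= t -> mfn (fun w : g_sigma_algebraType (past t) => z w s).
Proof.
move=> t0 st; apply: measurable_funD.
 apply: measurable_maxr; first exact: measurable_cst.
 apply: (@mfn_sigma_of _ _ _ _ setT (fun _ : unit => xi : Om -> R) _ tt) => //.
 by move=> X BX; apply: sub_sigma_algebra; left.
apply: (@mfn_sigma_of _ _ _ _ [set r | 0 <= r <= t] (fun r => W r : Om -> R)).
 by rewrite /= le_max lexx ge_max t0.
by move=> X BX; apply: sub_sigma_algebra; right.
Qed.

Lemma past_future A t a b : 0 <= t -> t <= a -> a < b -> <<s past t >> A ->
 indepRV P (\1_A : Om -> R) (fun w => W b w - W a w).
Proof.
move=> t0 ta ab pA; have a0 := le_trans t0 ta.
apply: (indepRV_sigma (F := past a) (G := sigma_of [set: unit] (fun _ w => W b w - W a w))).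
- apply: (indep_sub (indep_future BW indep a0 ab)) => //.
 by apply: smallest_sub => //; exact: smallest_sigma_algebra.
- apply: (@measurable_indic _ (g_sigma_algebraType (past a)) R setT A).
 apply: (g_sigma_sub _ pA) => X [SX|SX]; first by apply: sub_sigma_algebra; left.
 apply: sub_sigma_algebra; right; apply: g_sigma_sub SX => Y [r /= /andP[r0 rt] BY].
 by apply: sub_sigma_algebra; exists r => //=; rewrite r0 (le_trans rt).
- apply: (@mfn_sigma_of _ _ _ _ [set: unit] (fun _ w => W b w - W a w) _ tt) => //.
Qed.

Lemma past_measurable A t : <<s past t >> A -> measurable A.
Proof.
apply: smallest_sub; first exact: sigma_algebra_measurable.
move=> X [SX|SX]; apply: sigma_of_measurable SX => r _; exact: measurable_funPT.
Qed.

Lemma past_zero_set f t : 0 <= t -> mono_to f t -> <<s past t >> [set w | refl alpha f (z w) t = 0].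
Proof.
move=> t0 mf. have m : mfn (fun w : g_sigma_algebraType (past t) => refl alpha f (z w) t).
 apply: mfn_refl => //.
 - by move=> s _; exact: measurable_cst.
 - by move=> s st; exact: mfn_z_past.
 - by move=> w; exact: cpath_z.
by have := m measurableT [set 0] (measurable_set1 0); rewrite setTI.
Qed.

(* On {X_t = 0} the increment of the local time over [t, s] is at least
  (alpha (f s - f t) - G)^+ with G = W_s - W_t independent of the past. *)
Lemma mean_field_strict f t s : 0 <= t -> t < s -> fixed_to f s ->
 alpha * Pr P [set w | refl alpha f (z w) t = 0] < 1.
Proof.
move=> t0 ts fs; have [mf fE] := fs. have ft := fixed_to_le (ltW ts) fs; have [mft fEt] := ft.
set A := [set w | _]; have pA : <<s past t >> A by exact: past_zero_set. have mA := past_measurable pA.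
have s0 := le_trans t0 (ltW ts). pose G w := W s w - W t w; pose D := f s - f t.
pose h (x : R) := maxr 0 (alpha * D - x). have gG := gauss_incr t0 ts. have mh : measurable_fun setT h.
 apply: measurable_maxr; first exact: measurable_cst.
 by apply: measurable_funB; [exact: measurable_cst|exact: measurable_id].
have iG : igr P G by exact: gauss_igr gG. have EG : Ex P G = 0 by exact: gauss_mean0 gG.
have ic := igr_cst P (alpha * D). have ih : igr P (fun w => h (G w)).
 apply: (igr_dom _ (igr_norm (igrB ic iG))).
  exact: measurableT_comp mh (igr_mfn iG).
 move=> w; rewrite ger0_norm ?le_max ?lexx // ge_max normr_ge0 /=. exact: ler_norm.
pose e := Ex P (fun w => h (G w)). have D0 : 0 <= D by rewrite subr_ge0 mf // ltW.
have aD0 : 0 <= alpha * D by exact: mulr_ge0. have e_gt : alpha * D < e.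
 have iB := igrB ih (igrB ic iG). have : 0 < Ex P (fun w => h (G w) - (cst (alpha * D) w - G w)).
  apply: Ex_gt0 => //.
   by move=> w; rewrite subr_ge0 le_max lexx orbT.
  have := gauss_gt gG (alpha * D). rewrite (_ : [set w | alpha * D < W s w - W t w] =
   [set w | 0 < h (G w) - (cst (alpha * D) w - G w)]) //.
  apply/seteqP; split=> w /=; rewrite /h /G; move: (alpha * D) (W s w - W t w) => p q.
   by case: (leP 0 (p - q)) => h1 h2; lra.
  by case: (leP 0 (p - q)) => h1 h2; lra.
 by rewrite (ExB ih (igrB ic iG)) (ExB ic iG) Ex_cst EG -/e; lra.
have key w : \1_A w * h (G w) <= phi alpha f (z w) s - phi alpha f (z w) t.
 have czw := cpath_z w. have le0 : phi alpha f (z w) t <= phi alpha f (z w) s.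
  by apply: phi_mono => //; exact: ltW.
 rewrite indicE; case: (boolP (w \in A)) => wA; last by rewrite mul0r subr_ge0.
 rewrite mul1r ge_max subr_ge0 le0 /=. have h1 := phi_ub alpha0 mf czw (lexx s).
 have {}wA : refl alpha f (z w) t = 0 by move: wA; rewrite inE.
 have -> : G w = z w s - z w t by rewrite zpath_incr.
 rewrite /refl in wA; rewrite -/z in h1; rewrite /D mulrBr.
 by move: (phi _ _ _ s) (phi _ _ _ t) wA h1 => p q wA h1; lra.
have ind : indepRV P (\1_A : Om -> R) (fun w => h (G w)).
 have := indepRV_fun (past_future t0 (lexx t) ts pA) (@measurable_id _ _ setT) mh. by apply.
have [iM EM] := indep_igrM (igr_indic P mA) ih ind.
have := Ex_le iM (igrB (igr_phi mf) (igr_phi mft)) key.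
rewrite EM Ex_indic // (ExB (igr_phi mf) (igr_phi mft)) -/e.
rewrite -[Ex P (fun w => phi _ _ _ s)]/(Gam f s) -[Ex P (fun w => phi _ _ _ t)]/(Gam f t).
rewrite -fE // -fEt // -/D. have := Pr_ge0 P A; move: (Pr P A) => p p0 pe.
rewrite ltNge; apply/negP => ap.
have p_gt0 : 0 < p by rewrite lt_neqAle p0 andbT; apply: contraTneq ap => <-; rewrite mulr0 lt_geF.
have : p * (alpha * D) < p * e by rewrite ltr_pM2l. by nra.
Qed.

Lemma phi_left_step f y r t : mono_to f t -> cpath y -> r <= t ->
 forall o, (forall u, r < u -> u <= t -> y r - y u <= o) -> 0 <= o ->
 phi alpha f y t <= phi alpha f y r + alpha * (f t - f r) + o.
Proof.
move=> mf cy rt o ho o0. have mr := mono_to_le rt mf.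
have D0 : 0 <= alpha * (f t - f r) by rewrite mulr_ge0 // subr_ge0 mf.
apply: (@runsup_step _ (fun s => alpha * f s - y s) r) => //.
- exact: phi_ubd.
- by rewrite -/(phi alpha f y r); lra.
- move=> u ru ut; have h1 := phi_ub alpha0 mr cy (lexx r).
 have h2 : alpha * f u <= alpha * f t by apply: ler_wpM2l => //; exact: mf. by have := ho u ru ut; lra.
Qed.

Lemma phi_left_flat f y t : mono_to f t -> cpath y -> 0 < refl alpha f y t ->
 exists2 h, 0 < h & forall r, t - h < r -> r <= t -> phi alpha f y t = phi alpha f y r.
Proof.
move=> mf cy X0; have X20 : 0 < refl alpha f y t / 2 by rewrite divr_gt0.
have [cc _] := cy; have [h h0 H] := cts_dist (cc t) X20.
exists h => // r hr rt; apply/eqP; rewrite eq_le (phi_mono alpha0 mf cy rt) andbT.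
have : phi alpha f y t <= maxr (phi alpha f y r) (phi alpha f y t - refl alpha f y t / 2).
 apply: (@runsup_step _ (fun s => alpha * f s - y s) r) => //.
 - exact: phi_ubd.
 - by rewrite le_max lexx.
 move=> u ru ut; rewrite le_max; apply/orP; right.
 have h2 : alpha * f u <= alpha * f t by apply: ler_wpM2l => //; exact: mf.
 have := H u; rewrite ltr_norml ltr_distl => /(_ _)/andP[].
  by apply/andP; split; lra.
 rewrite /refl => a b; set p := phi _ _ _ _ in a b *; lra.
by rewrite le_max => /orP[//|]; lra.
Qed.

(** Let a be the jump of f at t from the left and D the corresponding jump of the regulator. D
    vanishes where X_t > 0 and is at most alpha a where X_t = 0, so a <= alpha P(X_t = 0) a, and the
    strict inequality forces a = 0. *)
Lemma mean_field_left f t s : 0 < t -> t < s -> fixed_to f s ->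
 forall e : R, 0 < e -> exists2 h : R, 0 < h & forall r, t - h < r -> r <= t -> f t - e < f r.
Proof.
move=> t0 ts fs; have strict := mean_field_strict (ltW t0) ts fs.
have ft := fixed_to_le (ltW ts) fs; have [mf fE] := ft.
set A := [set w | _] in strict; have mA : measurable A.
 exact: past_measurable (past_zero_set (ltW t0) mf).
pose u n := t - t * dy n. have ut n : u n < t by rewrite /u ltrBlDr ltrDl mulr_gt0 // dy_gt0.
have uS n : u n <= u n.+1.
 rewrite /u lerD2l lerN2; apply: ler_wpM2l; first exact: ltW.
 rewrite /dy exprS invfM ler_piMl ?invr_ge0 ?exprn_ge0 //; lra.
have mu n : mono_to f (u n) by exact: mono_to_le (ltW (ut n)) mf.
pose F n w := phi alpha f (z w) t - phi alpha f (z w) (u n). have F0 n w : 0 <= F n w.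
 by rewrite subr_ge0; apply: phi_mono => //; [exact: cpath_z|exact: ltW].
have FS n w : F n.+1 w <= F n w.
 by rewrite lerD2l lerN2; apply: phi_mono => //; exact: cpath_z.
have Fni w : nonincreasing_seq (F^~ w).
 by apply/nonincreasing_seqP => n; exact: FS.
have Fcv w : cvgn (F^~ w).
 by apply: nonincreasing_is_cvgn => //; exists 0 => _ [n _ <-].
pose D w := limn (F^~ w). have DF n w : D w <= F n w by apply: nonincreasing_cvgn_ge.
have D0 w : 0 <= D w by apply: limr_ge => //; exact: nearW.
have iF n : igr P (F n) by apply: igrB; exact: igr_phi.
have [iD cD] : igr P D /\ Ex P (F n) @[n --> \oo] --> Ex P D.
 apply: (Ex_dct (fun n => igr_mfn (iF n)) (igr_phi mf)) => [n w|w].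
  rewrite ger0_norm // /F lerBlDr lerDl; exact: phi_z_ge0.
 exact: Fcv.
set a := Ex P D in cD. have a0 : 0 <= a by exact: Ex_ge0. have EF n : Ex P (F n) = f t - f (u n).
 rewrite (ExB (igr_phi mf) (igr_phi (mu n))) [in RHS]fE // [f (u n) in RHS]fE //. exact: ltW.
have near_t (e : R) : 0 < e -> exists n0, forall n, (n0 <= n)%N -> t - e < u n.
 move=> e0; have et : 0 < e / (2 * t) by rewrite divr_gt0 // mulr_gt0.
 have [n0 _ H] := dy_small et; exists n0 => n nn; rewrite /u ltrD2l ltrN2.
 have := H n nn; rewrite ler_pdivlMr ?mulr_gt0 // => h. by rewrite mulrC; nra.
have DA w : D w <= \1_A w * (alpha * a).
 have cz := cpath_z w. rewrite indicE; case: (boolP (w \in A)) => wA; rewrite ?mul1r ?mul0r; last first.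
  have X0 : 0 < refl alpha f (z w) t.
   rewrite lt_neqAle refl_ge0 // andbT eq_sym; apply/eqP => X0. by move/negP: wA; apply; rewrite inE.
  have [h h0 H] := phi_left_flat mf cz X0. have [n0 Hn] := near_t h h0.
  apply: (le_trans (DF n0 w)); rewrite /F (H (u n0)) ?subrr //; first exact: Hn. exact: ltW.
 apply/ler_addgt0Pr => e e0.
 have e3 : 0 < e / (2 * (alpha + 1)) by rewrite divr_gt0 // mulr_gt0 // ltr_wpDl.
 have e4 : 0 < e / 4 by rewrite divr_gt0. have [cc _] := cz; have [h h0 H] := cts_dist (cc t) e4.
 have [n0 Hn] := near_t h h0. have /cvgrPdist_lt /(_ _ e3) [n1 _ Hn1] := cD. pose n := maxn n0 n1.
 have := Hn1 n (leq_maxr _ _); rewrite EF ltr_distlC => /andP[_ h1]. have hn := Hn n (leq_maxl _ _).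
 apply: (le_trans (DF n w)); rewrite /F lerBlDr.
 have osc : (forall v, u n < v -> v <= t -> z w (u n) - z w v <= e / 2).
  move=> v uv vt. have hv : `|v - t| < h by rewrite ltr_norml; apply/andP; split; lra.
  have hu : `|u n - t| < h.
   by have := ut n; rewrite ltr_norml => ?; apply/andP; split; lra.
  have := H v hv; have := H _ hu; rewrite !ltr_distl -/z => /andP[_ a2] /andP[b1 _]. by lra.
 have e20 : 0 <= e / 2 by rewrite divr_ge0 // ltW.
 apply: (le_trans (phi_left_step mf cz (ltW (ut n)) osc e20)).
 have h3 : alpha * (f t - f (u n)) <= alpha * (a + e / (2 * (alpha + 1))).
  by apply: ler_wpM2l => //; exact: ltW.
 have h4 : alpha * (e / (2 * (alpha + 1))) <= e / 2.
  rewrite mulrA ler_pdivrMr ?mulr_gt0 // ?ltr_wpDl //. by have := ltW e0; nra.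
 by rewrite mulrDr in h3; lra.
have iA : igr P (fun w => \1_A w * (alpha * a)).
 exact: (igr_indicM mA (igr_cst P (alpha * a))).
have := Ex_le iD iA DA. have -> : Ex P (fun w => \1_A w * (alpha * a)) = (alpha * a) * Pr P A.
 rewrite -(Ex_indic P mA) -(ExZ _ (igr_indic P mA)). by apply: eq_Ex => w; rewrite mulrC.
rewrite -/a => aa; have a_eq0 : a = 0 by nra. move=> e e0; have /cvgrPdist_lt /(_ _ e0) [n _ Hn] := cD.
have := Hn n (leqnn n); rewrite a_eq0 EF sub0r normrN => /ltr_normlP[_ h].
exists (t * dy n); first by rewrite mulr_gt0 // dy_gt0.
move=> r ur rt; have : f (u n) <= f r by apply: mf => //; exact: ltW. by lra.
Qed.

End mean_field.

Section mean_field_solutions.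
Implicit Types (f g l : R -> R) (s t K : R).

Let cz w : cpath (z w). Proof. exact: cpath_z. Qed.

Let zE w t : z w t = xi w + W (maxr 0 t) w.
Proof. by rewrite /z /= max_r. Qed.

Lemma phi_neg f t w : t <= 0 -> f t = 0 -> mono_to f t -> phi alpha f (z w) t = 0.
Proof.
move=> t0 ft mf; apply/eqP; rewrite eq_le phi_z_ge0 // andbT.
apply: runsup_le => // s st; have zs : z w s = z w 0.
 by have [_ ->] := cz w; rewrite // (le_trans st).
have : alpha * f s <= alpha * f t by apply: ler_wpM2l => //; exact: mf.
by have := z0_ge0 w; rewrite -/z zs ft mulr0; lra.
Qed.

Lemma Gam_neg f t : t <= 0 -> f t = 0 -> mono_to f t -> Gam f t = 0.
Proof.
move=> t0 ft mf; transitivity (Ex P (cst 0)); last exact: Ex_cst. by apply: eq_Ex => w; exact: phi_neg.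
Qed.

Lemma before_le (T : \bar R) s t : 0 <= s -> s <= t -> before T t -> before T s.
Proof. by move=> s0 st [t0 tT]; split=> //; apply: le_lt_trans tT; rewrite lee_fin. Qed.

Definition right_cts f t := forall e : R, 0 < e -> exists2 h : R, 0 < h &
 forall s, t <= s -> s <= t + h -> f s < f t + e.

(** Left continuity comes from [mean_field_left], which uses an increment after the time considered;
    hence the fixed-point property up to some s0 > K. *)
Lemma fixed_cpath f K s0 : 0 <= K -> K < s0 -> fixed_to f s0 ->
 (forall s, s <= 0 -> f s = 0) -> (forall t, 0 <= t -> t <= K -> right_cts f t) ->
 cpath (fun s => f (minr s K)).
Proof.
move=> K0 Ks ff f0 fr; have [mf _] := ff. split; last first.
 by move=> t t0; rewrite (min_l (le_trans t0 K0)) (min_l K0) !f0.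
move=> t; apply: dist_cts => e e0; set u := minr t K. have uK : u <= K by rewrite ge_min lexx orbT.
suff [h h0 H] : exists2 h : R, 0 < h & forall r, r <= K -> `|r - u| < h -> `|f r - f u| < e.
 exists h => // s sth; apply: H; first by rewrite ge_min lexx orbT.
 by apply: le_lt_trans sth; exact: dist_min.
have [u0|u0] := ltP u 0.
 exists (- u); first by rewrite oppr_gt0. move=> r _; rewrite ltr_norml => /andP[_ ru].
 by rewrite !f0 ?subrr ?normr0 //; lra.
have [h1 h10 H1] := fr u u0 uK e e0.
have [h2 h20 H2] : exists2 h : R, 0 < h & forall r, u - h < r -> r <= u -> f u - e < f r.
 move: u0; rewrite le_eqVlt => /orP[/eqP u0|u0].
  by exists 1 => // r _ ru; rewrite !f0 //; lra.
 by apply: (mean_field_left u0 _ ff e0); exact: le_lt_trans Ks.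
exists (minr h1 h2); first by rewrite lt_min h10.
move=> r rK; rewrite ltr_norml lt_min => /andP[a /andP[b c]].
have h12 : minr h1 h2 <= h2 by rewrite ge_min lexx orbT. have {}a : u - h2 < r by lra.
rewrite ltr_norml; have [ru|ru] := leP r u.
 have : f r <= f u by apply: mf => //; lra. by have := H2 r a ru; move=> ? ?; apply/andP; split; lra.
have : f u <= f r by apply: mf; [exact: ltW|lra]. have := H1 r (ltW ru); have -> : r <= u + h1 by lra.
by move=> /(_ isT) ? ?; apply/andP; split; lra.
Qed.

Lemma fixed_mv f (T : ext_time R) (q : R) : \val T = q%:E ->
 (forall s, s <= 0 -> f s = 0) -> (forall K, K < q -> fixed_to f K) ->
 (forall t, 0 <= t -> t < q -> right_cts f t) ->
 mv_solution alpha xi W f T.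
Proof.
move=> Tq f0 ff fr; rewrite /mv_solution Tq.
have bq K : before q%:E K -> 0 <= K /\ K < q by case; rewrite lte_fin.
have cK K : 0 <= K -> K < q -> cpath (fun s => f (minr s K)).
 move=> K0 Kq; apply: (@fixed_cpath f K ((K + q) / 2)) => //; [lra|apply: ff; lra|].
 by move=> t t0 tK; apply: fr => //; exact: le_lt_trans Kq.
have fmax s : f (maxr 0 s) = f s.
 by case: (leP 0 s) => // /ltW s0; rewrite !f0.
split.
 move=> t /bq[t0 tq]; pose K := (t + q) / 2.
 have [cc _] : cpath (fun s => f (minr s K)) by apply: cK; rewrite /K; lra.
 have ct : f s @[s --> t] --> f t.
  have tK : minr t K = t by rewrite min_l // /K; lra. have := cc t; rewrite /= /continuous_at tK.
  apply: cvg_trans; apply: near_eq_cvg. near=> s; rewrite min_l //; apply: ltW; near: s.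
  by apply: lt_nbhsl; rewrite /K; lra.
 split; first exact: cvg_at_right_filter ct.
 by move=> _; apply/cvg_ex; exists (f t); exact: cvg_at_left_filter ct.
pose Zs w t := xi w + W t w - alpha * f t.
exists (fun t w => Zs w t + runsup (fun s => - Zs w (maxr 0 s)) t).
exists (fun t w => runsup (fun s => - Zs w (maxr 0 s)) t). split.
 apply: aeW => w; apply: (@runsup_skorokhod _ (Zs w) q%:E).
  move=> K /bq[K0 Kq]; rewrite /Zs. have := cpathB (cpath_min K0 (cz w)) (cpathZ alpha (cK K K0 Kq)).
  congr cpath; apply/funext => s; rewrite zE fmax //.
 move=> /bq[_ q0]; rewrite /Zs f0 // mulr0 subr0. by have := z0_ge0 w; rewrite -/z zE max_l.
move=> t /bq[t0 tq]; have [mf fE] := ff t tq.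
rewrite expectation.unlock fE // [LHS]ExE; last exact: igr_phi.
apply: eq_integral => w _; congr EFin; apply: eq_runsup => s _. by rewrite -/z zE /Zs opprB fmax addrC.
Unshelve. all: by end_near. Qed.

Lemma cpath_Gam f : cpath f -> (forall t, mono_to f t) -> cpath (Gam f).
Proof.
move=> cf mf; have ca w := cpath_phi_arg alpha cf (cz w). split; last first.
 move=> t t0; apply: eq_Ex => w; rewrite /phi -/z. by rewrite !frozen_runsup.
move=> t; apply/(@cvg_nbhsP _ R^o) => u ut; apply/cvgrPdist_lt => e e0.
have [b Hb] : exists b, forall n, u n <= b.
 have /cvg_seq_bounded [M [_ HM]] : cvgn u by apply/cvg_ex; exists t.
 by exists (M + 1) => n; apply: (le_trans (ler_norm _)); apply: HM => //; rewrite ltrDl.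
have [_ cv] : igr P (fun w => phi alpha f (z w) t) /\
  Ex P (fun w => phi alpha f (z w) (u n)) @[n --> \oo] --> Ex P (fun w => phi alpha f (z w) t).
 apply: (@Ex_dct _ _ _ P (fun n w => phi alpha f (z w) (u n)) _ (fun w => phi alpha f (z w) b)).
 - by move=> n; exact: mfn_phi_z.
 - exact: igr_phi.
 - move=> n w; rewrite ger0_norm ?phi_z_ge0 //. by apply: phi_mono => //; exact: cz.
 - move=> w; have [cp _] := cpath_phi alpha cf (cz w). exact: (cvg_comp _ _ ut (cp t)).
by move/cvgrPdist_lt : cv => /(_ e e0).
Qed.

(** The limit of the Picard iterates is only known to be nondecreasing, whereas a solution must be
    right-continuous. The function g of right limits is again a fixed point, by dominated
    convergence along u n decreasing to t. *)
Lemma right_version f (q : R) : 0 < q -> fixed_to f q -> (forall s, s <= 0 -> f s = 0) ->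
 exists g, [/\ forall s, s <= 0 -> g s = 0, forall K, K < q -> fixed_to g K &
  forall t, 0 <= t -> t < q -> right_cts g t].
Proof.
move=> q0 [mf fE] f0. pose S t := [set f s | s in [set s | t < s /\ s <= q]]. pose g t := inf (S t).
have lbS t : lbound (S t) (f t).
 by move=> _ [s [ts sq] <-]; apply: mf => //; exact: ltW.
have S0 t : t < q -> S t !=set0 by move=> tq; exists (f q), q.
have g_ge t : t < q -> f t <= g t by move=> tq; exact: lb_le_inf (S0 t tq) (lbS t).
have g_le t s : t < s -> s <= q -> g t <= f s.
 by move=> ts sq; apply: ge_inf; [exists (f t); exact: lbS|exists s].
have g_app t (e : R) : t < q -> 0 < e -> exists2 s, t < s /\ s <= q & f s < g t + e.
 move=> tq e0; have [||_ [s ss <-] h] := @inf_adherent _ (S t) e.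
 - exact: e0.
 - by split; [exact: S0|exists (f t); exact: lbS].
 - by exists s.
have mg K : K < q -> mono_to g K.
 move=> Kq r s rs sK; apply: lb_le_inf; first by apply: S0; exact: le_lt_trans Kq.
 by move=> _ [u [su uq] <-]; apply: g_le => //; exact: le_lt_trans su.
have fix_g t : t < q -> g t = Gam g t.
 move=> tq; pose u n := t + (q - t) * dy n. have D0 : 0 < q - t by rewrite subr_gt0.
 have ut n : t < u n by rewrite /u ltrDl mulr_gt0 // dy_gt0. have uq n : u n <= q.
  rewrite /u -lerBrDl ger_pMr // /dy invf_le1 ?exprn_gt0 //. by rewrite exprn_ege1 //; lra.
 have u_near (k : R) : 0 < k -> exists n0, forall n, (n0 <= n)%N -> u n < t + k.
  move=> k0; have kt : 0 < k / (2 * (q - t)) by rewrite divr_gt0 // mulr_gt0.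
  have [n0 _ H] := dy_small kt; exists n0 => n nn; rewrite /u ltrD2l.
  by have := H n nn; rewrite ler_pdivlMr ?mulr_gt0 // => h; nra.
 have cu : f (u n) @[n --> \oo] --> g t.
  apply/cvgrPdist_lt => e e0; have [s [ts sq] fs] := g_app t e tq e0.
  have [n0 Hn] : exists n0, forall n, (n0 <= n)%N -> u n < t + (s - t).
   by apply: u_near; rewrite subr_gt0.
  exists n0 => // n /= /Hn un; rewrite ltr_distlC. have h1 := g_le t (u n) (ut n) (uq n).
  have h2 : f (u n) <= f s by apply: mf => //; lra. by apply/andP; split; lra.
 have mfu n : mono_to f (u n) by exact: mono_to_le (uq n) mf. have mgt := mg t tq.
 have lim_w w (e : R) : 0 < e ->
   \forall n \near \oo, `|phi alpha g (z w) t - phi alpha f (z w) (u n)| < e.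
  move=> e0. have e20 : 0 < e / 2 by rewrite divr_gt0.
  have ea : 0 < e / (2 * (alpha + 1)) by rewrite divr_gt0 // mulr_gt0 // ltr_wpDl.
  have [k k0 Hk] := cpath_ucts (cz w) q e20. have [n0 Hn] := u_near k k0.
  have /cvgrPdist_lt /(_ _ ea) [n1 _ Hn1] := cu.
  exists (maxn n0 n1) => // n /=; rewrite geq_max => /andP[nn0 nn1].
  have := Hn1 n nn1; rewrite ltr_distlC => /andP[_ fu].
  have un := Hn n nn0; have utn := ut n; have uqn := uq n. have hg := g_le t (u n) utn uqn.
  have a1 : alpha * (f (u n) - g t) < e / 2.
   apply: (@le_lt_trans _ _ (alpha * (e / (2 * (alpha + 1))))).
    by apply: ler_wpM2l => //; lra.
   by rewrite mulrA ltr_pdivrMr ?mulr_gt0 // ?ltr_wpDl //; nra.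
  have a0 : 0 <= alpha * (f (u n) - g t) by rewrite mulr_ge0 // subr_ge0.
  have up : phi alpha f (z w) (u n) <= phi alpha g (z w) t + (alpha * (f (u n) - g t) + e / 2).
   apply: runsup_le.
    by rewrite addr_ge0 ?phi_z_ge0 // addr_ge0 // ltW.
   move=> r ru; have [rt|tr] := leP r t.
    have h1 := phi_ub alpha0 mgt (cz w) rt. have h2 : alpha * f r <= alpha * g r.
     by apply: ler_wpM2l => //; apply: g_ge; exact: le_lt_trans tq.
    by lra.
   have h1 := phi_ub alpha0 mgt (cz w) (lexx t). have h2 : alpha * f r <= alpha * f (u n).
    by apply: ler_wpM2l => //; apply: mf.
   have := Hk r t (le_trans ru uqn) (ltW tq). rewrite (gtr0_norm (_ : 0 < r - t)) ?subr_gt0 // => h3.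
   have /h3 : r - t < k by lra. by rewrite ltr_distl => /andP[h4 _]; rewrite mulrBr; lra.
  (* The time shift by u n - t turns g r into a lower bound for f at a later time, at the cost of
     the modulus of continuity of z. *)
  have lo : phi alpha g (z w) t <= phi alpha f (z w) (u n) + e / 2.
   apply: runsup_le; first by rewrite addr_ge0 ?phi_z_ge0 // ltW.
   move=> r rt; have ru : r + (u n - t) <= u n by lra. have h1 := phi_ub alpha0 (mfu n) (cz w) ru.
   have h2 : alpha * g r <= alpha * f (r + (u n - t)).
    by apply: ler_wpM2l => //; apply: g_le; lra.
   have := Hk (r + (u n - t)) r _ _ _. have -> : `|r + (u n - t) - r| = u n - t.
    by rewrite addrC addKr ger0_norm // subr_ge0 ltW.
   have p1 : r + (u n - t) <= q by lra. have p2 : r <= q by lra. have p3 : u n - t < k by lra.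
   by move=> /(_ p1 p2 p3); rewrite ltr_distl => /andP[_]; lra.
  by rewrite ltr_distlC; apply/andP; split; lra.
 have [_ cG] : igr P (fun w => phi alpha g (z w) t) /\
   Ex P (fun w => phi alpha f (z w) (u n)) @[n --> \oo] -->
   Ex P (fun w => phi alpha g (z w) t).
  apply: (@Ex_dct _ _ _ P (fun n w => phi alpha f (z w) (u n)) _
   (fun w => phi alpha f (z w) q)); first last.
  - move=> w; apply/cvgrPdist_lt => e e0; exact: lim_w.
  - move=> n w; rewrite ger0_norm ?phi_z_ge0 //. by apply: phi_mono => //; exact: cz.
  - exact: igr_phi.
  - by move=> n; exact: mfn_phi_z.
 have cG' : f (u n) @[n --> \oo] --> Gam g t.
  have e : (fun n => f (u n)) = (fun n => Ex P (fun w => phi alpha f (z w) (u n))).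
   by apply/funext => n; rewrite fE.
  by rewrite e.
 by rewrite -(cvg_lim _ cu) // (cvg_lim _ cG').
have fixg K : K < q -> fixed_to g K.
 by move=> Kq; split; [exact: mg|move=> s sK; apply: fix_g; exact: le_lt_trans Kq].
exists g; split => //; last first.
 move=> t t0 tq e e0; have [s [ts sq] fs] := g_app t e tq e0.
 exists ((s - t) / 2); first by rewrite divr_gt0 // subr_gt0.
 by move=> r tr rh; apply: le_lt_trans fs; apply: g_le => //; lra.
have g0_ge : 0 <= g 0 by rewrite -{1}(f0 0 (lexx 0)); exact: g_ge. have gneg s : s < 0 -> g s = 0.
 move=> s0; apply/eqP; rewrite eq_le; apply/andP; split.
  by rewrite -(f0 0 (lexx 0)); apply: g_le => //; exact: ltW.
 by rewrite -(f0 s (ltW s0)); apply: g_ge; exact: lt_trans q0.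
suff g0 : g 0 = 0.
 by move=> s; rewrite le_eqVlt => /orP[/eqP ->//|]; exact: gneg.
(* Taking right limits might create a jump at 0. It would be carried by the paths with X_0 = 0 only,
   giving g 0 <= alpha P(X_0 = 0) g 0. *)
have q20 : 0 < q / 2 by rewrite divr_gt0. have q2q : q / 2 < q by lra.
have strict := mean_field_strict (lexx 0) q20 (fixg _ q2q).
set A := [set w | _] in strict; have mg0 := mg 0 q0. have mA : measurable A.
 apply: (past_measurable (past_zero_set (lexx 0) mg0)).
have key w : phi alpha g (z w) 0 <= \1_A w * (alpha * g 0).
 have z0 := z0_ge0 w. have le1 : phi alpha g (z w) 0 <= maxr 0 (alpha * g 0 - z w 0).
  apply: runsup_le; first by rewrite le_max lexx. move=> s s0; rewrite le_max; apply/orP; right.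
  have -> : z w s = z w 0 by have [_ ->] := cz w. by rewrite lerD2r; apply: ler_wpM2l => //; exact: mg0.
 have ge1 := phi_ub alpha0 mg0 (cz w) (lexx 0). have ge0 := phi_z_ge0 w mg0.
 have ag : 0 <= alpha * g 0 by exact: mulr_ge0.
 move: le1; rewrite -/z in ge0 z0 *; case: (leP 0 (alpha * g 0 - z w 0)) => h le1.
  have pe : phi alpha g (z w) 0 = alpha * g 0 - z w 0.
   by apply/eqP; rewrite eq_le le1 ge1.
  have X0 : refl alpha g (z w) 0 = 0 by rewrite /refl pe; lra. have Aw : w \in A by rewrite inE.
  by rewrite indicE Aw mul1r; lra.
 by apply: (le_trans le1); rewrite mulr_ge0 // indicE.
have iA : igr P (fun w => \1_A w * (alpha * g 0)).
 exact: (igr_indicM mA (igr_cst P (alpha * g 0))).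
have := Ex_le (igr_phi mg0) iA key.
have -> : Ex P (fun w => \1_A w * (alpha * g 0)) = (alpha * g 0) * Pr P A.
 rewrite -(Ex_indic P mA) -(ExZ _ (igr_indic P mA)). by apply: eq_Ex => w; rewrite mulrC.
rewrite -[leLHS]/(Gam g 0) -fix_g //. by move: (Pr P A) strict (g 0) g0_ge => p ap y y0 h; nra.
Qed.

Definition mv_it (n : nat) : R -> R := iter n Gam (fun=> 0).

Lemma mv_it_mono n t : mono_to (mv_it n) t.
Proof. by elim: n => [|n IH] //; exact: Gam_mono. Qed.

Lemma cpath_mv_it n : cpath (mv_it n).
Proof.
elim: n => [|n IH]; first exact: cpath_cst. by apply: cpath_Gam => // t; exact: mv_it_mono.
Qed.

Lemma mv_it_ge0 n t : 0 <= mv_it n t.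
Proof. by case: n => [|n] //; apply: Gam_ge0 => //; exact: mv_it_mono. Qed.

Lemma mv_it_le n t : mv_it n t <= mv_it n.+1 t.
Proof.
elim: n t => [|n IH] t; first exact: mv_it_ge0. change (Gam (mv_it n) t <= Gam (mv_it n.+1) t).
by apply: (Gam_le (@mv_it_mono n t) (@mv_it_mono n.+1 t)) => s _; exact: IH.
Qed.

Lemma mv_it_neg n t : t <= 0 -> mv_it n t = 0.
Proof.
by elim: n t => [|n IH] t t0 //; apply: Gam_neg => //; [exact: IH|exact: mv_it_mono].
Qed.

(** Monotonicity in time spreads the bound at q to all earlier times, and [phi_cvg] with dominated
    convergence passes to the limit in the fixed-point equation. *)
Lemma mv_it_limit (q B : R) : 0 < q -> (forall n, mv_it n q <= B) ->
 exists f, fixed_to f q /\ forall s, s <= 0 -> f s = 0.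
Proof.
move=> q0 HB; pose f t := sup (range (mv_it ^~ t)).
have bnd t : t <= q -> has_ubound (range (mv_it ^~ t)).
 move=> tq; exists B => _ [n _ <-]; apply: (le_trans _ (HB n)). exact: (@mv_it_mono n q).
have cv t : t <= q -> mv_it ^~ t @ \oo --> f t.
 move=> tq; apply: nondecreasing_cvgn; last exact: bnd.
 by apply/nondecreasing_seqP => n; exact: mv_it_le.
have ub n t : t <= q -> mv_it n t <= f t.
 by move=> tq; apply: ub_le_sup; [exact: bnd|exists n].
have mf : mono_to f q.
 move=> r s rs sq; apply: ge_sup; first by exists (mv_it 0 r); exists 0%N.
 move=> _ [n _ <-]; apply: (le_trans _ (ub n s sq)); exact: (@mv_it_mono n s).
exists f; split; last first.
 move=> s s0; have -> : f s = sup [set 0]; last by rewrite sup1.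
 congr sup; apply/seteqP; split=> [_ [n _ <-]|_ ->]; first by rewrite /= mv_it_neg. by exists 0%N.
split=> // s sq; have ms := mono_to_le sq mf. have c1 : (fun n => mv_it n.+1 s) @ \oo --> f s.
 by have := cv s sq; rewrite -(cvg_shiftS (mv_it ^~ s)).
have [_ c2] : igr P (fun w => phi alpha f (z w) s) /\
  Ex P (fun w => phi alpha (mv_it n) (z w) s) @[n --> \oo] -->
  Ex P (fun w => phi alpha f (z w) s).
 apply: (@Ex_dct _ _ _ P (fun n w => phi alpha (mv_it n) (z w) s) _ (fun w => phi alpha f (z w) s)).
 - by move=> n; apply: mfn_phi_z => //; exact: mv_it_mono.
 - exact: igr_phi.
 - move=> n w; rewrite ger0_norm ?phi_z_ge0 //; last exact: mv_it_mono. apply: phi_le => //.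
  by move=> r rs; apply: ub; exact: le_trans sq.
 - move=> w; apply: phi_cvg => //.
  + by move=> n; exact: mv_it_mono.
  + by move=> n r _; exact: mv_it_le.
  + by move=> r rs; apply: cv; exact: le_trans sq.
by rewrite -(cvg_lim _ c1) // (cvg_lim _ c2).
Qed.

Section from_solution.
Variables (l : R -> R) (T : ext_time R).
Hypothesis sol : mv_solution alpha xi W l T.
Let lf s := l (maxr 0 s).

Lemma mv_start : before (\val T) 0 -> l 0 = 0.
Proof.
move=> b0; have [_ [X [L [sk E]]]] := sol. apply: EFin_inj; rewrite E // expectation.unlock.
rewrite (ae_eq_integral_any (g := fun=> 0%E)) ?integral0 //.
by apply: filterS sk => w [_ _ h _ _]; rewrite h.
Qed.

Lemma mv_mono s t : 0 <= s -> s <= t -> before (\val T) t -> l s <= l t.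
Proof.
move=> s0 st bt; have [_ [X [L [sk E]]]] := sol. rewrite -lee_fin !E //; last exact: before_le bt.
rewrite expectation.unlock; apply: ae_le_integral_any.
by apply: filterS sk => w [_ _ _ h _]; rewrite lee_fin h.
Qed.

Lemma mv_fixed t : before (\val T) t -> fixed_to lf t.
Proof.
move=> bt; have t0 : 0 <= t by case: bt. have b0 : before (\val T) 0 by exact: before_le bt.
have mlf : mono_to lf t.
 move=> r s rs st; apply: mv_mono; first by rewrite le_max lexx.
  by rewrite ge_max !le_max lexx rs orbT.
 by apply: (before_le _ _ bt); rewrite ?le_max ?lexx // ge_max t0.
split=> // s st; have ms := mono_to_le st mlf. have [s0|s0] := leP s 0.
 have l0 : lf s = 0 by rewrite /lf max_l // mv_start. by rewrite l0 Gam_neg.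
have bs : before (\val T) s by apply: before_le bt => //; exact: ltW. have [_ [X [L [sk E]]]] := sol.
apply: EFin_inj; rewrite /lf max_r ?(ltW s0) // E // expectation.unlock.
rewrite [RHS]ExE; last exact: igr_phi. apply: ae_eq_integral_any; apply: filterS sk => w sk; congr EFin.
rewrite (skorokhod_runsup sk bs); apply: eq_runsup => r _. by rewrite -/z zE opprB addrC.
Qed.

Lemma mv_right t : before (\val T) t -> right_cts lf t.
Proof.
move=> bt e e0; have t0 : 0 <= t by case: bt.
have [cl _] := sol; have [+ _] := cl t bt => /cvgrPdist_lt /(_ e e0).
move=> /nbhs_ballP[h /= h0 H]; exists (h / 2); first by rewrite divr_gt0.
move=> s; rewrite le_eqVlt => /orP[/eqP <- _|ts sh]; first by rewrite ltrDl.
have := H s; rewrite /ball /= distrC ltr_norml => /(_ _ ts).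
have -> : (- h < s - t) && (s - t < h) by apply/andP; split; lra.
rewrite /lf !max_r //; last exact: le_trans (ltW ts). by move=> /(_ isT); rewrite ltr_distlC => /andP[_].
Qed.

Lemma mv_neg s : before (\val T) 0 -> s <= 0 -> lf s = 0.
Proof. by move=> b0 s0; rewrite /lf max_l // mv_start. Qed.

Lemma before_next (t : R) : before (\val T) t -> exists2 s, t < s & before (\val T) s.
Proof.
case: (\val T) => [r| |] [t0] //.
- rewrite lte_fin => tr; exists ((t + r) / 2); first by lra. by split; [lra|rewrite lte_fin; lra].
- by move=> _; exists (t + 1); [lra|split; [lra|exact: ltry]].
Qed.

Lemma mv_cpath K : before (\val T) K -> cpath (fun s => lf (minr s K)).
Proof.
move=> bK; have [s0 Ks bs] := before_next bK; have K0 : 0 <= K by case: bK.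
have b0 : before (\val T) 0 by exact: before_le bK.
apply: (fixed_cpath K0 Ks (mv_fixed bs)) => [s|t t0 tK]; first exact: mv_neg.
by apply: mv_right; exact: before_le bK.
Qed.

End from_solution.
End mean_field_solutions.

End one_particle.

(** * Events defined by countable quantifiers *)

Section countable_quantifiers.
Context {d : measure_display} {Om : measurableType d}.

Lemma measurable_ex (I : countType) (A : I -> set Om) : (forall i, measurable (A i)) ->
 measurable [set w | exists i, A i w].
Proof.
move=> mA; have -> : [set w | exists i, A i w] = \bigcup_i A i.
 by apply/seteqP; split=> w [i]; [exists i|move=> _ ?; exists i].
by apply: countable_bigcupT_measurable => //; exact: countableP.
Qed.

Lemma measurable_all (I : countType) (A : I -> set Om) : (forall i, measurable (A i)) ->
 measurable [set w | forall i, A i w].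
Proof.
move=> mA; have -> : [set w | forall i, A i w] = ~` [set w | exists i, (~` A i) w].
 apply/seteqP; split=> w /=; first by move=> H [i]; apply.
 by move=> nH i; apply: contrapT => nA; apply: nH; exists i.
by apply: measurableC; apply: measurable_ex => i; exact: measurableC.
Qed.

Lemma measurable_imp (p : Prop) (A : set Om) : (p -> measurable A) -> measurable [set w | p -> A w].
Proof.
move=> mA; have [hp|hp] := pselect p.
 have {}mA := mA hp. by have -> : [set w | p -> A w] = A by apply/seteqP; split=> w //=; exact.
by have -> : [set w | p -> A w] = setT by apply/seteqP; split=> w //= _ /hp.
Qed.

Lemma measurable_and (p : Prop) (A : set Om) : (p -> measurable A) -> measurable [set w | p /\ A w].
Proof.
move=> mA; have [hp|hp] := pselect p.
 have {}mA := mA hp. by have -> : [set w | p /\ A w] = A by apply/seteqP; split=> w //= [].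
by have -> : [set w | p /\ A w] = set0 by apply/seteqP; split=> w // [].
Qed.

End countable_quantifiers.

(** * The minimal fixed point near a given mean path *)

Section particle_stability.
Context {R : realType}.
Variables (alpha : R) (N : nat) (z : 'I_N -> R -> R).
Hypothesis alpha0 : 0 <= alpha.
Hypothesis N0 : (0 < N)%N.
Hypothesis cz : forall i, cpath (z i).
Hypothesis z0 : forall i, 0 <= z i 0.
Local Notation lam := (lam alpha z).
Local Notation good := (good alpha z).

(* Continuous induction: on [t1, t2] the stability estimate keeps lam close to
  f, hence the particles outside A stay positive and t remains good. *)
Lemma lam_close_extend f (t1 t2 dl eta e c : R) (A : {set 'I_N}) :
 cpath f -> (forall t, mono_to f t) -> (forall s, s <= 0 -> f s = 0) ->
 0 <= t1 -> t1 <= t2 -> 0 <= e ->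
 (forall s, 0 <= s -> s < t1 -> good s) ->
 (forall s, s <= t1 -> lfin alpha z s /\ `|lam s - f s| <= e) ->
 (forall s, s <= t2 -> `|avg_phi alpha z f s - f s| <= eta) ->
 (forall i, i \notin A -> forall s, t1 <= s -> s <= t2 -> dl < refl alpha f (z i) s) ->
 alpha * #|A|%:R <= c * N%:R -> 0 <= c -> c < 1 ->
 let B := (eta + (1 + alpha) * e) / (1 - c) in
 2 * alpha * B < dl ->
 (forall s, 0 <= s -> s <= t2 -> good s) /\
 (forall s, s <= t2 -> `|lam s - f s| <= B).
Proof.
move=> cf mf f0 t10 t12 e0 good1 close1 etaH AH cA c0 c1 B Bdl. have NR : 0 < N%:R :> R by rewrite ltr0n.
have eta0 : 0 <= eta by apply: le_trans (etaH t2 (lexx _)). have c1' : 0 < 1 - c by rewrite subr_gt0.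
have eB : e <= B.
 have h1 := mulr_ge0 alpha0 e0; have h2 := mulr_ge0 c0 e0. by rewrite /B ler_pdivlMr //; lra.
have B0 : 0 <= B by exact: le_trans eB.
have stab K : t1 <= K -> K <= t2 -> (forall s, 0 <= s -> s <= K -> good s) ->
  forall s, s <= K -> `|lam s - f s| <= B.
 move=> tK Kt gK; have K0 := le_trans t10 tK. have lK : lfin alpha z K by case: (gK K K0 (lexx K)).
 have cl := cpath_lam alpha0 N0 cz z0 K0 gK. have ml : mono_to (fun s => lam (minr s K)) K.
  by move=> r s rs sK; rewrite !min_l //; [apply: lam_mono lK _ _ rs sK|exact: le_trans sK].
 have [||||||||] := @stability_step R alpha alpha0 N z N0 cz
   (fun s => lam (minr s K)) f t1 K dl eta e c A cl cf ml (mf K) tK => //.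
 - move=> s sK; have ls : lfin alpha z s by exact: lfin_le lK.
  rewrite min_l // (lam_fix alpha0 N0 cz ls).
  congr (_ / _); apply: eq_bigr => i _; apply: eq_phi => r rs. by rewrite min_l // (le_trans rs).
 - by move=> s sK; apply: etaH; exact: le_trans Kt.
 - by move=> s st; rewrite min_l; [case: (close1 s st)|exact: le_trans tK].
 - by move=> i iA s ts sK; apply: AH => //; exact: le_trans Kt.
 - by move=> H _ s sK; have := H s sK; rewrite min_l.
have step u : t1 <= u -> u <= t2 -> (forall s, t1 <= s -> s < u -> good s) ->
  good u /\ (forall s, s <= u -> `|lam s - f s| <= B).
 move=> tu ut gu. have gu' s : 0 <= s -> s < u -> good s.
  by move=> s0 su; case: (ltP s t1) => st; [exact: good1|exact: gu].
 have u0 := le_trans t10 tu.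
 have [lu close] : lfin alpha z u /\ (forall s, s <= u -> `|lam s - f s| <= B).
  move: tu; rewrite le_eqVlt => /orP[/eqP <-|tu].
   split; first by case: (close1 t1 (lexx _)). by move=> s st; apply: le_trans eB; case: (close1 s st).
  have cls s : s < u -> `|lam s - f s| <= B.
   move=> su; pose K := maxr t1 s. have Ku : K < u by rewrite gt_max tu.
   apply: (stab K); rewrite ?le_max ?lexx ?orbT //; first by apply: ltW; exact: lt_le_trans ut.
   by move=> r r0 rK; apply: gu' => //; exact: le_lt_trans Ku.
  have lfs s : s < u -> lfin alpha z s.
   move=> su; case: (leP 0 s) => s0; first by case: (gu' s s0 su).
   by exists 0 => n; rewrite picard0 // ltW.
  have up n : picard alpha z n u <= f u + B.
   rewrite leNgt; apply/negP => h. have k0 : 0 < picard alpha z n u - (f u + B) by rewrite subr_gt0.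
   have [cc _] := cpath_picard alpha cz n. have [k kp H] := cts_dist (cc u) k0.
   have kk : u - k / 2 < u by lra. have := H (u - k / 2). have -> : `|u - k / 2 - u| < k.
    by rewrite addrAC subrr sub0r normrN gtr0_norm; lra.
   move=> /(_ isT); rewrite ltr_distl => /andP[h1 _]. have h2 := lam_ub n (lfs _ kk).
   have := cls _ kk; rewrite ler_distl => /andP[_ h3].
   have h4 : f (u - k / 2) <= f u by apply: (mf u) => //; exact: ltW. by lra.
  have lu : lfin alpha z u by exists (f u + B).
  split=> // s; rewrite le_eqVlt => /orP[/eqP ->|]; last exact: cls.
  rewrite ler_distl; apply/andP; split; last exact: lam_le. rewrite lerBlDr; apply/ler_addgt0Pr => k k0.
  have [cc _] := cf; have [h h0 H] := cts_dist (cc u) k0. have kk : u - h / 2 < u by lra.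
  have := H (u - h / 2). have -> : `|u - h / 2 - u| < h.
   by rewrite addrAC subrr sub0r normrN gtr0_norm; lra.
  move=> /(_ isT); rewrite ltr_distl => /andP[h1 _]. have := cls _ kk; rewrite ler_distl => /andP[h2 _].
  have h3 : lam (u - h / 2) <= lam u by apply: (lam_mono alpha0 N0 cz lu) => //; exact: ltW. by lra.
 split=> //; split=> //. have sub : zeros alpha z u \subset A.
  apply/fintype.subsetP => i; rewrite inE => /eqP X0; apply/negPn/negP => iA. have := AH i iA u tu ut.
  have ml := lam_mono alpha0 N0 cz lu. have := phi_dist alpha0 ml (mf u) (cz i) close.
  have := close u (lexx u); rewrite !ler_distl => /andP[a1 a2] /andP[b1 b2].
  move: X0; rewrite /refl => X0 X1. have : alpha * lam u <= alpha * (f u + B) by exact: ler_wpM2l.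
  by rewrite mulrDr; move: Bdl; lra.
 have le : alpha * #|zeros alpha z u|%:R <= alpha * #|A|%:R.
  by apply: ler_wpM2l => //; rewrite ler_nat subset_leq_card.
 by apply: (le_lt_trans (le_trans le cA)); rewrite gtr_pMl.
have g12 : forall s, t1 <= s -> s <= t2 -> good s.
 apply: real_ind => u tu ut gu. have [gu1 _] := step u tu ut gu.
 have [h h0 H] := lam_ext alpha0 N0 cz (ltr01 : 0 < (1 : R)) gu1.
 by exists h => // s us sh _; case: (H s us (ltW sh)).
have g02 : forall s, 0 <= s -> s <= t2 -> good s.
 by move=> s s0 st; case: (ltP s t1) => h; [exact: good1|exact: g12].
by split=> //; exact: (stab t2).
Qed.

End particle_stability.

Lemma phi_start {R : realType} (alpha : R) (f y : R -> R) t : 0 <= alpha -> cpath y -> 0 <= y 0 -> t <= 0 -> f t = 0 ->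
 mono_to f t -> phi alpha f y t = 0.
Proof.
move=> alpha0 cy y0 t0 ft mf; apply/eqP; rewrite eq_le phi_ge0 // andbT.
apply: runsup_le => // s st; have -> : y s = y 0 by have [_ ->] := cy; rewrite // (le_trans st).
have : alpha * f s <= alpha * f t by apply: ler_wpM2l => //; exact: mf. by rewrite ft mulr0; lra.
Qed.

(** Makes a path on the whole line out of one that is only meaningful before its lifetime. *)
Definition frozen_at {R : realType} (f : R -> R) (K s : R) := f (maxr 0 (minr s K)).

Lemma before_around {R : realType} (T : \bar R) (t : R) : before T t -> exists K, [/\ before T K, t < K &
 forall s, before T s -> `|s - t| < K - t -> s <= K].
Proof.
move=> bt; have [K tK bK] : exists2 K, t < K & before T K.
 case: bt => t0; case: T => [r| |] //.
  rewrite lte_fin => tr; exists ((t + r) / 2); first by lra. by split; [lra|rewrite lte_fin; lra].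
 by move=> _; exists (t + 1); [lra|split; [lra|exact: ltry]].
exists K; split=> // s bs; rewrite ltr_norml => /andP[_ h]; lra.
Qed.

Lemma before_clamp {R : realType} (T : \bar R) (K s : R) : before T K -> before T (maxr 0 (minr s K)).
Proof.
move=> bK; have K0 : 0 <= K by case: bK. apply: before_le bK; first by rewrite le_max lexx.
by rewrite ge_max K0 ge_min lexx orbT.
Qed.

(** * Measurability of the minimal fixed point and of its lifetime *)

Section minimal_solution.
Context {R : realType} {d : measure_display} {Om : measurableType d}.
Variables (alpha : R) (N : nat) (z : Om -> 'I_N -> R -> R).
Hypothesis alpha0 : 0 <= alpha.
Hypothesis N0 : (0 < N)%N.
Hypothesis cz : forall w i, cpath (z w i).
Hypothesis z0 : forall w i, 0 <= z w i 0.
Variable t : R.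
Hypothesis t0 : 0 <= t.
Hypothesis mz : forall i s, s <= t -> mfn (fun w => z w i s).

Let mp n s : s <= t -> mfn (fun w => picard alpha (z w) n s).
Proof. by move=> st; apply: (@mfn_picard _ _ _ alpha N z n t). Qed.

Lemma measurable_lfin s : s <= t -> measurable [set w | lfin alpha (z w) s].
Proof.
move=> st; have -> : [set w | lfin alpha (z w) s] =
  \bigcup_M \bigcap_n [set w | picard alpha (z w) n s <= M%:R].
 apply/seteqP; split=> w /=.
  move=> [M HM]; exists (Num.truncn `|M|).+1 => // n _ /=; apply: (le_trans (HM n)).
  by apply: (le_trans (ler_norm M)); apply: ltW; exact: truncnS_gt.
 by move=> [M _ HM]; exists M%:R => n; exact: HM.
apply: bigcup_measurable => M _; apply: bigcap_measurable => // n _. by apply: mfn_le; exact: mp.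
Qed.

(** The indicator restricts to the event where the Picard iterates converge; elsewhere [lam] is a
    default value. *)
Lemma mfn_indic_cvg (A : set Om) (F : nat -> Om -> R) (G : Om -> R) : measurable A ->
 (forall n, mfn (F n)) -> (forall w, A w -> F ^~ w @ \oo --> G w) ->
 mfn (fun w => \1_A w * G w).
Proof.
move=> mA mF FG; have mI := mfn_indic (R := R) mA.
apply: (@measurable_fun_cvg _ _ _ _ (fun n w => \1_A w * F n w)).
 by move=> n; apply: measurable_funM => //; exact: mF.
move=> w _; rewrite indicE; have [Aw|Aw] := pselect (A w).
 by rewrite mem_set // mul1r; under eq_fun do rewrite mul1r; exact: FG.
by rewrite memNset // mul0r; under eq_fun do rewrite mul0r; exact: cvg_cst.
Qed.

Lemma mfn_indic_phi_lam i s : s <= t ->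
 mfn (fun w => \1_[set w | lfin alpha (z w) s] w * phi alpha (lam alpha (z w)) (z w i) s).
Proof.
move=> st; apply: (@mfn_indic_cvg _ (fun n w => phi alpha (picard alpha (z w) n) (z w i) s)).
- exact: measurable_lfin.
- move=> n; apply: mfn_phi => //.
 + by move=> r rs; apply: mp; exact: le_trans st.
 + by move=> r rs; apply: mz; exact: le_trans st.
 + by move=> w; exact: picard_mono.
move=> w /= lw; apply: phi_cvg => //.
- by move=> n; exact: picard_mono.
- exact: lam_mono.
- by move=> n r _; exact: picard_le.
- by move=> r rs; apply: (lam_cvg alpha0 N0 (cz w)); exact: lfin_le lw.
Qed.

Lemma mfn_indic_lam s : s <= t -> mfn (fun w => \1_[set w | lfin alpha (z w) s] w * lam alpha (z w) s).
Proof.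
move=> st; apply: (@mfn_indic_cvg _ (fun n w => picard alpha (z w) n s) _ (measurable_lfin st)) => [n|w lw].
 exact: mp.
exact: (lam_cvg alpha0 N0 (cz w)).
Qed.

Let X w i s := refl alpha (lam alpha (z w)) (z w i) s.

(* No good time is missed: on [0, t] the sum of the reflected paths over each
  critical set A of particles is continuous, hence bounded away from 0. *)
Lemma lt_tau_star w : (t%:E < tau_star alpha (z w))%E <->
 lfin alpha (z w) t /\ forall A : {set 'I_N}, N%:R <= alpha * #|A|%:R ->
  exists n, forall q : rat, 0 <= (ratr q : R) <= t -> dy n <= \sum_(i in A) X w i (ratr q).
Proof.
have X0 i s : lfin alpha (z w) s -> 0 <= X w i s.
 by move=> ls; apply: refl_ge0 => //; exact: lam_mono.
split=> [tT|[lt H]].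
 have gd s : 0 <= s -> s <= t -> good alpha (z w) s.
  by move=> s0 st; apply: good_before; split=> //; apply: le_lt_trans tT; rewrite lee_fin.
 have lt : lfin alpha (z w) t by case: (gd t t0 (lexx t)). split=> // A NA.
 pose g s := lam alpha (z w) (minr s t). have cg : cpath g by exact: cpath_lam.
 have gX i s : s <= t -> refl alpha g (z w i) s = X w i s.
  move=> st; rewrite /X /refl /g min_l //; congr (_ + _).
  by apply: eq_phi => r rs; rewrite min_l // (le_trans rs).
 pose S s := \sum_(i in A) refl alpha g (z w i) s. have [cS _] : cpath S.
  rewrite /S; have := @cpath_sum R _ (enum A) (fun i s => refl alpha g (z w i) s).
  move=> /(_ (fun i => cpath_refl alpha cg (cz w i))).
  by congr cpath; apply/funext => s; rewrite big_enum.
 have [c /itvP ct cmin] := EVT_min t0 (continuous_subspaceT cS). have c0 : 0 <= c by rewrite ct.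
 have ctt : c <= t by rewrite ct. have lc : lfin alpha (z w) c by exact: lfin_le lt. have Sc : 0 < S c.
  rewrite lt_neqAle; apply/andP; split; last first.
   by apply: sumr_ge0 => i _; rewrite gX // X0.
  apply/negP => /eqP S0; have [_] := gd c c0 ctt; apply/negP; rewrite -leNgt.
  apply: (le_trans NA); apply: ler_wpM2l => //; rewrite ler_nat; apply: subset_leq_card.
  apply/fintype.subsetP => i iA; rewrite inE -/(X w i c) -gX //.
  have := S0; rewrite /S => /esym/eqP; rewrite psumr_eq0; last first.
   by move=> j _; rewrite gX // X0.
  by move=> /allP /(_ i (mem_index_enum i)); rewrite iA.
 have [n _ Hn] := dy_small Sc; exists n => q /andP[q0 qt]. apply: (le_trans (Hn n (leqnn n))).
 have := cmin (ratr q); rewrite in_itv /= q0 qt => /(_ isT) le.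
 apply: (le_trans le); rewrite /S le_eqVlt; apply/orP; left; apply/eqP.
 by apply: eq_bigr => i _; rewrite gX.
rewrite ltNge; apply/negP => Tt. have T0 := tau_star_ge0 alpha (z w).
have [s sE] : exists s, tau_star alpha (z w) = s%:E.
 by move: T0 Tt; case: (tau_star alpha (z w)) => // s _ _; exists s.
have bad := tau_star_bad alpha0 N0 (cz w) sE. have st : s <= t by rewrite -lee_fin -sE.
have s0 : 0 <= s by rewrite -lee_fin -sE. have ls : lfin alpha (z w) s by exact: lfin_le lt.
have NA : N%:R <= alpha * #|zeros alpha (z w) s|%:R.
 by rewrite leNgt; apply/negP => h; apply: bad.
have [n Hn] := H _ NA. have Xs i : i \in zeros alpha (z w) s -> X w i s = 0 by rewrite inE => /eqP.
move: s0; rewrite le_eqVlt => /orP[/eqP s0|s0].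
 have := Hn 0; rewrite rmorph0 lexx t0 => /(_ isT). rewrite big1; first by rewrite leNgt dy_gt0.
 by move=> i /Xs; rewrite -s0.
(* Just before s each particle of the critical set is at height at most (1 + alpha) e; N of them add
   up to [dy n / 4], below the claimed lower bound [dy n]. *)
have e0 : 0 < dy n / (4 * (alpha + 1) * N%:R) :> R.
 by rewrite divr_gt0 ?dy_gt0 // !mulr_gt0 // ?ltr0n // ltr_wpDl.
set e := dy n / _ in e0. have [h1 h10 H1] := lam_left alpha0 N0 (cz w) ls e0.
have [h2 h20 H2] := family_ucts t (cz w) e0. pose k := minr s (minr h1 h2).
have k0 : 0 < k by rewrite !lt_min s0 h10. have [q] : exists q : rat, ratr q \in `](s - k), s[.
 by apply: rat_in_itvoo; rewrite ltrBlDr ltrDl.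
rewrite in_itv /= => /andP[qk qs].
have [ks kh1 kh2] : [/\ k <= s, k <= h1 & k <= h2] by split; rewrite /k !ge_min lexx ?orbT.
have q0 : 0 <= ratr q :> R by lra. have qt : ratr q <= t by apply: le_trans st; exact: ltW.
have := Hn q; rewrite q0 qt => /(_ isT); rewrite leNgt => /negP; apply.
have Xq i : i \in zeros alpha (z w) s -> X w i (ratr q) <= e + alpha * e.
 move=> /Xs; rewrite /X /refl => Xi0.
 have lamq : lam alpha (z w) s - e < lam alpha (z w) (ratr q) by apply: H1; lra.
 have zq := H2 i (ratr q) s qt st. have dq : `|ratr q - s| < h2 by rewrite ltr0_norm ?subr_lt0 //; lra.
 have := zq dq; rewrite ltr_distl => /andP[_ z1].
 have ph := phi_mono alpha0 (lam_mono alpha0 N0 (cz w) ls) (cz w i) (ltW qs).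
 have al : alpha * (lam alpha (z w) s - e) <= alpha * lam alpha (z w) (ratr q).
  by apply: ler_wpM2l => //; exact: ltW.
 by rewrite mulrBr in al; lra.
apply: (@le_lt_trans _ _ (\sum_(i < N) (e + alpha * e))).
 rewrite big_mkcond; apply: ler_sum => i _; case: ifP => [/Xq//|_].
 by have e0' := ltW e0; apply: addr_ge0 => //; exact: mulr_ge0.
rewrite sumr_const card_ord -mulr_natr /e. have a1 : 0 < alpha + 1 by rewrite ltr_wpDl.
have NR : 0 < N%:R :> R by rewrite ltr0n.
have -> : (dy n / (4 * (alpha + 1) * N%:R) + alpha * (dy n / (4 * (alpha + 1) * N%:R))) * N%:R
  = dy n / 4 :> R.
 by field; rewrite !gt_eqF.
by have := @dy_gt0 R n; lra.
Qed.

Lemma measurable_lt_tau_star : measurable [set w | (t%:E < tau_star alpha (z w))%E].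
Proof.
pose F (q : rat) i w := \1_[set w | lfin alpha (z w) (ratr q)] w * X w i (ratr q).
rewrite (_ : [set _ | _] = [set w | lfin alpha (z w) t] `&`
  [set w | forall A : {set 'I_N}, N%:R <= alpha * #|A|%:R -> exists n : nat, forall q : rat,
   0 <= (ratr q : R) <= t -> [set w | dy n <= \sum_(i in A) F q i w] w]); last first.
 have E (A : {set 'I_N}) w (q : rat) : lfin alpha (z w) t -> 0 <= (ratr q : R) <= t ->
   \sum_(i in A) F q i w = \sum_(i in A) X w i (ratr q).
  move=> lt /andP[_ qt]; apply: eq_bigr => i _; rewrite /F indicE mem_set ?mul1r //=. exact: lfin_le lt.
 apply/seteqP; split=> w.
  move=> /= /lt_tau_star[lt H]; split=> // A NA; have [n Hn] := H A NA.
  by exists n => q qt; rewrite /= E //; exact: Hn.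
 move=> [/= lt H]; apply/lt_tau_star; split=> // A NA; have [n Hn] := H A NA.
 by exists n => q qt; rewrite -E //; exact: Hn.
apply: measurableI; first exact: measurable_lfin.
apply: measurable_all => A; apply: measurable_imp => _; apply: measurable_ex => n.
apply: measurable_all => q; apply: measurable_imp => /andP[_ qt]. apply: mfn_ge. have mF i : mfn (F q i).
 have -> : F q i = fun w => \1_[set w | lfin alpha (z w) (ratr q)] w * z w i (ratr q)
   - alpha * (\1_[set w | lfin alpha (z w) (ratr q)] w * lam alpha (z w) (ratr q))
   + \1_[set w | lfin alpha (z w) (ratr q)] w * phi alpha (lam alpha (z w)) (z w i) (ratr q).
  by apply/funext => w; rewrite /F /X /refl; ring.
 apply: measurable_funD; last exact: mfn_indic_phi_lam. apply: measurable_funB.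
  apply: measurable_funM; last exact: mz. by apply: mfn_indic; exact: measurable_lfin.
 by apply: measurable_funM; [exact: measurable_cst|exact: mfn_indic_lam].
have : mfn (fun w => \sum_(i <- enum A) F q i w) by exact: measurable_sum.
by congr mfn; apply/funext => w; rewrite big_enum.
Qed.

End minimal_solution.

(** * Fourth roots, eighth moments and absence of atoms *)

Section fourth_roots.
Context {R : realType} {d : measure_display} {Om : measurableType d}.
Variable P : probability Om R.
Implicit Type X : Om -> R.

Lemma mfn_root4 X : mfn X -> mfn (fun w => root4 (X w)).
Proof.
move=> mX; have ms : measurable_fun setT (@Num.sqrt R).
 by apply: continuous_measurable_fun; exact: sqrt_continuous.
by apply: (measurableT_comp ms); apply: (measurableT_comp ms).
Qed.

Lemma Ex_pow4_le X : mfn X -> igr P (fun w => X w ^+ 4) -> Ex P X ^+ 4 <= Ex P (fun w => X w ^+ 4).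
Proof.
move=> mX i4; have i2 := igr_pow mX i4 (isT : (2 <= 4)%N).
have i1 : igr P X by have := igr_pow mX i4 (isT : (1 <= 4)%N); under eq_fun do rewrite expr1.
apply: le_trans (Ex_sqr_le mX i4); rewrite (exprM _ 2 2).
apply: lerXn2r; rewrite ?nnegrE ?sqr_ge0 //; first by apply: Ex_ge0 => w; exact: sqr_ge0. set c := Ex P X.
have : 0 <= Ex P (fun w => X w ^+ 2 - (2 * c * X w - c ^+ 2)).
 apply: Ex_ge0 => w; have -> : X w ^+ 2 - (2 * c * X w - c ^+ 2) = (X w - c) ^+ 2 by ring.
 exact: sqr_ge0.
have i1' := igrZ (2 * c) i1; have ic := igr_cst P (c ^+ 2).
rewrite (ExB i2 (igrB i1' ic)) (ExB i1' ic) (ExZ _ i1) Ex_cst -/c; lra.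
Qed.

Lemma root4_moment X : (forall w, 0 <= X w) -> igr P X ->
 igr P (fun w => root4 (X w)) /\ Ex P (fun w => root4 (X w)) ^+ 4 <= Ex P X.
Proof.
move=> X0 iX; have X4 w : root4 (X w) ^+ 4 = X w by exact: root4E. have mr := mfn_root4 (igr_mfn iX).
have i4 : igr P (fun w => root4 (X w) ^+ 4) by under eq_fun do rewrite X4.
split; last by rewrite -(eq_Ex P X4); exact: Ex_pow4_le.
by have := igr_pow mr i4 (isT : (1 <= 4)%N); under eq_fun do rewrite expr1.
Qed.

End fourth_roots.

Section gaussian_complements.
Context {R : realType} {d : measure_display} {Om : measurableType d}.
Variable P : probability Om R.

(** The same device as for the fourth moment: (u / 4)^4 <= exp u for u = G^2 / (4 s^2), and the
    exponential has mean sqrt 2 <= 2. *)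
Lemma gauss_moment8 (s : R) G : gauss P s G -> igr P (fun w => G w ^+ 8) /\
 Ex P (fun w => G w ^+ 8) <= 2 * 16 ^+ 4 * s ^+ 8.
Proof.
move=> gG; have [s0 mG _] := gG; have sn : s != 0 by rewrite gt_eqF.
have q2 : (Num.sqrt 2 : R) ^+ 2 = 2 by rewrite sqr_sqrtr.
have q0 : 0 < Num.sqrt 2 :> R by rewrite sqrtr_gt0. have qle : Num.sqrt 2 <= 2 :> R by nra.
have [||ig E] := @gauss_exp _ _ _ _ _ _ gG ((4 * s ^+ 2)^-1) (Num.sqrt 2 * s).
- by rewrite mulr_gt0.
- by rewrite exprMn q2; field.
have mG8 : mfn (fun w => G w ^+ 8) by exact: measurable_funX.
have s8 : 0 <= s ^+ 8 by apply: exprn_ge0; exact: ltW.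
have key w : G w ^+ 8 <= 16 ^+ 4 * s ^+ 8 * expR ((4 * s ^+ 2)^-1 * G w ^+ 2).
 set u := (4 * s ^+ 2)^-1 * G w ^+ 2.
 have u0 : 0 <= u by rewrite mulr_ge0 ?sqr_ge0 // invr_ge0 mulr_ge0 ?sqr_ge0.
 have -> : G w ^+ 8 = 16 ^+ 4 * s ^+ 8 * (u / 4) ^+ 4.
  have -> : G w ^+ 8 = (G w ^+ 2) ^+ 4 by rewrite -exprM.
  have -> : G w ^+ 2 = 16 * s ^+ 2 * (u / 4) by rewrite /u; field. by rewrite 2!exprMn -(exprM s).
 apply: ler_wpM2l; first by apply: mulr_ge0 => //; apply: exprn_ge0.
 have -> : expR u = expR (u / 4) ^+ 4 by rewrite -expRM_natr; congr expR; field.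
 have u4 : 0 <= u / 4 by apply: divr_ge0. apply: lerXn2r; rewrite ?nnegrE ?expR_ge0 //.
 by apply: le_trans (expR_ge1Dx _); lra.
have ig8 : igr P (fun w => G w ^+ 8).
 apply: (@igr_dom _ _ _ _ _ _ mG8 (igrZ (16 ^+ 4 * s ^+ 8) ig)) => w.
 by rewrite ger0_norm // (_ : 8%N = (2 * 4)%N) // exprM exprn_ge0 // sqr_ge0.
split=> //; apply: (le_trans (Ex_le ig8 (igrZ _ ig) key)).
rewrite ExZ // E mulfK // (_ : 2 * 16 ^+ 4 * s ^+ 8 = 16 ^+ 4 * s ^+ 8 * 2); last by ring.
by apply: ler_wpM2l => //; apply: mulr_ge0 => //; apply: exprn_ge0.
Qed.

Lemma indep_atomless (s : R) X G : gauss P s G -> mfn X -> indepRV P X G ->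
 P [set w | X w + G w = 0] = 0%E.
Proof.
move=> gG mX ind; have [_ mG _] := gG. pose D : set (R * R) := [set p | p.1 + p.2 = 0].
have mD : measurable D.
 have -> : D = (fun p : R * R => p.1 + p.2) @^-1` [set 0] by [].
 have := @measurable_funD _ _ _ setT (fst : R * R -> R) snd measurable_fst measurable_snd.
 by move=> /(_ measurableT _ (measurable_set1 0)); rewrite setTI.
have mXG : measurable_fun setT (fun w => (X w, G w)) by exact: measurable_fun_pair.
pose X' : {mfun Om >-> R} := mfun_Sub (mem_set mX). pose G' : {mfun Om >-> R} := mfun_Sub (mem_set mG).
pose XG : {mfun Om >-> (R * R)%type} := mfun_Sub (mem_set mXG).
have E : (distribution P X' \x distribution P G')%E D = distribution P XG D.
 apply: product_measure_unique => // A B mA mB.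
rewrite -[LHS]/(distribution P XG D) -E /product_measure1. rewrite integral0_eq // => x _ /=.
have -> : xsection D x = [set - x].
 apply/seteqP; split=> y; rewrite /xsection /= inE /D /=; first by move=> /eqP; rewrite addrC addr_eq0 => /eqP.
 by move=> ->; rewrite subrr.
by rewrite /distribution /pushforward; exact: (gauss_atomless gG).
Qed.

End gaussian_complements.

Lemma pow_sum_le (R : realType) N (x : 'I_N -> R) k : ~~ odd k -> (0 < k)%N ->
 (\sum_i x i) ^+ k <= N%:R ^+ k * \sum_i x i ^+ k.
Proof.
move=> ek k0; case: N x => [|N] x; first by rewrite !big_ord0 expr0n gtn_eqF // mulr0.
have [i0 _ max] := @arg_maxP _ _ _ (@ord0 N) predT (fun i => `|x i|) isT.
have <- : `|\sum_i x i| ^+ k = (\sum_i x i) ^+ k by rewrite -normrX ger0_norm // exprn_even_ge0.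
apply: (@le_trans _ _ ((N.+1%:R * `|x i0|) ^+ k)).
 apply: lerXn2r; rewrite ?nnegrE ?mulr_ge0 //. apply: (le_trans (ler_norm_sum _ _ _)).
 have -> : N.+1%:R * `|x i0| = \sum_(i < N.+1) `|x i0| by rewrite sumr_const card_ord mulr_natl.
 by apply: ler_sum => i _; exact: max.
rewrite exprMn; apply: ler_wpM2l; first by apply: exprn_ge0.
rewrite -normrX ger0_norm ?exprn_even_ge0 // (bigD1 i0) //= lerDl.
by apply: sumr_ge0 => i _; exact: exprn_even_ge0.
Qed.

(** * Discrete walks: touching zero and occupation of low heights *)

Section discrete_touching.
Context {R : realType}.
Implicit Types (s : nat -> R).

Definition pos_upto s k := all (fun j => 0 <= s j) (iota 0 k.+1).
Definition low_upto (dl : R) s k := has (fun j => s j <= dl) (iota 0 k.+1).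
Definition touches dl s k := pos_upto s k && low_upto dl s k.

Lemma all_iotaS (p : pred nat) k : all p (iota 0 k.+2) = all p (iota 0 k.+1) && p k.+1.
Proof. by rewrite -[k.+2]addn1 iotaD all_cat /= andbT. Qed.

Lemma pos_uptoS s k : pos_upto s k.+1 = pos_upto s k && (0 <= s k.+1).
Proof. exact: all_iotaS. Qed.

Lemma low_uptoS dl s k : low_upto dl s k.+1 = low_upto dl s k || (s k.+1 <= dl).
Proof. by rewrite /low_upto -[k.+2]addn1 iotaD has_cat /= orbF. Qed.

Lemma pos_upto_last s k : pos_upto s k -> 0 <= s k.
Proof. by move=> /allP; apply; rewrite mem_iota add0n leqnn. Qed.

(* Start betting one unit at the first visit below dl and stop at the first
  negative value: the loss is at most dl plus one overshoot, whereas a walk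
  that stays nonnegative after the visit wins its final value minus dl. *)
Lemma touching_gain s (dl M : R) m : 0 <= dl -> 0 <= M -> (forall k, (k < m)%N -> `|s k.+1 - s k| <= M) ->
 forall k, (k <= m)%N ->
 let G := \sum_(j < k) (touches dl s j)%:R * (s j.+1 - s j) in
 (touches dl s k -> s k - dl <= G) /\ - dl - M <= G.
Proof.
move=> dl0 M0 step k km G. suff [H1 [H2 H3]] : (touches dl s k -> s k - dl <= G) /\
  ((pos_upto s k -> ~~ low_upto dl s k -> G = 0) /\ - dl - M <= G) by [].
rewrite /G {G}; elim: k km => [|k IH] km.
 rewrite big_ord0; split; last by split=> //; lra.
 by rewrite /touches /low_upto /= orbF => /andP[_ h]; lra.
have [IH1 [IH2 IH3]] := IH (ltnW km); rewrite big_ord_recr /=.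
have := step k km; rewrite ler_norml => /andP[st1 st2]. set G := \sum_(j < k) _ in IH1 IH2 IH3 *.
rewrite /touches pos_uptoS low_uptoS. case E : (touches dl s k); move: (E); rewrite /touches => E'.
 have /andP[pk lk] := E'; rewrite pk lk /= mul1r. have g1 := IH1 E; have sk := pos_upto_last pk.
 split; first by move=> _; lra. by split=> //; lra.
rewrite E' mul0r addr0; move/negbT: E'; rewrite negb_and => nE.
case: (boolP (pos_upto s k)) nE => //= pk lk. have G0 := IH2 pk lk; rewrite (negbTE lk) /= G0.
split; first by move=> /andP[_ h]; lra. by split=> //; lra.
Qed.

End discrete_touching.

Lemma ae_forall_count (R : realType) d (Om : measurableType d) (P : probability Om R)
  (I : countType) (Q : I -> Om -> Prop) :
 (forall i, {ae P, forall w, Q i w}) -> {ae P, forall w, forall i, Q i w}.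
Proof.
move=> H; have := @ae_foralln _ _ _ P (fun n w => if unpickle n is Some i then Q i w else True).
move=> K; apply: (filterS _ (K _)) => [w Hw i|n]; first by have := Hw (pickle i); rewrite pickleK.
by case: (unpickle n) => [i|]; [exact: H|exact: aeW].
Qed.

Section potential.
Context {R : realType}.
Implicit Types (s : nat -> R) (a x y : R).

Definition alive s k := all (fun j => 0 < s j) (iota 0 k.+1).

Lemma aliveS s k : alive s k.+1 = alive s k && (0 < s k.+1).
Proof. exact: all_iotaS. Qed.

Lemma alive_last s k : alive s k -> 0 < s k.
Proof. by move=> /allP; apply; rewrite mem_iota add0n leqnn. Qed.

(** A convex potential that vanishes above 8a and has second derivative 2 below: along a martingale
    its mean grows by the quadratic variation collected at low heights. *)
Definition pot a x := maxr 0 (8 * a - x) ^+ 2.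

Lemma pot_ge0 a x : 0 <= pot a x. Proof. exact: sqr_ge0. Qed.

Lemma pot_le a x M : 0 <= a -> 0 <= M -> - M <= x -> pot a x <= (8 * a + M) ^+ 2.
Proof.
move=> a0 M0 xM; rewrite /pot; apply: lerXn2r; rewrite ?nnegrE ?le_max ?lexx //; first lra.
by rewrite ge_max; apply/andP; split; lra.
Qed.

(** Below 8a this is the exact quadratic expansion. When x <= 5a and y jumps over the kink at 8a,
    then y >= 3a, so y^2 <= y^4 / (9 a^2) and the correction absorbs the loss. *)
Lemma pot_step a x y : 0 < a ->
 - 2 * maxr 0 (8 * a - x) * y + (x <= 5 * a)%R%:R * (y ^+ 2 - y ^+ 4 / (9 * a ^+ 2))
 <= pot a (x + y) - pot a x.
Proof.
move=> a0; rewrite /pot.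
have r0 : 0 <= y ^+ 4 / (9 * a ^+ 2) by rewrite divr_ge0 ?exprn_even_ge0 // mulr_ge0 ?sqr_ge0.
have y2 := sqr_ge0 y. have [m0|m0] := leP (8 * a - x) 0.
 rewrite (_ : (x <= 5 * a) = false) ?mulr0 ?mul0r ?expr0n /= ?subr0 ?addr0 ?sqr_ge0 //.
 by apply/negbTE; rewrite -ltNge; lra.
set m := 8 * a - x; rewrite -/m in m0. have -> : 8 * a - (x + y) = m - y by rewrite /m; ring.
have [ym|ym] := leP (m - y) 0; last first.
 have -> : (m - y) ^+ 2 - m ^+ 2 = - 2 * m * y + y ^+ 2 by ring.
 by rewrite lerD2l; case: (x <= 5 * a); rewrite ?mul1r ?mul0r //; lra.
rewrite expr0n /= sub0r; case: (boolP (x <= 5 * a)) => xa; last by rewrite mul0r addr0; nra.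
have ma : 3 * a <= m by rewrite /m; lra. rewrite mul1r; have : y ^+ 2 <= y ^+ 4 / (9 * a ^+ 2).
 rewrite ler_pdivlMr; last by rewrite mulr_gt0 // exprn_gt0.
 rewrite (exprD y 2 2); apply: ler_wpM2l => //. have ay : 3 * a <= y by lra. nra.
by move: (y ^+ 4 / _) => z; nra.
Qed.

(** The sum telescopes up to the first nonpositive value of s, which is at least -M. *)
Lemma exit_bound s a M m : 0 <= a -> 0 <= M -> (forall k, (k < m)%N -> `|s k.+1 - s k| <= M) ->
 \sum_(j < m) (alive s j)%:R * (pot a (s j.+1) - pot a (s j)) <= (8 * a + M) ^+ 2.
Proof.
move=> a0 M0 step.
suff H k : (k <= m)%N -> let G := \sum_(j < k) (alive s j)%:R * (pot a (s j.+1) - pot a (s j)) in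
  (alive s k -> G = pot a (s k) - pot a (s 0)) /\ G <= (8 * a + M) ^+ 2.
 by have [] := H m (leqnn m).
elim: k => [|k IH] km.
 by rewrite big_ord0 subrr; split=> //; exact: sqr_ge0.
have [IH1 IH2] := IH (ltnW km); rewrite big_ord_recr /= aliveS.
have := step k km; rewrite ler_norml => /andP[st1 _].
case: (boolP (alive s k)) IH1 => [ak /(_ isT) ->|_ _]; last by rewrite mul0r addr0; split.
have sk := alive_last ak; have p0 := pot_ge0 a (s 0).
have pk : pot a (s k.+1) <= (8 * a + M) ^+ 2 by apply: pot_le => //; lra. by rewrite mul1r; split; lra.
Qed.

End potential.

(** Markov's inequality and monotonicity in m bound the probability that the sequence ever reaches j
    + 1 by C / (j + 1). *)
Lemma ae_bounded (R : realType) d (Om : measurableType d) (P : probability Om R)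
  (F : nat -> Om -> R) (C : R) :
 (forall m, igr P (F m)) -> (forall m w, 0 <= F m w) -> (forall m w, F m w <= F m.+1 w) ->
 (forall m, Ex P (F m) <= C) -> {ae P, forall w, exists B, forall m, F m w <= B}.
Proof.
move=> iF F0 Fmono FC. pose E j m := [set w | j.+1%:R <= F m w].
have mE j m : measurable (E j m) by apply: mfn_ge; exact: igr_mfn (iF m). pose A j := \bigcup_m E j m.
have mA j : measurable (A j) by exact: bigcupT_measurable.
have C0 : 0 <= C by apply: le_trans (FC 0); exact: Ex_ge0.
have Fm w m m' : (m <= m')%N -> F m w <= F m' w.
 apply: (homo_leq (f := fun n => F n w) (r := <=%R)); [exact: lexx|exact: le_trans|].
 by move=> n; exact: Fmono.
have PA j : Pr P (A j) <= C / j.+1%:R.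
 have [_ cv] : igr P (\1_(A j) : Om -> R) /\ Ex P (\1_(E j m)) @[m --> \oo] --> Ex P (\1_(A j) : Om -> R).
  apply: (Ex_dct (F := fun m => \1_(E j m)) (g := cst 1)).
  - by move=> m; exact: mfn_indic.
  - exact: igr_cst.
  - by move=> m w; rewrite indicE; case: (_ \in _); rewrite ?normr1 ?normr0.
  - move=> w; apply: cvg_near_cst; case: (pselect (A j w)) => Aw.
    have [m _ Em] := Aw; exists m => // k /= mk; rewrite !indicE !mem_set //.
    exact: le_trans Em (Fm w _ _ mk).
   near=> m; rewrite !indicE !memNset // => Em; apply: Aw; by exists m.
 rewrite -Ex_indic //.
 have -> : Ex P (\1_(A j) : Om -> R) = limn (fun m => Ex P (\1_(E j m) : Om -> R)) by apply/esym/cvg_lim.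
 apply: limr_le; first by apply/cvg_ex; eexists; exact: cv.
 near=> m; rewrite Ex_indic //; apply: (le_trans (markov_ineq (ltr0Sn _ _) (iF m) (F0 m))).
 by rewrite ler_wpM2r ?invr_ge0.
pose A0 := \bigcap_j A j. have mA0 : measurable A0 by exact: bigcapT_measurable. have PA0 : Pr P A0 = 0.
 apply/eqP; rewrite eq_le Pr_ge0 andbT leNgt; apply/negP => p0. pose j := Num.truncn (C / Pr P A0).
 have le : Pr P A0 <= C / j.+1%:R.
  by apply: le_trans (PA j); apply: Pr_le => // w Aw; exact: Aw.
 have : C / Pr P A0 < j.+1%:R by exact: truncnS_gt.
 by rewrite ltr_pdivrMr // mulrC -ltr_pdivrMr // ltNge le.
exists A0; split=> //; first by rewrite -Pr_fin // PA0.
move=> w /= nB j _; apply: contrapT => Aw; apply: nB; exists j.+1%:R => m.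
by rewrite leNgt; apply/negP => h; apply: Aw; exists m => //; exact: ltW.
Unshelve. all: by end_near.
Qed.

Lemma geometric_half (R : realType) m : \sum_(n < m) (dy n : R) <= 2.
Proof.
have -> : \sum_(n < m) (dy n : R) = 2 - 2 * dy m.
 elim: m => [|m IH]; first by rewrite big_ord0 /dy expr0 invr1; lra.
 rewrite big_ord_recr /= IH /dy exprSr; field; exact: lt0r_neq0 (exprn_gt0 _ _).
by have := @dy_gt0 R m; lra.
Qed.

(** * Space and time scales for alpha = 1 *)

Section scale_sequences.
Context {R : realType}.

(** Heights a = 4^-n with time steps h = 64^-n = a^3. The exponent is a compromise: h^(1/2) must be
    small against a for [local_bound] to apply on a cell, while a^2 / h cells with oscillation
    h^(1/2) each must give a summable total. *)
Definition sc_a n : R := dy n ^+ 2.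
Definition sc_h n : R := dy n ^+ 6.
Definition sc_K (Q n : nat) := (Q * 64 ^ n)%N.

Lemma sc_a_gt0 n : 0 < sc_a n. Proof. exact: exprn_gt0 (dy_gt0 n). Qed.

Lemma sc_h_gt0 n : 0 < sc_h n. Proof. exact: exprn_gt0 (dy_gt0 n). Qed.

Lemma sc_h_pow n : sc_h n * (64 ^ n)%:R = 1.
Proof.
rewrite /sc_h /dy exprVn -exprM mulnC exprM (_ : 2 ^+ 6 = 64); last by rewrite -natrX.
by rewrite natrX mulVf // expf_neq0.
Qed.

End scale_sequences.

Section greedy.
Context {R : realType}.

(** From s go to the right end of a cell that covers s and pay [v n k] for it. The next point lies
    at the end of this cell, so no cell is paid twice; [T] keeps only the cells ending after s. All
    grids are contained in the finest one, so the number of finest cells left decreases. *)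
Lemma greedy_cover (g : R -> R) (h : nat -> R) (K : nat -> nat) (A : nat -> nat -> bool)
  (v : nat -> nat -> R) m t s0 :
 0 < h m -> (forall n, (n <= m)%N -> exists p : nat, h n = p%:R * h m) ->
 (forall n k, 0 <= v n k) -> 0 <= s0 -> s0 <= t ->
 (forall s, s0 <= s -> s <= t -> exists n k, [/\ (n <= m)%N, (k < K n)%N, A n k, s < k.+1%:R * h n &
   forall u, s <= u -> u <= t -> u <= k.+1%:R * h n -> g u - g s <= v n k]) ->
 g t - g s0 <= \sum_(n < m.+1) \sum_(k < K n) (A n k)%:R * v n k.
Proof.
move=> hm hE v0 s00 s0t cover. pose T s n k := (s < k.+1%:R * h n)%R%:R * ((A n k)%:R * v n k).
have T0 s n k : 0 <= T s n k by rewrite !mulr_ge0 // ler0n. suff H M s : s0 <= s -> s <= t ->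
  (Num.truncn (t / h m) <= Num.truncn (s / h m) + M)%N ->
  g t - g s <= \sum_(n < m.+1) \sum_(k < K n) T s n k.
 apply: le_trans (H (Num.truncn (t / h m)) s0 (lexx s0) s0t (leq_addl _ _)) _.
 apply: ler_sum => n _; apply: ler_sum => k _; rewrite /T.
 by case: (_ < _)%R; rewrite ?mul1r ?mul0r // mulr_ge0 // ler0n.
elim: M s => [|M IH] s s0s st HM. all: have [n [k [nm kK Ank sk Hu]]] := cover s s0s st.
all: have nm' : (n < m.+1)%N by []. all: have T1 : T s n k = v n k by rewrite /T sk Ank !mul1r.
all: have Tle : v n k <= \sum_(n < m.+1) \sum_(k < K n) T s n k
 by rewrite (bigD1 (Ordinal nm')) //= (bigD1 (Ordinal kK)) //= T1 -addrA lerDl addr_ge0 //;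
   apply: sumr_ge0 => ? _ //; apply: sumr_ge0.
all: have [tk|kt] := leP t (k.+1%:R * h n); first by apply: le_trans (Hu t st (lexx t) tk) Tle.
all: have [p hnE] := hE n nm.
all: have uE : k.+1%:R * h n = (k.+1 * p)%:R * h m by rewrite hnE natrM mulrA.
all: have lt : (Num.truncn (s / h m) < k.+1 * p)%N
 by rewrite truncn_lt_nat ?divr_ge0 ?(ltW hm) ?(le_trans s00) // ltr_pdivrMr // -uE.
all: have ge : (k.+1 * p <= Num.truncn (k.+1%:R * h n / h m))%N by rewrite uE mulfK ?gt_eqF // natrK.
 have := leq_trans lt (leq_trans ge _); rewrite addn0 in HM.
 have le : (Num.truncn (k.+1%:R * h n / h m) <= Num.truncn (t / h m))%N.
  by apply: le_truncn; rewrite ler_pM2r ?invr_gt0 // ltW.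
 by move=> /(_ _ le); rewrite ltnNge HM.
set u := k.+1%:R * h n in sk Hu kt uE ge. have := IH u (le_trans s0s (ltW sk)) (ltW kt).
have -> : (Num.truncn (t / h m) <= Num.truncn (u / h m) + M)%N.
 by apply: (leq_trans HM); rewrite addnS -addSn leq_add2r; exact: leq_trans lt ge.
move=> /(_ isT) H1; have H2 := Hu u (ltW sk) (ltW kt) (lexx u).
suff : v n k + \sum_(n < m.+1) \sum_(k < K n) T u n k <= \sum_(n < m.+1) \sum_(k < K n) T s n k.
 by move: H1 H2; lra.
have Tm n' k' : T u n' k' <= T s n' k'.
 rewrite /T; apply: ler_wpM2r; first by rewrite mulr_ge0 // ler0n.
 rewrite ler_nat; case: (boolP (u < _)) => // uk. by rewrite (lt_trans sk uk).
rewrite [X in _ + X](bigD1 (Ordinal nm')) //= [leRHS](bigD1 (Ordinal nm')) //= addrA.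
apply: lerD; last by apply: ler_sum => i _; apply: ler_sum => j _; exact: Tm.
rewrite [X in _ + X](bigD1 (Ordinal kK)) //= [leRHS](bigD1 (Ordinal kK)) //= addrA.
apply: lerD; last by apply: ler_sum => j _; exact: Tm. by rewrite T1 /T -/u ltxx mul0r addr0.
Qed.

End greedy.

Section grid_chaining.
Context {R : realType}.
Local Notation a n := (@sc_a R n).
Local Notation h n := (@sc_h R n).

Lemma dyS n : dy n = 2 * dy n.+1 :> R.
Proof. by rewrite /dy [2 ^+ n.+1]exprSr; field; rewrite gt_eqF // exprn_gt0. Qed.

Lemma sc_aS n : a n = 4 * a n.+1.
Proof. by rewrite /sc_a dyS; ring. Qed.

Lemma sc_hS n : h n = 64 * h n.+1.
Proof. by rewrite /sc_h dyS; ring. Qed.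

Lemma sc_h_scale n p : h n = (64 ^ p)%:R * h (n + p).
Proof.
elim: p => [|p IH]; first by rewrite addn0 mul1r. by rewrite addnS expnS mulnC natrM -mulrA -sc_hS.
Qed.

Variables (Q n1 : nat) (c : R) (y : R -> R).
Hypothesis c0 : 0 <= c.
Hypothesis cy : cpath y.
Hypothesis inc : forall n, (n1 <= n)%N -> forall k, (k < sc_K Q n)%N ->
 `|y (k.+1%:R * h n) - y (k%:R * h n)| <= c * a n.

Lemma sc_KD n p : sc_K Q (n + p) = (sc_K Q n * 64 ^ p)%N.
Proof. by rewrite /sc_K expnD mulnA. Qed.

Lemma grid_run n j r : (n1 <= n)%N -> (j + r <= sc_K Q n)%N ->
 `|y ((j + r)%:R * h n) - y (j%:R * h n)| <= r%:R * (c * a n).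
Proof.
move=> n1n; elim: r => [|r IH] jr; first by rewrite addn0 subrr normr0 mul0r.
have := IH (ltnW (leq_trans _ jr)); rewrite addnS ltnSn => /(_ isT) H1.
have := inc n1n (leq_trans _ jr) (k := j + r); rewrite addnS ltnSn => /(_ isT) H2.
rewrite -[r.+1%:R]natr1 mulrDl mul1r.
have -> : y ((j + r).+1%:R * h n) - y (j%:R * h n) = (y ((j + r).+1%:R * h n) - y ((j + r)%:R * h n))
  + (y ((j + r)%:R * h n) - y (j%:R * h n)) by rewrite addrA subrK.
by apply: (le_trans (ler_normD _ _)); rewrite addrC lerD.
Qed.

(** Each refinement has at most 64 steps of size c a' with a' the finer height, and 64 a' is 64/3
    times the drop of a from one level to the next, so the levels telescope. *)
Lemma grid_levels n k p j : (n1 <= n)%N -> (k < sc_K Q n)%N ->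
 (k * 64 ^ p <= j)%N -> (j <= k.+1 * 64 ^ p)%N ->
 `|y (j%:R * h (n + p)) - y (k%:R * h n)| <= c * (64 / 3 * (a n - a (n + p)) + a n).
Proof.
move=> n1n kK; elim: p j => [|p IH] j kj jk.
 rewrite addn0 subrr mulr0 add0r; rewrite expn0 !muln1 in kj jk. have [->|nj] := eqVneq j k.
  by rewrite subrr normr0 mulr_ge0 // ltW // sc_a_gt0.
 have -> : j = k.+1 by apply/eqP; rewrite eqn_leq jk ltn_neqAle eq_sym nj. exact: inc.
pose i := (j %/ 64)%N; pose r := (j %% 64)%N. have jE : j = (i * 64 + r)%N by exact: divn_eq.
have r64 : (r < 64)%N by exact: ltn_pmod.
have ki : (k * 64 ^ p <= i)%N by rewrite leq_divRL // -mulnA -expnSr. have ik : (i <= k.+1 * 64 ^ p)%N.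
 by rewrite -(leq_pmul2r (isT : (0 < 64)%N)) -mulnA -expnSr; apply: leq_trans jk; exact: leq_trunc_div.
have H1 := IH i ki ik.
have H2 : `|y (j%:R * h (n + p.+1)) - y ((i * 64)%:R * h (n + p.+1))| <= r%:R * (c * a (n + p.+1)).
 rewrite {1}jE; apply: grid_run; first by rewrite (leq_trans n1n) // leq_addr.
 by rewrite -jE sc_KD (leq_trans jk) // leq_mul2r kK orbT.
have e : (i * 64)%:R * h (n + p.+1) = i%:R * h (n + p).
 by rewrite natrM -mulrA addnS -sc_hS.
rewrite e in H2; have -> : y (j%:R * h (n + p.+1)) - y (k%:R * h n) =
  (y (j%:R * h (n + p.+1)) - y (i%:R * h (n + p))) + (y (i%:R * h (n + p)) - y (k%:R * h n)).
 by rewrite addrA subrK.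
apply: (le_trans (ler_normD _ _)). have r64R : r%:R <= 64 :> R by rewrite ler_nat ltnW.
have a1 := @sc_a_gt0 R (n + p.+1). have H3 : r%:R * (c * a (n + p.+1)) <= 64 * (c * a (n + p.+1)).
 by apply: ler_wpM2r => //; apply: mulr_ge0 => //; exact: ltW.
apply: (le_trans (lerD (le_trans H2 H3) H1)).
rewrite addnS in a1 *; rewrite (sc_aS (n + p)) le_eqVlt; apply/orP; left; apply/eqP. by field.
Qed.

(** Any t in the cell is approached by points of finer grids, and 64/3 + 1 <= 23. *)
Lemma grid_osc n k t : (n1 <= n)%N -> (k < sc_K Q n)%N ->
 k%:R * h n <= t -> t <= k.+1%:R * h n -> `|y t - y (k%:R * h n)| <= 23 * (c * a n).
Proof.
move=> n1n kK kt tk; have t0 : 0 <= t.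
 by apply: le_trans kt; apply: mulr_ge0 => //; apply: ltW; exact: sc_h_gt0.
have an := @sc_a_gt0 R n.
apply/ler_addgt0Pr => e e0; have [cc _] := cy; have [dl dl0 H] := cts_dist (cc t) e0.
have [p Hp] : exists p, h (n + p) < dl.
 have [m _ Hm] := dy_small (divr_gt0 dl0 (ltr0Sn R 1)).
 exists m; have := Hm (n + m)%N; rewrite /= leq_addl => /(_ isT) dm.
 apply: (@le_lt_trans _ _ (dy (n + m))); last by move: dm dl0; lra. have y0 := @dy_gt0 R (n + m).
 have y1 : dy (n + m) <= 1 :> R by rewrite /dy invf_le1 ?exprn_gt0 // exprn_ege1 // ler1n.
 by rewrite /sc_h exprS ger_pMr // exprn_ile1 // ltW.
have hp := @sc_h_gt0 R (n + p); pose j := Num.truncn (t / h (n + p)).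
have /andP[j1 j2] : j%:R <= t / h (n + p) < j.+1%:R by apply: truncn_itv; rewrite divr_ge0 // ltW.
rewrite ler_pdivlMr // in j1; rewrite ltr_pdivrMr // in j2. have kj : (k * 64 ^ p <= j)%N.
 rewrite -ltnS -(ltr_nat R) -(ltr_pM2r hp); apply: le_lt_trans j2. by rewrite natrM -mulrA -sc_h_scale.
have jk : (j <= k.+1 * 64 ^ p)%N.
 rewrite -(ler_nat R) -(ler_pM2r hp); apply: (le_trans j1). by rewrite natrM -mulrA -sc_h_scale.
have H1 := grid_levels n1n kK kj jk. have H2 : `|y (j%:R * h (n + p)) - y t| < e.
 apply: H; rewrite ler0_norm ?subr_le0 // opprB; apply: le_lt_trans Hp.
 by rewrite lerBlDr; apply: ltW; move: j2; rewrite -natr1 mulrDl mul1r addrC.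
rewrite distrC in H2.
have -> : y t - y (k%:R * h n) = (y t - y (j%:R * h (n + p))) + (y (j%:R * h (n + p)) - y (k%:R * h n)).
 by rewrite addrA subrK.
apply: (le_trans (ler_normD _ _)); rewrite addrC; apply: lerD; last exact: ltW.
apply: (le_trans H1); rewrite mulrCA; apply: ler_wpM2l => //. by have := @sc_a_gt0 R (n + p); lra.
Qed.

End grid_chaining.

Section local_bound.
Context {R : realType}.
Variables (alpha : R) (N : nat) (z : 'I_N -> R -> R).
Hypothesis a1 : alpha = 1.
Hypothesis N0 : (0 < N)%N.
Hypothesis cz : forall i, cpath (z i).

Let a0 : 0 <= alpha. Proof. by rewrite a1. Qed.

(* Some particle is at height at least S / N, so it needs no local time as long
  as the mean path has grown by less than that; the others then cannot make
  the mean path grow much. *)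
Lemma local_bound f K s u k : cpath f -> mono_to f K ->
 (forall r, r <= K -> f r = avg_phi alpha z f r) -> s <= u -> u <= K -> 0 <= k ->
 (forall i r, s <= r -> r <= u -> `|z i r - z i s| <= k) ->
 (N%:R + 1) * k < (\sum_(i < N) refl alpha f (z i) s) / N%:R ->
 f u - f s <= N%:R * k.
Proof.
move=> [cf ff] mf fE su uK k0 osc big. have NR : 0 < N%:R :> R by rewrite ltr0n.
have sK := le_trans su uK. have msK := mono_to_le sK mf. set S := \sum_(i < N) _ in big.
have [i0 Hi0] : exists i0, S / N%:R <= refl alpha f (z i0) s.
 apply: contrapT => H. have : S < \sum_(i < N) S / N%:R.
  apply: ltr_sum => [|i _]; first by apply/hasP; exists (Ordinal N0) => //; rewrite mem_index_enum.
  by rewrite ltNge; apply/negP => h; apply: H; exists i.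
 by rewrite sumr_const card_ord -[_ *+ _]mulr_natr divfK ?gt_eqF // ltxx.
rewrite leNgt; apply/negP => big2. have NkS : N%:R * k < S / N%:R - k by move: big; lra.
(* By continuity f would pass through f s + y with N k < y < S / N - k. By then [i0] has gained no
   local time and each other particle at most y + k, so N y <= (N - 1)(y + k), contradicting y > N
   k. *)
pose y := (N%:R * k + minr (f u - f s) (S / N%:R - k)) / 2. have y1 : N%:R * k < y.
 by rewrite /y; case: (leP (f u - f s) (S / N%:R - k)) => h; move: big2 NkS h; lra.
have y2 : y < f u - f s.
 by rewrite /y; case: (leP (f u - f s) (S / N%:R - k)) => h; move: big2 NkS h; lra.
have y3 : y + k < S / N%:R.
 by rewrite /y; case: (leP (f u - f s) (S / N%:R - k)) => h; move: big2 NkS h; lra.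
have y0 : 0 <= y by apply: le_trans (ltW y1); apply: mulr_ge0 => //; exact: ltW.
have [r /itvP rI fr] : exists2 r, r \in `[s, u] & f r = f s + y.
 apply: IVT => //; first by apply: continuous_subspaceT. have fsu : f s <= f u by apply: mf.
 by rewrite min_l // max_r //; apply/andP; split; [rewrite lerDl|move: y2; lra].
have sr : s <= r by rewrite rI. have ru : r <= u by rewrite rI.
have rK := le_trans ru uK; have mrK := mono_to_le rK mf.
have step (i : 'I_N) : phi alpha f (z i) r <= phi alpha f (z i) s + (y + k).
 have := phi_left_step a0 mrK (cz i) sr (o := k).
 rewrite a1 mul1r fr [f s + y]addrC addrK -addrA; apply => // v sv vr.
 have := osc i v (ltW sv) (le_trans vr ru); rewrite ler_norml => /andP[h _]; lra.
have step0 : phi alpha f (z i0) r <= phi alpha f (z i0) s.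
 have p0 := phi_ge0 a0 msK (cz i0). apply: (runsup_step sr _ (lexx _)); first exact: phi_ubd.
 move=> v sv vr; have fv : f v <= f s + y by rewrite -fr; exact: mrK.
 have := osc i0 v (ltW sv) (le_trans vr ru); rewrite ler_norml => /andP[h _].
 have al (x : R) : alpha * x = x by rewrite a1 mul1r.
 by rewrite -/(phi alpha f (z i0) s) al; move: Hi0 y3; rewrite /refl al; lra.
have E v : v <= K -> \sum_(i < N) phi alpha f (z i) v = f v * N%:R.
 by move=> vK; rewrite [in RHS]fE // /avg_phi divfK // gt_eqF.
have : \sum_(i < N) phi alpha f (z i) r <= \sum_(i < N) (phi alpha f (z i) s + (y + k)) - (y + k).
 rewrite (bigD1 i0) //= [X in _ <= X - _](bigD1 i0) //= addrAC; apply: lerD.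
  by rewrite addrK.
 by apply: ler_sum => i _; exact: step.
rewrite big_split /= !E // fr sumr_const card_ord -[_ *+ N]mulr_natr mulrDl => H.
have : N%:R * k <= y * N%:R - k - y + y by move: H; lra. by move: H y1; lra.
Qed.

End local_bound.

(** * Stopped paths and their left limits *)

Section stopped_paths.
Context {R : realType}.
Implicit Types (T : \bar R) (f g : R -> R).

Definition path_cts T f := forall t, before T t -> forall e : R, 0 < e ->
 exists2 h : R, 0 < h & forall s, before T s -> `|s - t| < h -> `|f s - f t| < e.

Lemma path_right T f t (e : R) : path_cts T f -> before T t -> 0 < e ->
 exists2 h : R, 0 < h & forall s, t <= s -> s < t + h -> before T s /\ `|f s - f t| < e.
Proof.
move=> cf bt e0; have [h h0 H] := cf t bt e e0; have [K [bK tK HK]] := before_around bt.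
exists (minr h (K - t)); first by rewrite lt_min h0 subr_gt0.
move=> s ts; rewrite addr_minr lt_min => /andP[s1 s2]. have t0 : 0 <= t by case: bt. have bs : before T s.
 apply: before_le bK; first exact: le_trans ts. by rewrite addrCA subrr addr0 in s2; exact: ltW.
by split=> //; apply: H => //; rewrite ger0_norm ?subr_ge0 // ltrBlDl.
Qed.

Lemma path_cts_mean N T (F : 'I_N -> R -> R) : (0 < N)%N ->
 (forall i, {within before T, continuous (F i)}) ->
 path_cts T (fun t => (\sum_(i < N) F i t) / N%:R).
Proof.
move=> N0 cF t bt e e0; have NR : 0 < N%:R :> R by rewrite ltr0n.
have c (r : seq 'I_N) : {within before T, continuous (fun t => \sum_(j <- r) F j t)}.
 elim: r => [|i r IH].
  have -> : (fun t : R => \sum_(j <- [::] : seq 'I_N) F j t) = (fun=> 0).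
   by apply: funext => u; rewrite big_nil.
  by move=> s; exact: cvg_cst.
 have -> : (fun t => \sum_(j <- i :: r) F j t) = (fun t => F i t + \sum_(j <- r) F j t).
  by apply: funext => u; rewrite big_cons.
 by move=> s; apply: cvgD; [exact: cF|exact: IH].
have [h h0 H] := within_cts_dist (c (index_enum 'I_N)) bt (mulr_gt0 e0 NR); exists h => // s bs st.
by rewrite -mulrBl normrM (gtr0_norm (_ : 0 < N%:R^-1)) ?invr_gt0 // ltr_pdivrMr //; exact: H.
Qed.

(* The oscillation of f just before its lifetime, tested on rationals only. *)
Definition rat_cauchy T f := forall n, exists q : rat, (0 <= ratr q :> R) /\
 ((ratr q)%:E < T)%E /\ forall r : rat, ratr q < ratr r :> R -> forall r' : rat,
 ratr q < ratr r' :> R -> ((ratr r)%:E < T)%E -> ((ratr r')%:E < T)%E ->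
 `|f (ratr r) - f (ratr r')| <= dy n.

Definition rat_above T f (c : R) := exists n, exists q : rat, (0 <= ratr q :> R) /\
 ((ratr q)%:E < T)%E /\ forall r : rat, ratr q < ratr r :> R ->
 ((ratr r)%:E < T)%E -> c + dy n <= f (ratr r).

Lemma rat_approx T f s (p e : R) : path_cts T f -> 0 <= p -> p < s -> (s%:E < T)%E ->
 0 < e -> exists r : rat, [/\ p < ratr r, ((ratr r)%:E < T)%E & `|f (ratr r) - f s| < e].
Proof.
move=> cf p0 ps sT e0; have bs : before T s by split=> //; apply: ltW; exact: le_lt_trans ps.
have [h h0 H] := path_right cf bs e0.
have [r] : exists r : rat, ratr r \in `]s, (s + h)[ by apply: rat_in_itvoo; rewrite ltrDl.
rewrite in_itv /= => /andP[sr rh]; have [[_ rT] d] := H (ratr r) (ltW sr) rh.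
by exists r; split=> //; exact: lt_trans sr.
Qed.

Lemma left_limit_rat (u v a e : R) f : f s @[s --> u^'-] --> v -> a < u -> 0 < e ->
 exists q : rat, [/\ a < ratr q, ratr q < u & forall s, ratr q <= s -> s < u -> `|v - f s| < e].
Proof.
move=> cv au e0; have [k /= k0 Hk] := (@cvgr_dist_lt _ _ _ _ _ _ _ cv _ e0).
have [q] : exists q : rat, ratr q \in `](maxr a (u - k)), u[.
 by apply: rat_in_itvoo; rewrite gt_max au ltrBlDr ltrDl.
rewrite in_itv /= gt_max => /andP[/andP[qa qk] qu]; exists q; split=> // s qs su.
by apply: Hk => //=; rewrite gtr0_norm ?subr_gt0 // ltrBlDl -ltrBlDr; apply: lt_le_trans qs.
Qed.

Lemma left_cvgP (u : R) f : 0 < u -> path_cts u%:E f -> cvg (f s @[s --> u^'-]) <-> rat_cauchy u%:E f.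
Proof.
move=> u0 cf; split.
 move=> /cvg_ex[v cv] n; have d2 : 0 < dy n / 2 :> R by rewrite divr_gt0 ?dy_gt0.
 have [q [q0 qu near]] := left_limit_rat cv u0 d2.
 exists q; split; [exact: ltW|split; [by rewrite lte_fin|]] => r qr r' qr'. rewrite !lte_fin => ru ru'.
 have n1 := near _ (ltW qr) ru; have n2 := near _ (ltW qr') ru'; rewrite distrC in n1.
 have -> : f (ratr r) - f (ratr r') = (f (ratr r) - v) + (v - f (ratr r')) by rewrite addrA subrK.
 by apply: (le_trans (ler_normD _ _)); move: n1 n2; lra.
move=> H; apply/cauchy_cvgP; apply: cauchy_exP => e e0. have e4 : 0 < e / 4 by rewrite divr_gt0.
have [n _ /(_ n (leqnn n)) dn] := dy_small e4.
have [q [q0 [qu Hq]]] := H n; have qu' := qu; rewrite lte_fin in qu'.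
pose s0 := (ratr q + u) / 2; have qs0 : ratr q < s0 by rewrite /s0; lra.
have s0u : s0 < u by rewrite /s0; lra.
exists (f s0); suff : \forall s \near u^'-, ball (f s0) e (f s) by []. near=> s.
have qs : ratr q < s by near: s; exact: nbhs_left_gt. have su : s < u by near: s; exact: nbhs_left_lt.
have s0E : (s0%:E < u%:E)%E by rewrite lte_fin. have sE : (s%:E < u%:E)%E by rewrite lte_fin.
have [r1 [a1 b1 c1]] := rat_approx cf q0 qs0 s0E e4. have [r2 [a2 b2 c2]] := rat_approx cf q0 qs sE e4.
have h := Hq r1 a1 r2 a2 b1 b2; rewrite /ball /= distrC in c1 *.
have -> : f s0 - f s = (f s0 - f (ratr r1)) + (f (ratr r1) - f (ratr r2)) + (f (ratr r2) - f s).
 by ring.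
have t1 := ler_normD (f s0 - f (ratr r1) + (f (ratr r1) - f (ratr r2))) (f (ratr r2) - f s).
have t2 := ler_normD (f s0 - f (ratr r1)) (f (ratr r1) - f (ratr r2)).
by move: t1 t2 c1 c2 h dn e0; rewrite /=; lra.
Unshelve. all: by end_near.
Qed.

Lemma left_limP (u c : R) f : 0 < u -> path_cts u%:E f -> rat_cauchy u%:E f ->
 c < lim (f s @[s --> u^'-]) <-> rat_above u%:E f c.
Proof.
move=> u0 cf /(left_cvgP u0 cf) cv; set v := lim _; have {}cv : f s @[s --> u^'-] --> v by exact: cv.
split=> [cv'|[n [q [q0 [qu Hq]]]]].
 have e0 : 0 < (v - c) / 2 by rewrite divr_gt0 // subr_gt0.
 have [n _ /(_ n (leqnn n)) dn] := dy_small e0. have [q [q0 qu near]] := left_limit_rat cv u0 e0.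
 exists n, q; split; [exact: ltW|split; [by rewrite lte_fin|]] => r qr.
 rewrite lte_fin => ru; have := near _ (ltW qr) ru. by rewrite ltr_norml => /andP[_ h]; move: dn h; lra.
have d0 := @dy_gt0 R n; have qu' := qu; rewrite lte_fin in qu'. suff : c + dy n <= v by lra.
apply/ler_addgt0Pr => e e0; have e2 : 0 < e / 2 by rewrite divr_gt0.
have [s [qs su near]] := left_limit_rat cv qu' e2. have h1 := Hq s qs; have := near _ (lexx _) su.
rewrite ltr_norml => /andP[h2 _]; move: h1; rewrite lte_fin su => /(_ isT). by move: h2; lra.
Qed.

Lemma stopped_right T f t (e : R) : path_cts T f -> 0 <= t -> 0 < e ->
 exists2 h : R, 0 < h & forall s, t <= s -> s < t + h -> `|stopped T f s - stopped T f t| < e.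
Proof.
move=> cf t0 e0; have [tT|Tt] := ltP t%:E T.
 have [h h0 H] := path_right cf (conj t0 tT) e0; exists h => // s ts sh.
 by have [[_ sT] d] := H s ts sh; rewrite /stopped sT tT.
exists 1 => // s ts _; have Ts : (T <= s%:E)%E by rewrite (le_trans Tt) // lee_fin.
have nlt (r : R) : (T <= r%:E)%E -> (r%:E < T)%E = false by move=> h; apply/negbTE; rewrite -leNgt.
rewrite /stopped !nlt //; by rewrite subrr normr0.
Qed.

End stopped_paths.

Section measurable_stopped.
Context {R : realType} {d : measure_display} {Om : measurableType d}.
Variables (tau : Om -> \bar R) (m : Om -> R -> R).
Hypothesis tau0 : forall w, (0 <= tau w)%E.
Hypothesis mtau : forall t, 0 <= t -> measurable [set w | (tau w <= t%:E)%E].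
Hypothesis mm : forall t (B : set R), 0 <= t -> measurable B ->
 measurable [set w | (t%:E < tau w)%E /\ B (m w t)].
Hypothesis cm : forall w, path_cts (tau w) (m w).

Let mlt t : measurable [set w | (t%:E < tau w)%E].
Proof.
have [t0|t0] := leP 0 t.
 have -> : [set w | (t%:E < tau w)%E] = ~` [set w | (tau w <= t%:E)%E].
  by apply/seteqP; split=> w /=; rewrite ltNge => /negP.
 by apply: measurableC; exact: mtau.
have -> : [set w | (t%:E < tau w)%E] = setT; last exact: measurableT.
by apply/seteqP; split=> w //= _; apply: lt_le_trans (tau0 w); rewrite lte_fin.
Qed.

Let D t w : R := \1_[set w | (t%:E < tau w)%E] w * m w t.

Let mD t : 0 <= t -> mfn (D t).
Proof.
move=> t0; apply: mfn_of_gt => c.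
have -> : [set w | c < D t w] = [set w | (t%:E < tau w)%E /\ [set x | c < x] (m w t)] `|`
  (~` [set w | (t%:E < tau w)%E] `&` [set w | c < 0]).
 apply/seteqP; split=> w; rewrite /= /D indicE.
  by case: (boolP (w \in _)) => [/set_mem /= h|/negP h]; rewrite ?mul1r ?mul0r => h';
   [left|right; split=> // h2; apply: h; exact: mem_set].
 move=> [[h1 h2]|[h1 h2]]; first by rewrite mem_set ?mul1r. by rewrite memNset ?mul0r.
apply: measurableU; first by apply: mm => //; rewrite -set_itvoy; exact: measurable_itv.
apply: measurableI; first exact: measurableC.
by have [c0|c0] := pselect (c < 0); [have -> : [set w : Om | c < 0] = setT by apply/seteqP; split|
 have -> : [set w : Om | c < 0] = set0 by apply/seteqP; split].
Qed.

Let m2 (r : rat) (A : set Om) : measurable A -> measurable [set w | ((ratr r)%:E < tau w)%E -> A w].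
Proof.
move=> mA; have -> : [set w | ((ratr r)%:E < tau w)%E -> A w] =
  ~` [set w | ((ratr r)%:E < tau w)%E] `|` A.
 apply/seteqP; split=> w /=; last by case.
 by move=> H; have [h|h] := pselect ((ratr r)%:E < tau w)%E; [right; exact: H|left].
by apply: measurableU => //; exact: measurableC.
Qed.

Lemma measurable_rat_cauchy : measurable [set w | rat_cauchy (tau w) (m w)].
Proof.
apply: measurable_all => n; apply: measurable_ex => q.
apply: measurable_and => q0; apply: measurableI; first exact: mlt.
apply: measurable_all => r; apply: measurable_imp => qr.
apply: measurable_all => r'; apply: measurable_imp => qr'.
have r0 : 0 <= ratr r :> R by apply: le_trans (ltW qr).
have r0' : 0 <= ratr r' :> R by apply: le_trans (ltW qr').
rewrite [X in measurable X](_ : _ = [set w | ((ratr r)%:E < tau w)%E ->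
  ((ratr r')%:E < tau w)%E -> `|D (ratr r) w - D (ratr r') w| <= dy n]); last first.
 by apply/seteqP; split=> w H h h'; have := H h h'; rewrite /D !indicE !mem_set ?mul1r.
apply: (@m2 r [set w | ((ratr r')%:E < tau w)%E -> `|D (ratr r) w - D (ratr r') w| <= dy n]).
apply: (@m2 r' [set w | `|D (ratr r) w - D (ratr r') w| <= dy n]).
by apply: mfn_le; apply: measurableT_comp => //; apply: measurable_funB; exact: mD.
Qed.

Lemma measurable_rat_above c : measurable [set w | rat_above (tau w) (m w) c].
Proof.
apply: measurable_ex => n; apply: measurable_ex => q.
apply: measurable_and => q0; apply: measurableI; first exact: mlt.
apply: measurable_all => r; apply: measurable_imp => qr.
have r0 : 0 <= ratr r :> R by apply: le_trans (ltW qr).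
rewrite [X in measurable X](_ : _ = [set w | ((ratr r)%:E < tau w)%E ->
  c + dy n <= D (ratr r) w]); last first.
 by apply/seteqP; split=> w H h; have := H h; rewrite /D !indicE !mem_set ?mul1r.
apply: (@m2 r [set w | c + dy n <= D (ratr r) w]). by apply: mfn_ge; exact: mD.
Qed.

(** Where the left limit at tau does not exist, [lim] returns 0; hence the case distinction by
    [rat_cauchy], next to the convention 0 for tau = 0. *)
Lemma measurable_stopped s : 0 <= s -> mfn (fun w => stopped (tau w) (m w) s).
Proof.
move=> s0; apply: mfn_of_gt => c. have -> : [set w | c < stopped (tau w) (m w) s] =
 [set w | (s%:E < tau w)%E /\ [set x | c < x] (m w s)] `|`
 ([set w | (tau w <= s%:E)%E] `&` (([set w | (tau w <= 0%:E)%E] `&` [set w | c < 0 /\ setT w]) `|`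
   (~` [set w | (tau w <= 0%:E)%E] `&`
    (([set w | rat_cauchy (tau w) (m w)] `&` [set w | rat_above (tau w) (m w) c]) `|`
    (~` [set w | rat_cauchy (tau w) (m w)] `&` [set w | c < 0 /\ setT w]))))).
 have cg w : (tau w <= s%:E)%E -> ~ (tau w <= 0%:E)%E ->
   exists u, [/\ tau w = u%:E, 0 < u & path_cts u%:E (m w)].
  move=> ts /negP; rewrite -ltNge => t0; case E : (tau w) ts t0 => [u| |] //= ts t0.
  by exists u; split=> //; rewrite -E.
 have l0 w u : tau w = u%:E -> 0 < u -> path_cts u%:E (m w) ->
   ~ rat_cauchy (tau w) (m w) -> lim (m w s @[s --> u^'-]) = 0.
  move=> E u0 cf; rewrite E => /(left_cvgP u0 cf) nc; exact: dvgP.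
 apply/seteqP; split=> w.
  rewrite /= /stopped; case: ifP => [tT|/negbT]; first by left.
  rewrite -leNgt => ts; case: ifP => [/eqP t0 c0|/eqP t0 cl].
   by right; split=> //; left; rewrite t0.
  right; split=> //; right; have nt : ~ (tau w <= 0%:E)%E.
   by move=> h; apply: t0; apply/eqP; rewrite eq_le h tau0.
  split=> //; have [u [E u0 cf]] := cg w ts nt; rewrite E /= in cl.
  have [rc|rc] := pselect (rat_cauchy (tau w) (m w)).
   by left; split=> //; rewrite E in rc *; apply/(left_limP _ u0 cf rc).
  by right; split=> //; split=> //; rewrite -(l0 w u E u0 cf rc).
 rewrite /= /stopped => -[[tT cm']|[ts H]]; first by rewrite tT.
 rewrite (ltNge s%:E) ts /=; case: ifP => [/eqP t0|/eqP t0].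
  by case: H => [[_ [c0 _]]//|[nt _]]; case: nt; rewrite t0.
 have nt : ~ (tau w <= 0%:E)%E.
  by move=> h; apply: t0; apply/eqP; rewrite eq_le h tau0.
 have [u [E u0 cf]] := cg w ts nt; rewrite E /=. case: H => [[/nt]|[_ [[rc ra]|[rc [c0 _]]]]] //.
  by rewrite E in rc ra; apply/(left_limP _ u0 cf rc).
 by rewrite (l0 w u).
have mc : measurable [set w : Om | c < 0 /\ setT w] by apply: measurable_and.
apply: measurableU; first by apply: mm => //; rewrite -set_itvoy; exact: measurable_itv.
apply: measurableI; first exact: mtau. apply: measurableU; first by apply: measurableI => //; exact: mtau.
apply: measurableI; first by apply: measurableC; exact: mtau.
apply: measurableU; apply: measurableI => //; first exact: measurable_rat_cauchy.
 exact: measurable_rat_above.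
by apply: measurableC; exact: measurable_rat_cauchy.
Qed.

End measurable_stopped.

(** * Topology of the path space and of the extended half-line *)

Section path_topology.
Context {R : realType} (T : \bar R).
Hypothesis T0 : (0 <= T)%E.
Implicit Types (f g : R -> R) (y : path_space T).

Lemma path_cts_frozen f K : path_cts T f -> before T K -> cpath (frozen_at f K).
Proof.
move=> cf bK; have K0 : 0 <= K by case: bK.
split=> [t|t t0]; last by rewrite /frozen_at (min_l (le_trans t0 K0)) (min_l K0) max_l ?maxxx.
apply: dist_cts => e e0; have [h h0 H] := cf _ (before_clamp t bK) e e0; exists h => // s sh; apply: H; first exact: before_clamp.
exact: le_lt_trans (dist_max0 _ _) (le_lt_trans (dist_min _ _ _) sh).
Qed.

Lemma path_of f : path_cts T f -> exists y, restricts_to f y.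
Proof.
move=> cf; have /subspace_sigL_continuousP c : {within before T, continuous f}.
 exact: dist_within_cts.
by exists (mkcts c).
Qed.

Lemma path_nbhs f y (U : set (path_space T)) : restricts_to f y -> nbhs y U ->
 exists K e, [/\ (K%:E < T)%E, 0 < e & forall g y', restricts_to g y' ->
  (forall t, before T t -> t <= K -> `|g t - f t| < e) -> U y'].
Proof.
move=> fy [_ [[V oV <-] /= Vy VU]]. pose f' : before T -> R := (y : continuousType (before T) R).
pose B (p : R * R) := [set g : before T -> R | forall t : before T, \val t <= p.1 -> `|g t - f' t| < p.2].
pose D := [set p : R * R | (p.1%:E < T)%E /\ 0 < p.2].
(* The bound K = -1 imposes no condition on a path; it makes the filter base nonempty even when T =
   0. *)
have Dm : D (-1, 1) by split=> //=; apply: lt_le_trans T0; rewrite lte_fin.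
have FF : Filter (filter_from D B).
 apply: filter_from_filter; first by exists (-1, 1). move=> [K e] [K' e'] [/= KT e0] [/= KT' e0'].
 exists (maxr K K', minr e e').
  by split => /=; [rewrite EFin_max gt_max KT|rewrite lt_min e0].
 move=> g /= H; split=> t tK; first by have := H t; rewrite le_max tK lt_min => /(_ isT) /andP[].
 by have := H t; rewrite le_max tK orbT lt_min => /(_ isT) /andP[].
have cv : {family compact, filter_from D B --> f'}.
 apply/fam_cvgP => A cA W /uniform_nbhs[E []]; rewrite -entourage_ballE => -[e /= e0 eE] EW.
 have [K KT AK] : exists2 K : R, (K%:E < T)%E & forall t, A t -> \val t <= K.
  have [A0|A0] := pselect (A !=set0); last first.
   by exists (-1); [case: Dm|move=> t At; case: A0; exists t].
  have cv : {within A, continuous (\val : before T -> R)}.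
   by apply: continuous_subspaceT => x; exact: initial_continuous.
  have [c _ H] := compact_EVT_max A0 cA cv. exists (\val c); first by have [] := set_mem (valP c).
  by move=> t At; apply: H; exact: mem_set.
 exists (K, e) => // g Bg; apply: EW => t At; apply: eE => /=.
 by rewrite /ball /= distrC; apply: Bg; exact: AK.
have : nbhs (f' : {family compact, before T -> R}) V by exact: open_nbhs_nbhs.
move=> /cv[[K e] [/= KT e0] BV]; exists K, e; split=> // g y' gy H.
apply: VU; apply: (BV (y' : continuousType (before T) R)) => t tK /=.
by rewrite gy /f' fy; apply: H => //; exact: set_mem (valP t).
Qed.

(* A countable base: f is dy m-close to the rational s_i on the i-th dyadic cell. *)
Definition cell (p m : nat) (s : seq rat) f := forall i, (i < size s)%N ->
 forall t, before T t -> i%:R * dy p <= t -> t < i.+1%:R * dy p -> `|f t - ratr (nth 0 s i)| <= dy m.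

Lemma path_cell f y (U : set (path_space T)) : path_cts T f -> restricts_to f y -> nbhs y U ->
 exists p m s, cell p m s f /\ forall g y', restricts_to g y' -> cell p m s g -> U y'.
Proof.
move=> cf fy /(path_nbhs fy)[K [e [KT e0 HU]]]. have [K0|K0] := ltP K 0.
 exists 0, 0, [::]; split=> // g y' gy _; apply: (HU g) => // t [t0 _] tK.
 by have := le_lt_trans t0 (le_lt_trans tK K0); rewrite ltxx.
have [K1 [bK1 KK1 _]] := before_around (conj K0 KT). have K10 : 0 <= K1 by case: bK1.
have e4 : 0 < e / 4 by rewrite divr_gt0. have [m _ /(_ m (leqnn m)) dm] := dy_small e4.
have [h h0 Hh] := cpath_ucts (path_cts_frozen cf bK1) K1 (dy_gt0 m.+1).
have hK : 0 < minr h (K1 - K) by rewrite lt_min h0 subr_gt0.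
have [p _ /(_ p.+1 (leqnSn p)) dp] := dy_small hK. set q := p.+1 in dp; have dq := @dy_gt0 R q.
have [dh dK] : dy q <= h /\ dy q <= K1 - K by move: dp; rewrite le_min => /andP[].
have tr (t : R) : 0 <= t -> exists i : nat, [/\ i%:R * dy q <= t & t < i.+1%:R * dy q].
 move=> t0; exists (Num.truncn (t / dy q)). have /andP[a b] := truncn_itv (divr_ge0 t0 (ltW dq)).
 by split; [rewrite -ler_pdivlMr|rewrite -ltr_pdivrMr].
have [n [n1 n2]] := tr K1 K10.
have /choice[r Hr] (i : nat) : exists r : rat, `|f (i%:R * dy q) - ratr r| < dy m.+1.
 have d1 := @dy_gt0 R m.+1.
 have [r] : exists r : rat, ratr r \in `](f (i%:R * dy q) - dy m.+1), (f (i%:R * dy q) + dy m.+1)[.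
  by apply: rat_in_itvoo; lra.
 by rewrite in_itv /= => /andP[a b]; exists r; rewrite ltr_distl; apply/andP; split; lra.
have fz t : 0 <= t -> t <= K1 -> frozen_at f K1 t = f t.
 by move=> t0 tK; rewrite /frozen_at min_l // max_r.
have idx (i : nat) t : (i < n)%N -> t < i.+1%:R * dy q -> t <= K1.
 move=> iN ti; apply: ltW; apply: (lt_le_trans ti); apply: le_trans n1. by rewrite ler_pM2r // ler_nat.
have mE := @dyS R m. have cf' : cell q m (mkseq r n) f.
 move=> i; rewrite size_mkseq => iN t [t0 _] it ti; rewrite nth_mkseq //.
 have tK := idx _ _ iN ti; have i0 : 0 <= i%:R * dy q :> R by rewrite mulr_ge0 // ltW.
 have := Hh t (i%:R * dy q) tK (le_trans it tK); rewrite ger0_norm ?subr_ge0 //.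
 rewrite !fz // ?(le_trans it) // => hh. have {}hh : `|f t - f (i%:R * dy q)| < dy m.+1.
  by apply: hh; apply: lt_le_trans dh; move: ti; rewrite -addn1 natrD mulrDl mul1r; lra.
 have h2 := Hr i; have := ler_distD (f (i%:R * dy q)) (f t) (ratr (r i)); move: hh h2; rewrite mE; lra.
exists q, m, (mkseq r n); split=> // g y' gy cg; apply: (HU g) => // t bt tK.
have t0 : 0 <= t by case: bt. have [i [i1 i2]] := tr t t0. have iN : (i < size (mkseq r n))%N.
 rewrite size_mkseq -(ltr_nat R) -(ltr_pM2r dq); apply: (le_lt_trans i1).
 by move: n2; rewrite -addn1 natrD mulrDl mul1r; lra.
have h1 := cg i iN t bt i1 i2; have h2 := cf' i iN t bt i1 i2.
by rewrite distrC in h2; have := ler_distD (ratr (nth 0 (mkseq r n) i)) (g t) (f t); lra.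
Qed.

(** Rational intervals, with [None] for the neighbourhoods of infinity. *)
Definition box (b : rat * option rat) (x : \bar R) :=
 ((ratr b.1)%:E < x)%E /\ (if b.2 is Some q then (x < (ratr q)%:E)%E else True).

Lemma time_box (t : ext_time R) (U : set (ext_time R)) : nbhs t U ->
 exists b, box b (\val t) /\ forall t' : ext_time R, box b (\val t') -> U t'.
Proof.
move=> [_ [[V oV <-] /= Vt VU]]. have : nbhs (\val t) V by exact: open_nbhs_nbhs.
have t0 := set_mem (valP t); case E : (\val t) t0 => [x| |] //= t0.
 move=> nV; have /nbhs_ballP[e /= e0 He] : nbhs x (fun r : R => V r%:E) by exact: nV.
 have [a] : exists a : rat, ratr a \in `](x - e), x[ by apply: rat_in_itvoo; rewrite ltrBlDr ltrDl.
 have [b] : exists b : rat, ratr b \in `]x, (x + e)[ by apply: rat_in_itvoo; rewrite ltrDl.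
 rewrite !in_itv /= => /andP[b1 b2] /andP[a1 a2].
 exists (a, Some b); split; first by rewrite /box E /= !lte_fin. move=> t' [].
 case E' : (\val t') => [x'| |] //=; rewrite !lte_fin => h1 h2; apply: VU => /=.
 rewrite set_valE E'; apply: He; rewrite /ball /= ltr_distl; apply/andP; split; lra.
move=> [M [_ HM]]; have [a] : exists a : rat, ratr a \in `]M, (M + 1)[ by apply: rat_in_itvoo; rewrite ltrDl.
rewrite in_itv /= => /andP[a1 _]; exists (a, None); split; first by rewrite /box E /= ltry.
move=> t' [/= h _]; apply: VU => /=; rewrite set_valE; apply: HM; apply: lt_trans h. by rewrite lte_fin.
Qed.

Context {d : measure_display} {Om : measurableType d}.

(** The preimage of an open set is a union over countable rational data; [ok] selects those data
    whose basic set lies inside U. *)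
Lemma random_path (Y : Om -> path_space T) (tau : Om -> ext_time R) (g : Om -> R -> R) :
 (forall w, path_cts T (g w)) -> (forall w, restricts_to (g w) (Y w)) ->
 (forall t, before T t -> mfn (g ^~ t)) ->
 (forall t, 0 <= t -> measurable [set w | (\val (tau w) <= t%:E)%E]) ->
 random_element (fun w => (Y w, tau w) : path_space T * ext_time R).
Proof.
move=> cg gY mg mtau U oU. have mle t : measurable [set w | (\val (tau w) <= t%:E)%E].
 have [t0|t0] := leP 0 t; first exact: mtau.
 rewrite (_ : [set _ | _] = set0) //; apply/seteqP; split=> w //= h.
 by have := le_trans (set_mem (valP (tau w))) h; rewrite lee_fin leNgt t0.
have mbox b : measurable [set w | box b (\val (tau w))].
 case: b => a b; apply: measurableI.
  rewrite [X in measurable X](_ : _ = ~` [set w | (\val (tau w) <= (ratr a)%:E)%E]).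
   exact: measurableC.
  by apply/seteqP; split=> w /=; rewrite ltNge => /negP.
 case: b => [b|] /=; last exact: measurableT.
 rewrite [X in measurable X](_ : _ = [set w | exists r : rat, ratr r < ratr b :> R /\
  (\val (tau w) <= (ratr r)%:E)%E]). apply: measurable_ex => r.
  by apply: (@measurable_and _ _ _ [set w | (\val (tau w) <= (ratr r)%:E)%E]) => _; exact: mle.
 apply/seteqP; split=> w /=; last first.
  by move=> [r [rb h]]; apply: le_lt_trans h _; rewrite lte_fin.
 have := set_mem (valP (tau w)); rewrite /=; case: (sval (tau w)) => [x| |] //= x0; rewrite lte_fin => xb.
 have [r] := rat_in_itvoo xb. by rewrite in_itv /= => /andP[/ltW r1 r2]; exists r; rewrite lee_fin.
have mcell p m s : measurable [set w | cell p m s (g w)].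
 rewrite [X in measurable X](_ : _ = [set w | forall i : nat, (i < size s)%N -> forall q : rat,
  [/\ before T (ratr q), i%:R * dy p <= ratr q :> R & ratr q < i.+1%:R * dy p :> R] ->
  `|g w (ratr q) - ratr (nth 0 s i)| <= dy m]).
  apply: measurable_all => i; apply: measurable_imp => _; apply: measurable_all => q.
  apply: measurable_imp => -[bq _ _]; apply: mfn_le; apply: measurableT_comp => //.
  by apply: measurable_funB; [exact: mg|exact: measurable_cst].
 apply/seteqP; split=> w H i iN; first by move=> q [b h1 h2]; exact: H.
 move=> t bt it ti; apply/ler_addgt0Pr => e e0. have [h h0 Hh] := path_right (cg w) bt e0.
 have [q] : exists q : rat, ratr q \in `]t, (minr (t + h) (i.+1%:R * dy p))[.
  by apply: rat_in_itvoo; rewrite lt_min ltrDl h0.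
 rewrite in_itv /= lt_min => /andP[tq /andP[qh qi]]. have [bq d1] := Hh _ (ltW tq) qh.
 have := H i iN q (And3 bq (le_trans it (ltW tq)) qi).
 by have := ler_distD (g w (ratr q)) (g w t) (ratr (nth 0 s i)); rewrite distrC in d1; lra.
pose ok (k : nat * nat * seq rat * (rat * option rat)) := forall f y (t : ext_time R), restricts_to f y ->
 cell k.1.1.1 k.1.1.2 k.1.2 f -> box k.2 (\val t) -> U (y, t).
pose A k := [set w | ok k /\ (cell k.1.1.1 k.1.1.2 k.1.2 (g w) /\ box k.2 (\val (tau w)))].
rewrite (_ : _ @^-1` U = \bigcup_k A k).
 apply: countable_bigcupT_measurable; first exact: countableP.
 move=> k; apply: (@measurable_and _ _ _ [set w | cell k.1.1.1 k.1.1.2 k.1.2 (g w) /\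
  box k.2 (\val (tau w))]) => _.
 exact: (measurableI _ _ (mcell _ _ _) (mbox _)).
apply/seteqP; split=> w /=; last by move=> [k _ [okk [c b]]]; exact: okk c b.
move=> Uw; have : nbhs (Y w, tau w) U by exact: open_nbhs_nbhs. move=> [[U1 U2] /= [n1 n2] sub].
have [p [m [s [c1 c2]]]] := path_cell (cg w) (gY w) n1. have [b [b1 b2]] := time_box n2.
exists (p, m, s, b) => //; split=> // f y t fy cf bt; apply: (sub (y, t)).
by split; [exact: c2 fy cf|exact: b2].
Qed.

End path_topology.

(** Convergence in probability to a constant: f is within e/2 of f x near x, and the rare complement
    costs at most 2 M times its probability. *)
Lemma cvg_weakly_cst {R : realType} (S : topologicalType) (d d' : measure_display)
 (Om : measurableType d) (Om' : measurableType d') (P : probability Om R) (P' : probability Om' R)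
 (X : nat -> Om -> S) (x : S) : (forall n, random_element (X n)) ->
 (forall U, nbhs x U -> whp P (fun n => X n @^-1` U)) -> cvg_weakly P P' X (fun _ => x).
Proof.
move=> mX wX; split=> //.
 move=> U _; have [Ux|Ux] := pselect (U x).
  by rewrite (_ : _ @^-1` U = setT) //; apply/seteqP; split.
 by rewrite (_ : _ @^-1` U = set0) //; apply/seteqP; split.
move=> f cf [M HM]. have mf n : mfn (f \o X n).
 apply: mfn_of_gt => c; apply: (mX n [set u | c < f u]).
 rewrite (_ : [set u | c < f u] = f @^-1` `]c, +oo[); first by apply: open_comp => //; move=> ? _; exact: cf.
 by apply/seteqP; split=> u /=; rewrite in_itv /= andbT.
have M0 : 0 <= M := le_trans (normr_ge0 _) (HM x). have Ef n : ('E_P[f \o X n] = (Ex P (f \o X n))%:E)%E.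
 rewrite /Ex unlock fineK //; apply: integrable_fin_num => //.
 by apply: (@igr_bnd _ _ _ P M) => // w; exact: HM.
have -> : ('E_P'[f \o (fun=> x)] = (f x)%:E)%E by rewrite expectation_cst.
under eq_fun do rewrite Ef; apply: cvg_EFin; first by apply: nearW.
rewrite (_ : fine \o _ = (fun n => Ex P (f \o X n))) //. apply/cvgrPdist_le => e e0.
pose U := [set u | `|f u - f x| < e / 2]. have e2 : 0 < e / 2 by rewrite divr_gt0. have nU : nbhs x U.
 by have /cvgrPdist_lt/(_ _ e2) := cf x; apply: filterS => u; rewrite distrC.
pose c := e / 2 / (2 * M + 1). have c0 : 0 < c by rewrite divr_gt0 // ltr_wpDl // mulr_ge0.
have [N0 HN] := wX U nU c c0; exists N0 => // n /= Nn. have [A [mA AU PA]] := HN n Nn.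
have iF : igr P (f \o X n) by apply: (@igr_bnd _ _ _ P M) => // w; exact: HM. have ic := igr_cst P (f x).
have iA := igr_indic P (measurableC mA). have E1 : f x = Ex P (cst (f x)) by rewrite Ex_cst.
have Eg : Ex P (fun w => e / 2 + 2 * M * \1_(~` A) w) <= e.
 rewrite (ExD (igr_cst _ _) (igrZ _ iA)) Ex_cst (ExZ _ iA) Ex_indic ?PrC //; last exact: measurableC.
 have : 2 * M * (1 - Pr P A) <= 2 * M * c by apply: ler_wpM2l; [exact: mulr_ge0|lra].
 have : 2 * M * c <= e / 2.
  by rewrite /c mulrCA ger_pMr // ler_pdivrMr ?mul1r; lra.
 have H (r : R) : 2 * M * c <= e / 2 -> r <= 2 * M * c -> e / 2 + r <= e by lra. exact: H.
have ig : igr P (fun w => e / 2 + 2 * M * \1_(~` A) w) by apply: igrD; [exact: igr_cst|exact: igrZ].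
have bd w : `|f (X n w) - f x| <= e / 2 + 2 * M * \1_(~` A) w.
 rewrite indicE; have [Aw|Aw] := pselect (A w).
  by rewrite memNset ?mulr0 ?addr0 //; apply/ltW; exact: (AU w Aw).
 rewrite mem_set // mulr1; have := HM x; have := HM (X n w); have := ler_normB (f (X n w)) (f x); lra.
rewrite distrC E1 -(ExB iF ic); apply: le_trans Eg; apply: (le_trans (Ex_norm (igrB iF ic))).
exact: (Ex_le (igr_norm (igrB iF ic)) ig bd).
Qed.

Section stopped_continuity.
Context {R : realType}.

Lemma stopped_cts (T : \bar R) (f : R -> R) : (0 <= T)%E -> path_cts T f ->
 (forall u, T = u%:E -> 0 < u -> cvg (f s @[s --> u^'-])) -> path_cts +oo%E (stopped T f).
Proof.
move=> T0 cf cv t [t0 _] e e0. have lt s : (s%:E < T)%E -> stopped T f s = f s by rewrite /stopped => ->.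
have ge s u : T = u%:E -> u <= s -> stopped T f s = stopped T f u.
 move=> E us; rewrite /stopped E !lte_fin ltxx ltNge us //.
have [tT|Tt] := ltP t%:E T.
 have [h h0 H] := cf t (conj t0 tT) e e0; have [K [bK tK HK]] := before_around (conj t0 tT).
 exists (minr h (K - t)); first by rewrite lt_min h0 subr_gt0.
 move=> s [s0 _]; rewrite lt_min => /andP[sh sK]. have sT : (s%:E < T)%E.
  have [_] := bK; apply: le_lt_trans; rewrite lee_fin. by move: sK; rewrite ltr_norml => /andP[_]; lra.
 by rewrite !lt //; apply: H.
have [u E] : exists u, T = u%:E by case: T T0 Tt {cf cv lt ge} => [u| |] //; exists u.
have ut : u <= t by move: Tt; rewrite E lee_fin.
move: ut; rewrite le_eqVlt => /orP[/eqP ut|ut]; last first.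
 exists (t - u); first by rewrite subr_gt0.
 move=> s _; rewrite ltr_norml => /andP[h _]; rewrite !(ge _ u) ?subrr ?normr0 ?ltW //; lra.
subst t; move: t0; rewrite le_eqVlt => /orP[/eqP u0|u0].
 by exists 1 => // s [s0 _] _; rewrite (ge s u) ?subrr ?normr0 // -u0.
have {}cv := cv u E u0. have sE : stopped T f u = lim (f s @[s --> u^'-]).
 by rewrite /stopped E lte_fin ltxx eqe gt_eqF.
have [h /= h0 H] := @cvgr_dist_lt _ _ _ _ _ _ _ cv _ e0.
exists h => // s _ sh; have [us|su] := leP u s; first by rewrite (ge s u) ?subrr ?normr0.
by rewrite lt ?E ?lte_fin // -E sE distrC; apply: H => //=; rewrite distrC.
Qed.

Lemma mono_left_cvg (f : R -> R) (u C : R) : 0 < u ->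
 (forall s t, 0 <= s -> s <= t -> t < u -> f s <= f t) ->
 (forall s, 0 <= s -> s < u -> f s <= C) -> cvg (f s @[s --> u^'-]).
Proof.
move=> u0 mf bf; apply: nondecreasing_at_left_is_cvgr; near=> x.
 have x0 : 0 < x by near: x; exact: nbhs_left_gt.
 move=> s t; rewrite !in_itv /= => /andP[xs su] /andP[xt tu] st; apply: mf => //.
 exact: ltW (lt_trans x0 xs).
have x0 : 0 < x by near: x; exact: nbhs_left_gt.
exists C => y; case=> s; rewrite /= in_itv /= => /andP[xs su] <-; apply: bf => //.
exact: ltW (lt_trans x0 xs).
Unshelve. all: by end_near.
Qed.

End stopped_continuity.

(** * Independent copies of the path and the law of large numbers *)

Section particle_system.
Context {R : realType} {d d' : measure_display}.
Context {Om : measurableType d} {Om' : measurableType d'}.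
Variables (P : probability Om R) (P' : probability Om' R).
Variables (alpha : R).
Variables (xi : nat -> {RV P >-> R}) (W : nat -> R -> {RV P >-> R}).
Variables (xi0 : {RV P' >-> R}) (W0 : R -> {RV P' >-> R}).
Hypothesis alpha0 : 0 <= alpha.
Hypothesis xi0_ge0 : forall w, 0 <= xi0 w.
Hypothesis BW0 : brownian W0.
Hypothesis indep0 : independent P' (sigma_of [set: unit] (fun _ => xi0 : Om' -> R))
 (sigma_of [set t | 0 <= t] (fun t => W0 t : Om' -> R)).
Hypothesis law_xi : forall i (B : set R), measurable B -> distribution P (xi i) B = distribution P' xi0 B.
Hypothesis mi_xi : mutually_independent P (fun i : nat => sigma_of [set: unit] (fun _ => xi i : Om -> R)).
Hypothesis BW : forall i, brownian (W i).
Hypothesis mi_W : mutually_independent P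
 (fun i : nat => sigma_of [set t | 0 <= t] (fun t => W i t : Om -> R)).
Hypothesis indep_xi_W : independent P (sigma_of [set: nat] (fun i => xi i : Om -> R))
 (sigma_of [set p : nat * R | 0 <= p.2] (fun p => W p.1 p.2 : Om -> R)).
Local Notation Gam := (Gam alpha xi0 BW0).
Implicit Types (f g : R -> R) (s t h : R).

Section iid_paths.
Definition Z (i : nat) (w : Om) : @wiener R := zpath (xi i) (BW i) w.
Definition Z0 (w : Om') : @wiener R := zpath xi0 BW0 w.

Let sx i := sigma_of [set: unit] (fun _ => xi i : Om -> R).
Let sW i := sigma_of [set t | 0 <= t] (fun t => W i t : Om -> R).

Let pix i : pi_measurable (sx i).
Proof. by apply: pi_sigma_of => _ _; exact: measurable_funPT. Qed.

Let piW i : pi_measurable (sW i).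
Proof. by apply: pi_sigma_of => t _; exact: measurable_funPT. Qed.

Lemma sub_sigma_xi i : sx i `<=` sigma_of [set: nat] (fun i => xi i : Om -> R).
Proof.
by apply: g_sigma_sub => X [_ _ BX]; apply: sub_sigma_algebra; exists i.
Qed.

Lemma sub_sigma_W i : sW i `<=` sigma_of [set p : nat * R | 0 <= p.2] (fun p => W p.1 p.2 : Om -> R).
Proof.
by apply: g_sigma_sub => X [t t0 BX]; apply: sub_sigma_algebra; exists (i, t).
Qed.

Lemma indep_one i : independent P (sx i) (sW i).
Proof. exact: indep_sub indep_xi_W (@sub_sigma_xi i) (@sub_sigma_W i). Qed.

Definition sigma_below (S : nat -> set_system Om) (n : nat) : set_system Om :=
 <<s \bigcup_(j in [set j | j \in iota 0 n]) S j >>.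

Lemma pi_sigma_below S n : (forall j, pi_measurable (S j)) -> pi_measurable (sigma_below S n).
Proof.
move=> pS; split; [|exact: g_sigma_setI|exact: g_sigma_setT].
apply: smallest_sub; first exact: sigma_algebra_measurable.
by move=> X [j _ SX]; case: (pS j) => mS _ _; exact: mS.
Qed.

(** Initial values and Brownian motions are grouped separately by mutual independence and then
    joined; this drives the induction on the number of particles. *)
Lemma indep_new_path n : independent P <<s sigma_below sx n `|` sigma_below sW n >> <<s sx n `|` sW n >>.
Proof.
apply: indep_join.
- exact: pi_sigma_below.
- exact: pix.
- exact: pi_sigma_below.
- exact: piW.
- move=> a1 a2 b1 b2 A1 A2 B1 B2; apply: indep_xi_W; apply: g_sigma_setI.
 + by apply: (g_sigma_sub _ A1) => X [j _ SX]; exact: (@sub_sigma_xi j).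
 + exact: sub_sigma_xi A2.
 + by apply: (g_sigma_sub _ B1) => X [j _ SX]; exact: (@sub_sigma_W j).
 + exact: sub_sigma_W B2.
- apply: mutual_group => //; first exact: iota_uniq. by rewrite mem_iota add0n ltnn andbF.
- apply: mutual_group => //; first exact: iota_uniq. by rewrite mem_iota add0n ltnn andbF.
Qed.

Lemma measurable_Z i : measurable_fun setT (Z i).
Proof. exact: measurable_zpath. Qed.

Lemma measurable_Z0 : measurable_fun setT Z0.
Proof. exact: measurable_zpath. Qed.

Lemma mfn_Z i (f : @wiener R -> R) : mfn f -> mfn (fun w => f (Z i w)).
Proof. by move=> mf; exact: measurableT_comp mf (measurable_Z i). Qed.

Lemma mfn_Z0 (f : @wiener R -> R) : mfn f -> mfn (fun w => f (Z0 w)).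
Proof. by move=> mf; exact: measurableT_comp mf measurable_Z0. Qed.

Lemma law_Z i A : measurable A -> P' (Z0 @^-1` A) = P (Z i @^-1` A).
Proof.
move=> mA; apply: (same_law_paths BW0 (BW i) indep0 (@indep_one i) _ mA) => B mB. by rewrite law_xi.
Qed.

Lemma igr_Z i (f : @wiener R -> R) : mfn f -> igr P' (fun w => f (Z0 w)) -> igr P (fun w => f (Z i w)).
Proof. by move=> mf; exact: (law_igr measurable_Z0 (measurable_Z i) (law_Z i) mf). Qed.

Lemma Ex_Z i (f : @wiener R -> R) : mfn f -> Ex P (fun w => f (Z i w)) = Ex P' (fun w => f (Z0 w)).
Proof. by move=> mf; rewrite (law_Ex measurable_Z0 (measurable_Z i) (law_Z i) mf). Qed.

Lemma indep_partial_sum (f : @wiener R -> R) n : mfn f ->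
 indepRV P (fun w => \sum_(j < n) f (Z j w)) (fun w => f (Z n w)).
Proof.
move=> mf; apply: (indepRV_sigma (@indep_new_path n)).
 apply: measurable_sum => j. suff mZ : measurable_fun setT (Z j :
   g_sigma_algebraType (sigma_below sx n `|` sigma_below sW n) -> @wiener R).
  exact: measurableT_comp mf mZ.
 have jn : (j : nat) \in iota 0 n by rewrite mem_iota add0n /= ltn_ord. move=> _ A mA; rewrite setTI.
 apply: g_sigma_sub (sigma_path_zpath (BW j) mA) => X [SX|SX];
  apply: sub_sigma_algebra; [left|right]; apply: sub_sigma_algebra;
  by exists (j : nat).
suff mZ : measurable_fun setT (Z n : g_sigma_algebraType (sx n `|` sW n) -> @wiener R).
 exact: measurableT_comp mf mZ.
by move=> _ A mA; rewrite setTI; exact: sigma_path_zpath.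
Qed.

(** In the induction the cross term 6 n m2^2 is at most 6 n m4 by Jensen, and 3 (n + 1)^2 - 3 n^2 =
    6 n + 3 leaves room for it and for the new fourth moment. *)
Lemma sum_moments (f : @wiener R -> R) n : mfn f ->
 igr P' (fun w => f (Z0 w) ^+ 4) -> Ex P' (fun w => f (Z0 w)) = 0 ->
 let S w := \sum_(j < n) f (Z j w) in
 [/\ igr P (fun w => S w ^+ 4), Ex P S = 0,
   Ex P (fun w => S w ^+ 2) = n%:R * Ex P' (fun w => f (Z0 w) ^+ 2) &
   Ex P (fun w => S w ^+ 4) <= 3 * n%:R ^+ 2 * Ex P' (fun w => f (Z0 w) ^+ 4)].
Proof.
move=> mf i4 E0. have mpw k : mfn (fun x : @wiener R => f x ^+ k) by exact: measurable_funX.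
have mf0 := mfn_Z0 mf. have iZ i : igr P (fun w => f (Z i w) ^+ 4) by exact: (igr_Z i (mpw 4%N)).
have i1 : igr P' (fun w => f (Z0 w)).
 have := igr_pow mf0 i4 (n := 1) isT. by congr igr; apply/funext => w; rewrite expr1.
have iZ1 i : igr P (fun w => f (Z i w)) by exact: igr_Z. elim: n => [|n IH] /=.
 have c0 : (fun w => \sum_(j < 0) f (Z j w)) = cst 0.
  by apply/funext => w; rewrite big_ord0.
 have c k : (fun w => (\sum_(j < 0) f (Z j w)) ^+ k.+1) = cst (0 : R).
  by apply/funext => w /=; rewrite big_ord0 expr0n.
 rewrite c0. by split; rewrite ?c ?Ex_cst ?mul0r ?expr0n ?mulr0 ?mul0r //; exact: igr_cst.
have nq : n.+1%:R = n%:R + 1 :> R by rewrite natr1.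
case: IH; set S := (fun w => \sum_(j < n) f (Z j w)) => iS ES E2 E4.
have Sr : (fun w => \sum_(j < n.+1) f (Z j w)) = (fun w => S w + f (Z n w)).
 by apply/funext => w; rewrite big_ord_recr.
have mS : mfn S by apply: measurable_sum => j; exact: mfn_Z. have iS1 : igr P S.
 have := igr_pow mS iS (n := 1) isT. by congr igr; apply/funext => w; rewrite expr1.
have mZn := mfn_Z n mf. have EZn : Ex P (fun w => f (Z n w)) = 0 by rewrite Ex_Z.
have [F2 F4] := fourth_moment_step mS mZn (indep_partial_sum n mf) iS (iZ n) EZn ES.
have sw k (w : Om) : (\sum_(j < n.+1) f (Z j w)) ^+ k = (S w + f (Z n w)) ^+ k.
 by rewrite big_ord_recr.
split.
- have := igr_pow4D mS mZn iS (iZ n); congr igr. by apply/funext => w; rewrite sw.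
- by rewrite Sr ExD // ES EZn addr0.
- rewrite (eq_Ex P (sw 2%N)) F2 E2 (Ex_Z n (mpw 2%N)) nq. by move: (Ex P' _) => m; ring.
- rewrite (eq_Ex P (sw 4%N)) F4 E2 (Ex_Z n (mpw 2%N)) (Ex_Z n (mpw 4%N)).
 have := Ex_sqr_le mf0 i4; move: E4; rewrite nq.
 move: (Ex P' (fun w => f (Z0 w) ^+ 2)) (Ex P' (fun w => f (Z0 w) ^+ 4)) (Ex P _). move=> m2 m4 x hx hm.
 have n0 : 0 <= n%:R :> R by []. move: (n%:R : R) n0 hx => q q0 hx.
 have -> : q * m2 * m2 = q * m2 ^+ 2 by ring. have hq : q * m2 ^+ 2 <= q * m4 by exact: ler_wpM2l.
 have m40 : 0 <= m4 by apply: le_trans hm; exact: sqr_ge0.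
 have -> : 3 * (q + 1) ^+ 2 * m4 = 3 * q ^+ 2 * m4 + 6 * (q * m4) + 3 * m4 by ring. by lra.
Qed.

Definition emp (f : @wiener R -> R) N (w : Om) := (\sum_(j < N) f (Z j w)) / N%:R.

Lemma mfn_emp (f : @wiener R -> R) N : mfn f -> mfn (emp f N).
Proof.
move=> mf; apply: measurable_funM; last exact: measurable_cst.
by apply: measurable_sum => j; exact: mfn_Z.
Qed.

Lemma emp_moment (f : @wiener R -> R) N : mfn f -> igr P' (fun w => f (Z0 w) ^+ 4) -> (0 < N)%N ->
 let m := Ex P' (fun w => f (Z0 w)) in
 igr P (fun w => (emp f N w - m) ^+ 4) /\
 Ex P (fun w => (emp f N w - m) ^+ 4) <= 3 * Ex P' (fun w => (f (Z0 w) - m) ^+ 4) / N%:R ^+ 2.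
Proof.
move=> mf i4 N0 m. have NR : N%:R != 0 :> R by rewrite pnatr_eq0 -lt0n. have mf0 := mfn_Z0 mf.
have i1 : igr P' (fun w => f (Z0 w)).
 have := igr_pow mf0 i4 (n := 1) isT. by congr igr; apply/funext => w; rewrite expr1.
have mg : mfn (fun x => f x - m) by apply: measurable_funB => //; exact: measurable_cst.
have j4 : igr P' (fun w => (f (Z0 w) - m) ^+ 4).
 exact: (igr_pow4D mf0 (measurable_cst (- m)) i4 (igr_cst P' ((- m) ^+ 4))).
have E0 : Ex P' (fun w => f (Z0 w) - m) = 0.
 by rewrite (ExB i1 (igr_cst P' m)) Ex_cst subrr.
have [iS _ _ E4] := sum_moments N mg j4 E0.
have e w : (emp f N w - m) ^+ 4 = (N%:R ^+ 4)^-1 * (\sum_(j < N) (f (Z j w) - m)) ^+ 4.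
 rewrite -exprVn -exprMn; congr (_ ^+ 4).
 by rewrite sumrB mulrBr sumr_const card_ord -[m *+ N]mulr_natl mulKf // mulrC.
split.
 by have := igrZ (N%:R ^+ 4)^-1 iS; congr igr; apply/funext => w; rewrite e.
rewrite (eq_Ex P e) ExZ // mulrC ler_pdivrMr ?exprn_gt0 ?ltr0n //.
apply: (le_trans E4); move: (Ex P' _) => q; move: (N%:R : R) NR => r r0.
by rewrite le_eqVlt; apply/orP; left; apply/eqP; field.
Qed.

Lemma emp_deviation (f : @wiener R -> R) N e : mfn f -> igr P' (fun w => f (Z0 w) ^+ 4) -> (0 < N)%N ->
 0 < e -> forall m, m = Ex P' (fun w => f (Z0 w)) ->
 Pr P [set w | e <= `|emp f N w - m|] <= 3 * Ex P' (fun w => (f (Z0 w) - m) ^+ 4) / (N%:R ^+ 2 * e ^+ 4).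
Proof.
move=> mf i4 N0 e0 m mE. have [] := emp_moment mf i4 N0; rewrite -mE => i E4.
have -> : [set w | e <= `|emp f N w - m|] = [set w | e ^+ 4 <= (emp f N w - m) ^+ 4].
 apply/seteqP; split=> w /=.
  move=> h; have := lerXn2r 4 (ltW e0 : e \in Num.nneg) (normr_ge0 _ : _ \in Num.nneg) h.
  by rewrite -normrX ger0_norm // pow4_ge0.
 by rewrite -(ger0_norm (pow4_ge0 (emp f N w - m))) normrX ler_pXn2r // nnegrE ltW.
apply: (le_trans (markov_ineq (exprn_gt0 4 e0) i (fun w => pow4_ge0 _))).
by rewrite [(_ * e ^+ 4)^-1]invfM [leRHS]mulrA ler_wpM2r // invr_ge0 exprn_ge0 // ltW.
Qed.

Lemma whp_emp (f : @wiener R -> R) e : mfn f -> igr P' (fun w => f (Z0 w) ^+ 4) -> 0 < e ->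
 whp P (fun N => [set w | `|emp f N w - Ex P' (fun w => f (Z0 w))| < e]).
Proof.
move=> mf i4 e0; set m := Ex P' _.
apply: (whp_rate (C := 3 * Ex P' (fun w => (f (Z0 w) - m) ^+ 4) / e ^+ 4)) => N N0.
set B := [set w | e <= `|emp f N w - m|]. have mB : measurable B.
 apply: mfn_ge; apply: measurableT_comp => //.
 by apply: measurable_funB; [exact: mfn_emp|exact: measurable_cst].
exists (~` B); split; first exact: measurableC.
 by move=> w /= /negP; rewrite -ltNge.
rewrite PrC // lerD2l lerN2; apply: (le_trans (emp_deviation mf i4 N0 e0 (erefl m))).
set q := Ex P' _; have q0 : 0 <= q by apply: Ex_ge0 => w; exact: pow4_ge0.
rewrite -[leRHS]mulrA -invfM ler_wpM2l //; first exact: mulr_ge0.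
rewrite lef_pV2 ?posrE ?mulr_gt0 ?exprn_gt0 ?ltr0n //.
rewrite [leLHS]mulrC; apply: ler_wpM2r; first by rewrite exprn_ge0 // ltW.
by rewrite expr2 ler_pMl ?ltr0n // ler1n.
Qed.

End iid_paths.

(** * Convergence of the minimal particle system to a mean-field fixed point *)

Local Notation phi := (phi alpha).
Local Notation refl := (refl alpha).
Definition zfam (N : nat) (w : Om) : 'I_N -> R -> R := fun i => cpath_fun (Z i w).
Local Notation lamN N w := (lam alpha (@zfam N w)).
Local Notation avgN N w := (avg_phi alpha (@zfam N w)).
Local Notation tauN N w := (tau_star alpha (@zfam N w)).
Local Notation goodN N w := (good alpha (@zfam N w)).

Lemma cpath_zfam N w i : cpath (@zfam N w i).
Proof. exact: cpath_ok. Qed.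

Lemma zfam_ge0 N w i : 0 <= @zfam N w i 0.
Proof. exact: z0_ge0. Qed.

Lemma avg_phi_emp f s N w : avgN N w f s = emp (fun x => phi f x s) N w.
Proof. by []. Qed.

Lemma mfn_phi_path f s : mono_to f s -> mfn (fun x : @wiener R => phi f x s).
Proof.
move=> mf; apply: mfn_phi => //.
- by move=> r _; exact: measurable_cst.
- by move=> r _; exact: mfn_eval.
- by move=> x; exact: cpath_ok.
Qed.

Lemma whp_avg_phi f s (e : R) : mono_to f s -> 0 < e ->
 whp P (fun N => [set w | `|avgN N w f s - Gam f s| < e]).
Proof.
move=> mf e0; apply: (@whp_emp (fun x => phi f x s)) => //.
 exact: mfn_phi_path.
exact: (igr_phi4 xi0 alpha0 BW0 mf).
Qed.

(* Monotone functions converging pointwise to a continuous limit converge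
  uniformly on compacts. *)
Lemma whp_avg_phi_unif f K (e : R) : cpath f -> (forall t, mono_to f t) -> 0 < e ->
 whp P (fun N => [set w | forall s, s <= K -> `|avgN N w f s - Gam f s| <= e]).
Proof.
move=> cf mf e0; have cG : cpath (Gam f) by exact: cpath_Gam. have e20 : 0 < e / 2 by rewrite divr_gt0.
have [h h0 Hh] := cpath_ucts cG (`|K| + 1) e20.
pose k := minr (h / 2) 1; have k0 : 0 < k by rewrite lt_min; apply/andP; split; lra. have kh : k < h.
 have : k <= h / 2 by rewrite ge_min lexx. by lra.
have k1 : k <= 1 by rewrite ge_min lexx orbT. pose m := (Num.truncn (`|K| / k)).+2.
have := @whp_fin _ _ _ P m (fun j N => [set w | `|avgN N w f (j%:R * k) - Gam f (j%:R * k)| < e / 2]).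
move=> /(_ (fun j _ => whp_avg_phi (@mf (j%:R * k)) e20)). apply: whp_sub; exists 1%N => N N1 w H s sK.
have mA := avg_phi_mono alpha0 N1 (@cpath_zfam N w) (mf (`|K| + 1)).
have mG := Gam_mono xi0 alpha0 BW0 (mf (`|K| + 1)).
have sK' : s <= `|K| by apply: le_trans sK _; exact: ler_norm. have [s0|s0] := leP s 0.
 have e1 : avgN N w f s = avgN N w f 0.
  by have [_ ->] := cpath_avg_phi alpha (@cpath_zfam N w) cf.
 have e2 : Gam f s = Gam f 0 by have [_ ->] := cG.
 have := H 0%N isT; rewrite mul0r e1 e2 => /ltW h1; apply: (le_trans h1); lra.
pose j := Num.truncn (s / k). have x0 : 0 <= s / k by rewrite divr_ge0 // ltW.
have [jle jlt] : j%:R * k <= s /\ s < j.+1%:R * k.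
 by rewrite -ler_pdivlMr // -ltr_pdivrMr //; have /andP[] := truncn_itv x0.
have jm : (j < (Num.truncn (`|K| / k)).+1)%N.
 rewrite ltnS; apply: le_truncn; rewrite ler_pM2r ?invr_gt0 //.
have jm1 : (j < m)%N by apply: leq_trans jm _. have jm2 : (j.+1 < m)%N by [].
have jk : j.+1%:R * k <= s + k by rewrite -natr1 mulrDl mul1r lerD2r.
have := H j jm1; have := H j.+1 jm2; rewrite /mkset /=. rewrite !ltr_distl => /andP[_ a2] /andP[b1 _].
have m1 := mA s _ (ltW jlt) (le_trans jk (lerD sK' k1)). have m2 := mA _ s jle (ler_wpDr ler01 sK').
have g1 := mG _ s jle (ler_wpDr ler01 sK').
have u1 := Hh (j.+1%:R * k) s (le_trans jk (lerD sK' k1)) (ler_wpDr ler01 sK').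
have u2 := Hh (j%:R * k) s (le_trans jle (ler_wpDr ler01 sK')) (ler_wpDr ler01 sK').
have d1 : `|j.+1%:R * k - s| < h.
 by rewrite ger0_norm ?subr_ge0; [lra|exact: ltW].
have d2 : `|j%:R * k - s| < h.
 rewrite ler0_norm ?subr_le0 //; rewrite -natr1 mulrDl mul1r in jlt; lra.
move: (u1 d1) (u2 d2); rewrite !ltr_distl => /andP[_ c1] /andP[c2 _].
by rewrite ler_distl; apply/andP; split; lra.
Qed.

(** The events {X_t <= dy n} decrease to {X_t = 0}, so their probabilities converge. *)
Lemma refl_le_small f t : mono_to f t -> alpha * Pr P' [set w | refl f (Z0 w) t = 0] < 1 ->
 exists2 dl : R, 0 < dl & alpha * Pr P' [set w | refl f (Z0 w) t <= dl] < 1.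
Proof.
move=> mf lt1; have mX := mfn_refl_z xi0 alpha0 BW0 mf.
have m0 : measurable [set w | refl f (Z0 w) t = 0].
 by have := mX measurableT [set 0] (measurable_set1 0); rewrite setTI.
have mn (c : R) : measurable [set w | refl f (Z0 w) t <= c] by exact: mfn_le.
have [_ cv] : igr P' (\1_[set w | refl f (Z0 w) t = 0] : Om' -> R) /\
  Ex P' (\1_[set w | refl f (Z0 w) t <= dy n]) @[n --> \oo] -->
  Ex P' (\1_[set w | refl f (Z0 w) t = 0]).
 apply: (Ex_dct _ (igr_cst P' (1 : R))).
 - by move=> n; exact: mfn_indic.
 - by move=> n w; rewrite indicE; case: (_ \in _); rewrite ?normr1 ?normr0.
 move=> w; have X0 : 0 <= refl f (Z0 w) t.
  by apply: refl_ge0 => //; exact: cpath_ok.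
 move: X0; rewrite le_eqVlt => /orP[/eqP X0|X0].
  apply: cvg_near_cst; apply: nearW => n; rewrite !indicE !mem_set //= -X0 //. exact: ltW (dy_gt0 n).
 have X20 : 0 < refl f (Z0 w) t / 2 by rewrite divr_gt0.
 apply: cvg_near_cst; have := dy_small X20; apply: filterS => n h.
 rewrite !indicE !memNset //=; first by move=> X1; rewrite X1 ltxx in X0.
 by move=> X1; have := le_trans X1 h; lra.
move: cv; rewrite Ex_indic // => cv.
have cva : alpha * Ex P' (\1_[set w | refl f (Z0 w) t <= dy n]) @[n --> \oo] -->
  alpha * Pr P' [set w | refl f (Z0 w) t = 0].
 by apply: cvgM => //; exact: cvg_cst.
have /cvgrPdist_lt := cva. set p := alpha * Pr P' [set w | refl f (Z0 w) t = 0] in lt1 *.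
have p0 : 0 < 1 - p by rewrite subr_gt0. move=> /(_ _ p0)[n _ /(_ n (leqnn n))]; rewrite Ex_indic // => h.
exists (dy n); first exact: dy_gt0. by move: h; rewrite ltr_distlC => /andP[_]; lra.
Qed.

(** A consists of the paths with X_t <= 2 dl or with oscillation at least dl / 8 on the window; the
    latter have probability of order h^2, so alpha P(A) stays below 1 for small h. Off A, going back
    in time the growth of alpha f is compensated by the regulator; going forward it is at most dl /
    4 by continuity of f. *)
Lemma cover_zero_set f t : cpath f -> (forall s, mono_to f s) -> 0 <= t ->
 alpha * Pr P' [set w | refl f (Z0 w) t = 0] < 1 ->
 exists dl h c : R, exists A : set (@wiener R), [/\ [/\ 0 < dl, 0 < h & measurable A], 0 <= c, c < 1,
    alpha * Pr P' [set w | A (Z0 w)] < c &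
    forall x : @wiener R, ~ A x -> forall s, maxr 0 (t - h) <= s -> s <= t + h -> dl < refl f x s].
Proof.
move=> cf mf t0 lt1; have [dl2 dl20] := refl_le_small (mf t) lt1.
set B := [set w | _]; set q := alpha * _ => q1. have q0 : 0 <= q by rewrite mulr_ge0 // Pr_ge0.
pose dl := dl2 / 2; have dl0 : 0 < dl by rewrite divr_gt0.
pose rho := dl / 8; have rho0 : 0 < rho by rewrite divr_gt0.
have rho4 : 0 < rho ^+ 4 by rewrite exprn_gt0.
have ea : 0 < dl / (4 * (alpha + 1)) by rewrite divr_gt0 // mulr_gt0 // ltr_wpDl.
have [cc _] := cf; have [h1 h10 Hh1] := cts_dist (cc t) ea. pose X := alpha * (osc_cst R * 4) / rho ^+ 4.
have oc0 := osc_cst_gt0 R. have X0 : 0 <= X.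
 by rewrite divr_ge0 ?(ltW rho4) // mulr_ge0 // mulr_ge0 // ltW.
pose eta := (1 - q) / 2; have eta0 : 0 < eta by rewrite divr_gt0 // subr_gt0.
have X10 : 0 < X + 1 by rewrite ltr_wpDl. pose h := minr (h1 / 2) (minr 1 (eta / 2 / (X + 1))).
have h0 : 0 < h.
 by rewrite !lt_min; apply/and3P; split; rewrite ?divr_gt0 //; lra.
have [hh1 hh2 hh3] : [/\ h <= h1 / 2, h <= 1 & h <= eta / 2 / (X + 1)].
 by split; rewrite /h !ge_min lexx ?orbT.
pose a := maxr 0 (t - h); have a0 : 0 <= a by rewrite le_max lexx.
have at_ : a <= t by rewrite ge_max t0 /= lerBlDr lerDl ltW. have ta : t <= a + 2 * h.
 have : t - h <= a by rewrite le_max lexx orbT. by lra.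
have tah : t + h <= a + 2 * h.
 have : t - h <= a by rewrite le_max lexx orbT. by lra.
have h20 : 0 < 2 * h by rewrite mulr_gt0. pose C := [set x : @wiener R | rho ^+ 4 <= osc4 x a (2 * h)].
pose D := [set x : @wiener R | refl f x t <= dl2]. have mC : measurable C.
 apply: mfn_ge; apply: mfn_osc4 => //; first by move=> s; exact: mfn_eval. by move=> x; exact: cpath_ok.
have mD : measurable D.
 apply: mfn_le; apply: mfn_refl => //; first by move=> r _; exact: measurable_cst.
  by move=> r _; exact: mfn_eval.
 by move=> x; exact: cpath_ok.
have mZ (E : set (@wiener R)) : measurable E -> measurable [set w | E (Z0 w)].
 by move=> mE; have := measurable_Z0 measurableT mE; rewrite setTI.
exists dl, h, (q + eta), (D `|` C); split.
- by split=> //; exact: measurableU.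
- by rewrite addr_ge0 // ltW.
- by rewrite /eta; lra.
- have [io Eo] := osc4_moment xi0 BW0 a0 h20.
 have PC : Pr P' [set w | C (Z0 w)] <= osc_cst R * (2 * h) ^+ 2 / rho ^+ 4.
  apply: (le_trans (markov_ineq rho4 io _)).
   by move=> w; apply: osc4_ge0 => //; exact: cpath_ok.
  by rewrite ler_wpM2r // invr_ge0 ltW.
 have PU : Pr P' [set w | (D `|` C) (Z0 w)] <= Pr P' B + Pr P' [set w | C (Z0 w)].
  exact: (PrU P' (mZ D mD) (mZ C mC)).
 have le1 : alpha * Pr P' [set w | (D `|` C) (Z0 w)] <=
   q + alpha * (osc_cst R * (2 * h) ^+ 2 / rho ^+ 4).
  by rewrite /q -mulrDr; apply: ler_wpM2l => //; apply: (le_trans PU); rewrite lerD2l.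
 apply: (le_lt_trans le1); rewrite ltrD2l.
 have -> : alpha * (osc_cst R * (2 * h) ^+ 2 / rho ^+ 4) = X * (h * h).
  rewrite /X; have : rho ^+ 4 != 0 by rewrite gt_eqF. by move: (rho ^+ 4) (osc_cst R) => r o r0; field.
 have le2 : X * (h * h) <= (X + 1) * h.
  apply: (@le_trans _ _ (X * h)); last by rewrite ler_pM2r // lerDl.
  by apply: ler_wpM2l => //; rewrite ger_pMl.
 apply: (le_lt_trans le2); rewrite mulrC.
 by move: hh3; rewrite ler_pdivlMr // => hh3; apply: (le_lt_trans hh3); lra.
move=> x nA s as_ sh. have cx : cpath x by exact: cpath_ok. have Xt : dl2 < refl f x t.
 by rewrite ltNge; apply/negP => le; apply: nA; left.
have oscx u : a <= u -> u <= t + h -> `|x u - x a| < rho.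
 move=> au ut; have o := osc4_ub a0 cx au (le_trans ut tah). have : osc4 x a (2 * h) < rho ^+ 4.
  by rewrite ltNge; apply/negP => le; apply: nA; right.
 move=> /(le_lt_trans o); rewrite -(ger0_norm (pow4_ge0 (x u - x a))) normrX.
 by rewrite ltr_pXn2r // nnegrE // ltW.
have th : t <= t + h by rewrite lerDl ltW. have := oscx t at_ th; have := oscx s as_ sh.
rewrite !ltr_norml => /andP[s1 s2] /andP[t1 t2].
rewrite /refl in Xt *; have dl2E : dl2 = 2 * dl by rewrite /dl; lra.
have rhoE : dl = 8 * rho by rewrite /rho; lra. have [st|st] := leP s t.
 have fts : f s <= f t by exact: (mf t). have := phi_left_step alpha0 (mf t) cx st (o := 2 * rho).
 have H1 : forall u, s < u -> u <= t -> x s - x u <= 2 * rho.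
  move=> u su ut; have := oscx u (le_trans as_ (ltW su)) (le_trans ut th).
  by rewrite ltr_norml => /andP[? ?]; lra.
 have r20 : 0 <= 2 * rho by lra. by move=> /(_ H1 r20); rewrite mulrBr; lra.
have fts : alpha * (f s - f t) <= dl / 4.
 have := Hh1 s; rewrite ltr_distl ltr_norml => /(_ _)/andP[].
  by apply/andP; split; lra.
 move=> _ f1; apply: (@le_trans _ _ (alpha * (dl / (4 * (alpha + 1))))).
  by apply: ler_wpM2l => //; lra.
 by rewrite mulrA ler_pdivrMr ?mulr_gt0 ?ltr_wpDl //; nra.
have p1 := phi_mono alpha0 (mf s) cx (ltW st). by rewrite mulrBr in fts; lra.
Qed.

Lemma whp_count (A : set (@wiener R)) (e : R) : measurable A -> 0 < e ->
 whp P (fun N => [set w | #|finset (fun i : 'I_N => Z i w \in A)|%:R <=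
  (Pr P' [set w | A (Z0 w)] + e) * N%:R]).
Proof.
move=> mA e0; have mI : mfn (\1_A : @wiener R -> R) by exact: mfn_indic.
have I01 x : (\1_A x : R) ^+ 4 <= 1 /\ 0 <= (\1_A x : R) ^+ 4.
 by rewrite indicE; case: (x \in A); rewrite ?expr1n ?expr0n; split.
have mZ : measurable [set w | A (Z0 w)].
 by have := measurable_Z0 measurableT mA; rewrite setTI.
have EI : Ex P' (fun w => \1_A (Z0 w)) = Pr P' [set w | A (Z0 w)].
 rewrite -(Ex_indic P' mZ); apply: eq_Ex => w; rewrite !indicE.
 by rewrite [w \in _](_ : _ = (Z0 w \in A)) //; apply/idP/idP; rewrite !inE.
have := @whp_emp (\1_A) e mI _ e0; rewrite EI => /(_ _) wI. apply: whp_sub (wI _); last first.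
 apply: (@igr_bnd _ _ _ P' 1); first by apply: measurable_funX; exact: mfn_Z0.
 by move=> w; have [h1 h2] := I01 (Z0 w); rewrite ger0_norm.
exists 1%N => N N1 w /=; have NR : 0 < N%:R :> R by rewrite ltr0n.
rewrite ltr_distl => /andP[_ h]; rewrite -ler_pdivrMr //; apply: le_trans (ltW h).
rewrite /emp le_eqVlt; apply/orP; left; apply/eqP; congr (_ / _).
rewrite -sum1_card natr_sum big_mkcond /=; apply: eq_bigr => i _. by rewrite inE indicE; case: (_ \in _).
Qed.

Definition close_to f K (e : R) (N : nat) : set Om := [set w |
 (forall s, 0 <= s -> s <= K -> goodN N w s) /\
 (forall s, s <= K -> `|lamN N w s - f s| <= e)].

(** Continuous induction. The window around t comes from [cover_zero_set] and does not depend on the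
    precision, so closeness at some t1 slightly before t, known to any precision, is carried across
    t by [lam_close_extend]. At t = 0 both paths vanish and nothing is needed before. *)
Theorem propagation f K : cpath f -> (forall t, mono_to f t) ->
 (forall s, s <= 0 -> f s = 0) -> 0 <= K -> (forall s, s <= K -> f s = Gam f s) ->
 (forall t, 0 <= t -> t <= K -> alpha * Pr P' [set w | refl f (Z0 w) t = 0] < 1) ->
 forall e : R, 0 < e -> whp P (close_to f K e).
Proof.
move=> cf mf f0 K0 fE strict.
suff H : forall t, 0 <= t -> t <= K -> forall e : R, 0 < e -> whp P (close_to f t e).
 exact: (H K K0 (lexx K)).
apply: real_ind => t t0 tK IH.
have [dl [h [c [A [[dl0 h0 mA] c0 c1 Ac H]]]]] := cover_zero_set cf mf t0 (strict t t0 tK).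
exists h => // s ts sh sK e e0. have c1' : 0 < 1 - c by rewrite subr_gt0.
(* The initial error e1 and the sampling error eta each produce half of e2, and e2 is small enough
   for 2 alpha e2 < dl. *)
pose e2 := minr e (dl / (4 * (alpha + 1))). have a10 : 0 < alpha + 1 by rewrite ltr_wpDl.
have e20 : 0 < e2 by rewrite lt_min e0 divr_gt0 // mulr_gt0. pose e1 := e2 * (1 - c) / (2 * (1 + alpha)).
have e10 : 0 < e1 by rewrite divr_gt0 ?mulr_gt0 // addrC. pose eta := e2 * (1 - c) / 2.
have eta0 : 0 < eta by rewrite divr_gt0 // mulr_gt0. have BE : (eta + (1 + alpha) * e1) / (1 - c) = e2.
 rewrite /eta /e1; have : 1 + alpha != 0 by rewrite gt_eqF // addrC. have : 1 - c != 0 by rewrite gt_eqF.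
 by move=> h1 h2; field; apply/andP.
have [t1 [t10 t1t t1h wt1]] : exists t1, [/\ 0 <= t1, t1 <= t, t - h < t1 &
  whp P (fun N => [set w | (forall s, 0 <= s -> s < t1 -> goodN N w s) /\
   forall s, s <= t1 -> lfin alpha (@zfam N w) s /\ `|lamN N w s - f s| <= e1])].
 have neg N w r : r <= 0 -> lfin alpha (@zfam N w) r /\ `|lamN N w r - f r| <= e1.
  move=> r0; split.
   by exists 0 => n; rewrite picard0 //; [exact: cpath_zfam|exact: zfam_ge0].
  rewrite lam0 //; [|exact: cpath_zfam|exact: zfam_ge0]. by rewrite f0 // subrr normr0 ltW.
 move: (t0); rewrite le_eqVlt => /orP[/eqP t00|tp].
  exists 0; split=> //; [by rewrite -t00; lra|].
  apply: whp_sub (whpT P); exists 0%N => N _ w _; split; last exact: neg.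
  by move=> r r0 /(le_lt_trans r0); rewrite ltxx.
 pose t1 := maxr (t / 2) (t - h / 2). have t1t : t1 < t by rewrite gt_max; apply/andP; split; lra.
 have t10 : 0 <= t1 by rewrite le_max; apply/orP; left; lra.
 exists t1; split=> //; [exact: ltW|by rewrite lt_max; apply/orP; right; lra|].
 apply: whp_sub (IH t1 t10 t1t e1 e10); exists 0%N => N _ w [g1 cl]; split.
  by move=> r r0 rt; apply: g1 => //; exact: ltW.
 move=> r rt; split; last exact: cl. have [r0|r0] := leP r 0; first by have [] := neg N w r r0.
 by have [] := g1 r (ltW r0) rt.
pose p := Pr P' [set w | A (Z0 w)]. have [k k0 kc] : exists2 k : R, 0 < k & alpha * (p + k) <= c.
 exists ((c - alpha * p) / (alpha + 1)); first by rewrite divr_gt0 // subr_gt0.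
 have cp : 0 < c - alpha * p by rewrite subr_gt0.
 rewrite mulrDr; have : alpha * ((c - alpha * p) / (alpha + 1)) <= c - alpha * p.
  by rewrite mulrA ler_pdivrMr //; nra.
 by lra.
have := whpI wt1 (whpI (whp_count mA k0) (@whp_avg_phi_unif f K eta cf mf eta0)).
apply: whp_sub; exists 1%N => N N1 w [[g1 cl1] [cnt unif]].
set AN := finset (fun i : 'I_N => Z i w \in A) in cnt.
have [||||||g cl] := @lam_close_extend R alpha N (@zfam N w) alpha0 N1
 (@cpath_zfam N w) (@zfam_ge0 N w) f t1 s dl eta e1 c AN cf mf f0 t10 (le_trans t1t ts)
 (ltW e10) g1 cl1.
- by move=> r rs; rewrite [f r]fE; [apply: unif|]; exact: le_trans sK.
- move=> i iA r tr rs; apply: H.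
 + by move: iA; rewrite inE => /negP h1 h2; apply: h1; rewrite inE.
 + rewrite ge_max (le_trans t10 tr) /=; apply: ltW; exact: lt_le_trans tr.
 + by apply: (le_trans rs); exact: ltW.
- apply: (@le_trans _ _ (alpha * ((p + k) * N%:R))); first exact: ler_wpM2l. by rewrite mulrA ler_wpM2r.
- exact: c0.
- exact: c1.
- rewrite BE; apply: (@le_lt_trans _ _ (2 * alpha * (dl / (4 * (alpha + 1))))).
  apply: ler_wpM2l; first by rewrite mulr_ge0. by rewrite /e2 ge_min lexx orbT.
 by rewrite mulrA ltr_pdivrMr ?mulr_gt0 //; nra.
split=> // r rs; apply: (le_trans (cl r rs)). by rewrite BE /e2 ge_min lexx.
Qed.

Lemma whp_nonempty (E : nat -> set Om) (N1 : nat) : whp P E -> exists2 N, (N1 <= N)%N & E N !=set0.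
Proof.
move=> wE; have e0 : 0 < 1 / 2 :> R by [].
have [N0 h] := wE _ e0; exists (maxn N0 N1); first exact: leq_maxr.
have [A [mA AE le]] := h _ (leq_maxl N0 N1).
have [[w Aw]|A0] := pselect (A !=set0); first by exists w; exact: AE.
exfalso; move: le; have -> : A = set0.
 by apply/seteqP; split=> // w Aw; apply: A0; exists w.
by rewrite /Pr measure0 /=; lra.
Qed.

Lemma mv_frozen (l : R -> R) (T : ext_time R) K : mv_solution alpha xi0 W0 l T ->
 before (\val T) K -> let f := frozen_at l K in
 [/\ cpath f, forall t, mono_to f t, forall s, s <= 0 -> f s = 0, forall s, s <= K -> f s = Gam f s &
   forall t, 0 <= t -> t <= K -> alpha * Pr P' [set w | refl f (Z0 w) t = 0] < 1].
Proof.
move=> sol bK f; have K0 : 0 <= K by case: bK. have b0 : before (\val T) 0 by exact: before_le bK.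
have [s0 Ks bs] := before_next bK. have [mfs fEs] := mv_fixed alpha0 xi0_ge0 BW0 sol bs.
have fE s : s <= K -> f s = l (maxr 0 s) by move=> sK; rewrite /f /frozen_at min_l.
have eqG s : s <= K -> Gam f s = Gam (fun s => l (maxr 0 s)) s.
 by move=> sK; apply: eq_Gam => r rs; apply: fE; exact: le_trans sK.
split.
- exact: (mv_cpath alpha0 xi0_ge0 BW0 indep0 sol bK).
- move=> t r s rs st; apply: (mv_mono sol); first by rewrite le_max lexx.
  by rewrite ge_max !le_max lexx /= le_min !ge_min rs lexx !orbT.
 exact: before_clamp.
- by move=> s s0'; rewrite fE ?(le_trans s0') // max_l // (mv_start sol b0).
- by move=> s sK; rewrite eqG // fE // fEs // (le_trans sK) // ltW.
- move=> t t0 tK; have := mean_field_strict alpha0 indep0 t0 (le_lt_trans tK Ks)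
  (mv_fixed alpha0 xi0_ge0 BW0 sol bs).
 congr (_ * Pr P' _ < _); apply/funext => w; congr (_ = _).
 rewrite /refl -fE //; congr (_ + _); apply: eq_phi => r rt. by rewrite fE // (le_trans rt).
Qed.

Lemma mv_chaos (l : R -> R) (T : ext_time R) K (e : R) :
 mv_solution alpha xi0 W0 l T -> before (\val T) K -> 0 < e ->
 whp P (close_to (frozen_at l K) K e).
Proof.
move=> sol bK e0; have [cf mf f0 fE st] := mv_frozen sol bK. have K0 : 0 <= K by case: bK.
by apply: (@propagation _ K cf mf f0 K0 fE st).
Qed.

(** Uniqueness of a deterministic equation from a random system: both solutions are close to the
    same [lam] with high probability, and one sample point where both are within e / 2 is enough. *)
Lemma mv_unique (l1 l2 : R -> R) (T1 T2 : ext_time R) t :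
 mv_solution alpha xi0 W0 l1 T1 -> mv_solution alpha xi0 W0 l2 T2 ->
 before (\val T1) t -> before (\val T2) t -> l1 t = l2 t.
Proof.
move=> sol1 sol2 b1 b2; apply/eqP; rewrite -subr_eq0 -normr_le0.
apply/ler_addgt0Pl => e e0; rewrite addr0; have e20 : 0 < e / 2 by rewrite divr_gt0.
have t0 : 0 <= t by case: b1. have [N _ [w [[_ h1] [_ h2]]]] :=
 whp_nonempty 0 (whpI (mv_chaos sol1 b1 e20) (mv_chaos sol2 b2 e20)).
have := h1 t (lexx t); have := h2 t (lexx t).
rewrite /frozen_at minxx max_r // !ler_distl => /andP[a1 a2] /andP[b1' b2']. by apply/andP; split; lra.
Qed.

Lemma mv_maximal_le (l l' : R -> R) (T T' : ext_time R) :
 maximal_mv_solution alpha xi0 W0 l T -> mv_solution alpha xi0 W0 l' T' ->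
 (\val T' <= \val T)%E.
Proof.
move=> [sol mx] sol'; apply: (mx l' T' sol') => t b1 b2. by rewrite (mv_unique sol' sol).
Qed.

(* A bound on the Picard iterates at time q yields a solution on [0, q). *)
Lemma mv_maximal_ge (l : R -> R) (T : ext_time R) (q B : R) : 0 < q ->
 maximal_mv_solution alpha xi0 W0 l T ->
 (forall n, mv_it alpha xi0 BW0 n q <= B) -> (q%:E <= \val T)%E.
Proof.
move=> q0 mx HB; have [f [ff f0]] := mv_it_limit alpha0 q0 HB.
have [g [g0 gf gr]] := right_version alpha0 indep0 q0 ff f0.
have qT : q%:E \in ext_time R by rewrite inE /ext_time /= lee_fin ltW.
have sol : mv_solution alpha xi0 W0 g (SigSub qT).
 by apply: (fixed_mv alpha0 xi0_ge0 indep0 (q := q)).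
exact: mv_maximal_le mx sol.
Qed.

Lemma xi_ge0_ae : {ae P, forall w, forall i, 0 <= xi i w}.
Proof.
have h i : P.-negligible [set w | xi i w < 0].
 exists [set w | xi i w < 0]; split=> //.
  by have := @mfn_lt _ _ _ (xi i) 0; apply; exact: measurable_funPT.
 have mB := @measurable_itv R `]-oo, 0[. have := law_xi i mB; rewrite /distribution /pushforward /=.
 have -> : xi i @^-1` `]-oo, 0[ = [set w | xi i w < 0].
  by apply/seteqP; split=> w /=; rewrite in_itv.
 move=> ->; have -> : xi0 @^-1` `]-oo, 0[ = set0; last exact: measure0.
 by apply/seteqP; split=> w //=; rewrite in_itv /= ltNge xi0_ge0.
have := negligible_bigcup h; apply: negligibleS => w /= /existsNP[i].
by move=> /negP; rewrite -ltNge => hi; exists i.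
Qed.

Lemma zfamE N w (i : 'I_N) t : 0 <= xi i w -> zfam w i t = xi i w + W i (maxr 0 t) w.
Proof. by move=> x0; rewrite /zfam /= max_r. Qed.

(** The pathwise form of a solution, in which every comparison with [lam] is made. *)
Definition solves_system N (L : 'I_N -> R -> Om -> R) (tau : Om -> ext_time R) w :=
 forall K, before (\val (tau w)) K -> let f := frozen_at (mean_path L w) K in
 [/\ cpath f, forall t, mono_to f t, forall s, s <= 0 -> f s = 0,
   forall s, s <= K -> f s = avgN N w f s &
   forall i, L i K w = phi f (@zfam N w i) K].

Lemma particle_solves N (L : 'I_N -> R -> Om -> R) (tau : Om -> ext_time R) :
 (0 < N)%N -> particle_solution alpha xi W L tau ->
 {ae P, forall w, solves_system L tau w}.
Proof.
move=> N0 [_ _ cL sk]; have xi_ae := xi_ge0_ae. apply: (filterS2 _ _ xi_ae sk) => w xw skw K bK f.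
have N0R : 0 < N%:R :> R by rewrite ltr0n. have K0 : 0 <= K by case: bK.
pose m := mean_path L w; pose mf s := m (maxr 0 s).
have Lm i s t : 0 <= s -> s <= t -> before (\val (tau w)) t -> L i s w <= L i t w.
 move=> s0 st bt; have [X [F [[_ _ _ mo _] FL]]] := skw i.
 by rewrite -!FL //; [exact: mo|exact: before_le bt].
have b0 : before (\val (tau w)) 0 by exact: before_le bK. have L0 i : L i 0 w = 0.
 by have [X [F [[_ _ F0 _ _] FL]]] := skw i; rewrite -FL // F0.
have mm s t : 0 <= s -> s <= t -> before (\val (tau w)) t -> m s <= m t.
 move=> s0 st bt; rewrite /m /mean_path ler_wpM2r ?invr_ge0 ?ler0n //.
 by apply: ler_sum => i _; exact: Lm.
have fE s : s <= K -> f s = mf s by move=> sK; rewrite /f /frozen_at min_l. have fmono t : mono_to f t.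
 move=> r s rs st; apply: mm; first by rewrite le_max lexx.
  by rewrite ge_max !le_max lexx /= le_min !ge_min rs lexx !orbT.
 exact: before_clamp.
have f0 s : s <= 0 -> f s = 0.
 move=> s0; rewrite fE ?(le_trans s0) // /mf max_l // /m /mean_path big1 ?mul0r //.
have LE i t : before (\val (tau w)) t -> t <= K -> L i t w = phi f (@zfam N w i) t.
 move=> bt tK; have [X [F [S FL]]] := skw i; rewrite -FL // (skorokhod_runsup S bt).
 by apply: eq_runsup => s st; rewrite zfamE // opprB fE ?(le_trans st).
have cf : cpath f := path_cts_frozen (path_cts_mean N0 (fun i => cL i w)) bK.
split=> // [s sK|i]; last exact: LE. have [s0|s0] := leP s 0.
 rewrite f0 // /avg_phi big1 ?mul0r // => i _.
 by apply: phi_start => //; [exact: cpath_zfam|exact: zfam_ge0|exact: f0].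
have bs : before (\val (tau w)) s by apply: (before_le _ _ bK) => //; exact: ltW.
rewrite {1}fE // /mf max_r ?(ltW s0) // /m /mean_path /avg_phi; congr (_ / _).
by apply: eq_bigr => i _; exact: LE.
Qed.

(** * The minimal fixed point as a solution of the particle system *)

Section minimal_particle_solution.
Variable N : nat.
Hypothesis N0 : (0 < N)%N.

Let cz w (i : 'I_N) : cpath (@zfam N w i).
Proof. exact: cpath_zfam. Qed.

Let z0 w (i : 'I_N) : 0 <= @zfam N w i 0.
Proof. exact: zfam_ge0. Qed.

Lemma tau_star_ext w : tauN N w \in ext_time R.
Proof. by rewrite inE; exact: tau_star_ge0. Qed.

Definition min_tau (w : Om) : ext_time R := SigSub (tau_star_ext w).
Definition min_L (i : 'I_N) (t : R) (w : Om) : R := phi (lamN N w) (@zfam N w i) t.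

Definition filtration_gens t : set_system Om := sigma_of [set i | (i < N)%N] (fun i => xi i : Om -> R)
 `|` sigma_of [set p : nat * R | (p.1 < N)%N /\ 0 <= p.2 <= t] (fun p => W p.1 p.2 : Om -> R).

Lemma mfn_zfam_filtration t (i : 'I_N) s : 0 <= t -> s <= t ->
 mfn (fun w : g_sigma_algebraType (filtration_gens t) => @zfam N w i s).
Proof.
move=> t0 st; apply: measurable_funD.
 apply: measurable_maxr; first exact: measurable_cst.
 apply: (@mfn_sigma_of _ _ _ _ [set i | (i < N)%N] (fun i => xi i : Om -> R)) => //.
  exact: ltn_ord.
 by move=> X SX; apply: sub_sigma_algebra; left.
apply: (@mfn_sigma_of _ _ _ _ [set p : nat * R | (p.1 < N)%N /\ 0 <= p.2 <= t]
 (fun p => W p.1 p.2 : Om -> R) _ (i : nat, maxr 0 s)).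
 by split; [exact: ltn_ord|rewrite /= le_max lexx ge_max t0].
by move=> X SX; apply: sub_sigma_algebra; right.
Qed.

Lemma min_before w K : before (\val (min_tau w)) K -> forall s, 0 <= s -> s <= K -> goodN N w s.
Proof.
move=> bK s s0 sK; apply: (good_before (alpha := alpha) (z := @zfam N w)). exact: (before_le s0 sK bK).
Qed.

Lemma min_cpath w K : before (\val (min_tau w)) K -> cpath (fun s => lamN N w (minr s K)).
Proof.
move=> bK; have K0 : 0 <= K by case: bK.
by apply: (cpath_lam alpha0 N0 (cz w) (z0 w) K0); exact: min_before.
Qed.

Lemma min_mean w K : before (\val (min_tau w)) K -> mean_path min_L w K = lamN N w K.
Proof.
move=> bK; have [lK _] := min_before bK (proj1 bK) (lexx K).
by rewrite [RHS](lam_fix alpha0 N0 (cz w) lK).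
Qed.

(** Adaptedness comes from applying the measurability lemmas with the sigma-algebra of the
    filtration at t in place of the ambient one. *)
Lemma min_particle_solution : particle_solution alpha xi W min_L min_tau.
Proof.
have mT t (t0 : 0 <= t) := @measurable_lt_tau_star R _ (g_sigma_algebraType (filtration_gens t))
 alpha N (fun w => @zfam N w) alpha0 N0 cz z0 t t0
 (fun i s st => mfn_zfam_filtration i t0 st).
split.
- move=> t t0; have := measurableC (mT t t0); congr (particle_filtration xi W N t _).
 by apply/seteqP; split=> w /=; rewrite leNgt => /negP.
- move=> i t B t0 mB. have mp := @mfn_indic_phi_lam R _ (g_sigma_algebraType (filtration_gens t))
  alpha N (fun w => @zfam N w) alpha0 N0 cz t
  (fun i s st => mfn_zfam_filtration i t0 st) i t (lexx t).
 have mB' := mp measurableT B mB; rewrite setTI in mB'.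
 have := measurableI _ _ (mT t t0) mB'; congr (particle_filtration xi W N t _).
 have E w : (t%:E < tauN N w)%E -> \1_[set w | lfin alpha (@zfam N w) t] w = 1 :> R.
  move=> tT; have [lt _] : goodN N w t by apply: good_before. by rewrite indicE mem_set.
 apply/seteqP; split=> w /= [tT]; rewrite /preimage /= E // mul1r. by move=> h; split.
 by move=> h; split=> //; rewrite E // mul1r.
- move=> i w; apply: dist_within_cts => t bt e e0. have [K [bK tK HK]] := before_around bt.
 have [cp _] := cpath_phi alpha (min_cpath bK) (cz w i). have [h h0 H] := cts_dist (cp t) e0.
 exists (minr h (K - t)); first by rewrite lt_min h0 subr_gt0.
 move=> s bs; rewrite lt_min => /andP[sh sK]; have := H s sh.
 rewrite /min_L; set f := (fun s => lam _ _ (minr s K)).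
 have fE r : r <= K -> phi f (@zfam N w i) r = phi (lamN N w) (@zfam N w i) r.
  by move=> rK; apply: eq_phi => u ur; rewrite /f min_l // (le_trans ur).
 by rewrite !fE ?(ltW tK) //; exact: HK.
- have := xi_ge0_ae; apply: filterS => w xw i.
 pose Zt t := xi i w + W i t w - alpha * mean_path min_L w t.
 have cKp K : before (\val (min_tau w)) K -> cpath (fun s => Zt (maxr 0 (minr s K))).
  move=> bK; have K0 : 0 <= K by case: bK.
  have := cpathB (cpath_min K0 (cz w i)) (cpathZ alpha (min_cpath bK)).
  congr cpath; apply/funext => s; rewrite /Zt zfamE // min_mean; last exact: before_clamp.
  congr (_ - _ * _); case: (leP 0 (minr s K)) => // /ltW h. by rewrite !lam0 //.
 have mean0 : before (\val (min_tau w)) 0 -> mean_path min_L w 0 = 0.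
  by move=> b0; rewrite min_mean // lam0.
 have Z0g : before (\val (min_tau w)) 0 -> 0 <= Zt 0.
  move=> b0; rewrite /Zt mean0 // mulr0 subr0. by have := z0 w i; rewrite zfamE // maxxx.
 exists (fun t => Zt t + runsup (fun s => - Zt (maxr 0 s)) t).
 exists (runsup (fun s => - Zt (maxr 0 s))); split.
  exact: (@runsup_skorokhod _ Zt _ cKp Z0g).
 move=> t bt; have t0 : 0 <= t by case: bt.
 apply: eq_runsup => s st; rewrite zfamE // /Zt min_mean; last first.
  by apply: before_le bt; [rewrite le_max lexx|rewrite ge_max t0 st].
 rewrite opprB; congr (_ * _ - _); case: (leP 0 s) => // /ltW h. by rewrite !lam0 //.
Qed.

(* The minimal solution is a solution, so the maximal one lives at least as
  long, and both coincide before tau_star. *)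
Lemma maximal_vs_minimal (L : 'I_N -> R -> Om -> R) (tau : Om -> ext_time R) :
 maximal_particle_solution alpha xi W L tau ->
 {ae P, forall w, [/\ solves_system L tau w, (tauN N w <= \val (tau w))%E &
  forall t, before (tauN N w) t -> mean_path L w t = lamN N w t]}.
Proof.
move=> [sol mx]. have ae1 := particle_solves N0 sol.
have agree w t : solves_system L tau w -> before (\val (tau w)) t -> before (tauN N w) t ->
  forall s, s <= t -> frozen_at (mean_path L w) t s = lamN N w s.
 move=> S bt bs; have [cf mf f0 fE _] := S t bt. apply: (lam_unique alpha0 N0 (cz w)
  (z0 w) _ cf (mf t) (f0 0 (lexx 0)) fE). by case: bt.
 exact: min_before.
have le : {ae P, forall w, (\val (min_tau w) <= \val (tau w))%E}.
 apply: mx min_particle_solution _; apply: filterS ae1 => w S i t b1 b2.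
 have [_ _ _ _ ->] := S t b2; apply: eq_phi => s st. by rewrite (agree w t S b2 b1).
apply: filterS2 ae1 le => w S lew; split=> // t bt. have bt' : before (\val (tau w)) t.
 by case: bt => t0 tT; split=> //; exact: lt_le_trans lew.
have := agree w t S bt' bt t (lexx t). by rewrite /frozen_at minxx max_r //; case: bt.
Qed.

End minimal_particle_solution.

(** * Bounds on Picard iterates and upper bounds on lifetimes *)

Section explosion.
Local Notation mv_it := (mv_it alpha xi0 BW0).

(** The constant c / (1 - alpha) solves M = alpha M + c and hence dominates every iterate; the
    number of zeros is at most N, and alpha N < N. *)
Lemma subcritical_good N w s : (0 < N)%N -> alpha < 1 -> goodN N w s.
Proof.
move=> N0 alpha1; have NR : 0 < N%:R :> R by rewrite ltr0n.
pose c := (\sum_(i < N) runsup (fun r => - @zfam N w i r) s) / N%:R.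
have ub i : ubd (fun r => - @zfam N w i r) s.
 by have := cpath_ubd s (cpathZ (-1) (cpath_zfam w i)); congr ubd; apply/funext => r; rewrite mulN1r.
have c0 : 0 <= c by apply: divr_ge0; [apply: sumr_ge0 => i _; exact: runsup_ge0|exact: ltW].
have H n : picard alpha (@zfam N w) n s <= c / (1 - alpha).
 elim: n => [|n IH]; first by apply: divr_ge0 => //; rewrite subr_ge0 ltW.
 have p0 : 0 <= picard alpha (@zfam N w) n s.
  by apply: picard_ge0 => // i; exact: cpath_zfam.
 apply: (@le_trans _ _ (alpha * picard alpha (@zfam N w) n s + c)).
  rewrite [picard _ _ _ _]/= /avg_phi /c ler_pdivrMr // mulrDl divfK ?gt_eqF //.
  have -> : alpha * picard alpha (@zfam N w) n s * N%:R =
    \sum_(i < N) (alpha * picard alpha (@zfam N w) n s).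
   by rewrite sumr_const card_ord mulr_natr.
  rewrite -big_split; apply: ler_sum => i _; rewrite /phi; apply: runsup_le.
   by apply: addr_ge0; [exact: mulr_ge0|exact: runsup_ge0].
  move=> r rs; apply: lerD; last exact: (runsup_ub (ub i)).
  by apply: ler_wpM2l => //; apply: picard_mono => // j; exact: cpath_zfam.
 rewrite -[leRHS]subr0 -(subrr (alpha * (c / (1 - alpha)))) opprB addrA.
 have -> : c / (1 - alpha) + alpha * (c / (1 - alpha)) - alpha * (c / (1 - alpha)) = alpha * (c / (1 - alpha)) + c.
  by field; rewrite gt_eqF // subr_gt0.
 by rewrite lerD2r ler_wpM2l.
split; first by exists (c / (1 - alpha)).
apply: (@le_lt_trans _ _ (alpha * N%:R)); last by rewrite gtr_pMl.
by apply: ler_wpM2l => //; rewrite ler_nat -[leqRHS](card_ord N) max_card.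
Qed.

Lemma subcritical_tau_star N w : (0 < N)%N -> alpha < 1 -> tauN N w = +oo%E.
Proof.
move=> N0 alpha1; rewrite /tau_star (_ : [set _ | _ in _] = set0) ?ereal_inf0 //.
by rewrite -subset0 => x [t [_ []]]; exact: subcritical_good.
Qed.

Lemma subcritical_bounded n q : 0 < q -> alpha < 1 -> mv_it n q <= Ex P' (zdev xi0 BW0 q) / (1 - alpha).
Proof.
move=> q0 alpha1; set D := Ex _ _. have D0 : 0 <= D by apply: Ex_ge0 => w; exact: zdev_ge0.
elim: n => [|n IH]; first by apply: divr_ge0 => //; rewrite subr_ge0 ltW.
apply: (@le_trans _ _ (alpha * mv_it n q + D)).
 have iD := igr_zdev xi0 BW0 q0.
 have -> : alpha * mv_it n q + D = Ex P' (fun w => alpha * mv_it n q + zdev xi0 BW0 q w).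
  by rewrite (ExD (igr_cst _ _) iD) Ex_cst.
 apply: Ex_le => [||w]; first by apply: igr_phi => //; exact: mv_it_mono.
  by apply: igrD => //; exact: igr_cst.
 have mm : mono_to (mv_it n) q by exact: mv_it_mono.
 rewrite -/(mv_it n); have := phi_bound xi0 alpha0 BW0 w q0 (lexx q) mm.
 by rewrite ger0_norm // mv_it_ge0.
have -> : D / (1 - alpha) = alpha * (D / (1 - alpha)) + D.
 by field; rewrite gt_eqF // subr_gt0.
by rewrite lerD2r ler_wpM2l.
Qed.

(** Time advances in steps of a fixed length h for which the mean oscillation is below m = E min(xi,
    1), truncated because xi may have no mean. If the iterates y n were bounded at s but not at s +
    h, the increments y (n + 1) - y n >= 0 would be bounded by a quantity tending to the mean of
    oscillation minus start, which is negative. *)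
Lemma critical_bounded q : alpha = 1 -> P' [set w | 0 < xi0 w] != 0%E ->
 exists B, forall n, mv_it n q <= B.
Proof.
move=> a1 x0. have im : igr P' (fun w => minr (xi0 w) 1).
 apply: (@igr_bnd _ _ _ P' 1); first by apply: measurable_minr => //; exact: measurable_cst.
 move=> w; rewrite ger0_norm ?ge_min ?lexx ?orbT // le_min xi0_ge0 ler01 //.
set m := Ex P' (fun w => minr (xi0 w) 1). have m0 : 0 < m.
 apply: Ex_gt0 => // [w|]; first by rewrite le_min xi0_ge0 ler01.
 by congr (P' _ != _): x0; apply/seteqP; split=> w /=; rewrite lt_min ltr01 andbT.
pose o (s h : R) w := root4 (osc4 (Z0 w) s h). have [h h0 Ho] : exists2 h : R, 0 < h & forall s, 0 <= s ->
  igr P' (o s h) /\ Ex P' (o s h) < m.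
 have c0 := @osc_cst_gt0 R; have c1 : 0 < osc_cst R + 1 by lra.
 pose h := m ^+ 2 / (osc_cst R + 1); have h0 : 0 < h by rewrite divr_gt0 // exprn_gt0.
 have hm : osc_cst R * h ^+ 2 < m ^+ 4.
  rewrite /h expr_div_n -exprM mulrA ltr_pdivrMr ?exprn_gt0 // [ltLHS]mulrC ltr_pM2l ?exprn_gt0 //.
  by rewrite sqrrD; have := sqr_ge0 (osc_cst R); lra.
 exists h => // s s0; have [iO EO] := osc4_moment xi0 BW0 s0 h0.
 have O0 w : 0 <= osc4 (Z0 w) s h by apply: osc4_ge0 => //; exact: cpath_z.
 have [io Eo] := root4_moment O0 iO; split=> //.
 rewrite -(@ltr_pXn2r _ 4) ?nnegrE ?(ltW m0) //; first exact: le_lt_trans Eo (le_lt_trans EO hm).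
 by apply: Ex_ge0 => w; exact: root4_ge0.
have step s : 0 <= s -> (exists B, forall n, mv_it n s <= B) -> exists B, forall n, mv_it n (s + h) <= B.
 move=> s0 [B HB]; have t0 : 0 < s + h by lra. apply: contrapT => nb. pose y n := mv_it n (s + h).
 have y0 n : 0 <= y n by exact: mv_it_ge0. have ymono : {homo y : a b / (a <= b)%N >-> a <= b}.
  by apply: homo_leq => // [|n]; [exact: le_trans|exact: mv_it_le].
 have yinf (C : R) : exists n0, forall n, (n0 <= n)%N -> C < y n.
  have [n0 Cn0] : exists n0, C < y n0.
   by apply: contrapT => H; apply: nb; exists C => n; rewrite leNgt; apply/negP => Cn; apply: H; exists n.
  by exists n0 => n n0n; apply: lt_le_trans Cn0 _; exact: ymono.
 have [io Eo] := Ho s s0. have iD := igr_zdev xi0 BW0 t0; set D := zdev xi0 BW0 (s + h) in iD.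
 have B0 : 0 <= B by apply: le_trans (HB 0). have iW : igr P' (W0 s) /\ Ex P' (W0 s) = 0.
  move: s0; rewrite le_eqVlt => /orP[/eqP <-|s0].
   have W00 : forall w, W0 0 w = 0 by case: BW0. have -> : (W0 0 : Om' -> R) = cst 0 by apply/funext.
   by split; [exact: igr_cst|exact: Ex_cst].
  have := gauss_incr BW0 (lexx 0) s0. have -> : (fun w => W0 s w - W0 0 w) = W0 s.
   by apply/funext => w; have [-> _ _ _] := BW0; rewrite subr0.
  by move=> g; split; [exact: gauss_igr g|exact: gauss_mean0 g].
 (* Times after s contribute at most y n + U to the supremum, times up to s at most B + D. As y n
    grows, the larger excess [F n] over y n tends to U, and U has negative mean. *)
 have [iWs EW] := iW. pose U w := o s h w - (minr (xi0 w) 1 + W0 s w).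
 have iU : igr P' U by apply: igrB => //; exact: igrD.
 have EU : Ex P' U < 0 by rewrite ExB ?ExD ?EW //; [rewrite addr0 subr_lt0|exact: igrD].
 pose F n w := maxr (B + D w - y n) (U w). have mU : mfn U by exact: igr_mfn iU.
 have mD : mfn D by exact: igr_mfn iD. have mF n : mfn (F n).
  apply: measurable_maxr => //; apply: measurable_funB; last exact: measurable_cst.
  by apply: measurable_funD => //; exact: measurable_cst.
 pose G w := `|U w| + (B + D w).
 have iG : igr P' G by apply: igrD; [exact: igr_norm|apply: igrD => //; exact: igr_cst].
 have Fb n w : `|F n w| <= G w.
  have Dw : 0 <= D w by exact: zdev_ge0.
  have := y0 n; have := ler_norm (U w); have := ler_norm (- U w); rewrite normrN.
  by rewrite /F /G; case: (leP (B + D w - y n) (U w)) => h1 *;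
   rewrite ler_norml; apply/andP; split; lra.
 have [_ cE] : igr P' U /\ Ex P' (F n) @[n --> \oo] --> Ex P' U.
  apply: (Ex_dct mF iG).
  - exact: Fb.
  - move=> w; have [n0 Hn0] := yinf (B + D w - U w). apply: cvg_near_cst; exists n0 => // n /= /Hn0 h1.
   by rewrite /F max_r //; lra.
 have Fge n : 0 <= Ex P' (F n).
  have iF : igr P' (F n) by exact: igr_dom (mF n) iG (Fb n).
  apply: (@le_trans _ _ (y n.+1 - y n)); first by rewrite subr_ge0 ymono.
  have mm : mono_to (mv_it n) (s + h) by exact: mv_it_mono. have ip := igr_phi xi0 alpha0 BW0 mm.
  have -> : y n.+1 - y n = Ex P' (fun w => phi (mv_it n) (Z0 w) (s + h) - y n).
   by rewrite (ExB ip (igr_cst _ _)) Ex_cst.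
  apply: Ex_le => // [|w]; first by apply: igrB => //; exact: igr_cst.
  rewrite lerBlDr; have Dw : 0 <= D w by exact: zdev_ge0. apply: runsup_le.
   rewrite /F; case: (leP (B + D w - y n) (U w)) => h1; have := y0 n; lra.
  have al (x : R) : alpha * x = x by rewrite a1 mul1r.
  move=> r rt; rewrite al; have dev := zdev_ub xi0 BW0 w t0 rt. have z00 := z0_ge0 xi0 BW0 w.
  have [rs|sr] := leP r s.
   have fr : mv_it n r <= B by apply: le_trans (HB n); exact: mv_it_mono.
   apply: (@le_trans _ _ (B + D w)).
    by move: dev z00 fr; rewrite -/D ler_norml => /andP[d1 _] z00 fr; rewrite /Z0; lra.
   by rewrite /F; case: (leP (B + D w - y n) (U w)) => h1; lra.
  have fr : mv_it n r <= y n by exact: mv_it_mono. apply: (@le_trans _ _ (y n + U w)); last first.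
   by rewrite /F; case: (leP (B + D w - y n) (U w)) => h1; lra.
  apply: lerD => //; rewrite /U. have := osc4_ub s0 (cpath_z xi0 BW0 w) (ltW sr) rt.
  move=> /le_root4; rewrite -/(o s h w) ler_norml => /andP[h1 _].
  have zs : minr (xi0 w) 1 + W0 s w <= Z0 w s.
   rewrite /Z0 zpathE // lerD2r max_r ?xi0_ge0 // ge_min lexx //.
  by move: h1 zs; rewrite /Z0; lra.
 suff : 0 <= Ex P' U by lra. have -> : Ex P' U = limn (fun n => Ex P' (F n)) by apply/esym/cvg_lim.
 by apply: limr_ge; [apply/cvg_ex; exists (Ex P' U)|near=> n; exact: Fge].
have all k : exists B, forall n, mv_it n (k%:R * h) <= B.
 elim: k => [|k IH]; first by exists 0 => n; rewrite mul0r mv_it_neg.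
 by rewrite -natr1 mulrDl mul1r; apply: step => //; apply: mulr_ge0 => //; exact: ltW.
have [B HB] := all (Num.truncn (`|q| / h)).+1; exists B => n; apply: le_trans (HB n).
apply: mv_it_mono => //; apply: (le_trans (ler_norm q)); rewrite -ler_pdivrMr //.
by apply: ltW; exact: truncnS_gt.
Unshelve. all: by end_near.
Qed.

Lemma critical_degenerate (l : R -> R) (T : ext_time R) : alpha = 1 ->
 P' [set w | 0 < xi0 w] = 0%E -> mv_solution alpha xi0 W0 l T -> ~ before (\val T) 0.
Proof.
move=> a1 x0 sol b0; have [cf mf f0 fE] := mv_frozen sol b0.
move=> /(_ 0 (lexx 0) (lexx 0)); rewrite {1}a1 mul1r; set A := [set w | _].
have m0 : measurable [set w | 0 < xi0 w] by by apply: mfn_gt; exact: measurable_funPT.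
suff -> : A = ~` [set w | 0 < xi0 w].
 by rewrite PrC // /Pr x0 /= subr0 ltxx.
have E w : refl (frozen_at l 0) (Z0 w) 0 = xi0 w.
 have zE : Z0 w 0 = xi0 w by rewrite /Z0 zpath0 max_r.
 rewrite /refl f0 // mulr0 subr0 zE [phi _ _ _]phi_start ?addr0 //.
 - exact: cpath_z.
 - by rewrite zE.
 - exact: f0.
apply/seteqP; split=> w; rewrite /A /= E; first by move=> ->; rewrite ltxx.
by move=> /negP; rewrite -leNgt => xw; apply/eqP; rewrite eq_le xw xi0_ge0.
Qed.

(** Convergence for each fixed n is enough: a large iterate of the mean-field map for a single n
    already forces every solution of the particle system to be large. *)
Lemma whp_picard n K (e : R) : 0 < e -> whp P (fun N => [set w | (0 < N)%N -> forall s, s <= K ->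
  `|picard alpha (@zfam N w) n s - mv_it n s| <= e]).
Proof.
elim: n e => [|n IH] e e0.
 by apply: whp_sub (whpT P); exists 0 => N _ w _ _ s _; rewrite subrr normr0 ltW.
have e1 : 0 < e / 2 / (1 + alpha) by rewrite !divr_gt0 // ltr_wpDr.
have e2 : 0 < e / 2 by rewrite divr_gt0. have mm0 t : mono_to (mv_it n) t by exact: mv_it_mono.
have H := @whp_avg_phi_unif (mv_it n) K _ (cpath_mv_it xi0 alpha0 BW0 n) mm0 e2. have := whpI (IH _ e1) H.
apply: whp_sub; exists 0 => N _ w [/= H1 H2] N0 s sK. have NR : 0 < N%:R :> R by rewrite ltr0n.
have pm : mono_to (picard alpha (@zfam N w) n) s.
 by apply: picard_mono => // i; exact: cpath_zfam.
have mm : mono_to (mv_it n) s by exact: mv_it_mono. have D : `|avgN N w (picard alpha (@zfam N w) n) s -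
  avgN N w (mv_it n) s| <= e / 2.
 rewrite /avg_phi -mulrBl -sumrB normrM (gtr0_norm (_ : 0 < N%:R^-1)) ?invr_gt0 //.
 rewrite ler_pdivrMr //; apply: (le_trans (ler_norm_sum _ _ _)).
 have -> : e / 2 * N%:R = \sum_(i < N) (e / 2) by rewrite sumr_const card_ord mulr_natr.
 apply: ler_sum => i _; apply: (@le_trans _ _ (alpha * (e / 2 / (1 + alpha)))).
  apply: phi_dist => //; first exact: cpath_zfam. by move=> r rs; apply: H1 => //; exact: le_trans sK.
 rewrite mulrA ler_pdivrMr ?ltr_wpDr // mulrC ler_wpM2l ?(ltW e2) //. by rewrite lerDr.
have := H2 s sK; move: D. move: (avg_phi _ _ _ _) (avg_phi _ _ _ _) (Gam _ _) => a b c h1 h2.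
by have := ler_normD (b - a) (a - c); rewrite addrA subrK; lra.
Qed.

(* A particle with small z at q is kept nonnegative only by a large local
  time, so the fraction of such particles bounds the mean path. *)
Lemma supercritical_level N w f q M (c : R) : (0 < N)%N -> mono_to f q -> 0 <= M ->
 f q = avgN N w f q -> 0 <= f q ->
 c * N%:R <= #|finset (fun i : 'I_N => @zfam N w i q <= M)|%:R -> 0 <= c ->
 1 < alpha * c -> f q <= alpha^-1 * (alpha * c) * M / (alpha * c - 1).
Proof.
move=> N0 mf M0 fE f0 cN c0 ac; have NR : 0 < N%:R :> R by rewrite ltr0n.
have a0 : 0 < alpha by move: ac; case: (ltrgtP alpha 0) alpha0 => // -> _; rewrite mul0r ltr10.
have h1 : #|finset (fun i : 'I_N => @zfam N w i q <= M)|%:R * (alpha * f q - M) <= f q * N%:R.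
 rewrite [in leRHS]fE /avg_phi divfK ?gt_eqF // -sum1_card natr_sum mulr_suml big_mkcond.
 apply: ler_sum => i _; have p0 := phi_ge0 alpha0 mf (cpath_zfam w i). case: ifP => [|_]; last exact: p0.
 rewrite inE mul1r => zM; have := phi_ub alpha0 mf (cpath_zfam w i) (lexx q). lra.
rewrite ler_pdivlMr ?subr_gt0 // mulKf ?gt_eqF //. have [aM|aM] := leP (alpha * f q) M.
 have : c * (alpha * f q) <= c * M by apply: ler_wpM2l. by lra.
have : c * N%:R * (alpha * f q - M) <= f q * N%:R.
 by apply: le_trans h1; apply: ler_wpM2r => //; rewrite subr_ge0 ltW.
rewrite -mulrA [N%:R * _]mulrC mulrA ler_pM2r //; lra.
Qed.

(** By maximality of T the mean-field iterates at q are unbounded. A particle system alive at q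
    would have a mean path above a large iterate, yet below the constant C of
    [supercritical_level]. *)
Lemma supercritical_tau (tau : nat -> Om -> ext_time R)
  (L : forall N : nat, 'I_N -> R -> Om -> R) (l : R -> R) (T : ext_time R) q :
 1 < alpha -> maximal_mv_solution alpha xi0 W0 l T -> (\val T < q%:E)%E ->
 whp P (fun N => [set w | (0 < N)%N -> solves_system (L N) (tau N) w -> (\val (tau N w) <= q%:E)%E]).
Proof.
move=> a1 mx Tq. have q0 : 0 < q by rewrite -lte_fin; apply: le_lt_trans Tq; exact: (set_mem (valP T)).
have unb B : exists n, B < mv_it n q.
 apply: contrapT => H; suff : (q%:E <= \val T)%E by rewrite leNgt Tq.
 apply: (@mv_maximal_ge l T q B) => // n. by rewrite leNgt; apply/negP => Bn; apply: H; exists n.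
have ai : 0 < 1 - alpha^-1 by rewrite subr_gt0 invf_lt1 // (lt_trans ltr01).
pose F (M : nat) := [set x : @wiener R | M%:R < x q].
have mF M : measurable (F M) by apply: mfn_gt; exact: mfn_eval.
have [M HM] : exists M, Pr P' [set w | F M (Z0 w)] < (1 - alpha^-1) / 3.
 pose I (M : nat) w : R := \1_[set w | F M (Z0 w)] w. have mFZ M : measurable [set w | F M (Z0 w)].
  by rewrite -[X in measurable X]setTI; apply: measurable_Z0.
 have [_ cv] : igr P' (cst 0) /\ Ex P' (I M) @[M --> \oo] --> Ex P' (cst 0).
  apply: (Ex_dct (g := cst 1)).
  - by move=> M; exact: mfn_indic.
  - exact: igr_cst.
  - by move=> M w; rewrite /I indicE; case: (_ \in _); rewrite ?normr1 ?normr0.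
  - move=> w; apply: cvg_near_cst. exists (Num.truncn `|Z0 w q|).+1 => // M /= MM.
   rewrite /I indicE memNset //= /F /=; apply/negP; rewrite -leNgt.
   apply: (le_trans (ler_norm _)); apply: (le_trans (ltW (truncnS_gt _))). by rewrite ler_nat.
 rewrite Ex_cst in cv; have e0 : 0 < (1 - alpha^-1) / 3 by rewrite divr_gt0.
 have [M _ /(_ M (leqnn M)) /=] := cvgr_lt _ cv _ e0. by rewrite Ex_indic //; exists M.
(* One third is spent on the probability that z exceeds M at q and one third on its empirical
   deviation. A fraction c of the particles is then below M, with alpha c = (alpha + 2) / 3 > 1. *)
have e0 : 0 < (1 - alpha^-1) / 3 by rewrite divr_gt0. pose c := 1 - 2 * ((1 - alpha^-1) / 3).
have c0 : 0 <= c.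
 have : 0 <= alpha^-1 by rewrite invr_ge0. rewrite /c; lra.
have ac : 1 < alpha * c.
 have : alpha * alpha^-1 = 1 by rewrite mulfV // gt_eqF // (lt_trans ltr01).
 rewrite /c; move: (alpha^-1) => b ab; have -> : alpha * (1 - 2 * ((1 - b) / 3)) = alpha / 3 + 2 / 3 * (alpha * b) by field.
 rewrite ab; lra.
pose C := alpha^-1 * (alpha * c) * M%:R / (alpha * c - 1). have [n Hn] := unb (C + 1).
have half : 0 < 1 / 2 :> R by rewrite divr_gt0. have W1 := whp_count (mF M) e0.
apply: whp_sub (whpI W1 (whp_picard n q half)).
exists 0 => N _ w [/= cnt pic] N0 S; rewrite leNgt; apply/negP => qtau.
have bq : before (\val (tau N w)) q by split=> //; exact: ltW.
have [cf mf f0 fE _] := S q bq; set f := frozen_at _ _ in cf mf f0 fE.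
have fq0 : 0 <= f q by rewrite -(f0 0 (lexx 0)); apply: (mf q) => //; exact: ltW. have fC : f q <= C.
 apply: (supercritical_level N0 (mf q)) => //; first exact: fE.
 have : addn #|finset (fun i : 'I_N => @zfam N w i q <= M%:R)|
   #|finset (fun i : 'I_N => Z i w \in F M)| = N.
  rewrite -[RHS]card_ord -[RHS](cardsC (finset (fun i : 'I_N => @zfam N w i q <= M%:R))).
  congr (_ + _)%N; apply: eq_card => i; rewrite !inE -ltNge. by apply/idP/idP; rewrite inE.
 move=> /(congr1 (fun k => k%:R : R)); rewrite natrD => E.
 have : c * N%:R + (Pr P' [set w | F M (Z0 w)] + (1 - alpha^-1) / 3) * N%:R <= N%:R.
  rewrite -mulrDl ger_pMl ?ltr0n // /c; lra.
 lra.
have p3 : picard alpha (@zfam N w) n q <= f q.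
 by apply: (picard_le_fixpoint alpha0 N0 (cpath_zfam w (N := N)) n (mf q)).
have := pic N0 q (lexx q); rewrite ler_norml => /andP[p1 p2]; move: Hn; lra.
Qed.

End explosion.

(** * Increments independent of the particle filtration *)

(** Larger than the filtration at t: it contains the other Brownian motions for all times, so that
    products of increments of two different particles are covered as well. *)
Definition rest N i t : set_system Om := sigma_of [set: nat] (fun j => xi j : Om -> R) `|`
 <<s <<s \bigcup_(j in [set j | j \in rem i (iota 0 N)])
     sigma_of [set r | 0 <= r] (fun r => W j r : Om -> R) >>
   `|` sigma_of [set r | 0 <= r <= t] (fun r => W i r : Om -> R) >>.

Lemma rest_future N i t u : 0 <= t -> t < u ->
 independent P <<s rest N i t >> (sigma_of [set: unit] (fun _ w => W i u w - W i t w)).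
Proof.
move=> t0 tu. have pW j : pi_measurable (sigma_of [set r | 0 <= r] (fun r => W j r : Om -> R)).
 by apply: pi_sigma_of => r _; exact: measurable_funPT.
have pWt : pi_measurable (sigma_of [set r | 0 <= r <= t] (fun r => W i r : Om -> R)).
 by apply: pi_sigma_of => r _; exact: measurable_funPT.
have pI : pi_measurable (sigma_of [set: unit] (fun _ w => W i u w - W i t w)).
 by apply: pi_sigma_of => _ _; exact: mfn_incr.
have pO : pi_measurable <<s \bigcup_(j in [set j | j \in rem i (iota 0 N)])
     sigma_of [set r | 0 <= r] (fun r => W j r : Om -> R) >>.
 split; [|exact: g_sigma_setI|exact: g_sigma_setT].
 apply: smallest_sub => [|X [j _ SX]]; first exact: sigma_algebra_measurable.
 by have [H _ _] := pW j; exact: H.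
have incr_sub : sigma_of [set: unit] (fun _ w => W i u w - W i t w) `<=`
  sigma_of [set r | 0 <= r] (fun r => W i r : Om -> R).
 pose T := g_sigma_algebraType (\bigcup_(r in [set r : R | 0 <= r])
   preimage_set_system setT (W i r : Om -> R) measurable).
 have mW r : 0 <= r -> mfn (W i r : T -> R).
  by move=> r0; apply: (@mfn_sigma_of _ _ _ _ [set t | 0 <= t] (fun t => W i t : Om -> R)).
 move=> X SX; apply: g_sigma_sub SX => Y [_ _ [D mD <-]]. have : mfn (fun w : T => W i u w - W i t w).
  by apply: measurable_funB; apply: mW => //; exact: le_trans (ltW tu).
 by move=> /(_ measurableT _ mD).
have past_sub : sigma_of [set r | 0 <= r <= t] (fun r => W i r : Om -> R) `<=`
  sigma_of [set r | 0 <= r] (fun r => W i r : Om -> R).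
 move=> X SX; apply: g_sigma_sub SX => Y [r /andP[r0 _] BX]; apply: sub_sigma_algebra. by exists r.
have one : independent P <<s <<s \bigcup_(j in [set j | j \in rem i (iota 0 N)])
     sigma_of [set r | 0 <= r] (fun r => W j r : Om -> R) >>
   `|` sigma_of [set r | 0 <= r <= t] (fun r => W i r : Om -> R) >>
  (sigma_of [set: unit] (fun _ w => W i u w - W i t w)).
 apply: (@indep_extend _ _ _ P _ _ _ (sigma_of [set r | 0 <= r] (fun r => W i r : Om -> R))) => //.
 - by move=> b1 b2 B1 B2; apply: g_sigma_setI; [exact: past_sub|exact: incr_sub].
 - apply: (@mutual_group _ _ _ P _ (fun j => sigma_of [set r | 0 <= r] (fun r => W j r : Om -> R))) => //.
   exact/rem_uniq/iota_uniq.
  by rewrite mem_rem_uniq ?iota_uniq // inE eqxx.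
 - by have [_ _ _] := BW i; exact.
have all_sub j : sigma_of [set r | 0 <= r] (fun r => W j r : Om -> R) `<=`
  sigma_of [set p : nat * R | 0 <= p.2] (fun p => W p.1 p.2 : Om -> R).
 exact: sub_sigma_W.
apply: (@indep_extend _ _ _ P _ _ _
 (sigma_of [set p : nat * R | 0 <= p.2] (fun p => W p.1 p.2 : Om -> R))) => //.
- by apply: pi_sigma_of => r _; exact: measurable_funPT.
- split; [|exact: g_sigma_setI|exact: g_sigma_setT].
 apply: smallest_sub => [|X [|]]; first exact: sigma_algebra_measurable.
  by have [H _ _] := pO; exact: H.
 by have [H _ _] := pWt; exact: H.
- move=> b1 b2 B1 B2; apply: g_sigma_setI; last exact: all_sub (incr_sub _ B2).
 apply: g_sigma_sub B1 => X [|SX]; last exact: all_sub (past_sub _ SX).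
 by apply: g_sigma_sub => Y [j _ SY]; exact: all_sub SY.
Qed.

Lemma filtration_le N s t : s <= t -> particle_filtration xi W N s `<=` particle_filtration xi W N t.
Proof.
move=> st; apply: g_sigma_sub => X [SX|SX]; first by apply: sub_sigma_algebra; left.
apply: sub_sigma_algebra; right; apply: g_sigma_sub SX => Y [r /= [rN /andP[r0 rs]] BY].
by apply: sub_sigma_algebra; exists r => //=; rewrite r0 (le_trans rs).
Qed.

Lemma filtration_rest N i t : particle_filtration xi W N t `<=` <<s rest N i t >>.
Proof.
apply: g_sigma_sub => X [SX|SX].
 apply: sub_sigma_algebra; left; apply: g_sigma_sub SX => Y [r _ BY].
 by apply: sub_sigma_algebra; exists r.
apply: g_sigma_sub SX => Y [[j r] /= [jN /andP[r0 rt]] BY].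
apply: sub_sigma_algebra; right; apply: sub_sigma_algebra. have [ji|ji] := eqVneq j i.
 right; apply: sub_sigma_algebra; exists r; first by rewrite /= r0. by rewrite -ji.
left; apply: sub_sigma_algebra; exists j; last by apply: sub_sigma_algebra; exists r.
by rewrite /= mem_rem_uniq ?iota_uniq // inE ji mem_iota.
Qed.

Lemma filtration_measurable N t : particle_filtration xi W N t `<=` measurable.
Proof.
apply: smallest_sub; first exact: sigma_algebra_measurable.
by move=> X [SX|SX]; apply: sigma_of_measurable SX => r _; exact: measurable_funPT.
Qed.

Lemma mfn_rest_W N i j t r : (j < N)%N -> j != i -> 0 <= r ->
 mfn (W j r : g_sigma_algebraType (rest N i t) -> R).
Proof.
move=> jN ji r0; apply: (@mfn_sigma_of _ _ _ _ [set r | 0 <= r] (fun r => W j r : Om -> R)) => //.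
move=> X SX; apply: sub_sigma_algebra; right; apply: sub_sigma_algebra; left.
apply: sub_sigma_algebra; exists j => //=. by rewrite mem_rem_uniq ?iota_uniq // inE ji mem_iota.
Qed.

Lemma filtration_future N i t s u A : 0 <= t -> t <= s -> s < u ->
 particle_filtration xi W N t A -> indepRV P (\1_A : Om -> R) (fun w => W i u w - W i s w).
Proof.
move=> t0 ts su FA; have s0 := le_trans t0 ts.
apply: (indepRV_sigma (F := rest N i s) (G := sigma_of [set: unit] (fun _ w => W i u w - W i s w))).
- by apply: (indep_sub (rest_future s0 su)) => //; apply: smallest_sub => //; exact: smallest_sigma_algebra.
- apply: (@measurable_indic _ (g_sigma_algebraType (rest N i s)) R setT A).
 exact: (filtration_rest (filtration_le ts FA)).
- by apply: (@mfn_sigma_of _ _ _ _ [set: unit] (fun _ w => W i u w - W i s w) _ tt).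
Qed.

Section one_step.
Variables (N : nat) (s u : R) (A : set Om).
Hypotheses (s0 : 0 <= s) (su : s < u) (FA : particle_filtration xi W N s A).

Let D (i : nat) w := W i u w - W i s w.

Let mA : measurable A. Proof. exact: filtration_measurable FA. Qed.

Let gD i : gauss P (Num.sqrt (u - s)) (D i). Proof. exact: gauss_incr. Qed.

Let ind i : indepRV P (\1_A : Om -> R) (D i).
Proof. exact: filtration_future FA. Qed.

Let q4 : Num.sqrt (u - s) ^+ 4 = (u - s) ^+ 2.
Proof. by rewrite (exprM _ 2 2) sqr_sqrtr // subr_ge0 ltW. Qed.

Definition step_sum w := \sum_(i < N) D i w.

Lemma mfn_step_sum : mfn step_sum.
Proof. by apply: measurable_sum => i; exact: mfn_incr. Qed.

Lemma step_sum_uncorrelated X : igr P X -> mfn (X : g_sigma_algebraType (filtration_gens N s) -> R) ->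
 igr P (fun w => X w * step_sum w) /\ Ex P (fun w => X w * step_sum w) = 0.
Proof.
move=> iX mX. have indX i : indepRV P X (D i).
 apply: (indepRV_sigma (F := rest N i s) (G := sigma_of [set: unit] (fun _ w => W i u w - W i s w))).
 - by apply: (indep_sub (rest_future s0 su)) => //; apply: smallest_sub => //; exact: smallest_sigma_algebra.
 - by move=> _ B mB; rewrite setTI; apply: filtration_rest; have := mX measurableT B mB; rewrite setTI.
 - by apply: (@mfn_sigma_of _ _ _ _ [set: unit] (fun _ w => W i u w - W i s w) _ tt).
have H i : igr P (fun w => X w * D i w) /\ Ex P (fun w => X w * D i w) = 0.
 have [ig E] := indep_igrM iX (gauss_igr (gD i)) (@indX i).
 by split=> //; rewrite E (gauss_mean0 (gD i)) mulr0.
have E w : X w * step_sum w = \sum_(i < N) X w * D i w by rewrite mulr_sumr.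
split; first by under eq_fun do rewrite E; apply: igr_sum => i; case: (H i).
rewrite (eq_Ex _ E) Ex_sum => [|i]; last by case: (H i). by apply: big1 => i _; case: (H i).
Qed.

Lemma step_sum_mean : igr P (fun w => \1_A w * step_sum w) /\ Ex P (fun w => \1_A w * step_sum w) = 0.
Proof.
apply: step_sum_uncorrelated; first exact: igr_indic.
exact: (@measurable_indic _ (g_sigma_algebraType (filtration_gens N s)) R setT A).
Qed.

(** Mixed products have mean zero, and one diagonal term already gives the lower bound, through
    [gauss_moment2]. *)
Lemma step_sum_sqr : (0 < N)%N -> igr P (fun w => \1_A w * step_sum w ^+ 2) /\
 Pr P A * ((u - s) / 2) <= Ex P (fun w => \1_A w * step_sum w ^+ 2).
Proof.
move=> N0. have C (i j : 'I_N) : igr P (fun w => \1_A w * (D i w * D j w)) /\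
  (if i == j then Pr P A * ((u - s) / 2) else 0) <= Ex P (fun w => \1_A w * (D i w * D j w)).
 have [<-|ij] := eqVneq i j.
  have iD := gauss_igrX (gD i) (isT : (2 <= 4)%N).
  have ind2 : indepRV P (\1_A : Om -> R) (fun w => D i w ^+ 2).
   by apply: (indepRV_fun (f := id) (g := fun x => x ^+ 2) (@ind i)) => //; exact: measurable_funX.
  have [ig E] := indep_igrM (igr_indic P mA) iD ind2. split; first exact: ig.
  rewrite -[leRHS]/(Ex P (fun w => \1_A w * D i w ^+ 2)) E Ex_indic //.
  apply: ler_wpM2l; first exact: Pr_ge0.
  by have := gauss_moment2 (gD i); rewrite sqr_sqrtr // subr_ge0 ltW.
 have indj : indepRV P (fun w => \1_A w * D i w) (D j).
  apply: (indepRV_sigma (F := rest N j s) (G := sigma_of [set: unit] (fun _ w => W j u w - W j s w))).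
  - by apply: (indep_sub (rest_future s0 su)) => //; apply: smallest_sub => //; exact: smallest_sigma_algebra.
  - apply: measurable_funM.
    apply: (@measurable_indic _ (g_sigma_algebraType (rest N j s)) R setT A).
    exact: filtration_rest FA.
   have ni : (i : nat) != j by [].
   by apply: measurable_funB; apply: mfn_rest_W => //; apply: le_trans (ltW su).
  - by apply: (@mfn_sigma_of _ _ _ _ [set: unit] (fun _ w => W j u w - W j s w) _ tt).
 have [igi _] := indep_igrM (igr_indic P mA) (gauss_igr (gD i)) (@ind i).
 have [ig E] := indep_igrM igi (gauss_igr (gD j)) indj.
 have e : (fun w => \1_A w * D i w * D j w) = (fun w => \1_A w * (D i w * D j w)).
  by apply/funext => w; rewrite mulrA.
 by rewrite e in ig E; split=> //; rewrite E (gauss_mean0 (gD j)) mulr0.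
have E w : \1_A w * step_sum w ^+ 2 = \sum_(i < N) \sum_(j < N) \1_A w * (D i w * D j w).
 by rewrite expr2 /step_sum mulr_suml mulr_sumr; apply: eq_bigr => i _; rewrite !mulr_sumr.
have Ci (i : 'I_N) : igr P (fun w => \sum_(j < N) \1_A w * (D i w * D j w)).
 by apply: igr_sum => j; case: (C i j).
split; first by under eq_fun do rewrite E; exact: igr_sum.
rewrite (eq_Ex _ E) Ex_sum // (bigD1 (Ordinal N0)) //=.
have Ege (i : 'I_N) : Pr P A * ((u - s) / 2) <= Ex P (fun w => \sum_(j < N) \1_A w * (D i w * D j w)).
 rewrite Ex_sum => [|j]; last by case: (C i j). rewrite (bigD1 i) //= -[leLHS]addr0; apply: lerD.
  by case: (C i i); rewrite eqxx.
 by apply: sumr_ge0 => j ji; case: (C i j) => _; rewrite eq_sym (negbTE ji).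
rewrite -[leLHS]addr0; apply: lerD; first exact: (Ege (Ordinal N0)).
apply: sumr_ge0 => i _; apply: le_trans (Ege i).
by apply: mulr_ge0; [exact: Pr_ge0|apply: divr_ge0 => //; rewrite subr_ge0 ltW].
Qed.

Lemma step_sum_pow4 : igr P (fun w => \1_A w * step_sum w ^+ 4) /\
 Ex P (fun w => \1_A w * step_sum w ^+ 4) <= 128 * N%:R ^+ 5 * Pr P A * (u - s) ^+ 2.
Proof.
have H i : igr P (fun w => \1_A w * D i w ^+ 4) /\
  Ex P (fun w => \1_A w * D i w ^+ 4) <= 128 * Pr P A * (u - s) ^+ 2.
 have [iD ED] := gauss_moment4 (gD i). have ind4 : indepRV P (\1_A : Om -> R) (fun w => D i w ^+ 4).
  by apply: (indepRV_fun (f := id) (g := fun x => x ^+ 4) (@ind i)) => //; exact: measurable_funX.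
 have [ig E] := indep_igrM (igr_indic P mA) iD ind4.
 split=> //; rewrite E Ex_indic // [128 * _]mulrC -mulrA; apply: ler_wpM2l; first exact: Pr_ge0.
 by rewrite -q4.
pose G w := N%:R ^+ 4 * \sum_(i < N) \1_A w * D i w ^+ 4.
have iG : igr P G by apply: igrZ; apply: igr_sum => i; case: (H i).
have le w : \1_A w * step_sum w ^+ 4 <= G w.
 rewrite /G -mulr_sumr [leRHS]mulrCA; apply: ler_wpM2l; first by rewrite indicE. exact: pow_sum_le.
have ig : igr P (fun w => \1_A w * step_sum w ^+ 4).
 apply: (igr_dom _ iG).
  by apply: measurable_funM; [exact: mfn_indic|apply: measurable_funX; exact: mfn_step_sum].
 by move=> w; rewrite ger0_norm // mulr_ge0 ?exprn_even_ge0 // indicE.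
split=> //; apply: (le_trans (Ex_le ig iG le)). rewrite ExZ; last by apply: igr_sum => i; case: (H i).
rewrite Ex_sum => [|i]; last by case: (H i). have -> : 128 * N%:R ^+ 5 * Pr P A * (u - s) ^+ 2 =
  N%:R ^+ 4 * \sum_(i < N) (128 * Pr P A * (u - s) ^+ 2) :> R.
 by rewrite sumr_const card_ord -mulr_natr; ring.
apply: ler_wpM2l; first exact: exprn_ge0. by apply: ler_sum => i _; case: (H i).
Qed.

End one_step.

Lemma step_sum_pow8 N s u : 0 <= s -> s < u -> igr P (fun w => step_sum N s u w ^+ 8) /\
 Ex P (fun w => step_sum N s u w ^+ 8) <= 2 * 16 ^+ 4 * N%:R ^+ 9 * (u - s) ^+ 4.
Proof.
move=> s0 su; pose D (i : nat) w := W i u w - W i s w.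
have H i : igr P (fun w => D i w ^+ 8) /\ Ex P (fun w => D i w ^+ 8) <= 2 * 16 ^+ 4 * (u - s) ^+ 4.
 have [iD ED] := gauss_moment8 (gauss_incr (BW i) s0 su); split=> //.
 by apply: (le_trans ED); rewrite (exprM _ 2 4) sqr_sqrtr // subr_ge0 ltW.
pose G w := N%:R ^+ 8 * \sum_(i < N) D i w ^+ 8.
have iG : igr P G by apply: igrZ; apply: igr_sum => i; case: (H i).
have le w : step_sum N s u w ^+ 8 <= G w by exact: pow_sum_le.
have ig : igr P (fun w => step_sum N s u w ^+ 8).
 apply: (igr_dom _ iG); first by apply: measurable_funX; exact: mfn_step_sum.
 by move=> w; rewrite ger0_norm // exprn_even_ge0.
split=> //; apply: (le_trans (Ex_le ig iG le)). rewrite ExZ; last by apply: igr_sum => i; case: (H i).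
rewrite Ex_sum => [|i]; last by case: (H i). have -> : 2 * 16 ^+ 4 * N%:R ^+ 9 * (u - s) ^+ 4 =
  N%:R ^+ 8 * \sum_(i < N) (2 * 16 ^+ 4 * (u - s) ^+ 4) :> R.
 by rewrite sumr_const card_ord -mulr_natr [N%:R ^+ 9]exprSr; ring.
apply: ler_wpM2l; first exact: exprn_ge0. by apply: ler_sum => i _; case: (H i).
Qed.

(** * The sum of the paths and the lifetime for alpha = 1 *)

Section sum_of_paths.
Variable N : nat.
Hypothesis N0 : (0 < N)%N.

(** For alpha = 1 this is also the sum of the reflected positions, see [sum_refl]: pushes and
    mean-field drift cancel. *)
Definition psum w t := \sum_(i < N) @zfam N w i t.

Lemma cpath_psum w : cpath (psum w).
Proof. by apply: cpath_sum => i; exact: cpath_zfam. Qed.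

Lemma psum_incr w s t : 0 <= s -> 0 <= t -> psum w t - psum w s = step_sum N s t w.
Proof.
move=> s0 t0; rewrite /psum -sumrB; apply: eq_bigr => i _. exact: (zpath_incr (xi i) (BW i)).
Qed.

Lemma filtration_psum s t (B : set R) : 0 <= t -> s <= t -> measurable B ->
 particle_filtration xi W N t [set w | B (psum w s)].
Proof.
move=> t0 st mB. have : mfn (fun w : g_sigma_algebraType (filtration_gens N t) => psum w s).
 by apply: measurable_sum => i; exact: mfn_zfam_filtration.
by move=> /(_ measurableT B mB); rewrite setTI.
Qed.

Lemma mfn_psum s : mfn (fun w => psum w s).
Proof.
apply: measurable_sum => i; exact: mfn_zpath.
Qed.

Lemma filtration_all t h (p : R -> bool) k : 0 <= h -> k%:R * h <= t -> measurable [set x | p x] ->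
 particle_filtration xi W N t [set w | all (fun j => p (psum w (j%:R * h))) (iota 0 k.+1)].
Proof.
move=> h0 kt mp; have FT : particle_filtration xi W N t setT by exact: g_sigma_setT.
elim: k kt => [|k IH] kt.
 have -> : [set w | all (fun j => p (psum w (j%:R * h))) (iota 0 1)] =
   [set w | [set x | p x] (psum w 0)].
  by apply/seteqP; split=> w /=; rewrite andbT mul0r.
 by rewrite mul0r in kt; exact: filtration_psum.
have -> : [set w | all (fun j => p (psum w (j%:R * h))) (iota 0 k.+2)] =
  [set w | all (fun j => p (psum w (j%:R * h))) (iota 0 k.+1)] `&`
  [set w | [set x | p x] (psum w (k.+1%:R * h))].
 by apply/seteqP; split=> w; rewrite /setI /mkset all_iotaS => /andP.
apply: g_sigma_setI.
 by apply: IH; apply: le_trans kt; rewrite ler_wpM2r // ler_nat.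
by apply: filtration_psum => //; apply: le_trans kt; rewrite mulr_ge0.
Qed.

Lemma filtration_touches h dl k : 0 <= h ->
 particle_filtration xi W N (k%:R * h) [set w | touches dl (fun j => psum w (j%:R * h)) k].
Proof.
move=> h0. have m1 : measurable [set x : R | 0 <= x] by rewrite -set_itvcy; exact: measurable_itv.
have m2 : measurable [set x : R | dl < x] by rewrite -set_itvoy; exact: measurable_itv.
have -> : [set w | touches dl (fun j => psum w (j%:R * h)) k] =
  [set w | all (fun j => 0 <= psum w (j%:R * h)) (iota 0 k.+1)] `\`
  [set w | all (fun j => dl < psum w (j%:R * h)) (iota 0 k.+1)].
 apply/seteqP; split=> w; rewrite /setD /mkset /touches /pos_upto /low_upto.
  move=> /andP[-> /hasP[j jk h1]]; split=> // /allP /(_ j jk); rewrite ltNge. by rewrite h1.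
 move=> [-> /negP]; rewrite -has_predC andTb => /hasP[j jk h1].
 by apply/hasP; exists j => //; rewrite leNgt.
pose T := g_sigma_algebraType (filtration_gens N (k%:R * h)).
have := @measurableD _ T _ _ (filtration_all h0 (lexx _) m1) (filtration_all h0 (lexx _) m2). exact.
Qed.

(** The increment of the Brownian motion of particle 0 is independent of all other terms of the sum
    and has no atoms. *)
Lemma psum_atomless q : 0 < q -> P [set w | psum w q = 0] = 0%E.
Proof.
move=> q0; have i0 : (0 < N)%N := N0.
pose X w := \sum_(i < N) maxr 0 (xi i w) + \sum_(i < N | i != Ordinal N0) W i q w.
pose G w := W 0 q w - W 0 0 w. have W00 w : W 0 0 w = 0 by have [-> _ _ _] := BW 0.
have E w : psum w q = X w + G w.
 rewrite /psum /X /G W00 subr0 -addrA [X in _ + X]addrC.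
 have -> : \sum_(i < N) @zfam N w i q = \sum_(i < N) (maxr 0 (xi i w) + W i q w).
  by apply: eq_bigr => i _; rewrite /zfam /Z zpathE // ltW.
 by rewrite big_split /= [X in _ + X](bigD1 (Ordinal N0)).
have gG : gauss P (Num.sqrt (q - 0)) G by exact: gauss_incr.
have mxi (i : nat) : mfn (xi i : g_sigma_algebraType (rest N 0 0) -> R).
 apply: (@mfn_sigma_of _ _ _ _ [set: nat] (fun j => xi j : Om -> R)) => //.
 by move=> Y SY; apply: sub_sigma_algebra; left.
have mX : mfn (X : g_sigma_algebraType (rest N 0 0) -> R).
 apply: measurable_funD.
  by apply: measurable_sum => i; apply: measurable_maxr; [exact: measurable_cst|exact: mxi].
 have mF (i : 'I_N) : mfn ((fun w => if i != Ordinal N0 then W i q w else 0) :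
   g_sigma_algebraType (rest N 0 0) -> R).
  have [->|ni] := eqVneq i (Ordinal N0); first exact: measurable_cst.
  by apply: mfn_rest_W => //; exact: ltW.
 have := measurable_sum (index_enum 'I_N) mF. by congr mfn; apply/funext => w; rewrite [RHS]big_mkcond.
have mX' : mfn X.
 apply: measurable_funD.
  by apply: measurable_sum => i; apply: measurable_maxr; [exact: measurable_cst|exact: measurable_funPT].
 rewrite (_ : (fun w => _) = fun w => \sum_(i < N) (if i != Ordinal N0 then W i q w else 0)); last first.
  by apply/funext => w; rewrite big_mkcond.
 apply: (@measurable_sum _ _ _ _ _ (index_enum 'I_N)
  (fun i w => if i != Ordinal N0 then W i q w else 0)) => i.
 by have [->|ni] := eqVneq i (Ordinal N0); [exact: measurable_cst|exact: measurable_funPT].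
have -> : [set w | psum w q = 0] = [set w | X w + G w = 0].
 by apply/seteqP; split=> w /=; rewrite E.
apply: (indep_atomless gG mX').
apply: (indepRV_sigma (F := rest N 0 0) (G := sigma_of [set: unit] (fun _ w => W 0 q w - W 0 0 w))) => //.
- have H := @rest_future N 0%N 0 q (lexx 0) q0. apply: (indep_sub H) => //.
 by apply: smallest_sub => //; exact: smallest_sigma_algebra.
- by apply: (@mfn_sigma_of _ _ _ _ [set: unit] (fun _ w => W 0 q w - W 0 0 w) _ tt).
Qed.

Section touching_estimate.
Variables (q dl : R).
Hypotheses (q0 : 0 < q) (dl0 : 0 < dl).

Let h n : R := q / 2 ^+ n.
Let s n w j := psum w (j%:R * h n).
Let En n := [set w | touches dl (s n w) (2 ^ n)].
Definition capped w := maxr 0 (minr (psum w q) 1).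

Let h0 n : 0 < h n. Proof. by rewrite divr_gt0 ?exprn_gt0. Qed.

Let hq n : (2 ^ n)%:R * h n = q.
Proof. by rewrite natrX mulrC divfK // gt_eqF // exprn_gt0. Qed.

Lemma measurable_touches n : measurable (En n).
Proof. by apply: filtration_measurable; exact: filtration_touches (ltW (h0 n)). Qed.

Lemma mfn_capped : mfn capped.
Proof.
apply: measurable_maxr; first exact: measurable_cst.
by apply: measurable_minr; [exact: mfn_psum|exact: measurable_cst].
Qed.

Lemma capped_bound w : 0 <= capped w <= 1.
Proof. by rewrite /capped le_max lexx ge_max ler01 ge_min lexx orbT. Qed.

Lemma igr_capped A : measurable A -> igr P (fun w => \1_A w * capped w).
Proof.
move=> mA; apply: (@igr_bnd _ _ _ P 1) => [|w].
 by apply: measurable_funM; [exact: mfn_indic|exact: mfn_capped].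
have /andP[c0 c1] := capped_bound w.
by rewrite indicE; case: (_ \in _); rewrite ?mul1r ?mul0r ?normr0 ?ger0_norm.
Qed.

(** The bet of [touching_gain] has mean zero; it wins at least the final value minus dl on the event
    and loses at most dl + M. Since |x| <= dl + x^4 / dl^3, all steps are bounded by M at once, and
    the sum of fourth powers has mean of order 2^-n. *)
Lemma touching_estimate n : Ex P (fun w => \1_(En n) w * capped w) <=
 2 * dl + 128 * N%:R ^+ 5 * q ^+ 2 / dl ^+ 3 * dy n.
Proof.
pose x j w := step_sum N (j%:R * h n) (j.+1%:R * h n) w. pose A j := [set w | touches dl (s n w) j].
have t0 j : 0 <= j%:R * h n by apply: mulr_ge0 => //; exact: ltW.
have tS j : j%:R * h n < j.+1%:R * h n by rewrite ltr_pM2r // ltr_nat.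
have tD j : j.+1%:R * h n - j%:R * h n = h n by rewrite -mulrBl -natrB // subSnn mul1r.
have FA j : particle_filtration xi W N (j%:R * h n) (A j).
 exact: filtration_touches (ltW (h0 n)).
have dx j w : s n w j.+1 - s n w j = x j w by exact: psum_incr.
have H1 j := step_sum_mean (t0 j) (tS j) (FA j).
have H4 j : igr P (fun w => x j w ^+ 4) /\ Ex P (fun w => x j w ^+ 4) <= 128 * N%:R ^+ 5 * h n ^+ 2.
 have FT : particle_filtration xi W N (j%:R * h n) setT by exact: g_sigma_setT.
 have := step_sum_pow4 (t0 j) (tS j) FT; rewrite tD.
 have -> : (fun w => \1_setT w * step_sum N (j%:R * h n) (j.+1%:R * h n) w ^+ 4) = (fun w => x j w ^+ 4).
  by apply/funext => w; rewrite indicT mul1r.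
 by rewrite /Pr probability_setT /= mulr1.
pose D w := \sum_(j < 2 ^ n) \1_(A j) w * x j w.
pose M w := dl + (dl ^+ 3)^-1 * \sum_(j < 2 ^ n) x j w ^+ 4.
have iD : igr P D by apply: igr_sum => j; case: (H1 j). have ED : Ex P D = 0.
 rewrite Ex_sum => [|j]; last by case: (H1 j). by apply: big1 => j _; case: (H1 j).
have iM : igr P M.
 by apply: igrD; [exact: igr_cst|apply: igrZ; apply: igr_sum => j; case: (H4 j)].
have d3 : 0 < dl ^+ 3 by exact: exprn_gt0.
have sum0 w : 0 <= \sum_(j < 2 ^ n) x j w ^+ 4 by apply: sumr_ge0 => j _; exact: exprn_even_ge0.
have M0 w : 0 <= M w by apply: addr_ge0; [exact: ltW|apply: mulr_ge0 => //; rewrite invr_ge0 ltW].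
have EM : Ex P M <= dl + 128 * N%:R ^+ 5 * q ^+ 2 / dl ^+ 3 * dy n.
 rewrite ExD; [|exact: igr_cst|by apply: igrZ; apply: igr_sum => j; case: (H4 j)].
 rewrite Ex_cst lerD2l ExZ; last by apply: igr_sum => j; case: (H4 j).
 rewrite Ex_sum => [|j]; last by case: (H4 j).
 apply: (@le_trans _ _ ((dl ^+ 3)^-1 * \sum_(j < 2 ^ n) (128 * N%:R ^+ 5 * h n ^+ 2))).
  apply: ler_wpM2l; first by rewrite invr_ge0 ltW. by apply: ler_sum => j _; case: (H4 j).
 rewrite sumr_const card_ord -[_ *+ _]mulr_natr natrX /h /dy le_eqVlt; apply/orP; left; apply/eqP.
 by field; rewrite !gt_eqF // exprn_gt0.
have step w k : (k < 2 ^ n)%N -> `|s n w k.+1 - s n w k| <= M w.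
 move=> kn; rewrite dx; set y := x k w. have le4 : y ^+ 4 <= \sum_(j < 2 ^ n) x j w ^+ 4.
  by rewrite (bigD1 (Ordinal kn)) //= lerDl; apply: sumr_ge0 => j _; exact: exprn_even_ge0.
 apply: (@le_trans _ _ (dl + (dl ^+ 3)^-1 * y ^+ 4)); last first.
  by rewrite lerD2l ler_wpM2l // invr_ge0 ltW.
 rewrite -[y ^+ 4](ger0_norm (exprn_even_ge0 _ _)) // normrX; move: `|y| (normr_ge0 y) => z z0.
 have [zd|zd] := leP z dl; first by rewrite -[leLHS]addr0 lerD // mulr_ge0 ?invr_ge0 ?exprn_ge0 // ltW.
 rewrite mulrC ler_wpDl ?(ltW dl0) // ler_pdivlMr // [z ^+ 4]exprS ler_wpM2l //.
 by apply: lerXn2r; rewrite ?nnegrE ?(ltW dl0) ?(ltW zd).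
have key w : \1_(En n) w * capped w <= D w + (dl + M w).
 have [g1 g2] := touching_gain (ltW dl0) (M0 w) (step w) (leqnn (2 ^ n)).
 have DE : \sum_(j < 2 ^ n) (touches dl (s n w) j)%:R * (s n w j.+1 - s n w j) = D w.
  apply: eq_bigr => j _; rewrite dx indicE; congr (_ * _).
  suff -> : (w \in A j) = touches dl (s n w) j by [].
  by apply/idP/idP => [/set_mem //|h1]; exact: mem_set.
 rewrite DE in g1 g2; rewrite indicE. case: (boolP (w \in En n)) => [|_]; last by rewrite mul0r; lra.
 rewrite inE => E; rewrite mul1r; have := g1 E; rewrite /s hq.
 have : 0 <= psum w q by have /andP[/pos_upto_last] := E; rewrite /s hq.
 move=> p0 p1; have : capped w <= psum w q by rewrite /capped ge_max p0 ge_min lexx.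
 by have := M0 w; lra.
have idM : igr P (fun w => dl + M w) by apply: igrD => //; exact: igr_cst.
apply: (le_trans (Ex_le (igr_capped (measurable_touches n)) (igrD iD idM) key)).
by rewrite (ExD iD idM) ED add0r (ExD (igr_cst _ _) iM) Ex_cst; lra.
Qed.

End touching_estimate.

(** A path that stays nonnegative and vanishes before q is seen by all fine grids to come below
    every dl, so it lies in A. The touching estimate gives E(1_A capped) = 0; on A the sum is then
    nonpositive at q, hence zero there, which has probability zero. *)
Lemma no_touching q : 0 < q -> {ae P, forall w, (forall s, 0 <= s -> s <= q -> 0 <= psum w s) ->
 forall s, 0 <= s -> s < q -> psum w s != 0}.
Proof.
move=> q0. pose h n : R := q / 2 ^+ n. have h0 n : 0 < h n by rewrite divr_gt0 ?exprn_gt0.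
pose En dl n := [set w | touches dl (fun j => psum w (j%:R * h n)) (2 ^ n)].
have mE dl n : measurable (En dl n) by exact: measurable_touches.
pose B dl m := \bigcap_(n in [set n | (m <= n)%N]) En dl n. have mB dl m : measurable (B dl m).
 by rewrite /B bigcap_mkcond; apply: bigcapT_measurable => n; case: ifP.
pose C dl := \bigcup_m B dl m. have mC dl : measurable (C dl) by apply: bigcupT_measurable.
have EC dl : 0 < dl -> Ex P (fun w => \1_(C dl) w * capped q w) <= 3 * dl.
 move=> dl0. have [_ cv] : igr P (fun w => \1_(C dl) w * capped q w) /\
   Ex P (fun w => \1_(B dl m) w * capped q w) @[m --> \oo] --> Ex P (fun w => \1_(C dl) w * capped q w).
  apply: (Ex_dct (F := fun m w => \1_(B dl m) w * capped q w) (g := cst 1)).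
  - by move=> m; exact: igr_mfn (igr_capped q (mB dl m)).
  - exact: igr_cst.
  - move=> m w; have /andP[c0 c1] := capped_bound q w.
   by rewrite indicE; case: (_ \in _); rewrite ?mul1r ?mul0r ?normr0 ?ger0_norm.
  - move=> w; apply: cvg_near_cst; case: (pselect (C dl w)) => Cw.
    have [m _ Bm] := Cw; exists m => // k /= mk; congr (_ * _).
    by rewrite !indicE !mem_set // => n /= kn; apply: Bm; exact: leq_trans kn.
   near=> m; rewrite !indicE !memNset // => Bm; apply: Cw; by exists m.
 pose c := 128 * N%:R ^+ 5 * q ^+ 2 / dl ^+ 3.
 have c0 : 0 <= c by apply: divr_ge0; [apply: mulr_ge0; [exact: mulr_ge0 (exprn_ge0 _ _)|exact: sqr_ge0]|
   apply: exprn_ge0; exact: ltW].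
 have e0 : 0 < dl / (c + 1) by rewrite divr_gt0 // ltr_wpDl. have [n0 _ Hn0] := dy_small e0.
 have bnd m : Ex P (fun w => \1_(B dl m) w * capped q w) <= 3 * dl.
  pose n := maxn m n0. apply: (@le_trans _ _ (Ex P (fun w => \1_(En dl n) w * capped q w))).
   apply: Ex_le; [exact: igr_capped|exact: igr_capped|move=> w].
   have /andP[p0 _] := capped_bound q w; apply: ler_wpM2r => //.
   rewrite !indicE; case: (boolP (w \in B dl m)) => // /set_mem Bw.
   by rewrite mem_set //; apply: Bw; exact: leq_maxl.
  apply: (le_trans (touching_estimate q0 dl0 n)); rewrite -/c. have : c * dy n <= dl.
   apply: (@le_trans _ _ (c * (dl / (c + 1)))).
    by apply: ler_wpM2l => //; apply: Hn0; exact: leq_maxr.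
   by rewrite mulrA ler_pdivrMr ?ltr_wpDl // mulrC ler_wpM2l ?(ltW dl0) // lerDl.
  by lra.
 have -> : Ex P (fun w => \1_(C dl) w * capped q w) =
   limn (fun m => Ex P (fun w => \1_(B dl m) w * capped q w)) by apply/esym/cvg_lim.
 apply: limr_le; first by apply/cvg_ex; eexists; exact: cv. by near=> m; exact: bnd.
pose A := \bigcap_j C (dy j). have mA : measurable A by apply: bigcapT_measurable.
have EA : Ex P (fun w => \1_A w * capped q w) = 0.
 apply/eqP; rewrite eq_le; apply/andP; split; last first.
  by apply: Ex_ge0 => w; have /andP[c0 _] := capped_bound q w; rewrite mulr_ge0 // indicE.
 rewrite leNgt; apply/negP => e0.
 have e3 : 0 < Ex P (fun w => \1_A w * capped q w) / 6 by rewrite divr_gt0.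
 have [j _ /(_ j (leqnn j)) Hj] := dy_small e3. have : Ex P (fun w => \1_A w * capped q w) <= 3 * dy j.
  apply: le_trans (EC _ (dy_gt0 j)); apply: Ex_le; [exact: igr_capped|exact: igr_capped|move=> w].
  have /andP[c0 _] := capped_bound q w; apply: ler_wpM2r => //.
  rewrite !indicE; case: (boolP (w \in A)) => // /set_mem Aw. by rewrite mem_set //; exact: Aw.
 by move: Hj e0; lra.
have ae1 : {ae P, forall w, \1_A w * capped q w = 0}.
 apply: Ex_eq0_ae => // [|w]; first exact: igr_capped.
 by have /andP[c0 _] := capped_bound q w; rewrite mulr_ge0 // indicE.
have ae2 : {ae P, forall w, psum w q <> 0}.
 exists [set w | psum w q = 0]; split; last by move=> w /= /contrapT.
  by have := mfn_psum q measurableT (measurable_set1 0); rewrite setTI.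
 exact: psum_atomless.
apply: filterS2 ae1 ae2 => w H1 H2 pos s s0 sq; apply/eqP => Ss; apply: H2. have Aw : A w.
 move=> j _; have dj := @dy_gt0 R j; have [cc _] := cpath_psum w. have [k k0 Hk] := cts_dist (cc s) dj.
 have kq : 0 < k / q by rewrite divr_gt0. have [m _ Hm] := dy_small kq; exists m => // n /= mn.
 have hk : h n <= k.
  by have := Hm n mn; rewrite /dy ler_pdivlMr // mulrC.
 pose i := Num.truncn (s / h n).
 have /andP[i1 i2] : i%:R <= s / h n < i.+1%:R by apply: truncn_itv; rewrite divr_ge0 // ltW.
 rewrite ler_pdivlMr // in i1; rewrite ltr_pdivrMr // in i2. have iq : (i < 2 ^ n)%N.
  rewrite -(ltr_nat R) -(ltr_pM2r (h0 n)); apply: (le_lt_trans i1); apply: (lt_le_trans sq).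
  by rewrite /h natrX mulrC divfK // gt_eqF // exprn_gt0.
 rewrite /En /= /touches; apply/andP; split.
  apply/allP => u; rewrite mem_iota add0n ltnS => /andP[_ un]; apply: pos.
   by apply: mulr_ge0 => //; exact: ltW.
  have -> : q = (2 ^ n)%:R * h n by rewrite /h natrX mulrC divfK // gt_eqF // exprn_gt0.
  by apply: ler_wpM2r; [exact: ltW|rewrite ler_nat].
 apply/hasP; exists i; first by rewrite mem_iota add0n ltnS /= ltnW.
 have : `|psum w (i%:R * h n) - psum w s| < dy j.
  apply: Hk; rewrite ler0_norm ?subr_le0 // opprB.
  by apply: lt_le_trans hk; rewrite ltrBlDr; move: i2; rewrite -natr1 mulrDl mul1r addrC.
 by rewrite Ss subr0 => /ltW /(le_trans (ler_norm _)).
have pq : 0 <= psum w q by apply: pos => //; exact: ltW.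
move: H1; rewrite indicE mem_set // mul1r /capped => c0.
have : minr (psum w q) 1 <= 0 by rewrite -c0 le_max lexx orbT.
by rewrite ge_min => /orP[p0|]; [apply/eqP; rewrite eq_le p0 pq|rewrite ler10].
Unshelve. all: by end_near.
Qed.

Lemma sum_refl w f s : f s = avgN N w f s ->
 \sum_(i < N) refl f (@zfam N w i) s = psum w s - (alpha - 1) * N%:R * f s.
Proof.
move=> fE; have NR : N%:R != 0 :> R by rewrite pnatr_eq0 -lt0n.
have E : \sum_(i < N) phi f (@zfam N w i) s = f s * N%:R.
 by rewrite [in RHS]fE /avg_phi divfK.
rewrite /refl big_split /= E big_split /= sumr_const card_ord -[X in _ + X + _]mulr_natr /psum.
by rewrite mulNr; ring.
Qed.

Lemma critical_positive w s : alpha = 1 -> goodN N w s -> 0 < psum w s.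
Proof.
move=> a1 [ls card]. have cz := @cpath_zfam N w. have lE := lam_fix alpha0 N0 cz ls.
have r0 (i : 'I_N) : 0 <= refl (lamN N w) (@zfam N w i) s.
 by apply: refl_ge0 => //; exact: lam_mono.
have := sum_refl lE; rewrite a1 subrr !mul0r subr0 -a1 => <-.
rewrite lt_neqAle sumr_ge0 // andbT eq_sym psumr_eq0 //; apply/negP => /allP all0.
move: card; rewrite [X in X * _]a1 mul1r ltr_nat ltnNge => /negP; apply.
rewrite -{1}(card_ord N) subset_leq_card //; apply/fintype.subsetP => i _.
by rewrite inE; exact: all0 (mem_index_enum i).
Qed.

(** If a solution outlived tau_star, [lam] would be finite there, and a bad time with finite [lam]
    has all N particles at zero, so the sum vanishes. The sum must nevertheless stay nonnegative
    afterwards, which [no_touching] excludes. Rational end points make the exceptional set a single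
    null set. *)
Lemma critical_lifetime : alpha = 1 -> {ae P, forall w,
 forall (L : 'I_N -> R -> Om -> R) (tau : Om -> ext_time R), solves_system L tau w ->
  (\val (tau w) <= tauN N w)%E /\
  (psum w 0 <= 0 -> \val (tau w) = 0%E)}.
Proof.
move=> a1. have ae : {ae P, forall w, forall q : rat, 0 < (ratr q : R) ->
  (forall s, 0 <= s -> s <= ratr q -> 0 <= psum w s) ->
  forall s, 0 <= s -> s < ratr q -> psum w s != 0}.
 apply: ae_forall_count => q; have [q0|q0] := ltP 0 (ratr q : R).
  by apply: filterS (no_touching q0) => w H _; exact: H.
 by apply: aeW => w.
apply: filterS ae => w H L tau S. have T0 := set_mem (valP (tau w)). have cz := @cpath_zfam N w.
have key s : 0 <= s -> (s%:E < \val (tau w))%E -> psum w s <= 0 -> False.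
 move=> s0 sT p0. have [r sr rT] : exists2 r : R, s < r & (r%:E < \val (tau w))%E.
  case: (\val (tau w)) sT => [u| |] //.
   rewrite lte_fin => su; exists ((s + u) / 2); first lra. by rewrite lte_fin; lra.
  by exists (s + 1); [lra|exact: ltry].
 have [q /itvP qI] := rat_in_itvoo sr. have q0 : 0 < ratr q :> R by apply: le_lt_trans s0 _; rewrite qI.
 have bq : before (\val (tau w)) (ratr q).
  by split; [exact: ltW|apply: lt_trans rT; rewrite lte_fin qI].
 have [cf mf f0 fE _] := S (ratr q) bq. have pos t : 0 <= t -> t <= ratr q -> 0 <= psum w t.
  move=> t0 tq; have := sum_refl (fE t tq); rewrite {2}a1 subrr !mul0r subr0 => <-.
  by apply: sumr_ge0 => i _; apply: refl_ge0.
 have sq : s < ratr q by rewrite qI. have := H q q0 pos s s0 sq; rewrite eq_le p0 pos ?(ltW sq) //.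
split; last first.
 move=> p0; apply/eqP; rewrite eq_le T0 andbT leNgt; apply/negP => h. exact: (key 0 (lexx 0) h p0).
rewrite leNgt; apply/negP => lt. have [s sE] : exists s, tauN N w = s%:E.
 have := tau_star_ge0 alpha (@zfam N w). case: (tau_star _ _) lt => // [s _ _|]; first by exists s.
 by rewrite ltNge leey.
rewrite sE in lt; have s0 : 0 <= s by rewrite -lee_fin -sE tau_star_ge0.
have bs : before (\val (tau w)) s by []. have [cf mf f0 fE _] := S s bs.
have ls : lfin alpha (@zfam N w) s.
 exists (frozen_at (mean_path L w) s s) => n. exact: (picard_le_fixpoint alpha0 N0 cz n (mf s) fE).
have bad := tau_star_bad alpha0 N0 cz sE.
apply: (key s s0 lt); rewrite leNgt; apply/negP => p0; apply: bad; split=> //.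
rewrite ltNge; apply/negP => NA. have all i : i \in zeros alpha (@zfam N w) s.
 have : (#|zeros alpha (@zfam N w) s| = #|'I_N|)%N.
  apply/eqP; rewrite eqn_leq max_card card_ord -(ler_nat R). by move: NA; rewrite [X in X * _]a1 mul1r.
 by move=> /subset_cardP /(_ (subset_predT _)) ->.
have lE := lam_fix alpha0 N0 cz ls.
have E := sum_refl lE; rewrite (_ : alpha - 1 = 0) ?a1 ?subrr // !mul0r subr0 -a1 in E.
move: p0; rewrite -E big1 ?ltxx // => i _. by have := all i; rewrite inE => /eqP.
Qed.

End sum_of_paths.

(** * Time spent by the sum at low heights before it reaches zero *)

Section occupation.
Variable N : nat.
Hypothesis N0 : (0 < N)%N.
Local Notation psum := (psum N).

Section one_scale.
Variables (a h : R) (K : nat).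
Hypotheses (a0 : 0 < a) (h0 : 0 < h).

Let s w j := psum w (j%:R * h).
Let x j w := step_sum N (j%:R * h) (j.+1%:R * h) w.
Let C4 : R := 128 * N%:R ^+ 5.
Definition moment8_cst : R := 2 * 16 ^+ 4 * N%:R ^+ 9.

Definition active k := [set w | alive (s w) k /\ s w k <= 5 * a].

Let t0 j : 0 <= j%:R * h. Proof. by apply: mulr_ge0 => //; exact: ltW. Qed.
Let tS j : j%:R * h < j.+1%:R * h. Proof. by rewrite ltr_pM2r // ltr_nat. Qed.
Let tD j : j.+1%:R * h - j%:R * h = h.
Proof. by rewrite -mulrBl -natrB // subSnn mul1r. Qed.

Let dx j w : s w j.+1 - s w j = x j w.
Proof. exact: psum_incr. Qed.

Lemma filtration_alive k : particle_filtration xi W N (k%:R * h) [set w | alive (s w) k].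
Proof.
have m1 : measurable [set x : R | 0 < x] by rewrite -set_itvoy; exact: measurable_itv.
exact: filtration_all (ltW h0) (lexx _) m1.
Qed.

Lemma filtration_active k : particle_filtration xi W N (k%:R * h) (active k).
Proof.
have m1 : measurable [set x : R | x <= 5 * a] by rewrite -set_itvNyc; exact: measurable_itv.
have -> : active k = [set w | alive (s w) k] `&` [set w | [set x | x <= 5 * a] (s w k)] by [].
by apply: g_sigma_setI; [exact: filtration_alive|exact: filtration_psum].
Qed.

Lemma measurable_active k : measurable (active k).
Proof. by apply: filtration_measurable; exact: filtration_active. Qed.

(** Expectation of [exit_bound] through [pot_step]: the linear term has mean zero, the square gives
    at least h / 2 per active step, and the smallness of h lets the quartic correction take at most
    half of it. On the right, (8a + M)^2 <= 128 a^2 + 2 M^2 with M^2 = a^2 plus eighth powers over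
    a^6. *)
Lemma occupation : 128 * N%:R ^+ 5 * h <= 9 / 4 * a ^+ 2 -> \sum_(k < K) Pr P (active k) * (h / 4) <=
 130 * a ^+ 2 + 2 * (K%:R * (moment8_cst * h ^+ 4) / a ^+ 6).
Proof.
move=> ha; have a6 : 0 < a ^+ 6 by exact: exprn_gt0. have mA j : measurable [set w | alive (s w) j].
 by apply: filtration_measurable; exact: filtration_alive.
pose X j w : R := \1_[set w | alive (s w) j] w * maxr 0 (8 * a - s w j).
have X8 j w : 0 <= X j w <= 8 * a.
 rewrite /X indicE; case: (boolP (w \in _)) => [|_]; last by rewrite mul0r lexx mulr_ge0 // ltW.
 move=> /set_mem /alive_last sj; rewrite mul1r le_max lexx ge_max andTb; apply/andP.
 by split; [apply: mulr_ge0 => //; exact: ltW|rewrite gerBl ltW].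
have mXF j : mfn (X j : g_sigma_algebraType (filtration_gens N (j%:R * h)) -> R).
 apply: measurable_funM.
  apply: (@measurable_indic _ (g_sigma_algebraType (filtration_gens N (j%:R * h))) R setT).
  exact: filtration_alive.
 apply: measurable_maxr; first exact: measurable_cst.
 apply: measurable_funB; first exact: measurable_cst.
 by apply: measurable_sum => i; exact: mfn_zfam_filtration.
have mX j : mfn (X j).
 apply: measurable_funM; first exact: mfn_indic. apply: measurable_maxr; first exact: measurable_cst.
 by apply: measurable_funB; [exact: measurable_cst|exact: mfn_psum].
have iX j : igr P (X j).
 by apply: (@igr_bnd _ _ _ P (8 * a)) => // w; have /andP[p q] := X8 j w; rewrite ger0_norm.
have H1 j := step_sum_uncorrelated (t0 j) (tS j) (iX j) (mXF j).
have H2 j := step_sum_sqr (t0 j) (tS j) (@filtration_active j) N0.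
have H4 j := step_sum_pow4 (t0 j) (tS j) (@filtration_active j).
have H8 j := step_sum_pow8 N (t0 j) (tS j). pose c : R := (9 * a ^+ 2)^-1.
pose L j w := - 2 * (X j w * x j w) + (\1_(active j) w * x j w ^+ 2 - c * (\1_(active j) w * x j w ^+ 4)).
have iL j : igr P (L j) /\ Pr P (active j) * (h / 4) <= Ex P (L j).
 have [i1 E1] := H1 j; have [i2 E2] := H2 j; have [i4 E4] := H4 j.
 have i1' := igrZ (- 2) i1; have i4' := igrZ c i4; have i24 := igrB i2 i4'. split; first exact: igrD.
 rewrite /L (ExD i1' i24) (ExB i2 i4') (ExZ _ i1) (ExZ _ i4) E1 mulr0 add0r. rewrite tD in E2 E4.
 have c0 : 0 <= c by rewrite invr_ge0 mulr_ge0 // sqr_ge0. have p0 := Pr_ge0 P (active j).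
 have E4' := ler_wpM2l c0 E4.
 have : c * (128 * N%:R ^+ 5 * Pr P (active j) * h ^+ 2) <= Pr P (active j) * (h / 4).
  have -> : c * (128 * N%:R ^+ 5 * Pr P (active j) * h ^+ 2) =
    Pr P (active j) * h * ((128 * N%:R ^+ 5 * h) / (9 * a ^+ 2)).
   by rewrite /c; field; rewrite gt_eqF.
  have -> : Pr P (active j) * (h / 4) = Pr P (active j) * h * (1 / 4) by ring.
  apply: ler_wpM2l; first by apply: mulr_ge0 => //; exact: ltW.
  rewrite ler_pdivrMr; last by rewrite mulr_gt0 // exprn_gt0.
  by apply: (le_trans ha); rewrite le_eqVlt; apply/orP; left; apply/eqP; field.
 by move: E2 E4'; lra.
pose U w := 130 * a ^+ 2 + 2 * ((a ^+ 6)^-1 * \sum_(j < K) x j w ^+ 8).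
have i8 : igr P (fun w => \sum_(j < K) x j w ^+ 8) by apply: igr_sum => j; case: (H8 j).
have i8' := igrZ 2 (igrZ (a ^+ 6)^-1 i8). have iU : igr P U by apply: igrD => //; exact: igr_cst.
have key w : \sum_(j < K) L j w <= U w.
 have sum0 : 0 <= \sum_(j < K) x j w ^+ 8 by apply: sumr_ge0 => j _; exact: exprn_even_ge0.
 pose M2 := a ^+ 2 + (a ^+ 6)^-1 * \sum_(j < K) x j w ^+ 8.
 have M20 : 0 <= M2 by apply: addr_ge0; [exact: sqr_ge0|apply: mulr_ge0 => //; rewrite invr_ge0 ltW].
 have step k : (k < K)%N -> `|s w k.+1 - s w k| <= Num.sqrt M2.
  move=> kK; rewrite dx -sqrtr_sqr ler_wsqrtr // /M2; set y := x k w.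
  have le8 : y ^+ 8 <= \sum_(j < K) x j w ^+ 8.
   by rewrite (bigD1 (Ordinal kK)) //= lerDl; apply: sumr_ge0 => j _; exact: exprn_even_ge0.
  apply: (@le_trans _ _ (a ^+ 2 + (a ^+ 6)^-1 * y ^+ 8)); last first.
   by rewrite lerD2l ler_wpM2l // invr_ge0 ltW.
  have [ya|ya] := leP (y ^+ 2) (a ^+ 2).
   by rewrite (le_trans ya) // lerDl mulr_ge0 ?exprn_even_ge0 // invr_ge0 ltW.
  rewrite ler_wpDl ?sqr_ge0 // mulrC ler_pdivlMr // (exprD y 2 6); apply: ler_wpM2l; first exact: sqr_ge0.
  rewrite (exprM a 2 3) (exprM y 2 3); apply: lerXn2r; rewrite ?nnegrE ?sqr_ge0 //; exact: ltW.
 have eb := exit_bound (ltW a0) (sqrtr_ge0 M2) step.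
 apply: (@le_trans _ _ ((8 * a + Num.sqrt M2) ^+ 2)); last first.
  have q2 : Num.sqrt M2 ^+ 2 = M2 by exact: sqr_sqrtr.
  have -> : U w = 128 * a ^+ 2 + 2 * M2 by rewrite /U /M2; ring. move: q2; move: (Num.sqrt M2) => r <-.
  rewrite -subr_ge0 (_ : _ - _ = (8 * a - r) ^+ 2); last by ring. exact: sqr_ge0.
 apply: le_trans eb; apply: ler_sum => j _; rewrite -/(s w j.+1) -/(s w j).
 have -> : s w j.+1 = s w j + x j w by rewrite -dx addrC subrK. have ps := pot_step (s w j) (x j w) a0.
 rewrite /L /X !indicE /active. have -> : (w \in [set w | alive (s w) j]) = alive (s w) j.
  by apply/idP/idP => [/set_mem //|h1]; exact: mem_set.
 have -> : (w \in [set w | alive (s w) j /\ s w j <= 5 * a]) = alive (s w) j && (s w j <= 5 * a).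
  by apply/idP/idP => [/set_mem [-> ->] //|/andP h1]; exact: mem_set.
 case: (alive (s w) j); rewrite ?andFb ?andTb ?mul0r ?mul1r ?mulr0 ?subr0 ?addr0 //.
 apply: le_trans ps; rewrite -mulrA lerD2l /c; case: (s w j <= 5 * a); rewrite ?mul1r ?mul0r ?mulr0 ?subr0 //.
 by rewrite [_^-1 * _]mulrC.
apply: (@le_trans _ _ (\sum_(k < K) Ex P (L k))); first by apply: ler_sum => k _; case: (iL k).
rewrite -Ex_sum => [|k]; last by case: (iL k).
apply: (le_trans (Ex_le _ iU key)); first by apply: igr_sum => k; case: (iL k).
rewrite (ExD (igr_cst _ _) i8') Ex_cst (ExZ _ (igrZ _ i8)) (ExZ _ i8) lerD2l.
apply: ler_wpM2l => //; rewrite mulrC; apply: ler_wpM2r; first by rewrite invr_ge0 ltW.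
rewrite Ex_sum => [|j]; last by case: (H8 j). apply: (@le_trans _ _ (\sum_(j < K) moment8_cst * h ^+ 4)).
 by apply: ler_sum => j _; case: (H8 j) => _; rewrite tD.
by rewrite sumr_const card_ord -[_ *+ _]mulr_natr mulrC.
Qed.

End one_scale.

End occupation.

(** * Summation over the scales *)

Section scales.
Variable N : nat.
Hypothesis N0 : (0 < N)%N.
Variable Q : nat.
Hypothesis Q0 : (0 < Q)%N.

Local Notation sc_K := (sc_K Q).

Lemma sc_Kh n : (sc_K n)%:R * sc_h n = Q%:R :> R.
Proof. by rewrite /sc_K natrM -mulrA [_ * sc_h n]mulrC sc_h_pow mulr1. Qed.

Definition sc_act n k := active N (sc_a n) (sc_h n) k.
Definition sc_osc n (i : 'I_N) k w := root4 (osc4 (@zfam N w i) (k%:R * sc_h n) (sc_h n)).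
(** Up to a factor, [sc_V] bounds the growth of [lam] over the active cells of scale n, while a
    small [sc_U] forces all grid increments of that scale to be small compared with a. *)
Definition sc_V n w := \sum_(k < sc_K n) \1_(sc_act n k) w * \sum_(i < N) sc_osc n i k w.
Definition sc_U n w := \sum_(k < sc_K n) \sum_(i < N)
 (@zfam N w i (k.+1%:R * sc_h n) - @zfam N w i (k%:R * sc_h n)) ^+ 8 / sc_a n ^+ 8.

Let C8 := moment8_cst N.
Let C8' := moment8_cst 1.

Lemma sc_V_ge0 n w : 0 <= sc_V n w.
Proof.
apply: sumr_ge0 => k _; apply: mulr_ge0; first by rewrite indicE.
by apply: sumr_ge0 => i _; exact: root4_ge0.
Qed.

Lemma sc_U_ge0 n w : 0 <= sc_U n w.
Proof.
apply: sumr_ge0 => k _; apply: sumr_ge0 => i _. by apply: divr_ge0; apply: exprn_even_ge0.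
Qed.

Let dy1 n : dy n <= 1 :> R.
Proof. by rewrite /dy invf_le1 ?exprn_gt0 // exprn_ege1 // ler1n. Qed.

(** Write y = [dy n], so a = y^2 and h = y^6. An oscillation x satisfies x <= y^3 + x^4 / y^9 with E
    x^4 of order h^2 = y^12, hence costs y^3 on average; the expected number of active cells is of
    order y^4 / h. The product is of order y. *)
Lemma sc_V_mean n : 128 * N%:R ^+ 5 * dy n ^+ 2 <= 9 / 4 :> R -> igr P (sc_V n) /\
 Ex P (sc_V n) <= 4 * (130 + 2 * Q%:R * C8) * N%:R * (1 + osc_cst R) * dy n.
Proof.
move=> small; set y := dy n; have y0 : 0 < y by exact: dy_gt0.
have a0 := @sc_a_gt0 R n; have h0 := @sc_h_gt0 R n. have c0 := @osc_cst_gt0 R.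
have occ : \sum_(k < sc_K n) Pr P (sc_act n k) * (sc_h n / 4) <= (130 + 2 * Q%:R * C8) * y ^+ 4.
 have := occupation N0 (sc_K n) a0 h0. have -> : 128 * N%:R ^+ 5 * sc_h n <= 9 / 4 * sc_a n ^+ 2 :> R.
  rewrite /sc_h /sc_a -/y -exprM (exprD y 2 4) mulrA; apply: ler_wpM2r => //.
  by apply: exprn_ge0; exact: ltW.
 have a2 : sc_a n ^+ 2 = y ^+ 4 by rewrite /sc_a -exprM.
 have -> : (sc_K n)%:R * (moment8_cst N * sc_h n ^+ 4) / sc_a n ^+ 6 = Q%:R * C8 * y ^+ 6.
  have -> : (sc_K n)%:R * (moment8_cst N * sc_h n ^+ 4) = Q%:R * C8 * sc_h n ^+ 3.
   by rewrite -(sc_Kh n) [sc_h n ^+ 4]exprS /C8; ring.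
  by rewrite /sc_h /sc_a -/y; field; rewrite gt_eqF.
 rewrite a2 => /(_ isT) H; apply: (le_trans H); rewrite [leRHS]mulrDl lerD2l (mulrA 2 (Q%:R * C8)) (mulrA 2 Q%:R).
 apply: ler_wpM2l; first by rewrite !mulr_ge0 // exprn_ge0.
 by apply: ler_wiXn2l; [exact: ltW|exact: dy1|].
have io k (i : 'I_N) : igr P (fun w => \1_(sc_act n k) w * sc_osc n i k w) /\
  Ex P (fun w => \1_(sc_act n k) w * sc_osc n i k w) <=
  Pr P (sc_act n k) * (y ^+ 3 * (1 + osc_cst R)).
 have mA : measurable (sc_act n k) by exact: measurable_active.
 have t0 : 0 <= k%:R * sc_h n :> R by apply: mulr_ge0 => //; exact: ltW.
 have FA : particle_filtration xi W N (k%:R * sc_h n) (sc_act n k).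
  by rewrite /sc_act; apply: filtration_active.
 have ind s t : k%:R * sc_h n <= s -> s < t ->
   indepRV P (\1_(sc_act n k) : Om -> R) (fun w => W i t w - W i s w).
  by move=> ks st; exact: (filtration_future i t0 ks st FA).
 have [i4 E4] := indic_osc4 (xi i) (BW i) mA t0 h0 ind.
 have O0 w : 0 <= osc4 (@zfam N w i) (k%:R * sc_h n) (sc_h n).
  by apply: osc4_ge0 => //; exact: cpath_zfam.
 pose G w := y ^+ 3 * \1_(sc_act n k) w + (y ^+ 9)^-1 * (\1_(sc_act n k) w *
   osc4 (@zfam N w i) (k%:R * sc_h n) (sc_h n)).
 have y3 : 0 < y ^+ 3 by exact: exprn_gt0. have y9 : 0 < y ^+ 9 by exact: exprn_gt0.
 have iI := igr_indic P mA. have iG : igr P G by apply: igrD; exact: igrZ.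
 have le w : \1_(sc_act n k) w * sc_osc n i k w <= G w.
  rewrite /G -(root4E (O0 w)) -/(sc_osc n i k w) mulrCA [y ^+ 3 * _]mulrC -mulrDr.
  apply: ler_wpM2l; first by rewrite indicE.
  move: (sc_osc n i k w) (root4_ge0 (osc4 (@zfam N w i) (k%:R * sc_h n) (sc_h n))) => x _.
  have x4 : 0 <= (y ^+ 9)^-1 * x ^+ 4 by rewrite mulr_ge0 ?exprn_even_ge0 // invr_ge0 ltW.
  have [xy|xy] := leP x (y ^+ 3); first by rewrite (le_trans xy) // lerDl.
  rewrite ler_wpDl ?(ltW y3) // mulrC ler_pdivlMr // [x ^+ 4]exprS (exprM y 3 3).
  apply: ler_wpM2l; first exact: le_trans (ltW y3) (ltW xy).
  by apply: lerXn2r; rewrite ?nnegrE ?(ltW y3) ?(ltW xy) // (le_trans (ltW y3)) // ltW.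
 have ig : igr P (fun w => \1_(sc_act n k) w * sc_osc n i k w).
  apply: (igr_dom _ iG).
   apply: measurable_funM; first exact: mfn_indic.
   by apply: mfn_root4; apply: mfn_osc4 => // [r|w]; [exact: mfn_zpath|exact: cpath_zfam].
  by move=> w; rewrite ger0_norm // mulr_ge0 ?root4_ge0 // indicE.
 split=> //; apply: (le_trans (Ex_le ig iG le)).
 rewrite (ExD (igrZ _ iI) (igrZ _ i4)) (ExZ _ iI) (ExZ _ i4) Ex_indic //.
 apply: (@le_trans _ _ (y ^+ 3 * Pr P (sc_act n k) + (y ^+ 9)^-1 *
  (osc_cst R * Pr P (sc_act n k) * sc_h n ^+ 2))).
  by rewrite lerD2l; apply: ler_wpM2l => //; rewrite invr_ge0 ltW.
 rewrite /sc_h -/y -exprM le_eqVlt; apply/orP; left; apply/eqP. by field; rewrite gt_eqF.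
have iSum k : igr P (fun w => \1_(sc_act n k) w * \sum_(i < N) sc_osc n i k w).
 by under eq_fun do rewrite mulr_sumr; apply: igr_sum => i; case: (io k i).
split; first exact: igr_sum. rewrite Ex_sum //.
apply: (@le_trans _ _ (\sum_(k < sc_K n) (Pr P (sc_act n k) * (sc_h n / 4) *
  (4 * N%:R * (y ^+ 3 * (1 + osc_cst R)) / sc_h n)))).
 apply: ler_sum => k _; rewrite (eq_Ex _ (fun w => mulr_sumr _ _ _ _)).
 rewrite Ex_sum => [|i]; last by case: (io k i).
 apply: (@le_trans _ _ (\sum_(i < N) Pr P (sc_act n k) * (y ^+ 3 * (1 + osc_cst R)))).
  by apply: ler_sum => i _; case: (io k i).
 rewrite sumr_const card_ord -[_ *+ _]mulr_natr le_eqVlt; apply/orP; left; apply/eqP.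
 by field; rewrite gt_eqF.
rewrite -mulr_suml. have k0 : 0 <= 4 * N%:R * (y ^+ 3 * (1 + osc_cst R)) / sc_h n.
 apply: divr_ge0; last exact: ltW. by rewrite !mulr_ge0 ?exprn_ge0 ?addr_ge0 // ltW.
apply: (le_trans (ler_wpM2r k0 occ)).
by rewrite /sc_h -/y le_eqVlt; apply/orP; left; apply/eqP; field; rewrite gt_eqF.
Qed.

Lemma sc_U_mean n : igr P (sc_U n) /\ Ex P (sc_U n) <= Q%:R * N%:R * C8' * dy n ^+ 2.
Proof.
set y := dy n; have y0 : 0 < y by exact: dy_gt0. have a0 := @sc_a_gt0 R n; have h0 := @sc_h_gt0 R n.
have H k (i : 'I_N) : let D w := @zfam N w i (k.+1%:R * sc_h n) - @zfam N w i (k%:R * sc_h n) in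
  igr P (fun w => D w ^+ 8 / sc_a n ^+ 8) /\
  Ex P (fun w => D w ^+ 8 / sc_a n ^+ 8) <= C8' * sc_h n ^+ 4 / sc_a n ^+ 8.
 move=> D; have t0 j : 0 <= j%:R * sc_h n :> R by apply: mulr_ge0 => //; exact: ltW.
 have tS : k%:R * sc_h n < k.+1%:R * sc_h n :> R by rewrite ltr_pM2r // ltr_nat.
 have DE w : D w = W i (k.+1%:R * sc_h n) w - W i (k%:R * sc_h n) w.
  exact: (zpath_incr (xi i) (BW i)).
 have [i8 E8] := gauss_moment8 (gauss_incr (BW i) (t0 k) tS).
 have e : (fun w => D w ^+ 8 / sc_a n ^+ 8) = (fun w => (sc_a n ^+ 8)^-1 *
   (W i (k.+1%:R * sc_h n) w - W i (k%:R * sc_h n) w) ^+ 8).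
  by apply/funext => w; rewrite DE mulrC.
 rewrite e; split; first exact: igrZ.
 rewrite (ExZ _ i8) [leRHS]mulrC; apply: ler_wpM2l; first by rewrite invr_ge0 exprn_ge0 // ltW.
 apply: (le_trans E8); rewrite (exprM _ 2 4) sqr_sqrtr ?subr_ge0 ?(ltW tS) //.
 by rewrite -mulrBl -natrB // subSnn mul1r /C8' /moment8_cst expr1n mulr1.
have iS k : igr P (fun w => \sum_(i < N)
  (@zfam N w i (k.+1%:R * sc_h n) - @zfam N w i (k%:R * sc_h n)) ^+ 8 / sc_a n ^+ 8).
 by apply: igr_sum => i; case: (H k i).
split; first exact: igr_sum. rewrite Ex_sum //.
apply: (@le_trans _ _ (\sum_(k < sc_K n) (C8' * sc_h n ^+ 4 / sc_a n ^+ 8 * N%:R))).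
 apply: ler_sum => k _; rewrite Ex_sum => [|i]; last by case: (H k i).
 apply: (@le_trans _ _ (\sum_(i < N) (C8' * sc_h n ^+ 4 / sc_a n ^+ 8))).
  by apply: ler_sum => i _; case: (H k i).
 by rewrite sumr_const card_ord -[_ *+ _]mulr_natr.
rewrite sumr_const card_ord -[_ *+ _]mulr_natr -(sc_Kh n) /sc_h /sc_a -/y.
by rewrite le_eqVlt; apply/orP; left; apply/eqP; field; rewrite gt_eqF.
Qed.

(** The mean of [sc_U] is of order y^2, so it may be divided by y = [dy]; a bounded sum then gives
    [sc_U] <= B y, which tends to zero. *)
Lemma scale_sums : exists n0, {ae P, forall w, exists B : R, forall m,
 \sum_(n < m) (sc_V (n0 + n) w + sc_U (n0 + n) w / dy (n0 + n)) <= B}.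
Proof.
have [n0 Hn0] : exists n0, forall n, (n0 <= n)%N -> 128 * N%:R ^+ 5 * dy n ^+ 2 <= 9 / 4 :> R.
 have NR : 0 < N%:R :> R by rewrite ltr0n. have e0 : 0 < 9 / 4 / (128 * N%:R ^+ 5) :> R.
  by apply: divr_gt0; [exact: divr_gt0|apply: mulr_gt0 => //; exact: exprn_gt0].
 have [n0 _ H] := dy_small e0; exists n0 => n /H {}H.
 have yy : (dy n : R) ^+ 2 <= dy n by rewrite expr2 ger_pMr ?dy_gt0.
 have h0 : 0 < 128 * N%:R ^+ 5 :> R by apply: mulr_gt0 => //; exact: exprn_gt0.
 apply: (@le_trans _ _ (128 * N%:R ^+ 5 * dy n)); first by apply: ler_wpM2l => //; exact: ltW.
 by move: H; rewrite /= ler_pdivlMr // mulrC.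
exists n0. pose CV := 4 * (130 + 2 * Q%:R * C8) * N%:R * (1 + osc_cst R). pose CU := Q%:R * N%:R * C8'.
have c0 := @osc_cst_gt0 R. have CV0 : 0 <= CV.
 rewrite /CV !mulr_ge0 ?addr_ge0 ?mulr_ge0 ?exprn_ge0 //; exact: ltW.
have CU0 : 0 <= CU by rewrite /CU !mulr_ge0 ?exprn_ge0.
pose T n w := sc_V (n0 + n) w + sc_U (n0 + n) w / dy (n0 + n).
have HT n : igr P (T n) /\ Ex P (T n) <= (CV + CU) * dy n.
 have [iV EV] := sc_V_mean (Hn0 (n0 + n)%N (leq_addr _ _)). have [iU EU] := sc_U_mean (n0 + n).
 have y0 := @dy_gt0 R (n0 + n).
 have e : T n = fun w => sc_V (n0 + n) w + (dy (n0 + n))^-1 * sc_U (n0 + n) w.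
  by apply/funext => w; rewrite /T mulrC.
 have iU' := igrZ (dy (n0 + n))^-1 iU. rewrite e; split; first exact: igrD.
 rewrite (ExD iV iU') (ExZ _ iU). have EU' : (dy (n0 + n))^-1 * Ex P (sc_U (n0 + n)) <= CU * dy (n0 + n).
  rewrite mulrC ler_pdivrMr // -mulrA -expr2; exact: EU.
 apply: (@le_trans _ _ ((CV + CU) * dy (n0 + n))); first by rewrite mulrDl; exact: lerD.
 apply: ler_wpM2l; first exact: addr_ge0.
 by rewrite /dy lef_pV2 ?posrE ?exprn_gt0 // ler_weXn2l ?ler1n // leq_addl.
have T0 n w : 0 <= T n w.
 by apply: addr_ge0; [exact: sc_V_ge0|apply: divr_ge0; [exact: sc_U_ge0|exact: ltW (dy_gt0 _)]].
apply: (@ae_bounded _ _ _ P (fun m w => \sum_(n < m) T n w) ((CV + CU) * 2)).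
- by move=> m; apply: igr_sum => n; case: (HT n).
- by move=> m w; apply: sumr_ge0 => n _; exact: T0.
- by move=> m w; rewrite big_ord_recr /= lerDl; exact: T0.
- move=> m; rewrite Ex_sum => [|n]; last by case: (HT n).
 apply: (@le_trans _ _ (\sum_(n < m) (CV + CU) * dy n)).
  by apply: ler_sum => n _; case: (HT n).
 rewrite -mulr_sumr; apply: ler_wpM2l; [exact: addr_ge0|exact: geometric_half].
Qed.

End scales.

(** * Boundedness of the mean path up to its lifetime for alpha = 1 *)

Section critical_explosion.
Variable N : nat.
Hypothesis N0 : (0 < N)%N.
Hypothesis a1 : alpha = 1.
Local Notation psum := (psum N).
Local Notation sc_osc := (sc_osc (N := N)).
Local Notation sc_act := (sc_act N).

Let NR : 0 < N%:R :> R. Proof. by rewrite ltr0n. Qed.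
Let N1 : 1 <= N%:R :> R. Proof. by rewrite ler1n. Qed.

Lemma lam_local_bound w t s u k : 0 <= t -> (forall r, 0 <= r -> r <= t -> goodN N w r) ->
 s <= u -> u <= t -> 0 <= k ->
 (forall i r, s <= r -> r <= u -> `|@zfam N w i r - @zfam N w i s| <= k) ->
 (N%:R + 1) * k < psum w s / N%:R ->
 lamN N w u - lamN N w s <= N%:R * k.
Proof.
move=> t0 gd su ut k0 osc big. have cz := @cpath_zfam N w.
have z0 (i : 'I_N) : 0 <= @zfam N w i 0 by exact: zfam_ge0. have [lt _] := gd t t0 (lexx t).
pose f r := lamN N w (minr r t). have fE r : r <= t -> f r = lamN N w r by move=> rt; rewrite /f min_l.
have cf : cpath f by exact: cpath_lam. have mf : mono_to f t.
 move=> r r' rr r't; rewrite !fE ?(le_trans rr) //; exact: (lam_mono alpha0 N0 cz lt).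
have ff r : r <= t -> f r = avgN N w f r.
 move=> rt; rewrite fE // (lam_fix alpha0 N0 cz (lfin_le alpha0 N0 cz rt lt)).
 rewrite /avg_phi; congr (_ / _); apply: eq_bigr => i _; apply: eq_phi => v vr.
 by rewrite fE // (le_trans vr).
have st := le_trans su ut. have := local_bound a1 N0 cz cf mf ff su ut k0 osc.
rewrite (sum_refl N0 (ff s st)) !fE //. rewrite (_ : alpha - 1 = 0) ?mul0r ?subr0; first exact.
by rewrite a1 subrr.
Qed.

Lemma scale_increments w Q n0 B p c : 0 < c ->
 (forall m, \sum_(n < m) (sc_V N Q (n0 + n) w + sc_U N Q (n0 + n) w / dy (n0 + n)) <= B) ->
 (forall n, (p <= n)%N -> B * dy (n0 + n) <= c ^+ 8) ->
 forall n, (n0 + p <= n)%N -> forall k, (k < sc_K Q n)%N -> forall i : 'I_N,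
 `|@zfam N w i (k.+1%:R * @sc_h R n) - @zfam N w i (k%:R * @sc_h R n)| <= c * @sc_a R n.
Proof.
move=> c0 HB Hp n pn k kK i. have n0n : (n0 <= n)%N by apply: leq_trans pn; exact: leq_addr.
pose q := (n - n0)%N; have nE : n = (n0 + q)%N by rewrite /q subnKC.
have pq : (p <= q)%N by move: pn; rewrite nE leq_add2l. have y0 := @dy_gt0 R n; have an := @sc_a_gt0 R n.
have T0 j : 0 <= sc_V N Q (n0 + j) w + sc_U N Q (n0 + j) w / dy (n0 + j).
 apply: addr_ge0; first exact: sc_V_ge0. by apply: divr_ge0; [exact: sc_U_ge0|apply: ltW; exact: dy_gt0].
have UB : sc_U N Q n w <= c ^+ 8.
 apply: le_trans (Hp q pq); rewrite -ler_pdivrMr -?nE //; apply: le_trans (HB q.+1).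
 rewrite big_ord_recr /= -nE -[leLHS]add0r; apply: lerD; first by apply: sumr_ge0 => j _; exact: T0.
 by rewrite lerDr; exact: sc_V_ge0.
set D := _ - _. have D8 : D ^+ 8 / @sc_a R n ^+ 8 <= sc_U N Q n w.
 have F0 (j : 'I_(sc_K Q n)) (i' : 'I_N) : 0 <= (@zfam N w i' (j.+1%:R * @sc_h R n) -
   @zfam N w i' (j%:R * @sc_h R n)) ^+ 8 / @sc_a R n ^+ 8.
  by apply: divr_ge0; apply: exprn_even_ge0.
 rewrite /sc_U (bigD1 (Ordinal kK)) //= (bigD1 i) //= -addrA lerDl.
 by apply: addr_ge0; [apply: sumr_ge0 => j _; exact: (F0 (Ordinal kK))|
  apply: sumr_ge0 => j _; apply: sumr_ge0 => i' _; exact: F0].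
have ca : 0 <= c * @sc_a R n by apply: mulr_ge0; exact: ltW.
rewrite -(@ler_pXn2r _ 8) ?nnegrE ?normr_ge0 // -normrX ger0_norm ?exprn_even_ge0 //.
by rewrite exprMn -ler_pdivrMr ?exprn_gt0 //; exact: le_trans D8 UB.
Qed.

(** If the sum is positive at T, [local_bound] applies on a whole left neighbourhood. Otherwise each
    s near T lies in an active cell of the scale matching the height of the sum; there [local_bound]
    controls the growth of [lam] by the oscillations of the cell, and [greedy_cover] adds up to at
    most 2 N times the sum of the [sc_V]. *)
Lemma critical_lam_bounded : {ae P, forall w, forall T : R, tauN N w = T%:E ->
 exists C, forall t, 0 <= t -> t < T -> lamN N w t <= C}.
Proof.
have ae : {ae P, forall w, forall Q : nat, exists n0 B, forall m,
  \sum_(n < m) (sc_V N Q.+1 (n0 + n) w + sc_U N Q.+1 (n0 + n) w / dy (n0 + n)) <= B}.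
 apply: ae_forall_count => Q. have [n0 H] := scale_sums N0 Q.+1.
 by apply: filterS H => w [B HB]; exists n0, B.
apply: filterS ae => w HQ T TE. have cz := @cpath_zfam N w.
have T0 : 0 <= T by rewrite -lee_fin -TE tau_star_ge0. have gd t : 0 <= t -> t < T -> goodN N w t.
 by move=> t0 tT; apply: good_before; split=> //; rewrite TE lte_fin.
have gd' t : t < T -> forall r, 0 <= r -> r <= t -> goodN N w r.
 by move=> tT r r0 rt; apply: gd => //; exact: le_lt_trans tT.
have pos t : 0 <= t -> t < T -> 0 < psum w t.
 by move=> t0 tT; exact: (critical_positive N0 a1 (gd t t0 tT)).
have lmono s t : t < T -> 0 <= t -> s <= t -> lamN N w s <= lamN N w t.
 by move=> tT t0 st; have [lt _] := gd t t0 tT; exact: (lam_mono alpha0 N0 cz lt).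
have [T0'|T0'] := leP T 0; first by exists 0 => t t0 tT; move: (lt_le_trans tT T0'); rewrite ltNge t0.
have [cS _] := cpath_psum N w.
suff [s0 [C [s00 s0T HC]]] : exists s0 C, [/\ 0 <= s0, s0 < T & forall t, s0 <= t -> t < T ->
  lamN N w t - lamN N w s0 <= C].
 exists (lamN N w s0 + maxr 0 C) => t t0 tT. have [ts|st] := leP t s0.
  by apply: (le_trans (lmono t s0 s0T s00 ts)); rewrite lerDl le_max lexx.
 rewrite addrC -lerBlDr; apply: (le_trans (HC t (ltW st) tT)). by rewrite le_max lexx orbT.
have start (e : R) : 0 < e -> exists s0, [/\ 0 <= s0, s0 < T & forall s, s0 <= s -> s <= T -> `|s - T| < e].
 move=> e0; exists (maxr 0 (T - e / 2)); split.
 - by rewrite le_max lexx.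
 - by rewrite gt_max T0' ltrBlDr ltrDl divr_gt0.
 - move=> s; rewrite ge_max => /andP[_ h1] h2; rewrite ler0_norm ?subr_le0 //; lra.
have [ST|ST] := leP (psum w T) 0; last first.
 pose k := psum w T / (4 * N%:R * (N%:R + 1)).
 have k0 : 0 < k by rewrite divr_gt0 // !mulr_gt0 // ltr_wpDr. have [h h0 Hh] := family_ucts T cz k0.
 have S2 : 0 < psum w T / 2 by rewrite divr_gt0. have [e e0 He] := cts_dist (cS T) S2.
 have [|s0 [s00 s0T Hs]] := start (minr h e); first by rewrite lt_min h0.
 exists s0, (N%:R * k); split=> // t st tT.
 apply: (lam_local_bound (le_trans s00 st) (gd' t tT) st (lexx t) (ltW k0)) => [i r sr rt|].
  apply: ltW; apply: Hh; [exact: le_trans (ltW tT)|exact: ltW|].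
  have := Hs r sr (le_trans rt (ltW tT)); have := Hs s0 (lexx _) (ltW s0T).
  rewrite !lt_min => /andP[g1 _] /andP[g2 _].
  have rT := le_trans rt (ltW tT); rewrite ger0_norm ?subr_ge0 //.
  by rewrite ltr0_norm ?subr_lt0 // in g1; lra.
 have := Hs s0 (lexx _) (ltW s0T); rewrite lt_min => /andP[_ /He]. rewrite ltr_norml => /andP[g1 _].
 have -> : (N%:R + 1) * k = psum w T / 4 / N%:R.
  by rewrite /k; field; rewrite !gt_eqF // ltr_wpDr.
 by rewrite ltr_pM2r ?invr_gt0 //; lra.
have [n0 [B HB]] := HQ (Num.truncn T); set Q := (Num.truncn T).+1 in HB.
have TQ : T < Q%:R by exact: truncnS_gt. have B0 : 0 <= B by have := HB 0; rewrite big_ord0.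
(* On a cell the paths move by at most 23 c a, so [local_bound] is used with k <= 46 N c a and needs
   N (N + 1) k < a; the left side is at most 92 c N^3 a. *)
pose c : R := (100 * N%:R ^+ 3)^-1. have c0 : 0 < c by rewrite invr_gt0 mulr_gt0 // exprn_gt0.
have [p Hp] : exists p, forall n, (p <= n)%N -> B * dy (n0 + n) <= c ^+ 8.
 have e0 : 0 < c ^+ 8 / (B + 1) by rewrite divr_gt0 ?exprn_gt0 // ltr_wpDl.
 have [p _ H] := dy_small e0; exists p => n pn. apply: (@le_trans _ _ (B * (c ^+ 8 / (B + 1)))).
  by apply: ler_wpM2l => //; apply: H; rewrite /= (leq_trans pn) // leq_addl.
 rewrite mulrA ler_pdivrMr ?ltr_wpDl // mulrC; apply: ler_wpM2l; first exact: exprn_ge0 (ltW c0).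
 by rewrite lerDl.
have inc := scale_increments c0 HB Hp. have ap : 0 < 4 * @sc_a R (n0 + p) by rewrite mulr_gt0 // sc_a_gt0.
have [e e0 He] := cts_dist (cS T) ap. have [s0 [s00 s0T Hs]] := start e e0.
exists s0, (2 * N%:R * B); split=> // t s0t tT.
have small s : s0 <= s -> s <= t -> psum w s < 4 * @sc_a R (n0 + p).
 move=> ss st; have sT : s <= T by apply: (le_trans st); exact: ltW.
 by have := He s (Hs s ss sT); rewrite ltr_norml => /andP[_]; lra.
have [y y0 Hy] : exists2 y, 0 < y & forall s, s0 <= s -> s <= t -> y <= psum w s.
 have [r /itvP rI rmin] := EVT_min s0t (continuous_subspaceT cS).
 exists (psum w r); first by apply: pos; [apply: (le_trans s00)|apply: le_lt_trans tT]; rewrite rI.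
 by move=> s ss st; apply: rmin; rewrite in_itv /= ss st.
have [m pm am] : exists2 m, (p <= m)%N & @sc_a R (n0 + m) <= y.
 have [j _ Hj] := dy_small y0; exists (p + j)%N; first exact: leq_addr.
 apply: le_trans (Hj (n0 + (p + j))%N _); last by rewrite /= addnA leq_addl.
 have y1 : dy (n0 + (p + j)) <= 1 :> R by rewrite /dy invf_le1 ?exprn_gt0 // exprn_ege1 // ler1n.
 by rewrite /sc_a expr2 ger_pMr // dy_gt0.
pose v n k := 2 * N%:R * \sum_(i < N) sc_osc (n0 + n) i k w.
have v0 n k : 0 <= v n k by rewrite !mulr_ge0 // sumr_ge0 // => i _; exact: root4_ge0.
apply: (@le_trans _ _ (\sum_(n < m.+1) \sum_(k < sc_K Q (n0 + n))
  (w \in sc_act (n0 + n) k)%:R * v n k)); last first.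
 apply: (@le_trans _ _ (2 * N%:R * \sum_(n < m.+1) sc_V N Q (n0 + n) w)).
  rewrite mulr_sumr; apply: ler_sum => n _; rewrite mulr_sumr; apply: ler_sum => k _.
  by rewrite indicE /v mulrCA.
 apply: ler_wpM2l; first by rewrite mulr_ge0.
 apply: le_trans (HB m.+1); apply: ler_sum => n _; rewrite lerDl.
 by apply: divr_ge0; [exact: sc_U_ge0|apply: ltW; exact: dy_gt0].
apply: (@greedy_cover _ _ (fun n => @sc_h R (n0 + n)) (fun n => sc_K Q (n0 + n))
 (fun n k => w \in sc_act (n0 + n) k)) => //.
- exact: sc_h_gt0.
- move=> n nm; exists (64 ^ (m - n))%N. by rewrite (sc_h_scale (n0 + n) (m - n)) -addnA subnKC.
move=> s ss st; have s_0 : 0 <= s := le_trans s00 ss; have sT : s < T := le_lt_trans st tT.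
pose pr n := (p <= n)%N && (@sc_a R (n0 + n) <= psum w s).
have exn : exists n, pr n by exists m; rewrite /pr pm (le_trans am) // Hy.
(* The least n gives the largest height a below the sum. Since heights shrink by 4, or by the choice
   of s0 when n = p, the sum is at most 4 a; the threshold 5 a of [active] leaves a for the motion
   between the left end of the cell and s. *)
have [n /andP[pn an] nmin] := ex_minnP exn.
have nm : (n <= m)%N by apply: nmin; rewrite /pr pm (le_trans am) // Hy.
have a4 : psum w s <= 4 * @sc_a R (n0 + n).
 have [np|np] := eqVneq n p; first by rewrite np; apply: ltW; exact: small.
 have n_gt : (p < n)%N by rewrite ltn_neqAle eq_sym np. have n1 : (0 < n)%N by apply: leq_ltn_trans n_gt.
 have : ~~ pr n.-1 by apply/negP => /nmin; rewrite leqNgt prednK // leqnn.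
 rewrite /pr -ltnS prednK // n_gt /= -ltNge => /ltW h1; apply: (le_trans h1).
 by rewrite sc_aS -addnS prednK.
have hn := @sc_h_gt0 R (n0 + n); have a_n := @sc_a_gt0 R (n0 + n).
set h := @sc_h R (n0 + n) in hn; set a := @sc_a R (n0 + n) in an a4 a_n. pose k := Num.truncn (s / h).
have /andP[k1 k2] : k%:R <= s / h < k.+1%:R by apply: truncn_itv; rewrite divr_ge0 // ltW.
rewrite ler_pdivlMr // in k1; rewrite ltr_pdivrMr // in k2. have kK : (k < sc_K Q (n0 + n))%N.
 rewrite -(ltr_nat R) -(ltr_pM2r hn) sc_Kh; apply: (le_lt_trans k1); exact: lt_trans sT TQ.
have npn : (n0 + p <= n0 + n)%N by rewrite leq_add2l. have dev i r : k%:R * h <= r -> r <= k.+1%:R * h ->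
  `|@zfam N w i r - @zfam N w i (k%:R * h)| <= 23 * (c * a).
 apply: (@grid_osc R Q (n0 + p) c (@zfam N w i) (ltW c0) (cz i) _ (n0 + n)%N k r npn kK).
 by move=> n' pn' k' kK'; exact: inc.
have N2 : N%:R <= N%:R ^+ 2 :> R by rewrite expr2 ler_pMr.
have N3 : N%:R <= N%:R ^+ 3 :> R by rewrite exprS ler_peMr ?exprn_ege1 // ltW.
have cN3 : c * (100 * N%:R ^+ 3) = 1 by rewrite /c mulVf // gt_eqF // mulr_gt0 // exprn_gt0.
have cN : 23 * N%:R * c <= 1.
 rewrite -[leRHS]cN3 [leLHS]mulrC; apply: ler_wpM2l; first exact: ltW.
 by move: N3 NR; move: (N%:R ^+ 3) => x; lra.
have kh0 : 0 <= k%:R * h by apply: mulr_ge0 => //; exact: ltW. exists n, k; split=> //.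
 apply: mem_set; split; last first.
  rewrite -/h -/a; have : psum w (k%:R * h) - psum w s <= N%:R * (23 * (c * a)).
   rewrite /psum -sumrB; have -> : N%:R * (23 * (c * a)) = \sum_(i < N) (23 * (c * a)).
    by rewrite sumr_const card_ord mulr_natl.
   apply: ler_sum => i _; apply: (le_trans (ler_norm _)); rewrite distrC.
   by apply: dev => //; exact: ltW.
  have : 23 * N%:R * c * a <= 1 * a by apply: ler_wpM2r => //; exact: ltW. by move: a4; lra.
 apply/allP => j; rewrite mem_iota add0n ltnS => /andP[_ jk].
 have jks : j%:R * h <= s by apply: le_trans k1; apply: ler_wpM2r; [exact: ltW|rewrite ler_nat].
 by apply: pos; [apply: mulr_ge0 => //; exact: ltW|exact: le_lt_trans sT].
move=> u su ut uk. have O0 (i : 'I_N) : 0 <= osc4 (@zfam N w i) (k%:R * h) h by exact: osc4_ge0.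
have hE : k.+1%:R * h = k%:R * h + h by rewrite -natr1 mulrDl mul1r.
have ob i r : k%:R * h <= r -> r <= k.+1%:R * h ->
  `|@zfam N w i r - @zfam N w i (k%:R * h)| <= sc_osc (n0 + n) i k w.
 by move=> kr rk; apply: le_root4; apply: osc4_ub => //; rewrite -hE.
have oS (i : 'I_N) : sc_osc (n0 + n) i k w <= 23 * (c * a).
 have ca0 : 0 <= 23 * (c * a) by apply: mulr_ge0 => //; apply: mulr_ge0; exact: ltW.
 rewrite -(@ler_pXn2r _ 4) ?nnegrE ?root4_ge0 // /sc_osc root4E //.
 apply: osc4_le; [exact: exprn_ge0| |exact: ltW].
 move=> r kr rk; rewrite -[leLHS]ger0_norm ?exprn_even_ge0 // normrX.
 by apply: lerXn2r; rewrite ?nnegrE ?normr_ge0 //; apply: dev => //; rewrite hE.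
set o := fun i : 'I_N => sc_osc (n0 + n) i k w in oS ob. have o0 i : 0 <= o i by exact: root4_ge0.
have oi (i : 'I_N) : o i <= \sum_(i < N) o i by rewrite (bigD1 i) //= lerDl sumr_ge0.
have -> : v n k = N%:R * (2 * \sum_(i < N) o i) by rewrite /v mulrA [N%:R * 2]mulrC.
apply: (lam_local_bound (le_trans s_0 st) (gd' t tT) su ut) => [|i r sr ru|].
- by rewrite mulr_ge0 // sumr_ge0.
- have kr : k%:R * h <= r := le_trans k1 sr. have rk : r <= k.+1%:R * h := le_trans ru uk.
 have e1 := ob i r kr rk; have e2 := ob i s k1 (ltW k2); rewrite distrC in e2.
 have -> : @zfam N w i r - @zfam N w i s = (@zfam N w i r - @zfam N w i (k%:R * h)) +
   (@zfam N w i (k%:R * h) - @zfam N w i s) by rewrite addrA subrK.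
 apply: (le_trans (ler_normD _ _)); apply: (le_trans (lerD e1 e2)).
 have := oi i; rewrite -/(o i); move: (o i) (\sum_(i < N) o i) => x x'.
 by clear; move=> H; rewrite mulr_natl mulr2n lerD.
have sumo : \sum_(i < N) o i <= N%:R * (23 * (c * a)).
 have -> : N%:R * (23 * (c * a)) = \sum_(i < N) (23 * (c * a)).
  by rewrite sumr_const card_ord mulr_natl.
 by apply: ler_sum => i _; exact: oS.
rewrite ltr_pdivlMr //; apply: lt_le_trans an.
apply: (@le_lt_trans _ _ ((N%:R + N%:R) * (2 * (N%:R * (23 * (c * a)))) * N%:R)).
 apply: ler_wpM2r; first exact: ltW. have le1 : N%:R + 1 <= N%:R + N%:R :> R by rewrite lerD2l.
 have o2 : 0 <= 2 * \sum_(i < N) o i by apply: mulr_ge0 => //; apply: sumr_ge0.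
 have o3 : 2 * \sum_(i < N) o i <= 2 * (N%:R * (23 * (c * a))) by apply: ler_wpM2l.
 by apply: ler_pM => //; apply: addr_ge0.
have -> : (N%:R + N%:R) * (2 * (N%:R * (23 * (c * a)))) * N%:R = 92 * (c * N%:R ^+ 3) * a by ring.
have -> : c * N%:R ^+ 3 = 1 / 100 by rewrite /c; field; rewrite gt_eqF. by move: a_n; lra.
Qed.

End critical_explosion.

(** * Fluctuations of order N^(-1/2) for alpha < 1 *)

Section rate.
Hypothesis alpha1 : alpha < 1.

Let a10 : 0 < 1 - alpha. Proof. by rewrite subr_gt0. Qed.

(** For alpha < 1 the averaged map contracts the uniform distance over the whole horizon, so no
    small time steps are needed. *)
Lemma subcritical_stability N w f K e : (0 < N)%N -> cpath f -> (forall t, mono_to f t) ->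
 0 <= K -> (forall s, s <= K -> `|avgN N w f s - f s| <= e) ->
 forall s, s <= K -> `|lamN N w s - f s| <= e / (1 - alpha).
Proof.
move=> N0 cf mf K0 He. have NR : 0 < N%:R :> R by rewrite ltr0n. have cz := @cpath_zfam N w.
have z0 (i : 'I_N) : 0 <= @zfam N w i 0 by exact: zfam_ge0.
have gd s : goodN N w s by exact: subcritical_good. have [lK _] := gd K.
have cl : cpath (fun s => lamN N w (minr s K)) by apply: cpath_lam.
have [C HC] := cpath_bdd (cpathB cl cf) K. pose S := [set `|lamN N w s - f s| | s in [set s | s <= K]].
have hS : has_sup S.
 split; first by exists `|lamN N w K - f K|, K => /=.
 by exists C => _ [s sK <-]; have := HC s sK; rewrite min_l.
have ub s : s <= K -> `|lamN N w s - f s| <= sup S.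
 by move=> sK; apply: sup_ubound; [case: hS|exists s].
have step s : s <= K -> `|lamN N w s - f s| <= alpha * sup S + e.
 move=> sK; have [ls _] := gd s; rewrite (lam_fix alpha0 N0 cz ls).
 have D : `|avgN N w (lamN N w) s - avgN N w f s| <= alpha * sup S.
  rewrite /avg_phi -mulrBl -sumrB normrM (gtr0_norm (_ : 0 < N%:R^-1)) ?invr_gt0 //.
  rewrite ler_pdivrMr //; apply: (le_trans (ler_norm_sum _ _ _)).
  have -> : alpha * sup S * N%:R = \sum_(i < N) (alpha * sup S).
   by rewrite sumr_const card_ord mulr_natr.
  apply: ler_sum => i _; apply: phi_dist => //; first exact: lam_mono.
  by move=> r rs; apply: ub; exact: le_trans sK.
 rewrite (_ : _ - f s = (avgN N w (lamN N w) s - avgN N w f s) + (avgN N w f s - f s)); last by ring.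
 by apply: (le_trans (ler_normD _ _)); apply: lerD => //; exact: He.
have : sup S <= alpha * sup S + e.
 by apply: ge_sup; [case: hS|move=> _ [s sK <-]; exact: step].
move=> h s sK; apply: (le_trans (ub s sK)); rewrite ler_pdivlMr //; lra.
Qed.

Section fluctuations.
Variables (f : R -> R) (K : R).
Hypotheses (cf : cpath f) (mf : forall t, mono_to f t) (f0 : forall s, s <= 0 -> f s = 0).
Hypotheses (K0 : 0 < K) (fE : forall s, s <= K -> f s = Gam f s).

Definition incr_cst : R := 8 * (osc_cst R / (1 - alpha) ^+ 4 + osc_cst R).

Lemma incr_cst_ge0 : 0 <= incr_cst.
Proof.
have c0 := @osc_cst_gt0 R; apply: mulr_ge0 => //; apply: addr_ge0; last exact: ltW.
by apply: divr_ge0; [exact: ltW|apply: exprn_ge0; exact: ltW].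
Qed.

(** An increment of the regulator is at most alpha (f t - f s) + O, with O the oscillation of z.
    Taking means, f t - f s <= E O / (1 - alpha), so f is as regular as the oscillation allows and
    fourth moments are of order (t - s)^2. *)
Lemma phi_incr_moment s t : 0 <= s -> s < t -> t <= K -> let g w := phi f (Z0 w) t - phi f (Z0 w) s in
 [/\ igr P' (fun w => g w ^+ 4), Ex P' g = f t - f s &
   Ex P' (fun w => g w ^+ 4) <= incr_cst * (t - s) ^+ 2].
Proof.
move=> s0 st tK g; have h0 : 0 < t - s by rewrite subr_gt0. have sK := le_trans (ltW st) tK.
have it := igr_phi xi0 alpha0 BW0 (@mf t); have is_ := igr_phi xi0 alpha0 BW0 (@mf s).
have mt := mfn_phi_z xi0 alpha0 BW0 (@mf t); have ms := mfn_phi_z xi0 alpha0 BW0 (@mf s).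
have mg : mfn g by apply: measurable_funB.
have Eg : Ex P' g = f t - f s by rewrite (ExB it is_) (fE tK) (fE sK).
have [iO EO] := osc4_moment xi0 BW0 s0 h0. pose O w := root4 (osc4 (Z0 w) s (t - s)).
have O4 w : O w ^+ 4 = osc4 (Z0 w) s (t - s).
 by apply: root4E; apply: osc4_ge0 => //; exact: cpath_z.
have mO : mfn O.
 by apply: mfn_root4; apply: mfn_osc4 => // [r|w]; [exact: mfn_z|exact: cpath_z].
have iO4 : igr P' (fun w => O w ^+ 4) by under eq_fun do rewrite O4.
have EO4 : Ex P' (fun w => O w ^+ 4) <= osc_cst R * (t - s) ^+ 2.
 by rewrite (eq_Ex P' O4).
have iO1 : igr P' O by have := igr_pow mO iO4 (isT : (1 <= 4)%N); under eq_fun do rewrite expr1.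
have g0 w : 0 <= g w by rewrite subr_ge0; apply: phi_mono => //; [exact: cpath_z|exact: ltW].
have gle w : g w <= alpha * (f t - f s) + O w.
 rewrite lerBlDl addrA; apply: phi_left_step => //; [exact: cpath_z|exact: ltW| |exact: root4_ge0].
 move=> u su ut; apply: (le_trans (ler_norm _)); rewrite distrC; apply: le_root4.
 by apply: osc4_ub => //; [exact: cpath_z|exact: ltW|rewrite addrCA subrr addr0].
have df0 : 0 <= f t - f s by rewrite subr_ge0; apply: mf => //; exact: ltW.
have dfle : f t - f s <= Ex P' O / (1 - alpha).
 rewrite ler_pdivlMr //; have : Ex P' g <= alpha * (f t - f s) + Ex P' O.
  have iR : igr P' (fun w => alpha * (f t - f s) + O w) by apply: igrD => //; exact: igr_cst.
  apply: (le_trans (Ex_le (igrB it is_) iR gle)). by rewrite (ExD (igr_cst _ _) iO1) Ex_cst.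
 by rewrite Eg; lra.
have df4 : (f t - f s) ^+ 4 <= osc_cst R / (1 - alpha) ^+ 4 * (t - s) ^+ 2.
 apply: (@le_trans _ _ ((Ex P' O / (1 - alpha)) ^+ 4)).
  by apply: lerXn2r; rewrite ?nnegrE // (le_trans df0).
 rewrite expr_div_n [leRHS]mulrAC; apply: ler_wpM2r; first by rewrite invr_ge0 exprn_ge0 // ltW.
 exact: le_trans (Ex_pow4_le mO iO4) EO4.
pose G w := 8 * ((f t - f s) ^+ 4 + O w ^+ 4).
have iG : igr P' G by apply: igrZ; apply: igrD => //; exact: igr_cst. have gG w : g w ^+ 4 <= G w.
 apply: (@le_trans _ _ (((f t - f s) + O w) ^+ 4)); last exact: pow4_add.
 have le1 : g w <= f t - f s + O w.
  apply: (le_trans (gle w)); rewrite lerD2r.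
  move: df0; rewrite le_eqVlt => /orP[/eqP <-|d0]; last by rewrite ger_pMl // ltW. by rewrite mulr0.
 apply: lerXn2r => //; rewrite nnegrE //; apply: addr_ge0 => //; exact: root4_ge0.
have ig4 : igr P' (fun w => g w ^+ 4).
 apply: (igr_dom _ iG); first exact: measurable_funX. by move=> w; rewrite ger0_norm ?pow4_ge0.
split=> //; apply: (le_trans (Ex_le ig4 iG gG)).
rewrite (ExZ _ (igrD (igr_cst _ _) iO4)) (ExD (igr_cst _ _) iO4) Ex_cst /incr_cst -[leRHS]mulrA.
by apply: ler_wpM2l => //; rewrite [leRHS]mulrDl; exact: lerD.
Qed.

(** Increments of Y are centred averages of N independent copies, so [emp_moment] puts 1 / N^2 in
    front of (t - s)^2 and chaining keeps it. The factor 16 pays for centring: (g - m)^4 <= 8 (g^4 +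
    m^4), and m^4 is at most the fourth moment of g. *)
Lemma sup_fluctuation N : (0 < N)%N -> let Y w s := avgN N w f s - f s in
 [/\ igr P (fun w => osc4 (Y w) 0 K),
   Ex P (fun w => osc4 (Y w) 0 K) <= 4000 * (3 * (16 * incr_cst) / N%:R ^+ 2) * K ^+ 2 &
   forall w s, s <= K -> `|Y w s| <= root4 (osc4 (Y w) 0 K)].
Proof.
move=> N0 Y; have NR : 0 < N%:R :> R by rewrite ltr0n.
have cz w (i : 'I_N) : cpath (@zfam N w i) by exact: cpath_zfam.
have cY w : cpath (Y w) by apply: cpathB => //; apply: cpath_avg_phi.
have YE w s : Y w s = emp (fun x => phi f x s) N w - f s.
 by rewrite -avg_phi_emp.
have mY s : mfn (fun w => Y w s).
 under eq_fun do rewrite YE; apply: measurable_funB; last exact: measurable_cst.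
 by apply: mfn_emp; exact: mfn_phi_path.
have N2 : 0 < N%:R ^+ 2 :> R by exact: exprn_gt0. have K'0 : 0 <= 3 * (16 * incr_cst) / N%:R ^+ 2.
 apply: divr_ge0; last exact: ltW. by apply: mulr_ge0 => //; apply: mulr_ge0 => //; exact: incr_cst_ge0.
have mom s t : 0 <= s -> s <= t -> t <= 0 + K -> igr P (fun w => (Y w t - Y w s) ^+ 4) /\
  Ex P (fun w => (Y w t - Y w s) ^+ 4) <= 3 * (16 * incr_cst) / N%:R ^+ 2 * (t - s) ^+ 2.
 rewrite add0r => s0; rewrite le_eqVlt => /orP[/eqP <-|st] tK.
  have e : (fun w => (Y w s - Y w s) ^+ 4) = cst 0.
   by apply/funext => w; rewrite subrr expr0n.
  by rewrite e; split; [exact: igr_cst|rewrite Ex_cst subrr expr0n mulr0].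
 have [i4 E1 E4] := phi_incr_moment s0 st tK. pose G (x : @wiener R) := phi f x t - phi f x s.
 have mG : mfn G by apply: measurable_funB; exact: mfn_phi_path. have [ie Ee] := emp_moment mG i4 N0.
 have e w : (Y w t - Y w s) ^+ 4 = (emp G N w - Ex P' (fun w => G (Z0 w))) ^+ 4.
  rewrite E1 !YE /emp /G sumrB mulrBl; congr (_ ^+ 4); ring.
 split; first by under eq_fun do rewrite e. rewrite (eq_Ex P e); apply: (le_trans Ee).
 apply: (@le_trans _ _ (3 * (16 * (incr_cst * (t - s) ^+ 2)) / N%:R ^+ 2)); last first.
  by move: incr_cst => c; rewrite le_eqVlt; apply/orP; left; apply/eqP; field; rewrite gt_eqF.
 apply: ler_wpM2r; first by rewrite invr_ge0 ltW. apply: ler_wpM2l => //.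
 set m := Ex P' (fun w => G (Z0 w)). have mGZ : mfn (fun w => G (Z0 w)) by exact: mfn_Z0.
 have im : igr P' (fun w => (G (Z0 w) + - m) ^+ 4).
  apply: igr_pow4D => //; [exact: measurable_cst|exact: igr_cst].
 have iR : igr P' (fun w => 8 * (G (Z0 w) ^+ 4 + m ^+ 4)).
  by apply: igrZ; apply: igrD => //; exact: igr_cst.
 apply: (@le_trans _ _ (Ex P' (fun w => 8 * (G (Z0 w) ^+ 4 + m ^+ 4)))).
  apply: Ex_le => // w; apply: (le_trans (pow4_add _ _)). by rewrite (exprM (- m) 2 2) sqrrN -exprM.
 have i4G : igr P' (fun w => G (Z0 w) ^+ 4) := i4. have im4 := igr_cst P' (m ^+ 4).
 rewrite (ExZ _ (igrD i4G im4)) (ExD i4G im4) Ex_cst.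
 have m4 : m ^+ 4 <= Ex P' (fun w => G (Z0 w) ^+ 4) by exact: Ex_pow4_le.
 have : 16 * Ex P' (fun w => G (Z0 w) ^+ 4) <= 16 * (incr_cst * (t - s) ^+ 2).
  by apply: ler_wpM2l.
 by move: m4; lra.
have [iY EY] := chaining (lexx 0) K0 K'0 mY cY mom. split=> // w s sK. have Y0 : Y w 0 = 0.
 rewrite /Y f0 // subr0 /avg_phi big1 ?mul0r // => i _; apply: phi_start => //; last exact: f0.
 exact: zfam_ge0.
have [_ fr] := cY w; have O0 : 0 <= osc4 (Y w) 0 K by apply: osc4_ge0.
have [s0|s0] := leP s 0; first by rewrite fr // Y0 normr0 root4_ge0.
rewrite -[Y w s]subr0 -{1}Y0; apply: le_root4. by apply: osc4_ub => //; [exact: ltW|rewrite add0r].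
Qed.

Lemma rate_bound : exists2 C : R, 0 <= C & forall N, (0 < N)%N -> forall y : R, 0 < y ->
 exists A, [/\ measurable A, (forall w, A w -> forall s, s <= K ->
   `|lamN N w s - f s| < y) & 1 - C / (N%:R ^+ 2 * y ^+ 4) <= Pr P A].
Proof.
pose C := 4000 * (3 * (16 * incr_cst)) * K ^+ 2 / (1 - alpha) ^+ 4. have C0 : 0 <= C.
 apply: divr_ge0; last by apply: exprn_ge0; exact: ltW. apply: mulr_ge0; last exact: sqr_ge0.
 apply: mulr_ge0; first exact: ler0n.
 by apply: mulr_ge0 => //; apply: mulr_ge0 => //; exact: incr_cst_ge0.
exists C => // N N0 y y0; have [iY EY HY] := sup_fluctuation N0.
set Y := fun w s => avgN N w f s - f s in iY EY HY. have y1 : 0 < y * (1 - alpha) by exact: mulr_gt0.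
have y4 : 0 < (y * (1 - alpha)) ^+ 4 by exact: exprn_gt0. have mO := igr_mfn iY. have cY w : cpath (Y w).
 by apply: cpathB => //; apply: cpath_avg_phi => // i; exact: cpath_zfam.
have O0 w : 0 <= osc4 (Y w) 0 K by apply: osc4_ge0.
exists [set w | osc4 (Y w) 0 K < (y * (1 - alpha)) ^+ 4]; split; first exact: mfn_lt.
 move=> w /= Ow s sK. have lt : root4 (osc4 (Y w) 0 K) < y * (1 - alpha).
  by rewrite -(@ltr_pXn2r _ 4) ?nnegrE ?root4_ge0 ?(ltW y1) // root4E.
 apply: le_lt_trans (subcritical_stability N0 cf mf (ltW K0) (HY w) sK) _. by rewrite ltr_pdivrMr.
have -> : [set w | osc4 (Y w) 0 K < (y * (1 - alpha)) ^+ 4] =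
  ~` [set w | (y * (1 - alpha)) ^+ 4 <= osc4 (Y w) 0 K].
 by apply/seteqP; split=> w /=; rewrite ltNge => /negP.
rewrite PrC; last exact: mfn_ge. rewrite lerD2l lerN2; apply: (le_trans (markov_ineq y4 iY O0)).
apply: (@le_trans _ _ (4000 * (3 * (16 * incr_cst) / N%:R ^+ 2) * K ^+ 2 / (y * (1 - alpha)) ^+ 4)).
 by apply: ler_wpM2r => //; rewrite invr_ge0 ltW.
rewrite le_eqVlt; apply/orP; left; apply/eqP; rewrite /C exprMn; field. by rewrite !gt_eqF // ltr0n.
Qed.

End fluctuations.

End rate.

(** * Weak convergence and stochastic boundedness *)

Section assembly.
Variables (L : forall N : nat, 'I_N -> R -> Om -> R) (tau : nat -> Om -> ext_time R).
Variables (l : R -> R) (T : ext_time R).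
Hypothesis mxp : forall N, (0 < N)%N -> maximal_particle_solution alpha xi W (@L N) (tau N).
Hypothesis mx : maximal_mv_solution alpha xi0 W0 l T.
Definition Lbar N w := stopped (\val (tau N w)) (mean_path (@L N) w).

Let tau0 N w : (0 <= \val (tau N w))%E := set_mem (valP (tau N w)).
Let T0 : (0 <= \val T)%E := set_mem (valP T).
Let sol : mv_solution alpha xi0 W0 l T := mx.1.

Lemma mean_path_cts N w : (0 < N)%N -> path_cts (\val (tau N w)) (mean_path (@L N) w).
Proof. by move=> N0; have [[_ _ cL _] _] := mxp N0; exact: path_cts_mean N0 (fun i => cL i w). Qed.

Lemma measurable_lifetime N t : (0 < N)%N -> 0 <= t -> measurable [set w | (\val (tau N w) <= t%:E)%E].
Proof. by move=> N0 t0; have [[/(_ t t0) /filtration_measurable]] := mxp N0. Qed.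

Lemma mfn_Lbar N s : (0 < N)%N -> 0 <= s -> mfn (fun w => Lbar N w s).
Proof.
move=> N0; apply: (measurable_stopped (tau := fun w => \val (tau N w)) (m := mean_path (@L N))).
- by move=> w; exact: tau0.
- by move=> t; exact: measurable_lifetime.
- move=> t B t0 mB; have [[_ mL _ _] _] := mxp N0. pose A := [set w | (t%:E < \val (tau N w))%E].
 have mA : measurable A.
  rewrite (_ : A = ~` [set w | (\val (tau N w) <= t%:E)%E]).
   by apply: measurableC; exact: measurable_lifetime.
  by apply/seteqP; split=> w; rewrite /A /= ltNge => /negP.
 have mLi (i : 'I_N) : measurable_fun A (L i t).
  by move=> _ C mC; have /filtration_measurable := mL i t C t0 mC.
 have mm : measurable_fun A (fun w => mean_path (@L N) w t).
  by apply: measurable_funM; [exact: measurable_sum|exact: measurable_cst].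
 exact: mm mA B mB.
- by move=> w; exact: mean_path_cts.
Qed.

Lemma ae_minimal N : (0 < N)%N -> {ae P, forall w, [/\ solves_system (@L N) (tau N) w,
  (tauN N w <= \val (tau N w))%E &
  forall t, before (tauN N w) t -> mean_path (@L N) w t = lamN N w t]}.
Proof. by move=> N0; exact: (maximal_vs_minimal N0 (mxp N0)). Qed.

(** The mean path is nondecreasing, so its left limit at a finite lifetime exists once it is
    bounded. For alpha < 1 the lifetime is infinite. For alpha > 1 the sum of the positions, equal
    to the sum of the paths minus (alpha - 1) N times the mean path, is nonnegative. For alpha = 1
    the lifetime is tau_star and [critical_lam_bounded] applies. *)
Lemma ae_Lbar_cts N : (0 < N)%N -> {ae P, forall w, path_cts +oo%E (Lbar N w)}.
Proof.
move=> N0; have NR : 0 < N%:R :> R by rewrite ltr0n.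
pose bnd w := forall u, \val (tau N w) = u%:E -> exists C, forall s, 0 <= s -> s < u ->
 mean_path (@L N) w s <= C.
suff ab : {ae P, forall w, bnd w}.
 apply: filterS2 (ae_minimal N0) ab => w [S _ _] B. apply: stopped_cts => //; first exact: mean_path_cts.
 move=> u E u0; have [C HC] := B u E; apply: (mono_left_cvg u0 _ HC) => s t s0 st tu.
 have bt : before (\val (tau N w)) t by split; [exact: le_trans st|rewrite E lte_fin].
 have [_ mf _ _ _] := S t bt; have t0 : 0 <= t by case: bt.
 by have := mf t s t st (lexx t); rewrite /frozen_at minxx (min_l st) !max_r.
have [a1|a1|a1] := ltgtP alpha 1.
- apply: filterS (ae_minimal N0) => w [_ + _] u E. by rewrite subcritical_tau_star // E leye_eq.
- apply: filterS (ae_minimal N0) => w [S _ _] u E. have [C HC] := cpath_bdd (cpath_psum N w) u.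
 have c0 : 0 < (alpha - 1) * N%:R by rewrite mulr_gt0 // subr_gt0.
 exists (C / ((alpha - 1) * N%:R)) => s s0 su.
 have bs : before (\val (tau N w)) s by split=> //; rewrite E lte_fin. have [cf mf f0 fE _] := S s bs.
 have := sum_refl N0 (fE s (lexx s)).
 have : 0 <= \sum_(i < N) refl (frozen_at (mean_path (@L N) w) s) (@zfam N w i) s.
  by apply: sumr_ge0 => i _; apply: refl_ge0 => //; exact: cpath_zfam.
 move=> + e; rewrite e {1}/frozen_at minxx max_r // subr_ge0 => h.
 rewrite ler_pdivlMr // mulrC; apply: (le_trans h). exact: le_trans (ler_norm _) (HC s (ltW su)).
- apply: filterS3 (ae_minimal N0) (critical_lifetime N0 a1)
  (critical_lam_bounded N0 a1) => w [S le mE] /(_ _ _ S)[ge _] B u E.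
 have tE : tauN N w = u%:E by apply/eqP; rewrite eq_le -{1}E le -E ge.
 have [C HC] := B u tE; exists C => s s0 su; rewrite mE; first exact: HC.
 by split=> //; rewrite tE lte_fin.
Qed.

Lemma whp_ae (E : nat -> set Om) : (forall N, (0 < N)%N -> {ae P, forall w, E N w}) -> whp P E.
Proof.
move=> aE e e0; exists 1%N => N N0; have [A [mA A0 sub]] := aE N N0.
exists (~` A); split; first exact: measurableC.
 by move=> w Aw; apply: contrapT => nE; apply: Aw; exact: sub.
by rewrite PrC // /Pr A0 /=; lra.
Qed.

Lemma mv_close K e : before (\val T) K -> 0 < e -> whp P (fun N => [set w | (K%:E < \val (tau N w))%E /\
  forall s, 0 <= s -> s <= K -> `|Lbar N w s - l s| <= e]).
Proof.
move=> bK e0; have K0 : 0 <= K by case: bK. have h1 := mv_chaos sol bK e0. have h2 := whp_ae ae_minimal.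
apply: whp_sub (whpI h1 h2); exists 1%N => N N0 w [[gd cl] [S le mE]]. have KT : (K%:E < tauN N w)%E.
 rewrite ltNge; apply/negP => h; have := tau_star_ge0 alpha (@zfam N w).
 case E : (tau_star _ _) h => [u| |] // h u0. have cz := @cpath_zfam N w.
 by apply: (tau_star_bad alpha0 N0 cz E); apply: gd.
split; first exact: lt_le_trans le. move=> s s0 sK; have sT : (s%:E < tauN N w)%E.
 by apply: le_lt_trans KT; rewrite lee_fin.
rewrite /Lbar /stopped (lt_le_trans sT le) mE //. by have := cl s sK; rewrite /frozen_at (min_l sK) max_r.
Qed.

Lemma lifetime_ge q B : 0 < q -> (forall n, mv_it alpha xi0 BW0 n q <= B) -> (q%:E <= \val T)%E.
Proof.
by move=> q0 HB; exact: (mv_maximal_ge q0 mx HB).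
Qed.

(** A finite T is possible only for alpha > 1, settled by [supercritical_tau], or for alpha = 1 with
    xi = 0 almost surely, when all particles start at zero and the lifetime is 0. *)
Lemma whp_lifetime_le q : (\val T < q%:E)%E -> whp P (fun N => [set w | (\val (tau N w) <= q%:E)%E]).
Proof.
move=> Tq; have q0 : 0 < q by rewrite -lte_fin; exact: le_lt_trans Tq.
have nb B : (forall n, mv_it alpha xi0 BW0 n q <= B) -> False.
 by move=> HB; have := lifetime_ge q0 HB; rewrite leNgt Tq.
have [a1|a1|a1] := ltgtP alpha 1.
- by case: (nb (Ex P' (zdev xi0 BW0 q) / (1 - alpha))) => n; exact: subcritical_bounded.
- have h1 := supercritical_tau tau L a1 mx Tq. apply: whp_sub (whpI h1 (whp_ae ae_minimal)).
 by exists 1%N => N N0 w [H [S _ _]]; exact: H.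
have [x0|x0] := eqVneq (P' [set w | 0 < xi0 w]) 0%E; last first.
 by have [B HB] := critical_bounded q a1 x0; case: (nb B).
apply: whp_ae => N N0. have xi_le : {ae P, forall w, forall i, xi i w <= 0}.
 apply: ae_forall_count => i; exists [set w | 0 < xi i w]; split.
 - by apply: mfn_gt; exact: measurable_funPT.
 - have mB := @measurable_itv R `]0, +oo[; have := law_xi i mB.
  rewrite /distribution /pushforward /= => e; rewrite -x0; move: e; congr (P _ = P' _).
   by apply/seteqP; split=> w /=; rewrite in_itv /= andbT.
  by apply/seteqP; split=> w /=; rewrite in_itv /= andbT.
 - by move=> w /= /negP; rewrite -ltNge.
apply: filterS3 (ae_minimal N0) (critical_lifetime N0 a1) xi_le. move=> w [S _ _] /(_ _ _ S)[_ h] xw.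
suff p0 : psum N w 0 <= 0.
 by change ((\val (tau N w) <= q%:E)%E); rewrite (h p0) lee_fin ltW.
rewrite /psum big1 // => i _; rewrite /zfam /Z zpath0 max_l //; exact: xw.
Qed.

Lemma limit_cts : path_cts (\val T) l.
Proof.
move=> t bt e e0; have [K [bK tK HK]] := before_around bt; have t0 : 0 <= t by case: bt.
have [[cf _] _ _ _ _] := mv_frozen sol bK. have [h h0 H] := cts_dist (cf t) e0; exists (minr h (K - t)).
 by rewrite lt_min h0 subr_gt0.
move=> s bs; rewrite lt_min => /andP[sh /(HK s bs) sK]; have s0 : 0 <= s by case: bs.
by have := H s sh; rewrite /frozen_at (min_l sK) (min_l (ltW tK)) !max_r.
Qed.

Lemma weak_convergence : exists (Y : nat -> Om -> path_space (\val T)) (y : path_space (\val T)),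
 [/\ forall N, (0 < N)%N -> {ae P, forall w, restricts_to (Lbar N w) (Y N w)}, restricts_to l y &
   cvg_weakly P P' (fun n w => (Y n.+1 w, tau n.+1 w)) (fun _ => (y, T))].
Proof.
have /choice[G HG] N : exists G, [/\ measurable G, (0 < N)%N -> P G = 0%E &
  forall w, ~ G w -> (0 < N)%N -> path_cts +oo%E (Lbar N w)].
 have [->|N0] := posnP N; first by exists set0; split.
 have [G [mG G0 sub]] := ae_Lbar_cts N0; exists G; split=> // w Gw _.
 by apply: contrapT => nc; apply: Gw; exact: sub.
(* The path is set to zero on a measurable null set containing the discontinuous samples, so that it
   defines an element of C([0, T)) for every w. *)
pose g N w : R -> R := fun s => if (0 < N)%N then \1_(~` G N) w * Lbar N w s else 0.
have cg N w : path_cts (\val T) (g N w).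
 have [mG _ cG] := HG N.
 have -> : g N w = fun s => if (0 < N)%N then \1_(~` G N) w * Lbar N w s else 0 by [].
 move=> t [t0 _] e e0; case: posnP => [_|N0].
  by exists 1 => // s _ _; rewrite subrr normr0.
 have [Gw|Gw] := pselect (G N w).
  by exists 1 => // s _ _; rewrite indicE memNset ?mul0r ?subrr ?normr0.
 have [h h0 H] := cG w Gw N0 t (conj t0 (ltry _)) e e0; exists h => // s [s0 _] sh.
 by rewrite indicE mem_set // !mul1r; apply: H => //; split=> //; exact: ltry.
have /choice[Y HY] N : exists Y : Om -> path_space (\val T), forall w, restricts_to (g N w) (Y w).
 by have H w := path_of (cg N w); have [Y HY] := choice H; exists Y.
have [y Hy] := path_of limit_cts. have gE N w s : (0 < N)%N -> ~ G N w -> g N w s = Lbar N w s.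
 by move=> N0 Gw; rewrite /g N0 indicE mem_set // mul1r.
have nG N : (0 < N)%N -> {ae P, forall w, ~ G N w}.
 move=> N0; have [mG G0 _] := HG N; exists (G N); split=> //; first exact: G0. by move=> w /= /contrapT.
exists Y, y; split=> // [N N0|].
 by apply: filterS (nG N N0) => w Gw t; rewrite HY gE.
apply: cvg_weakly_cst => [n|U nU].
 apply: (random_path T0 (g := g n.+1)) => // [t [t0 _]|t t0]; last exact: measurable_lifetime.
 have [mG _ _] := HG n.+1; rewrite /g /=.
 by apply: measurable_funM; [exact: mfn_indic (measurableC mG)|exact: mfn_Lbar].
suff [E [wE EU]] : exists E, whp P E /\ forall N, (0 < N)%N -> E N `<=` [set w | U (Y N w, tau N w)].
 move=> e e0; have [N0 HN] := wE e e0; exists N0 => N NN.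
 have [A [mA AE PA]] := HN N.+1 (leqW NN); exists A; split=> // w Aw. exact: (EU N.+1 isT w (AE w Aw)).
have {nU}[[U1 U2] /= [n1 n2] sub] := nU. have [K [e [KT e0 HU1]]] := path_nbhs T0 Hy n1.
have [b [bT HU2]] := time_box n2.
have w1 : whp P (fun N => [set w | forall s, before (\val T) s -> s <= K -> `|Lbar N w s - l s| < e]).
 have [K0|K0] := ltP K 0.
  apply: whp_sub (whpT P); exists 0%N => N _ w _ s [s0 _] sK.
  by have := le_lt_trans s0 (le_lt_trans sK K0); rewrite ltxx.
 have e2 : 0 < e / 2 by rewrite divr_gt0.
 apply: whp_sub (mv_close (conj K0 KT) e2); exists 0%N => N _ w [_ H] s [s0 _] sK.
 by apply: le_lt_trans (H s s0 sK) _; lra.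
have w2 : whp P (fun N => [set w | ((ratr b.1)%:E < \val (tau N w))%E]).
 have [a0|a0] := ltP (ratr b.1 : R) 0.
  apply: whp_sub (whpT P); exists 0%N => N _ w _. by apply: lt_le_trans (tau0 N w); rewrite lte_fin.
 by apply: whp_sub (mv_close (conj a0 bT.1) ltr01); exists 0%N => N _ w [].
have w3 : whp P (fun N => [set w | if b.2 is Some q then (\val (tau N w) < (ratr q)%:E)%E else True]).
 case: b.2 bT.2 => [q|] /= Tq; last by apply: whp_sub (whpT P); exists 0%N.
 have [q' q1 q2] : exists2 q' : R, (\val T < q'%:E)%E & q' < ratr q.
  have Tq' : (\val T < (ratr q)%:E)%E by exact: Tq.
  have := T0; move: Tq'; case: (\val T) => [x| |] h1 h2; last by move: h2; rewrite leNgt ltNyr.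
   by move: h1; rewrite lte_fin => h1; exists ((x + ratr q) / 2); rewrite ?lte_fin; lra.
  by move: h1; rewrite ltNge leey.
 apply: whp_sub (whp_lifetime_le q1); exists 0%N => N _ w h. by apply: le_lt_trans h _; rewrite lte_fin.
exists (fun N => [set w | forall s, before (\val T) s -> s <= K -> `|Lbar N w s - l s| < e] `&`
 ([set w | box b (\val (tau N w))] `&` [set w | ~ G N w])); split.
 apply: whpI => //; apply: whpI; last exact: whp_ae.
 by apply: whp_sub (whpI w2 w3); exists 0%N => N _ w [].
move=> N N0 w [H1 [H2 Gw]]; apply: (sub (Y N w, tau N w)); split; last exact: HU2.
by apply: (HU1 (g N w)) => // t bt tK; rewrite gE //; exact: H1.
Qed.

(** Both paths are continuous from the right, so the supremum is seen by the rationals of [0, t] and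
    by t itself. *)
Lemma measurable_deviation N (t c : R) : (0 < N)%N -> 0 <= t -> (forall s, 0 <= s -> before (\val T) s) ->
 measurable [set w | (c%:E <=
  ereal_sup [set `|Lbar N w s - l s|%:E | s in [set s : R | (0 <= s <= t)%R]])%E].
Proof.
move=> N0 t0 bT; pose D w s := `|Lbar N w s - l s|.
have mD s b : 0 <= s -> measurable [set w | b < D w s].
 move=> s0; apply: mfn_gt; apply: measurableT_comp => //.
 by apply: measurable_funB; [exact: mfn_Lbar|exact: measurable_cst].
pose E n := [set w | c - dy n < D w t] `|`
 [set w | exists q : rat, (0 <= (ratr q : R) <= t) /\ c - dy n < D w (ratr q)].
rewrite [X in measurable X](_ : _ = [set w | forall n, E n w]).
 apply: measurable_all => n; apply: measurableU; first exact: mD. apply: measurable_ex => q.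
 by apply: (@measurable_and _ _ _ [set w | c - dy n < D w (ratr q)]) => /andP[q0 _]; exact: mD.
apply/seteqP; split=> w /=.
 move=> h n; have : ((c - dy n)%:E < ereal_sup [set (D w s)%:E | s in [set s : R | (0 <= s <= t)%R]])%E.
  by apply: lt_le_trans h; rewrite lte_fin gtrBl dy_gt0.
 move=> /ereal_sup_gt[_ [s /andP[s0 st] <-]]; rewrite lte_fin => hs.
 move: st; rewrite le_eqVlt => /orP[/eqP st|st]; first by left; rewrite -st.
 right; have e0 : 0 < (D w s - (c - dy n)) / 2 by rewrite divr_gt0 // subr_gt0.
 have [h1 h10 H1] := stopped_right (@mean_path_cts N w N0) s0 e0.
 have [h2 h20 H2] := path_right limit_cts (bT s s0) e0.
 have [q] : exists q : rat, ratr q \in `]s, (minr t (minr (s + h1) (s + h2)))[.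
  by apply: rat_in_itvoo; rewrite !lt_min st !ltrDl h10 h20.
 rewrite in_itv /= !lt_min => /andP[sq /andP[qt /andP[q1 q2]]].
 exists q; split; first by rewrite (le_trans s0 (ltW sq)) ltW.
 have a1 := H1 _ (ltW sq) q1; have [_ a2] := H2 _ (ltW sq) q2.
 rewrite -/(Lbar N w (ratr q)) -/(Lbar N w s) in a1.
 have : D w s <= D w (ratr q) + (`|Lbar N w (ratr q) - Lbar N w s| + `|l (ratr q) - l s|).
  rewrite /D; have -> : Lbar N w s - l s = (Lbar N w (ratr q) - l (ratr q)) +
   ((Lbar N w s - Lbar N w (ratr q)) + (l (ratr q) - l s)) by ring.
  apply: (le_trans (ler_normD _ _)); rewrite lerD2l.
  by apply: (le_trans (ler_normD _ _)); rewrite [in leRHS]distrC.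
 by move: a1 a2; lra.
move=> H; apply/lee_addgt0Pr => e e0; have [n _ /(_ n (leqnn n)) de] := dy_small e0.
have [s [s0 st hs]] : exists s, [/\ 0 <= s, s <= t & c - dy n < D w s].
 by case: (H n) => [h|[q [/andP[q0 qt] h]]]; [exists t|exists (ratr q)].
apply: (@le_trans _ _ ((D w s)%:E + e%:E)%E); first by rewrite -EFinD lee_fin; lra.
by apply: leeD2r; apply: ereal_sup_ubound; exists s => //=; rewrite s0.
Qed.

Lemma fluctuations (t eps : R) : alpha < 1 -> 0 <= t -> 0 < eps -> exists2 z : R, 0 < z &
 (limn_esup (fun N => P [set w | ((z / Num.sqrt N%:R)%:E <=
  ereal_sup [set `|Lbar N w s - l s|%:E | s in [set s : R | (0 <= s <= t)%R]])%E]) < eps%:E)%E.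
Proof.
move=> a1 t0 e0. have Tq q : 0 < q -> (q%:E <= \val T)%E.
 move=> q0; apply: (lifetime_ge q0 (B := Ex P' (zdev xi0 BW0 q) / (1 - alpha))) => n.
 exact: subcritical_bounded.
have bT s : 0 <= s -> before (\val T) s.
 by move=> s0; split=> //; apply: lt_le_trans (Tq (s + 1) _); rewrite ?lte_fin; lra.
pose K := t + 1; have K0 : 0 < K by rewrite /K; lra.
have [cf mf f0 fE _] := mv_frozen sol (bT K (ltW K0)). have [C C0 HC] := rate_bound a1 cf mf f0 K0 fE.
(* [rate_bound] will be used with y = z / (2 sqrt N), for which C / (N^2 y^4) = 16 C / z^4; halving
   y keeps the deviation strictly below the threshold z / sqrt N. *)
have [z z0 Cz] : exists2 z : R, 0 < z & 16 * C / z ^+ 4 <= eps / 2.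
 have q0 : 0 <= 32 * C / eps by rewrite divr_ge0 ?mulr_ge0 // ltW.
 pose z := 1 + 32 * C / eps; have z1 : 1 <= z by rewrite lerDl. exists z; first exact: lt_le_trans z1.
 rewrite ler_pdivrMr ?exprn_gt0 ?(lt_le_trans _ z1) //. apply: (@le_trans _ _ (eps / 2 * z)); last first.
  by apply: ler_wpM2l; [rewrite divr_ge0 // ltW|rewrite -[leLHS]expr1 ler_weXn2l].
 have -> : eps / 2 * z = eps / 2 + 16 * C by rewrite /z; field; rewrite gt_eqF.
 by rewrite lerDr divr_ge0 // ltW.
exists z => //; set u := fun N => _. suff ub N : (0 < N)%N -> (u N <= (eps / 2)%:E)%E.
 apply: (@le_lt_trans _ _ (eps / 2)%:E); last by rewrite lte_fin; lra.
 apply: (@le_trans _ _ (ereal_sup (u @` [set N | (0 < N)%N]))).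
  by apply: ereal_inf_lbound; exists [set N | (0 < N)%N] => //; exists 1%N.
 by apply: ge_ereal_sup => _ [N N0 <-]; exact: ub.
move=> N0; have NR : 0 < N%:R :> R by rewrite ltr0n.
have sN : 0 < Num.sqrt N%:R :> R by rewrite sqrtr_gt0.
pose y := z / Num.sqrt N%:R / 2; have y0 : 0 < y by rewrite !divr_gt0.
have [A [mA AH PA]] := HC N N0 y y0. have mS := @measurable_deviation N t (z / Num.sqrt N%:R) N0 t0 bT.
rewrite /u; set S := [set w | _] in mS *. have SA0 : P (S `&` A) = 0%E.
 have [B [mB B0 sub]] := ae_minimal N0.
 apply/eqP; rewrite -measure_le0 -[leRHS]B0; apply: le_measure; rewrite ?inE //.
  exact: measurableI.
 move=> w [Sw Aw]; apply: sub => -[_ + mE]; rewrite subcritical_tau_star // leye_eq => /eqP tE.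
 move: Sw; rewrite /S /= leNgt => /negP; apply.
 apply: (@le_lt_trans _ _ y%:E); last by rewrite lte_fin /y; have := divr_gt0 z0 sN; lra.
 apply: ge_ereal_sup => _ [s /= /andP[s0 st] <-]; rewrite lee_fin. have sK : s <= K by rewrite /K; lra.
 have := AH w Aw s sK; rewrite /frozen_at (min_l sK) max_r // => /ltW.
 rewrite /Lbar /stopped tE ltry mE //. by rewrite subcritical_tau_star //; split=> //; exact: ltry.
have : (P S <= P (S `&` A) + P (~` A))%E.
 apply: (@le_trans _ _ (P ((S `&` A) `|` ~` A))).
  apply: le_measure; rewrite ?inE //.
   by apply: measurableU; [exact: measurableI|exact: measurableC].
  by move=> w Sw; have [Aw|Aw] := pselect (A w); [left|right].
 by apply: measureU2; [exact: measurableI|exact: measurableC].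
rewrite SA0 add0e -(Pr_fin _ (measurableC mA)) (PrC _ mA) => h; apply: (le_trans h).
rewrite lee_fin; apply: le_trans Cz; have -> : 16 * C / z ^+ 4 = C / (N%:R ^+ 2 * y ^+ 4).
 have s2 : Num.sqrt N%:R ^+ 2 = N%:R :> R by rewrite sqr_sqrtr // ltW.
 have -> : y ^+ 4 = z ^+ 4 / (16 * N%:R ^+ 2).
  by rewrite -[in RHS]s2 /y; field; rewrite gt_eqF.
 by field; rewrite !gt_eqF.
by move: PA; lra.
Qed.

End assembly.

End particle_system.

Theorem theorem1p15 (R : realType) (alpha : R)
    (d d' : measure_display) (Om : measurableType d) (Om' : measurableType d')
    (P : probability Om R) (P' : probability Om' R)
    (xi : nat -> {RV P >-> R}) (W : nat -> R -> {RV P >-> R})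
    (xi0 : {RV P' >-> R}) (W0 : R -> {RV P' >-> R})
    (L : forall N : nat, 'I_N -> R -> Om -> R) (tau : nat -> Om -> ext_time R)
    (l : R -> R) (T : ext_time R) :
  0 <= alpha ->
  (forall w, 0 <= xi0 w) ->
  brownian W0 ->
  independent P' (sigma_of [set: unit] (fun _ => xi0 : Om' -> R))
    (sigma_of [set t | 0 <= t] (fun t => W0 t : Om' -> R)) ->
  (forall i (B : set R), measurable B ->
     distribution P (xi i) B = distribution P' xi0 B) ->
  mutually_independent P
    (fun i : nat => sigma_of [set: unit] (fun _ => xi i : Om -> R)) ->
  (forall i, brownian (W i)) ->
  mutually_independent P
    (fun i : nat => sigma_of [set t | 0 <= t] (fun t => W i t : Om -> R)) ->
  independent P (sigma_of [set: nat] (fun i => xi i : Om -> R))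
    (sigma_of [set p : nat * R | 0 <= p.2] (fun p => W p.1 p.2 : Om -> R)) ->
  (forall N, (0 < N)%N -> maximal_particle_solution alpha xi W (L N) (tau N)) ->
  maximal_mv_solution alpha xi0 W0 l T ->
  let Lbar N w := stopped (\val (tau N w)) (mean_path (L N) w) in
  (exists (Y : nat -> Om -> path_space (\val T)) (y : path_space (\val T)),
     [/\ forall N, (0 < N)%N ->
           {ae P, forall w, restricts_to (Lbar N w) (Y N w)},
         restricts_to l y &
         cvg_weakly P P' (fun n w => (Y n.+1 w, tau n.+1 w))
           (fun _ => (y, T))]) /\
  (alpha < 1 -> forall t : R, 0 <= t -> forall eps : R, 0 < eps ->
     exists2 z : R, 0 < z &
       (limn_esup (fun N => P [set w |
          ((z / Num.sqrt N%:R)%:E <=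
             ereal_sup [set `|Lbar N w s - l s|%:E | s in [set s : R | (0 <= s <= t)%R]])%E])
        < eps%:E)%E).
Proof.
move=> alpha0 xi0_ge0 BW0 indep0 law_xi mi_xi BW mi_W indep_xi_W mxp mx Lb; split.
  exact: (weak_convergence alpha0 xi0_ge0 BW0 indep0 law_xi mi_xi BW mi_W indep_xi_W mxp mx).
move=> a1 t t0 eps e0.
exact: (fluctuations alpha0 xi0_ge0 BW0 indep0 law_xi mi_xi BW mi_W indep_xi_W mxp mx a1 t0 e0).
Qed.
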